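(* Let $6 \leq n < \infty$ and suppose that $q_{n-1}$ and $q_n$ are both non-zero. Suppose that $\ker A = \mathrm{span}\{e_1,e_2\}=\{u\in\mathbb{R}^n: u_3=\cdots=u_n=0\}$. Then the stochastic Lorenz-96 system $$d u_m = (u_{m+1}-u_{m-2})u_{m-1}\, dt - (Au)_m\, dt + q_m\, dW_t^{(m)}, \qquad 1\le m\le n,$$ admits at least one stationary measure $\mu$, and $\langle u\rangle^p \in L^1(d\mu)$ for all $p < 1/3$.
   Context: The unknown is $u_t=(u_1,\dots,u_n)\in\mathbb{R}^n$, with periodic indices $u_{i+kn}=u_i$ for $k\in\mathbb{Z}$. $W^{(m)}$ are independent standard one-dimensional Brownian motions, $q_m\in\mathbb{R}$ are fixed parameters, and $A\in\mathbb{R}^{n\times n}$ is positive semi-definite. $e_1,\dots,e_n$ is the canonical basis. A stationary measure is a Borel probability measure on $\mathbb{R}^n$ invariant under the Markov semigroup $\mathcal{P}_tf(u_0)=\mathbf{E}f(u_t)$ of the SDE. $\langle u\rangle=(1+|u|^2)^{1/2}$. *)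

(* Defs.v *)
From HB Require Import structures.
From mathcomp Require Import all_boot all_order all_algebra.
From mathcomp Require Import all_classical all_reals all_analysis.

Set Implicit Arguments.
Unset Strict Implicit.
Unset Printing Implicit Defensive.

Import Order.TTheory GRing.Theory Num.Theory.
Import numFieldNormedType.Exports.

Local Open Scope classical_set_scope.
Local Open Scope ring_scope.

(* R^n as a measurable space: column vectors with their Borel sigma-algebra.  *)
Notation Rn R n := (g_sigma_algebraType (@open 'cV[R]_n)).

(* The library norm on matrices is the max norm, hence the explicit           *)
(* Euclidean formula.                                                         *)
Definition japanese_bracket (R : realType) (n : nat) (u : 'cV[R]_n) : R :=
  Num.sqrt (1 + \sum_(i < n) (u i 0) ^+ 2).

(* Positive semi-definite matrices are taken to be symmetric.                  *)
Definition psd (R : realType) (n : nat) (A : 'M[R]_n) : Prop :=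
  A^T = A /\ forall x : 'cV[R]_n, 0 <= (x^T *m A *m x) 0 0.

(* The coordinate u_m is u i 0 with i = m - 1; ordS and ord_pred are the      *)
(* successor and predecessor modulo n, which implement u_{m+n} = u_m.         *)
Definition lorenz96_drift (R : realType) (n : nat) (A : 'M[R]_n)
    (u : 'cV[R]_n) : 'cV[R]_n :=
  \col_(i < n) ((u (ordS i) 0 - u (ord_pred (ord_pred i)) 0)
                  * u (ord_pred i) 0 - (A *m u) i 0).

Section stochastic.
Context (R : realType) (d : measure_display) (Omega : measurableType d).
Variable P : probability Omega R.

(* Used only for systems F i containing setT, so that the product rule over   *)
(* all of I contains the rule for each subfamily.                             *)
Definition indep_systems (I : finType) (F : I -> set (set Omega)) : Prop :=
  forall E : I -> set Omega, (forall i, F i (E i)) ->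
    P (\bigcap_(i in [set: I]) E i) = (\prod_(i : I) P (E i))%E.

Definition sigma_of (J : Type) (T : set J) (X : J -> Omega -> R)
  : set (set Omega) :=
  <<s \bigcup_(j in T) preimage_set_system setT (X j) measurable >>.

Definition time : set R := `[0, +oo[.

Definition brownian_motion (B : R -> {RV P >-> R}) : Prop :=
  [/\ {ae P, forall w, B 0 w = 0},
      {ae P, forall w, {within time, continuous (fun t => B t w)}},
      (forall s t : R, 0 <= s -> s < t -> forall U, measurable U ->
         P ((fun w => B t w - B s w) @^-1` U) =
         normal_prob 0 (Num.sqrt (t - s)) U) &
      (forall (k : nat) (t : nat -> R), 0 <= t 0%N ->
         {homo t : i j / (i <= j)%N >-> i <= j} ->
         indep_systems (fun i : 'I_k =>
           sigma_of [set: unit] (fun _ w => B (t i.+1) w - B (t i) w)))].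

Definition indep_brownian_motions (n : nat) (W : 'I_n -> R -> {RV P >-> R})
  : Prop :=
  (forall m, brownian_motion (W m)) /\
  indep_systems (fun m => sigma_of time (fun t => W m t : Omega -> R)).

(* u solves du = b(u) dt + diag(q) dW with u_0 = x. As the noise is additive, *)
(* the Ito integral of the constant q_m is q_m W^(m)_t and the equation is a  *)
(* pathwise integral equation.                                                *)
Definition sde_solution (n : nat) (b : 'cV[R]_n -> 'cV[R]_n) (q : 'I_n -> R)
    (W : 'I_n -> R -> {RV P >-> R}) (x : Rn R n) (u : R -> Omega -> Rn R n)
  : Prop :=
  (forall t : R, 0 <= t -> measurable_fun setT (u t)) /\
  {ae P, forall w,
    {within time, continuous (fun t => u t w : 'cV[R]_n)} /\
    forall t : R, 0 <= t -> forall m : 'I_n,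
      (u t w : 'cV[R]_n) m 0 =
        (x : 'cV[R]_n) m 0
        + \int[lebesgue_measure]_(s in `[0, t]) (b (u s w)) m 0
        + q m * W m t w}.

(* S t f x = E f(u_t) for the solution u started at x; the definition         *)
(* includes that the solution exists and that the value does not depend on    *)
(* the choice of the solution.                                                *)
Definition sde_semigroup (n : nat) (b : 'cV[R]_n -> 'cV[R]_n) (q : 'I_n -> R)
    (W : 'I_n -> R -> {RV P >-> R})
    (S : R -> (Rn R n -> R) -> Rn R n -> R) : Prop :=
  forall x : Rn R n,
    (exists u, sde_solution b q W x u) /\
    forall u, sde_solution b q W x u ->
      forall (t : R) (f : Rn R n -> R), 0 <= t -> measurable_fun setT f -> bounded_fun f ->
        (S t f x)%:E = 'E_P[fun w => f (u t w)]%E.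

Definition stationary_measure (n : nat) (b : 'cV[R]_n -> 'cV[R]_n)
    (q : 'I_n -> R) (W : 'I_n -> R -> {RV P >-> R})
    (mu : probability (Rn R n) R) : Prop :=
  exists2 S, sde_semigroup b q W S &
    forall (t : R) (f : Rn R n -> R), 0 <= t -> measurable_fun setT f -> bounded_fun f ->
      (\int[mu]_x (S t f x)%:E = \int[mu]_x (f x)%:E)%E.

End stochastic.

(* Main.v *)
(** A function V with gen V <= C - c <u>^(1/3) is built as
    K_2 |u|^2 + K_1 u_1 u_2 u_3 / <u>^2 + E_1 + E_2. The first term dissipates
    u_3, ..., u_n and the second one (u_1 u_2)^2 / <u>^2, which suffices except
    where exactly one of u_1, u_2, say l = u_k, is of order <u>. There X = u_(k-2)
    and Y = u_(k-1) satisfy dY = l X + ..., which a multiplier of the form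
    - (l / <u>) X atan (Y / <u>^(1/3)) turns into a large dissipation of X. Where
    X is too small for this to suffice, the noise q_(n-1) or q_n acting on X makes
    <u>^(1/3) X^2 grow at the rate <u>^(1/3), once the resonant part
    l X (Y - u_(k-4)) u_(k-3) of its drift is compensated.

    As the noise is additive, the equation is solved path by path, and the Ito
    formula can be replaced by Taylor expansions along Euler chains with clipped
    increments. Summed along the chain, the Lyapunov inequality bounds the mean
    of <u>^(1/3) under the occupation measures, which have a weak limit along an
    ultrafilter. Locally uniform convergence of the chains to the flow makes the
    limit invariant. *)

Require Import Defs.
From HB Require Import structures.
From mathcomp Require Import all_boot all_order all_algebra.
From mathcomp Require Import all_classical all_reals all_analysis.
From mathcomp Require Import measurable_realfun ring lra zify.

Set Implicit Arguments.
Unset Strict Implicit.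
Unset Printing Implicit Defensive.

Import Order.TTheory GRing.Theory Num.Theory.
Import numFieldNormedType.Exports.

Local Open Scope classical_set_scope.
Local Open Scope ring_scope.

(** * Borel sets of R^n and independence *)

(** The nonlinearity conserves |u|^2, so the energy alone gives no return from large values of u_1
    and u_2. Write l for the large coordinate, X for the one two places before it and r = <u>^(1/3).
    The exponent 1/3 is a balance of two mechanisms: the arctangent multiplier, with the scale r for
    Y, dissipates about l^2 X^2 / (<u> r), that is (r X)^2, while the noise on X yields a decrease
    of about r as long as r X^2 is bounded. Since (r X)^2 >= r as soon as r X^2 >= 1, the sum is of
    order at least r throughout the critical region. For l = u_1 the coordinate X is u_(n-1), for l
    = u_2 it is u_n: this is where q_(n-1) and q_n enter. The main obstacle is that errors are of
    order e^2, with e the size of all coordinates but l, and e contains the other undamped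
    coordinate. They become affordable after multiplication by l^2 / <u>^2, because (u_1 u_2)^2 /
    <u>^2 is already dissipated. *)

Section vector_measurability.
Context (R : realType) (n : nat).
Local Notation V := 'cV[R]_n.

Lemma continuous_Rn_measurable (f : V -> R) :
  continuous f -> measurable_fun setT (f : Rn R n -> R).
Proof.
move=> cf; apply: (measurability _ (measurable_realfun.RGenOpens.measurableE R)).
move=> _ [B [a [b ->] <-]]; rewrite setTI.
apply: sub_sigma_algebra; apply: open_comp; [by move=> x _; exact: cf|exact: interval_open].
Qed.

Lemma measurable_coord (i : 'I_n) :
  measurable_fun setT (fun u : Rn R n => (u : V) i 0).
Proof. by apply: continuous_Rn_measurable; exact: coord_continuous. Qed.

(** Second countability through cubes with rational centres. A cube is a product, so this reduces
    the measurability of a map into R^n to that of its coordinates, as in [measurable_col]. *)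
Lemma open_cV_bigcup (O : set V) : open O ->
  O = \bigcup_(ck in [set ck : 'cV[rat]_n * nat |
        [set u : V | forall i, `|u i 0 - ratr (ck.1 i 0)| < ck.2.+1%:R^-1] `<=` O])
      [set u : V | forall i, `|u i 0 - ratr (ck.1 i 0)| < ck.2.+1%:R^-1].
Proof.
move=> oO; apply/seteqP; split => [x Ox|x [ck /= ckO]]; last exact: ckO.
have : nbhs x O by exact: open_nbhs_nbhs.
move=> /nbhs_ballP[e /= e0 xeO].
have [k ke] : exists k : nat, k.+1%:R^-1 < e / 2.
  have e2 : 0 < e / 2 by exact: divr_gt0.
  have [k _ /(_ k (leqnn _)) /= H] := near_infty_natSinv_lt (PosNum e2).
  by exists k.
have k0 : (0 : R) < k.+1%:R^-1 by rewrite invr_gt0.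
have H (i : 'I_n) : exists q : rat, `|x i 0 - ratr q| < k.+1%:R^-1.
  have [q] : exists q : rat, ratr q \in `]x i 0 - k.+1%:R^-1, x i 0 + k.+1%:R^-1[.
    by apply: rat_in_itvoo; rewrite ltrD2l gt0_cp.
  by rewrite in_itv /= => /andP[q1 q2]; exists q; rewrite ltr_distlC q1 q2.
have [c cx] := choice H.
exists (\col_i c i, k) => /=; last by move=> i; rewrite mxE; exact: cx.
move=> y /= yc; apply: xeO; rewrite mx_norm_ball /ball_ /=.
rewrite {1}/Num.Def.normr /= mx_normrE.
apply/bigmax_ltP; split => // -[i j] _ /=.
rewrite ord1 !mxE; have := cx i; have := yc i; rewrite mxE => y1 x1.
rewrite -(subrKA (ratr (c i))) (splitr e).
apply: le_lt_trans (ler_normD _ _) _; apply: ltrD; first exact: lt_trans x1 ke.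
by rewrite distrC; exact: lt_trans y1 ke.
Qed.

Lemma measurable_col d (T : measurableType d) (f : T -> V) :
  (forall i, measurable_fun setT (fun t => f t i 0)) ->
  measurable_fun setT (f : T -> Rn R n).
Proof.
move=> mf; apply: (measurability (@open V : set (set (Rn R n)))) => //.
move=> _ [B oB <-].
rewrite setTI (open_cV_bigcup oB) preimage_bigcup bigcup_mkcond.
apply: countable_bigcupT_measurable; first exact: countableP.
move=> [c k]; case: ifPn => // _ /=.
rewrite (_ : _ @^-1` _ = \bigcap_(i in [set: 'I_n])
   ((fun t => f t i 0) @^-1` ball (ratr (c i 0) : R) k.+1%:R^-1)); last first.
  apply/seteqP; split => [t /= H i _|t H i]; rewrite /= /ball /= distrC; first exact: H.
  by have := H i I; rewrite /= /ball /= distrC.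
apply: fin_bigcap_measurable => // i _.
rewrite -[X in measurable X]setTI; apply: mf => //.
exact: measurable_ball.
Qed.

(** A pi-system generating the Borel sets, on which laws with independent coordinates are explicit
    products. *)
Definition rectangles : set (set V) :=
  [set A | exists2 E : 'I_n -> set R, (forall i, measurable (E i)) &
    A = [set u : V | forall i, E i (u i 0)]].

Lemma rectangles_setI : setI_closed rectangles.
Proof.
move=> _ _ [E mE ->] [F mF ->]; exists (fun i => E i `&` F i).
  by move=> i; exact: measurableI.
by apply/seteqP; split => [u [/= H1 H2] i|u /= H]; [|split => i; have [] := H i].
Qed.

Lemma rectanglesT : rectangles setT.
Proof. by exists (fun=> setT) => //; apply/seteqP; split. Qed.

(** The identity is measurable from the generated sigma-algebra to the Borel one because its
    coordinates are. *)
Lemma measurable_rectangles (A : set (Rn R n)) : measurable A -> <<s rectangles >> A.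
Proof.
move=> mA.
have mid : measurable_fun setT ((fun u => u) : g_sigma_algebraType rectangles -> Rn R n).
  apply: measurable_col => i _ B mB; rewrite setTI; apply: sub_sigma_algebra.
  exists (fun j => if j == i then B else setT); first by move=> j; case: ifP.
  apply/seteqP; split => [u /= Bu j|u /= /(_ i)]; last by rewrite eqxx.
  by case: eqP => // ->.
by have := mid measurableT A mA; rewrite setTI.
Qed.

Lemma rectangles_measurable (A : set (Rn R n)) : rectangles A -> measurable A.
Proof.
move=> [E mE ->].
rewrite (_ : [set u : V | _] = \bigcap_(i in [set: 'I_n])
   ((fun u : Rn R n => (u : V) i 0) @^-1` E i)).
  apply: fin_bigcap_measurable => // i _.
  by rewrite -[X in measurable X]setTI; exact: measurable_coord.
by apply/seteqP; split => [u /= H i _|u H i]; [exact: H|exact: H].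
Qed.

End vector_measurability.

Section independence.
Context (R : realType) (d : measure_display) (Omega : measurableType d).
Variable P : probability Omega R.

(** Uniqueness of measures: for fixed [B] both sides are finite measures in [A], the restriction of
    [P] to [B] and the multiple of [P] by [P B]. *)
Lemma indep_g_sigma (G : set (set Omega)) (B : set Omega) :
  G `<=` measurable -> setI_closed G -> G setT -> measurable B ->
  (forall A, G A -> P (A `&` B) = (P A * P B)%E) ->
  forall A, <<s G >> A -> P (A `&` B) = (P A * P B)%E.
Proof.
move=> mG GI GT mB H A GA.
have PB0 : 0 <= fine (P B) by exact: fine_ge0.
have PBE : P B = (fine (P B))%:E by rewrite fineK// fin_num_measure.
have -> : P (A `&` B) = mrestr P mB A by [].
rewrite muleC PBE -[RHS]/(mscale (NngNum PB0) P A).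
apply: (@g_sigma_algebra_measure_unique _ _ _ G _ (fun=> setT)) => //.
- by rewrite bigcup_const.
- by move=> C GC; rewrite /= /mrestr H// /mscale /= -PBE muleC.
- move=> _; rewrite /mrestr /=; apply: le_lt_trans (probability_le1 _ _) _; last by rewrite ltry.
  exact: measurableI.
Qed.

(** Independence makes the law of the pair the product of the laws, and Tonelli unfolds it. The
    second sample point freezes [X] while [Y] is averaged, which is the form needed for the Markov
    property of the chain. *)
Lemma joint_law d1 d2 (T1 : measurableType d1) (T2 : measurableType d2)
  (X : {RV P >-> T1}) (Y : {RV P >-> T2}) :
  (forall A B, measurable A -> measurable B ->
     P (X @^-1` A `&` Y @^-1` B) = (P (X @^-1` A) * P (Y @^-1` B))%E) ->
  forall g : T1 * T2 -> \bar R, measurable_fun setT g -> (forall z, 0 <= g z)%E ->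
  (\int[P]_w g (X w, Y w) = \int[P]_w \int[P]_w' g (X w, Y w'))%E.
Proof.
move=> H g mg g0.
have mXY : measurable_fun setT (fun w => (X w, Y w)).
  by apply/measurable_fun_pairP; split; exact: measurable_funPT.
pose XY : {RV P >-> (T1 * T2)%type} := HB.pack (fun w => (X w, Y w))
  (isMeasurableFun.Build _ _ _ _ _ mXY).
have -> : (\int[P]_w g (X w, Y w) = \int[distribution P XY]_z g z)%E.
  by rewrite ge0_integral_distribution.
have E : (\int[distribution P XY]_z g z =
   \int[distribution P X \x distribution P Y]_z g z)%E.
  apply: eq_measure_integral => A mA _; apply/esym.
  apply: product_measure_unique => //.
rewrite E.
rewrite fubini_tonelli1// ge0_integral_distribution//=.
- apply: eq_integral => w _; rewrite /fubini_F ge0_integral_distribution//=.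
  exact: measurableT_comp.
- exact: measurable_fun_fubini_tonelli_F.
- by move=> y; rewrite /fubini_F; apply: integral_ge0.
Qed.

End independence.

(** * Clipped Gaussian variables *)

Section normal_moments.
Context (R : realType).
Local Notation mu := (@lebesgue_measure R).

(** The change of variables goes through the abstract Radon-Nikodym derivative, which agrees almost
    everywhere with the explicit density because both have the same integrals over measurable
    sets. *)
Lemma ge0_integral_normal_prob (m s : R) (f : R -> R) : s != 0 ->
  measurable_fun setT f -> (forall x, 0 <= f x) ->
  (\int[normal_prob m s]_x (f x)%:E = \int[mu]_x (f x * normal_pdf m s x)%:E)%E.
Proof.
move=> s0 mf f0.
rewrite -(Radon_Nikodym_SigmaFinite.change_of_variables (normal_prob_dominates m s)) //.
- apply: ae_eq_integral => //.
  + apply: emeasurable_funM; first exact/measurable_EFinP.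
    by apply: measurable_int; exact: Radon_Nikodym_SigmaFinite.f_integrable (normal_prob_dominates m s).
  + apply/measurable_EFinP/measurable_funM => //; exact: measurable_normal_pdf.
  + have := @integral_ae_eq _ _ _ mu setT measurableT
      (fun x => (normal_pdf m s x)%:E) (Radon_Nikodym_SigmaFinite.f (normal_prob m s) mu).
    move=> /(_ (Radon_Nikodym_SigmaFinite.f_integrable (normal_prob_dominates m s))).
    move=> H.
    have : ae_eq mu setT (Radon_Nikodym_SigmaFinite.f (normal_prob m s) mu) (fun x => (normal_pdf m s x)%:E).
      apply: H.
        apply/measurable_EFinP; exact: measurable_normal_pdf.
      move=> E _ mE; rewrite -Radon_Nikodym_SigmaFinite.f_integral//.
      exact: normal_prob_dominates.
    apply: filterS => x /(_ I) Hx _; by rewrite Hx EFinM.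

- exact/measurable_EFinP.
Qed.

Lemma normal_pdf0E (s x : R) : s != 0 ->
  normal_pdf 0 s x = normal_peak s * expR (- x ^+ 2 / (s ^+ 2 *+ 2)).
Proof. by move=> s0; rewrite /normal_pdf (negbTE s0) /normal_fun subr0. Qed.

Lemma normal_prob_oppr (s : R) (f : R -> R) : s != 0 ->
  continuous f -> (forall x, 0 <= f x) ->
  (\int[mu]_(x in `]-oo, 0%R]) (f x * normal_pdf 0 s x)%:E =
   \int[mu]_(x in `[0%R, +oo[) (f (- x) * normal_pdf 0 s x)%:E)%E.
Proof.
move=> s0 cf f0; rewrite -[in X in `]-oo, X]](@oppr0 R) ge0_integration_by_substitutionNy.
- apply: eq_integral => x _ /=; congr (_ * _)%:E.
  by rewrite !normal_pdf0E// sqrrN.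
- rewrite oppr0; apply: continuous_subspaceT => x; apply: cvgM; first exact: cf.
  exact: continuous_normal_pdf.
- by move=> x _; rewrite mulr_ge0// normal_pdf_ge0.
Qed.

Lemma ge0_integral_normal_scale (h : R) (f : R -> R) : 0 < h ->
  continuous f -> (forall x, 0 <= f x) ->
  (\int[mu]_x (f x * normal_pdf 0 (Num.sqrt h) x)%:E =
   \int[mu]_x (f (Num.sqrt h * x) * normal_pdf 0 1 x)%:E)%E.
Proof.
move=> h0 cf f0.
have sh0 : 0 < Num.sqrt h by rewrite sqrtr_gt0.
have dF : (fun x : R => Num.sqrt h * x)^`()%classic = cst (Num.sqrt h).
  by apply/funext => x; rewrite derive1E derive_val /= /GRing.scale /= ?mulr1 ?mulr0 ?addr0 ?add0r.
rewrite (@increasing_ge0_integration_by_substitutionT _ (fun x => Num.sqrt h * x)).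
- apply: eq_integral => x _ /=; rewrite dF /= -mulrA; congr (_ * _)%:E.
  rewrite fctE /= !normal_pdf0E ?gt_eqF// /normal_peak.
  rewrite mulrAC exprMn sqr_sqrtr ?ltW// expr1n mul1r; congr (_ * _); last first.
    by congr (expR _); rewrite -mulr_natr; field; rewrite gt_eqF.
  rewrite -mulrnAr sqrtrM ?ltW// invfM mulrAC mulVf ?mul1r//.
  by rewrite gt_eqF.
- by move=> x y xy; rewrite ltr_pM2l.
- by rewrite dF => x; exact: cvg_cst.
- by rewrite dF; exact: is_cvg_cst.
- by rewrite dF; exact: is_cvg_cst.
- by move=> x; apply: derivableM.
- by apply/gt0_cvgMrNy.
- by apply/gt0_cvgMry.
- move=> x; apply: cvgM; first exact: cf.
  by apply: continuous_normal_pdf; rewrite gt_eqF.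
- by move=> x; rewrite mulr_ge0// normal_pdf_ge0.
Qed.

(** Half of the Gaussian exponent absorbs the polynomial: y <= exp y at y = x^2 / 8, squared, gives
    x^4 <= 64 exp (x^2 / 4). The other half is the density of variance 2. Moments are thus finite
    without being computed. *)
Lemma pow4_normal_pdf (x : R) :
  x ^+ 4 * normal_pdf 0 1 x <= 64 * normal_peak 1 / normal_peak (Num.sqrt 2) * normal_pdf 0 (Num.sqrt 2) x.
Proof.
have s2 : Num.sqrt 2 != 0 :> R by rewrite sqrtr_eq0 -ltNge.
have p2 := normal_peak_gt0 s2.
rewrite !normal_pdf0E ?oner_eq0// mulrA -(mulrA 64) -[leRHS]mulrA.
set e1 := expR _; set e2 := expR (_ / (_ ^+ _ *+ 2)).
have -> : x ^+ 4 * (normal_peak 1 * e1) = normal_peak 1 * (x ^+ 4 * e1) by ring.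
have -> : 64 * (normal_peak 1 / normal_peak (Num.sqrt 2)) * (normal_peak (Num.sqrt 2) * e2)
  = normal_peak 1 * (64 * e2) by field; rewrite gt_eqF.
rewrite ler_wpM2l ?normal_peak_ge0// /e1 /e2.
rewrite sqr_sqrtr// expr1n.
have -> : - x ^+ 2 / (1 *+ 2) = - x ^+ 2 / (2 *+ 2) + (- x ^+ 2 / (2 *+ 2)) by field.
rewrite expRD mulrA ler_wpM2r ?expR_ge0//.
have -> : - x ^+ 2 / (2 *+ 2) = - (x ^+ 2 / 4) by field.
rewrite expRN ler_pdivrMr ?expR_gt0//.
have -> : x ^+ 2 / 4 = x ^+ 2 / 8 + x ^+ 2 / 8 by field.
rewrite expRD.
have H : x ^+ 2 / 8 <= expR (x ^+ 2 / 8).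
  by apply: le_trans (expR_ge1Dx _); rewrite lerDr.
have -> : x ^+ 4 = 64 * ((x ^+ 2 / 8) * (x ^+ 2 / 8)) by field.
by rewrite ler_wpM2l// ler_pM// divr_ge0 ?sqr_ge0.
Qed.

(** Truncation to [-1, 1], written with absolute values so that continuity and oddness are
    immediate. *)
Definition clip1 (x : R) : R := (`|x + 1| - `|x - 1|) / 2.

Lemma clip1_continuous : continuous clip1.
Proof.
move=> x; apply: cvgMr_tmp; apply: cvgB; apply: cvg_norm.
  by apply: cvgD; [exact: cvg_id|exact: cvg_cst].
by apply: cvgB; [exact: cvg_id|exact: cvg_cst].
Qed.

Lemma clip1N (x : R) : clip1 (- x) = - clip1 x.
Proof.
rewrite /clip1 -mulNr opprB; congr ((_ - _) / _).
  by rewrite -normrN opprD opprK.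
by rewrite -normrN opprD !opprK.
Qed.

Lemma clip1_bound (x : R) : `|clip1 x| <= 1.
Proof.
rewrite ler_norml /clip1; case: (ger0P (x + 1)); case: (ger0P (x - 1)); lra.
Qed.

Lemma clip1_le (x : R) : `|clip1 x| <= `|x|.
Proof.
rewrite ler_norml /clip1; case: (ger0P x); case: (ger0P (x + 1)); case: (ger0P (x - 1)); lra.
Qed.

Lemma clip1_id (x : R) : `|x| <= 1 -> clip1 x = x.
Proof.
rewrite ler_norml /clip1; case: (ger0P (x + 1)); case: (ger0P (x - 1)); lra.
Qed.

(** If |x| > 1 the left side is negative. In expectation the loss x^4 is of order h^2, so clipping
    does not change the variance of an increment to first order in h. *)
Lemma clip1_sqr (x : R) : x ^+ 2 - x ^+ 4 <= clip1 x ^+ 2 <= x ^+ 2.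
Proof.
apply/andP; split; last by rewrite -(real_normK (num_real x)) -real_normK ?num_real// ler_sqr ?nnegrE// clip1_le.
have [x1|x1] := leP `|x| 1.
  by rewrite clip1_id// gerBl -[4%N]/(2 * 2)%N exprM sqr_ge0.
apply: (@le_trans _ _ 0); last exact: sqr_ge0.
rewrite subr_le0 -[4%N]/(2 * 2)%N exprM -(real_normK (num_real x)).
have : 1 <= `|x| ^+ 2 by rewrite expr_ge1// ltW.
move: (`|x| ^+ 2) => y; nra.
Qed.

Lemma measurable_clip1 : measurable_fun setT clip1.
Proof. by apply: continuous_measurable_fun; exact: clip1_continuous. Qed.

Let mpdf : measurable_fun setT (normal_pdf (0 : R) 1).
Proof. exact: measurable_normal_pdf. Qed.

Lemma normal_moment4_fin :
  (\int[mu]_x (x ^+ 4 * normal_pdf 0 1 x)%:E < +oo)%E.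
Proof.
set K := 64 * normal_peak 1 / normal_peak (Num.sqrt 2) : R.
have K0 : 0 <= K by rewrite /K divr_ge0 ?mulr_ge0 ?normal_peak_ge0.
apply: (@le_lt_trans _ _ (\int[mu]_x (K%:E * (normal_pdf 0 (Num.sqrt 2) x)%:E))%E).
  apply: ge0_le_integral => //.
  - by move=> x _; rewrite lee_fin mulr_ge0 ?normal_pdf_ge0// -[4%N]/(2 * 2)%N exprM sqr_ge0.
  - by apply/measurable_EFinP/measurable_funM.
  - by apply: emeasurable_funM => //; apply/measurable_EFinP; exact: measurable_normal_pdf.
  - by move=> x _; rewrite -EFinM lee_fin pow4_normal_pdf.
rewrite ge0_integralZl//.
- by rewrite integral_normal_pdf mule1 ltry.
- by apply/measurable_EFinP; exact: measurable_normal_pdf.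
- by move=> x _; rewrite lee_fin normal_pdf_ge0.
Qed.

Lemma normal_moment2_fin :
  (\int[mu]_x (x ^+ 2 * normal_pdf 0 1 x)%:E < +oo)%E.
Proof.
apply: (@le_lt_trans _ _ (\int[mu]_x ((normal_pdf 0 1 x)%:E + (x ^+ 4 * normal_pdf 0 1 x)%:E))%E).
  apply: ge0_le_integral => //.
  - by move=> x _; rewrite lee_fin mulr_ge0 ?normal_pdf_ge0 ?sqr_ge0.
  - by apply/measurable_EFinP/measurable_funM.
  - apply: emeasurable_funD; first exact/measurable_EFinP.
    by apply/measurable_EFinP/measurable_funM.
  - move=> x _; rewrite -EFinD lee_fin -[X in _ <= X + _]mul1r -mulrDl ler_wpM2r ?normal_pdf_ge0//.
    rewrite -[4%N]/(2 * 2)%N exprM; move: (x ^+ 2) => y; nra.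
rewrite ge0_integralD//.
- by rewrite integral_normal_pdf lte_add_pinfty ?ltry// normal_moment4_fin.
- by move=> x _; rewrite lee_fin normal_pdf_ge0.
- exact/measurable_EFinP.
- by move=> x _; rewrite lee_fin mulr_ge0 ?normal_pdf_ge0// -[4%N]/(2 * 2)%N exprM sqr_ge0.
- by apply/measurable_EFinP/measurable_funM.
Qed.

Lemma normal_moment2_gt0 :
  (0 < \int[mu]_x (x ^+ 2 * normal_pdf 0 1 x)%:E)%E.
Proof.
have p0 : 0 < normal_pdf 0 1 (2 : R).
  by rewrite normal_pdf0E ?oner_eq0// mulr_gt0 ?expR_gt0 ?normal_peak_gt0 ?oner_eq0.
apply: (@lt_le_trans _ _ (\int[mu]_(x in `[1%R, 2%R]) (normal_pdf 0 1 2)%:E)%E).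
  rewrite integral_cst//= lebesgue_measure_itv /= lte_fin ltr1n.
  by rewrite -EFinB -EFinM lte_fin mulr_gt0//; lra.
apply: (@le_trans _ _ (\int[mu]_(x in `[1%R, 2%R]) (x ^+ 2 * normal_pdf 0 1 x)%:E)%E).
  apply: ge0_le_integral => //.
  - by move=> x _; rewrite lee_fin ltW.
  - by apply/measurable_EFinP/measurable_funTS/measurable_funM.
  - move=> x; rewrite /= in_itv /= => /andP[x1 x2]; rewrite lee_fin.
    rewrite -[leLHS]mul1r ler_pM ?(ltW p0)//; first by rewrite expr_ge1// ; lra.
    rewrite !normal_pdf0E ?oner_eq0// ler_wpM2l ?normal_peak_ge0// ler_expR.
    rewrite ler_pM2r// lerN2 ler_sqr// nnegrE; lra.
apply: ge0_subset_integral => //.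
  by apply/measurable_EFinP/measurable_funM.
by move=> x _; rewrite lee_fin mulr_ge0 ?normal_pdf_ge0 ?sqr_ge0.
Qed.

Lemma normal_integral_oppr (f : R -> R) :
  continuous f -> (forall x, 0 <= f x) ->
  (\int[mu]_x (f x * normal_pdf 0 1 x)%:E = \int[mu]_x (f (- x) * normal_pdf 0 1 x)%:E)%E.
Proof.
move=> cf f0.
have cfN : continuous (fun x => f (- x)).
  by move=> x; apply: continuous_comp; [exact: opp_continuous|exact: cf].
have split0 (g : R -> R) : continuous g -> (forall x, 0 <= g x) ->
  (\int[mu]_x (g x * normal_pdf 0 1 x)%:E =
   \int[mu]_(x in `]-oo, 0%R]) (g x * normal_pdf 0 1 x)%:E +
   \int[mu]_(x in `[0%R, +oo[) (g x * normal_pdf 0 1 x)%:E)%E.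
  move=> cg g0.
  have mg : measurable_fun setT (EFin \o (fun x => g x * normal_pdf 0 1 x)).
    by apply/measurable_EFinP/measurable_funM => //; exact: continuous_measurable_fun.
  rewrite -integral_itv_obnd_cbnd; last exact: measurable_funTS.
  rewrite -ge0_integral_setU//.
  - by rewrite -(setCitvl (BRight 0)) setUv.
  - exact: measurable_funTS.
  - by move=> x _; rewrite lee_fin mulr_ge0 ?normal_pdf_ge0.
  - by apply/disj_setPS; rewrite -setCitvl setICr.
rewrite split0// [RHS]split0// addeC; congr (_ + _)%E.
  rewrite [RHS](normal_prob_oppr (oner_neq0 R) cfN)//.
  by apply: eq_integral => x _; rewrite opprK.
exact: (normal_prob_oppr (oner_neq0 R) cf).
Qed.

(* That this moment is 1 is not needed: it only rescales the noise. *)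
Definition gauss2 : R := fine (\int[mu]_x (x ^+ 2 * normal_pdf 0 1 x)%:E)%E.

(** Positivity keeps the rescaled noise coefficients non-zero wherever the original ones are. *)
Lemma gauss2_gt0 : 0 < gauss2.
Proof. by rewrite fine_gt0// normal_moment2_gt0 normal_moment2_fin. Qed.

Definition gauss4 : R := fine (\int[mu]_x (x ^+ 4 * normal_pdf 0 1 x)%:E)%E.

Lemma gauss4_ge0 : 0 <= gauss4.
Proof.
apply: fine_ge0; apply: integral_ge0 => x _.
by rewrite lee_fin mulr_ge0 ?normal_pdf_ge0// -[4%N]/(2 * 2)%N exprM sqr_ge0.
Qed.

Section moments_of_normal_variable.
Context d (Omega : measurableType d) (P : probability Omega R) (X : {RV P >-> R}) (h : R).
Hypothesis h0 : 0 < h.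
Hypothesis lawX : forall U, measurable U -> P (X @^-1` U) = normal_prob 0 (Num.sqrt h) U.

Lemma ge0_integral_normal_RV (f : R -> R) : continuous f -> (forall x, 0 <= f x) ->
  (\int[P]_w (f (X w))%:E = \int[mu]_x (f (Num.sqrt h * x) * normal_pdf 0 1 x)%:E)%E.
Proof.
move=> cf f0; rewrite -ge0_integral_normal_scale//.
have mf := continuous_measurable_fun cf.
rewrite -ge0_integral_normal_prob// ?gt_eqF ?sqrtr_gt0//.
have mX : measurable_fun setT (X : Omega -> measurableTypeR R) 
  by move=> mT U mU; exact: (@measurable_funPT _ _ _ _ X mT U mU).
have mf' : measurable_fun setT (EFin \o f : measurableTypeR R -> \bar R) by exact/measurable_EFinP.
have := @ge0_integral_pushforward _ _ _ (measurableTypeR R) R _ mX P setT (EFin \o f) measurableT mf'.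
rewrite preimage_setT => <-; last by move=> x _ /=; rewrite lee_fin.
by apply: (eq_measure_integral (normal_prob 0 (Num.sqrt h))) => A mA _; exact: lawX.
Qed.

Lemma clip1_integrable k : P.-integrable setT (fun w => (clip1 (X w) ^+ k)%:E).
Proof.
apply: (@le_integrable _ _ _ _ _ _ _ (EFin \o cst 1)) => //.
- apply/measurable_EFinP/measurable_funX; apply: measurableT_comp => //; exact: measurable_clip1.
- by move=> x _ /=; rewrite lee_fin normrX normr1 exprn_ile1// clip1_bound.
- exact: finite_measure_integrable_cst.
Qed.

(** The Gaussian formulas above concern nonnegative integrands, so [clip1] is split into its
    positive and negative parts, which are exchanged by the reflection. *)
Lemma clip1_mean0 : (\int[P]_w (clip1 (X w))%:E = 0)%E.
Proof.
have mt : measurable_fun setT (fun w => clip1 (X w)).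
  by apply: measurableT_comp => //; exact: measurable_clip1.
have it := clip1_integrable 1.
pose fp x := (`|clip1 x| + clip1 x) / 2; pose fn x := (`|clip1 x| - clip1 x) / 2.
have cfp : continuous fp.
  by move=> x; apply: cvgMr_tmp; apply: cvgD; [apply: cvg_norm|]; exact: clip1_continuous.
have cfn : continuous fn.
  by move=> x; apply: cvgMr_tmp; apply: cvgB; [apply: cvg_norm|]; exact: clip1_continuous.
have fp0 x : 0 <= fp x.
  by rewrite divr_ge0// -lerBlDr sub0r -normrN ler_norm.
have fn0 x : 0 <= fn x by rewrite divr_ge0// subr_ge0 ler_norm.
have E : (\int[P]_w (fp (X w))%:E = \int[P]_w (fn (X w))%:E)%E.
  rewrite !ge0_integral_normal_RV// normal_integral_oppr//.
  - by apply: eq_integral => x _; rewrite mulrN /fp clip1N normrN.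
  - by move=> x; apply: continuous_comp; [exact: mulrl_continuous|exact: cfp].
have b (f : R -> R) : continuous f -> (forall x, `|f x| <= 1) ->
    P.-integrable setT (fun w => (f (X w))%:E).
  move=> cf f1; apply: (@le_integrable _ _ _ _ _ _ _ (EFin \o cst 1)) => //.
  - by apply/measurable_EFinP; apply: measurableT_comp => //; exact: continuous_measurable_fun.
  - by move=> x _ /=; rewrite lee_fin normr1.
  - exact: finite_measure_integrable_cst.
have bt x := clip1_bound x.
have ip : P.-integrable setT (fun w => (fp (X w))%:E).
  apply: b => // x; rewrite ger0_norm// /fp; have := bt x; have := ler_norm (clip1 x); lra.
have in_ : P.-integrable setT (fun w => (fn (X w))%:E).
  apply: b => // x; rewrite ger0_norm// /fn; have := bt x; have := ler_norm (- clip1 x); rewrite normrN; lra.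
transitivity (\int[P]_w ((fp (X w))%:E - (fn (X w))%:E))%E.
  by apply: eq_integral => w _; rewrite -EFinB /fp /fn; congr EFin; field.
by rewrite integralB// E subee// -E; exact: integrable_fin_num.
Qed.

(** Two-sided because the Hessian entries that multiply it in [step_lyapunov] have no sign. *)
Lemma clip1_moment2 : h * gauss2 - h ^+ 2 * gauss4 <= \int[P]_w (clip1 (X w) ^+ 2) <= h * gauss2.
Proof.
have m2 : measurable_fun setT (fun x : R => (x ^+ 2 * normal_pdf 0 1 x)%:E).
  by apply/measurable_EFinP/measurable_funM.
have m4 : measurable_fun setT (fun x : R => (x ^+ 4 * normal_pdf 0 1 x)%:E).
  by apply/measurable_EFinP/measurable_funM.
have e4 (x : R) : 0 <= x ^+ 4 by rewrite -[4%N]/(2 * 2)%N exprM sqr_ge0.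
have p0 (x : R) : 0 <= normal_pdf 0 1 x := normal_pdf_ge0 _ _ _.
have c2 : continuous (fun x => clip1 x ^+ 2).
  by move=> x; apply: (continuous_comp (g := fun y : R => y ^+ _)); [exact: clip1_continuous|exact: exprn_continuous].
have ms : measurable_fun setT (fun x : R => (clip1 (Num.sqrt h * x) ^+ 2 * normal_pdf 0 1 x)%:E).
  apply/measurable_EFinP/measurable_funM => //.
  apply: measurable_funX; apply: measurableT_comp; first exact: measurable_clip1.
  exact: mulrl_measurable.
have g2E : (gauss2%:E = \int[mu]_x (x ^+ 2 * normal_pdf 0 1 x)%:E)%E.
  by rewrite fineK// ge0_fin_numE ?normal_moment2_fin// ltW// normal_moment2_gt0.
have g4E : (gauss4%:E = \int[mu]_x (x ^+ 4 * normal_pdf 0 1 x)%:E)%E.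
  by rewrite fineK// ge0_fin_numE ?normal_moment4_fin//; apply: integral_ge0 => x _; rewrite lee_fin mulr_ge0.
have sq (x : R) : clip1 (Num.sqrt h * x) ^+ 2 <= h * x ^+ 2.
  by have /andP[_] := clip1_sqr (Num.sqrt h * x); rewrite [(Num.sqrt h * x) ^+ 2]exprMn sqr_sqrtr// ltW.
have sq' (x : R) : h * x ^+ 2 <= clip1 (Num.sqrt h * x) ^+ 2 + h ^+ 2 * x ^+ 4.
  have /andP[+ _] := clip1_sqr (Num.sqrt h * x).
  have -> : (Num.sqrt h * x) ^+ 4 = (Num.sqrt h ^+ 2) ^+ 2 * x ^+ 4 by ring.
  have -> : (Num.sqrt h * x) ^+ 2 = Num.sqrt h ^+ 2 * x ^+ 2 by ring.
  have -> : Num.sqrt h ^+ 2 = h by rewrite sqr_sqrtr// ltW.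
  lra.
have -> : \int[P]_w (clip1 (X w) ^+ 2) = fine (\int[mu]_x (clip1 (Num.sqrt h * x) ^+ 2 * normal_pdf 0 1 x)%:E)%E.
  by rewrite /Rintegral (ge0_integral_normal_RV c2)// => x; exact: sqr_ge0.
set I := (\int[mu]_x (clip1 (Num.sqrt h * x) ^+ 2 * normal_pdf 0 1 x)%:E)%E.
have I0 : (0 <= I)%E by apply: integral_ge0 => x _; rewrite lee_fin mulr_ge0// sqr_ge0.
have Ile : (I <= (h * gauss2)%:E)%E.
  rewrite EFinM g2E -ge0_integralZl//; last 2 first.
    by move=> x _; rewrite lee_fin mulr_ge0// sqr_ge0.
    by rewrite lee_fin ltW.
  apply: ge0_le_integral => //.
  - by move=> x _; rewrite lee_fin mulr_ge0// sqr_ge0.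
  - exact: emeasurable_funM.
  - by move=> x _; rewrite -EFinM lee_fin mulrA ler_wpM2r.
have Ifin : I \is a fin_num by rewrite ge0_fin_numE//; apply: le_lt_trans Ile _; rewrite ltry.
apply/andP; split; last by rewrite -lee_fin fineK.
rewrite lerBlDr -lee_fin EFinD fineK// !EFinM g2E g4E -!ge0_integralZl//; last 4 first.
- by move=> x _; rewrite lee_fin mulr_ge0.
- by rewrite lee_fin sqr_ge0.
- by move=> x _; rewrite lee_fin mulr_ge0// sqr_ge0.
- by rewrite lee_fin ltW.
rewrite -ge0_integralD//; last 3 first.
- by move=> x _; rewrite lee_fin mulr_ge0// sqr_ge0.
- by move=> x _; rewrite -EFinM lee_fin mulr_ge0 ?sqr_ge0// mulr_ge0.
- exact: emeasurable_funM.
apply: ge0_le_integral => //.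
- move=> x _; rewrite -EFinM lee_fin; apply: mulr_ge0; first exact: ltW.
  by apply: mulr_ge0 => //; exact: sqr_ge0.
- exact: emeasurable_funM.
- by apply: emeasurable_funD => //; exact: emeasurable_funM.
- by move=> x _; rewrite -!EFinM -EFinD lee_fin mulrA [X in _ + X]mulrA -mulrDl ler_wpM2r.
Qed.

Lemma clip1_moment4 : \int[P]_w (clip1 (X w) ^+ 4) <= h ^+ 2 * gauss4.
Proof.
have m4 : measurable_fun setT (fun x : R => (x ^+ 4 * normal_pdf 0 1 x)%:E).
  by apply/measurable_EFinP/measurable_funM.
have e4 (x : R) : 0 <= x ^+ 4 by rewrite -[4%N]/(2 * 2)%N exprM sqr_ge0.
have p0 (x : R) : 0 <= normal_pdf 0 1 x := normal_pdf_ge0 _ _ _.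
have c4 : continuous (fun x => clip1 x ^+ 4).
  by move=> x; apply: (continuous_comp (g := fun y : R => y ^+ _)); [exact: clip1_continuous|exact: exprn_continuous].
have g4E : (gauss4%:E = \int[mu]_x (x ^+ 4 * normal_pdf 0 1 x)%:E)%E.
  by rewrite fineK// ge0_fin_numE ?normal_moment4_fin//; apply: integral_ge0 => x _; rewrite lee_fin mulr_ge0.
have -> : \int[P]_w (clip1 (X w) ^+ 4) = fine (\int[mu]_x (clip1 (Num.sqrt h * x) ^+ 4 * normal_pdf 0 1 x)%:E)%E.
  by rewrite /Rintegral (ge0_integral_normal_RV c4).
rewrite -lee_fin.
set I := (\int[mu]_x (clip1 (Num.sqrt h * x) ^+ 4 * normal_pdf 0 1 x)%:E)%E.
have I0 : (0 <= I)%E by apply: integral_ge0 => x _; rewrite lee_fin mulr_ge0// sqr_ge0.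
have Ile : (I <= (h ^+ 2 * gauss4)%:E)%E.
  rewrite EFinM g4E -ge0_integralZl//; last 2 first.
    by move=> x _; rewrite lee_fin mulr_ge0.
    by rewrite lee_fin sqr_ge0.
  apply: ge0_le_integral => //.
  - by move=> x _; rewrite lee_fin mulr_ge0.
  - apply/measurable_EFinP/measurable_funM => //.
    apply: measurable_funX; apply: measurableT_comp; first exact: measurable_clip1.
    exact: mulrl_measurable.
  - exact: emeasurable_funM.
  - move=> x _; rewrite -EFinM lee_fin mulrA ler_wpM2r//.
    have := clip1_sqr (Num.sqrt h * x); rewrite exprMn sqr_sqrtr; last exact: ltW.
    move=> /andP[_ H].
    have -> : h ^+ 2 * x ^+ 4 = (h * x ^+ 2) ^+ 2 by ring.
    have -> : clip1 (Num.sqrt h * x) ^+ 4 = (clip1 (Num.sqrt h * x) ^+ 2) ^+ 2 by ring.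
    by rewrite ler_sqr// nnegrE ?sqr_ge0// mulr_ge0 ?sqr_ge0// ltW.
by rewrite fineK// ge0_fin_numE//; apply: le_lt_trans Ile _; rewrite ltry.
Qed.

End moments_of_normal_variable.

End normal_moments.

(** * Functions of class C^2 *)

Section C2_functions.
Context (R : realType) (n : nat).
Local Notation V := 'cV[R]_n.

(** Landau symbols O(|d|^k) and, for [remo], o(|d|^2), uniform for [x] in bounded sets. Such Taylor
    estimates take the place of a theory of second derivatives in several variables. *)
Definition remO (k : nat) (r : V -> V -> R) := forall M : R, 0 < M ->
  exists C e : R, [/\ 0 <= C, 0 < e &
    forall x d : V, `|x| <= M -> `|d| <= e -> `|r x d| <= C * `|d| ^+ k].

Definition remo (r : V -> V -> R) := forall M e : R, 0 < M -> 0 < e ->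
  exists2 f : R, 0 < f &
    forall x d : V, `|x| <= M -> `|d| <= f -> `|r x d| <= e * `|d| ^+ 2.

Lemma remOD k r s : remO k r -> remO k s -> remO k (fun x d => r x d + s x d).
Proof.
move=> hr hs M M0; have [C [e [C0 e0 H]]] := hr M M0; have [D [f [D0 f0 K]]] := hs M M0.
exists (C + D), (Num.min e f); split; first exact: addr_ge0.
  by rewrite lt_min e0 f0.
move=> x d xM; rewrite le_min => /andP[de df].
by apply: le_trans (ler_normD _ _) _; rewrite mulrDl lerD// ?H// K.
Qed.

Lemma remOM k l r s : remO k r -> remO l s ->
  remO (k + l) (fun x d => r x d * s x d).
Proof.
move=> hr hs M M0; have [C [e [C0 e0 H]]] := hr M M0; have [D [f [D0 f0 K]]] := hs M M0.
exists (C * D), (Num.min e f); split; first exact: mulr_ge0.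
  by rewrite lt_min e0 f0.
move=> x d xM; rewrite le_min => /andP[de df].
by rewrite normrM exprD mulrACA ler_pM// ?H// K.
Qed.

Lemma remO_leq k l r : (l <= k)%N -> remO k r -> remO l r.
Proof.
move=> lk hr M M0; have [C [e [C0 e0 H]]] := hr M M0.
exists C, (Num.min e 1); split => //; first by rewrite lt_min e0 ltr01.
move=> x d xM; rewrite le_min => /andP[de d1]; apply: le_trans (H _ _ xM de) _.
by rewrite ler_wpM2l// ler_wiXn2l.
Qed.

Lemma remO_remo r : remO 3 r -> remo r.
Proof.
move=> hr M e M0 e0; have [C [f [C0 f0 H]]] := hr M M0.
have C1 : 0 < C + 1 by rewrite ltr_wpDl.
exists (Num.min f (e / (C + 1))); first by rewrite lt_min f0 divr_gt0.
move=> x d xM; rewrite le_min => /andP[df de]; apply: le_trans (H _ _ xM df) _.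
rewrite exprS mulrA ler_wpM2r ?sqr_ge0//.
apply: (@le_trans _ _ ((C + 1) * `|d|)); first by rewrite ler_wpM2r// lerDl.
by rewrite mulrC -ler_pdivlMr.
Qed.

Lemma remo_remO r : remo r -> remO 2 r.
Proof.
by move=> hr M M0; have [f f0 H] := hr M 1 M0 ltr01; exists 1, f; split.
Qed.

Lemma remoD r s : remo r -> remo s -> remo (fun x d => r x d + s x d).
Proof.
move=> hr hs M e M0 e0; have e2 : 0 < e / 2 by rewrite divr_gt0.
have [f f0 H] := hr M _ M0 e2; have [g g0 K] := hs M _ M0 e2.
exists (Num.min f g); first by rewrite lt_min f0 g0.
move=> x d xM; rewrite le_min => /andP[df dg].
apply: le_trans (ler_normD _ _) _; by rewrite (splitr e) mulrDl lerD//; [exact: H|exact: K].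
Qed.

Lemma remoM r s : remO 0 r -> remo s -> remo (fun x d => r x d * s x d).
Proof.
move=> hr hs M e M0 e0; have [C [f [C0 f0 H]]] := hr M M0.
have C1 : 0 < C + 1 by rewrite ltr_wpDl.
have [g g0 K] := hs M (e / (C + 1)) M0 (divr_gt0 e0 C1).
exists (Num.min f g); first by rewrite lt_min f0 g0.
move=> x d xM; rewrite le_min => /andP[df dg]; rewrite normrM.
apply: (@le_trans _ _ ((C + 1) * (e / (C + 1) * `|d| ^+ 2))).
  rewrite ler_pM// ?K//; apply: le_trans (H _ _ xM df) _.
  by rewrite expr0 mulr1 lerDl.
by rewrite mulrA (mulrC (C + 1)) divfK ?gt_eqF.
Qed.

Lemma eq_remo r s : (forall x d, r x d = s x d) -> remo s -> remo r.
Proof.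
by move=> rs hs M e M0 e0; have [f f0 H] := hs M e M0 e0; exists f => // x d; rewrite rs; exact: H.
Qed.

(* [gr] and [hs] are meant to be the gradient and the Hessian of [fv]; only [C2]
   enforces it. *)
Record fn := Fn { fv : V -> R ; gr : V -> 'I_n -> R ; hs : V -> 'I_n -> 'I_n -> R }.

Definition d1 (F : fn) (x d : V) : R := \sum_i gr F x i * d i 0.
Definition d2 (F : fn) (x d : V) : R := \sum_i \sum_j hs F x i j * d i 0 * d j 0.
Definition rem2 (F : fn) (x d : V) : R :=
  fv F (x + d) - fv F x - d1 F x d - d2 F x d / 2.

Definition loc_bounded (f : V -> R) := forall M : R, 0 < M ->
  exists2 C : R, 0 <= C & forall x : V, `|x| <= M -> `|f x| <= C.

(** Class C^2 in the sense of a locally uniform second-order Taylor expansion. This is what the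
    one-step estimate of the Euler chain consumes, and it passes to sums, products and
    compositions. *)
Definition C2 (F : fn) := [/\ loc_bounded (fv F), forall i, loc_bounded (gr F ^~ i),
  forall i j, loc_bounded (fun x => hs F x i j) & remo (rem2 F)].

Lemma loc_boundedD f g : loc_bounded f -> loc_bounded g -> loc_bounded (fun x => f x + g x).
Proof.
move=> hf hg M M0; have [C C0 H] := hf M M0; have [D D0 K] := hg M M0.
exists (C + D); first exact: addr_ge0.
by move=> x xM; apply: le_trans (ler_normD _ _) _; rewrite lerD ?H ?K.
Qed.

Lemma loc_boundedM f g : loc_bounded f -> loc_bounded g -> loc_bounded (fun x => f x * g x).
Proof.
move=> hf hg M M0; have [C C0 H] := hf M M0; have [D D0 K] := hg M M0.
exists (C * D); first exact: mulr_ge0.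
by move=> x xM; rewrite normrM ler_pM ?H ?K.
Qed.

Lemma loc_bounded_cst c : loc_bounded (fun=> c).
Proof. by move=> M M0; exists `|c|. Qed.

Lemma loc_bounded_remO f : loc_bounded f -> remO 0 (fun x _ => f x).
Proof.
move=> hf M M0; have [C C0 H] := hf M M0; exists C, 1; split => // x d xM _.
by rewrite expr0 mulr1; exact: H.
Qed.

Lemma remO_sum k (I : Type) (s : seq I) (r : I -> V -> V -> R) :
  (forall i, remO k (r i)) -> remO k (fun x d => \sum_(i <- s) r i x d).
Proof.
move=> hr; elim: s => [|i s IH].
  by move=> M M0; exists 0, 1; split => // x d _ _; rewrite big_nil normr0 mul0r.
have H := remOD (hr i) IH.
by move=> M M0; have [C [e [C0 e0 K]]] := H M M0; exists C, e; split => // x d xM de; rewrite big_cons; exact: K.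
Qed.

Lemma mxcoord_le (u : V) i : `|u i 0| <= `|u|.
Proof.
rewrite {2}/Num.Def.normr /= mx_normrE; apply/bigmax_geP; right => /=.
by exists (i, 0).
Qed.

Lemma remO_coord i : remO 1 (fun _ d => d i 0).
Proof. by move=> M M0; exists 1, 1; split => // x d _ _; rewrite expr1 mul1r mxcoord_le. Qed.

Lemma C2_big1 F : C2 F -> remO 1 (d1 F).
Proof.
move=> [_ hg _ _]; apply: remO_sum => i.
exact: (remOM (loc_bounded_remO (hg i)) (remO_coord i)).
Qed.

Lemma C2_big2 F : C2 F -> remO 2 (d2 F).
Proof.
move=> [_ _ hh _]; apply: remO_sum => i; apply: remO_sum => j.
exact: (remOM (remOM (loc_bounded_remO (hh i j)) (remO_coord i)) (remO_coord j)).
Qed.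

Definition cst_fn (c : R) := Fn (fun=> c) (fun _ _ => 0) (fun _ _ _ => 0).
Definition coord_fn (k : 'I_n) := Fn (fun x => x k 0) (fun _ i => (i == k)%:R) (fun _ _ _ => 0).
Definition add_fn F G := Fn (fun x => fv F x + fv G x)
  (fun x i => gr F x i + gr G x i) (fun x i j => hs F x i j + hs G x i j).
Definition mul_fn F G := Fn (fun x => fv F x * fv G x)
  (fun x i => fv F x * gr G x i + fv G x * gr F x i)
  (fun x i j => fv F x * hs G x i j + fv G x * hs F x i j +
                gr F x i * gr G x j + gr F x j * gr G x i).
Definition comp_fn (f f1 f2 : R -> R) F := Fn (fun x => f (fv F x))
  (fun x i => f1 (fv F x) * gr F x i)
  (fun x i j => f1 (fv F x) * hs F x i j + f2 (fv F x) * gr F x i * gr F x j).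

Lemma C2_cst c : C2 (cst_fn c).
Proof.
split => [|i|i j|]; try exact: loc_bounded_cst.
apply: (@eq_remo _ (fun _ _ => 0)).
  move=> x d; rewrite /rem2 /d1 /d2 /= big1 => [|i _]; last by rewrite mul0r.
  rewrite big1 => [|i _]; last by rewrite big1// => j _; rewrite !mul0r.
  by rewrite subrr mul0r !subr0.
by move=> M e M0 e0; exists 1 => // x d _ _; rewrite normr0 mulr_ge0 ?sqr_ge0// ltW.
Qed.

Lemma C2_coord k : C2 (coord_fn k).
Proof.
split => [|i|i j|]; try exact: loc_bounded_cst.
  by move=> M M0; exists M; [exact: ltW|move=> x; exact: le_trans (mxcoord_le _ _)].
apply: (@eq_remo _ (fun _ _ => 0)).
  move=> x d; rewrite /rem2 /d1 /d2 /= [X in _ - X / 2]big1; last first.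
    by move=> i _; rewrite big1// => j _; rewrite !mul0r.
  rewrite (bigD1 k)//= eqxx mul1r big1; last by move=> i /negbTE ->; rewrite mul0r.
  by rewrite !mxE mul0r subr0 addr0 (addrC (x k 0)) addrK subrr.
by move=> M e M0 e0; exists 1 => // x d _ _; rewrite normr0 mulr_ge0 ?sqr_ge0// ltW.
Qed.

Lemma C2_add F G : C2 F -> C2 G -> C2 (add_fn F G).
Proof.
move=> [F0 F1 F2 F3] [G0 G1 G2 G3]; split => [|i|i j|]; try exact: loc_boundedD.
apply: eq_remo (remoD F3 G3) => x d; rewrite /rem2 /d1 /d2 /=.
under eq_bigr do rewrite mulrDl.
rewrite big_split /=.
under [X in _ - X / 2]eq_bigr do under eq_bigr do rewrite !mulrDl.
under [X in _ - X / 2]eq_bigr do rewrite big_split.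
rewrite big_split /=; lra.
Qed.

Lemma C2_mul F G : C2 F -> C2 G -> C2 (mul_fn F G).
Proof.
move=> cF cG; have [F0 F1 F2 F3] := cF; have [G0 G1 G2 G3] := cG.
have bF1 := C2_big1 cF; have bG1 := C2_big1 cG; have bF2 := C2_big2 cF; have bG2 := C2_big2 cG.
split => [|i|i j|].
- exact: loc_boundedM.
- by apply: loc_boundedD; exact: loc_boundedM.
- by do !apply: loc_boundedD; exact: loc_boundedM.
have half k r : remO k r -> remO k (fun x d => 2^-1 * r x d).
  move=> hr; exact: (remOM (k := 0) (loc_bounded_remO (loc_bounded_cst _)) hr).
have BF : remO 2 (fun x d => 2^-1 * d2 F x d + rem2 F x d).
  by apply: remOD; [exact: half|exact: remo_remO].
have BG : remO 2 (fun x d => 2^-1 * d2 G x d + rem2 G x d).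
  by apply: remOD; [exact: half|exact: remo_remO].
(* The five pieces of the remainder of a product: value times remainder, twice, and the cross
   products of expansions, whose orders add up to 3 or 4. *)
have K1 := remoM (loc_bounded_remO F0) G3.
have K2 := remoM (loc_bounded_remO G0) F3.
have K3 := remO_remo (remOM bF1 BG).
have K4 := remO_remo (remOM BF bG1).
have K5 := remO_remo (remO_leq (isT : (3 <= 4)%N) (remOM BF BG)).
apply: eq_remo (remoD K1 (remoD K2 (remoD K3 (remoD K4 K5)))) => x d.
have E1 : d1 (mul_fn F G) x d = fv F x * d1 G x d + fv G x * d1 F x d.
  by rewrite /d1 !mulr_sumr -big_split; apply: eq_bigr => i _ /=; ring.
have E2 : d2 (mul_fn F G) x d = fv F x * d2 G x d + fv G x * d2 F x d + 2 * d1 F x d * d1 G x d.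
  rewrite /d2 /d1 -mulrA [d1sum in 2 * d1sum]mulr_suml mulr_sumr !mulr_sumr -!big_split /=.
  transitivity (\sum_i \sum_j ((fv F x * hs G x i j + fv G x * hs F x i j) * d i 0 * d j 0 +
      (gr F x i * d i 0) * (gr G x j * d j 0)) + \sum_i \sum_j (gr F x j * d j 0) * (gr G x i * d i 0)).
    rewrite -big_split; apply: eq_bigr => i _; rewrite -big_split; apply: eq_bigr => j _ /=; ring.
  rewrite [X in _ + X]exchange_big /= -big_split; apply: eq_bigr => i _ /=.
  rewrite !mulr_sumr -!big_split /=; apply: eq_bigr => j _; ring.
rewrite {1}/rem2 E1 E2 /=.
have -> : fv F (x + d) = rem2 F x d + fv F x + d1 F x d + d2 F x d / 2 by rewrite /rem2; field.
have -> : fv G (x + d) = rem2 G x d + fv G x + d1 G x d + d2 G x d / 2 by rewrite /rem2; field.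
by field.
Qed.

(** Relative to a domain [I] because the powers of 1 + t are only expanded for t >= 0. *)
Definition C2on (I : set R) (f f1 f2 : R -> R) := forall M : R, 0 < M ->
  (exists2 C : R, 0 <= C & forall t, I t -> `|t| <= M -> [/\ `|f t| <= C, `|f1 t| <= C & `|f2 t| <= C]) /\
  (forall e : R, 0 < e -> exists2 g : R, 0 < g & forall t s, I t -> I (t + s) -> `|t| <= M -> `|s| <= g ->
     `|f (t + s) - f t - f1 t * s - f2 t * s ^+ 2 / 2| <= e * s ^+ 2).

Lemma C2_comp I f f1 f2 F : C2on I f f1 f2 -> (forall x, I (fv F x)) -> C2 F ->
  C2 (comp_fn f f1 f2 F).
Proof.
move=> hf IF cF; have [F0 F1 F2 F3] := cF.
have bF1 := C2_big1 cF; have bF2 := C2_big2 cF.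
have lb (g : R -> R) : (forall M, 0 < M -> exists2 C : R, 0 <= C & forall t, I t -> `|t| <= M -> `|g t| <= C) ->
    loc_bounded (fun x => g (fv F x)).
  move=> hg M M0; have [C C0 H] := F0 M M0.
  have C1 : 0 < C + 1 by rewrite ltr_wpDl.
  have [D D0 K] := hg _ C1; exists D => // x xM; apply: K => //.
  by apply: le_trans (H _ xM) _; rewrite lerDl.
have l0 : loc_bounded (fun x => f (fv F x)).
  by apply: lb => M M0; have [[C C0 H] _] := hf M M0; exists C => // t It tM; have [] := H t It tM.
have l1 : loc_bounded (fun x => f1 (fv F x)).
  by apply: lb => M M0; have [[C C0 H] _] := hf M M0; exists C => // t It tM; have [] := H t It tM.
have l2 : loc_bounded (fun x => f2 (fv F x)).
  by apply: lb => M M0; have [[C C0 H] _] := hf M M0; exists C => // t It tM; have [] := H t It tM.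
split => [//|i|i j|].
- exact: loc_boundedM.
- by apply: loc_boundedD; do !apply: loc_boundedM.
have half k r : remO k r -> remO k (fun x d => 2^-1 * r x d).
  move=> hr; exact: (remOM (k := 0) (loc_bounded_remO (loc_bounded_cst _)) hr).
have BF : remO 2 (fun x d => 2^-1 * d2 F x d + rem2 F x d).
  by apply: remOD; [exact: half|exact: remo_remO].
have BD : remO 1 (fun x d => d1 F x d + (2^-1 * d2 F x d + rem2 F x d)).
  by apply: remOD => //; exact: remO_leq BF.
pose D x d := d1 F x d + (2^-1 * d2 F x d + rem2 F x d).
have DE x d : fv F (x + d) = fv F x + D x d by rewrite /D /rem2; field.
have K1 : remo (fun x d => f (fv F x + D x d) - f (fv F x) - f1 (fv F x) * D x d - f2 (fv F x) * D x d ^+ 2 / 2).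
  move=> M e M0 e0; have [C C0 H] := F0 M M0.
  have C1 : 0 < C + 1 by rewrite ltr_wpDl.
  have [E [g [E0 g0 K]]] := BD M M0.
  have E1 : 0 < E + 1 by rewrite ltr_wpDl.
  have [_ /(_ (e / (E + 1) ^+ 2))[|a a0 L]] := hf _ C1.
    by rewrite divr_gt0// exprn_gt0.
  exists (Num.min g (a / (E + 1))); first by rewrite lt_min g0 divr_gt0.
  move=> x d xM; rewrite le_min => /andP[dg da].
  have Dd : `|D x d| <= (E + 1) * `|d|.
    by apply: le_trans (K _ _ xM dg) _; rewrite expr1 ler_wpM2r// lerDl.
  apply: le_trans (L _ _ _ _ _ _) _ => //.
  - by rewrite -DE.
  - by apply: le_trans (H _ xM) _; rewrite lerDl.
  - by apply: le_trans Dd _; rewrite mulrC -ler_pdivlMr.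
  rewrite -mulrA ler_wpM2l ?(ltW e0)// mulrC ler_pdivrMr ?exprn_gt0//.
  rewrite -(real_normK (num_real (D x d))) -exprMn mulrC.
  by rewrite ler_sqr ?nnegrE// ?mulr_ge0// ?ltW.
have K2 := remoM (loc_bounded_remO l1) F3.
(* With D the full increment of F, D^2 - d1^2 = (D - d1) (D + d1) has order 2 + 1, so the square of
   the increment may be replaced by that of its linear part. *)
have K3 : remo (fun x d => f2 (fv F x) * (2^-1 * ((2^-1 * d2 F x d + rem2 F x d) * (D x d + d1 F x d)))).
  apply: remoM; first exact: loc_bounded_remO.
  apply: remO_remo; apply: half; apply: (remOM (k := 2) (l := 1)) => //.
  exact: remOD.
apply: eq_remo (remoD K1 (remoD K2 K3)) => x d.
have E1 : d1 (comp_fn f f1 f2 F) x d = f1 (fv F x) * d1 F x d.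
  by rewrite /d1 mulr_sumr; apply: eq_bigr => i _ /=; ring.
have E2 : d2 (comp_fn f f1 f2 F) x d = f1 (fv F x) * d2 F x d + f2 (fv F x) * d1 F x d ^+ 2.
  rewrite /d2 /d1 expr2 mulr_suml !mulr_sumr -!big_split /=; apply: eq_bigr => i _.
  rewrite !mulr_sumr -!big_split /=; apply: eq_bigr => j _; ring.
rewrite {1}/rem2 E1 E2 /= DE /D; by field.
Qed.

End C2_functions.

Section smooth_functions.
Context (R : realType).
Implicit Types (f : R -> R) (I : set R).

Lemma derivS (f g : R -> R) (t a b : R) : is_derive t (1:R) f a -> is_derive t (1:R) g b ->
  is_derive t (1:R) (fun x => f x + g x) (a + b).
Proof. by move=> D1 D2; exact: is_deriveD. Qed.

Lemma derivP (f g : R -> R) (t a b : R) : is_derive t (1:R) f a -> is_derive t (1:R) g b ->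
  is_derive t (1:R) (fun x => f x * g x) (f t * b + g t * a).
Proof. by move=> D1 D2; exact: is_deriveM. Qed.

Lemma derivC (c t : R) : is_derive t (1:R) (fun=> c) 0.
Proof. exact: is_derive_cst. Qed.

Lemma derivI (t : R) : is_derive t (1:R) (fun x : R => x) 1.
Proof. exact: is_derive_id. Qed.

Lemma deriv_eq (f g : R -> R) (t a b : R) : is_derive t (1:R) f a -> f =1 g -> a = b ->
  is_derive t (1:R) g b.
Proof. by move=> D /funext <- <-. Qed.

Definition between (a b c : R) := Num.min a b <= c <= Num.max a b.

Lemma between_trans (a b c e : R) : between a b c -> between a c e -> between a b e.
Proof. by rewrite /between /Num.min /Num.max; do !case: ifPn; rewrite -?leNgt; lra. Qed.

Lemma between_abs (a b c : R) : between a b c -> `|c - a| <= `|b - a|.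
Proof.
rewrite /between /Num.min /Num.max; case: (ger0P (c - a)); case: (ger0P (b - a)); do !case: ifPn; rewrite -?leNgt; lra.
Qed.

Lemma mean_value_le f (f' : R -> R) (a b K : R) :
  (forall c, between a b c -> is_derive c (1:R) f (f' c)) ->
  (forall c, between a b c -> `|f' c| <= K) -> `|f b - f a| <= K * `|b - a|.
Proof.
suff H (a' b' : R) : a' <= b' -> (forall c : R, a' <= c <= b' -> is_derive c (1:R) f (f' c)) ->
    (forall c : R, a' <= c <= b' -> `|f' c| <= K) -> `|f b' - f a'| <= K * `|b' - a'|.
  move=> D B; have [ab|/ltW ab] := leP a b.
    by apply: H => // c cab; [apply: D|apply: B]; rewrite /between (min_idPl ab) (max_idPr ab).
  by rewrite distrC (distrC b); apply: H => // c cab; [apply: D|apply: B]; rewrite /between (min_idPr ab) (max_idPl ab).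
move=> ab D B; have [||c cab ->] := @MVT_segment _ f f' a' b' ab.
- by move=> x; rewrite in_itv /= => /andP[x1 x2]; apply: D; rewrite !ltW.
- apply: derivable_within_continuous => x; rewrite in_itv /= => xab.
  by have Dx := D x xab; exact: ex_derive.
by rewrite normrM ler_wpM2r// B//; move: cab; rewrite in_itv.
Qed.

(** A bounded third derivative gives a cubic remainder, by three applications of the mean value
    inequality. *)
Lemma C2on_derive I f f1 f2 f3 :
  (forall a b c, I a -> I b -> between a b c -> I c) ->
  (forall t, I t -> is_derive t (1:R) f (f1 t)) ->
  (forall t, I t -> is_derive t (1:R) f1 (f2 t)) ->
  (forall t, I t -> is_derive t (1:R) f2 (f3 t)) ->
  (forall M : R, 0 < M -> exists2 C : R, 0 <= C & forall t, I t -> `|t| <= M ->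
     [/\ `|f t| <= C, `|f1 t| <= C, `|f2 t| <= C & `|f3 t| <= C]) ->
  C2on I f f1 f2.
Proof.
move=> cI D0 D1 D2 B M M0; split.
  by have [C C0 H] := B M M0; exists C => // t It tM; have [] := H t It tM.
move=> e e0; have M1 : 0 < M + 1 by rewrite ltr_wpDr.
have [C C0 H] := B _ M1; have C1 : 0 < C + 1 by rewrite ltr_wpDl.
exists (Num.min 1 (e / (C + 1))); first by rewrite lt_min ltr01 divr_gt0.
move=> t s It Its tM; rewrite le_min => /andP[s1 se].
have Ib c : between t (t + s) c -> I c by exact: cI.
have sE c : between t (t + s) c -> `|c - t| <= `|s| by move=> /between_abs; rewrite addrAC subrr add0r.
have cM c : between t (t + s) c -> `|c| <= M + 1.
  move=> cb; rewrite -[c](subrK t) (le_trans (ler_normD _ _))// addrC lerD//.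
  exact: le_trans (sE _ cb) s1.
have A2 c : between t (t + s) c -> `|f2 c - f2 t| <= C * `|s|.
  move=> cb; apply: (@le_trans _ _ (C * `|c - t|)); last by rewrite ler_wpM2l// sE.
  apply: (@mean_value_le _ f3) => x xb; have xb' := between_trans cb xb.
    by apply: D2; exact: Ib.
  by have [] := H x (Ib _ xb') (cM _ xb').
have A1 c : between t (t + s) c -> `|f1 c - f1 t - f2 t * (c - t)| <= C * `|s| * `|s|.
  move=> cb; apply: (@le_trans _ _ (C * `|s| * `|c - t|)); last by rewrite ler_wpM2l ?sE// mulr_ge0.
  pose g x := f1 x - f1 t - f2 t * (x - t).
  have -> : f1 c - f1 t - f2 t * (c - t) = g c - g t by rewrite /g !subrr mulr0 subr0 subr0.
  apply: (@mean_value_le _ (fun x => f2 x - f2 t)) => x xb; have xb' := between_trans cb xb.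
    apply: (deriv_eq (derivS (D1 x (Ib _ xb')) (derivS (derivC (- f1 t) x)
      (derivP (derivC (- f2 t) x) (derivS (derivI x) (derivC (- t) x)))))).
      by move=> y; rewrite /g; ring.
    by ring.
  exact: A2.
pose g x := f x - f t - f1 t * (x - t) - f2 t * (x - t) ^+ 2 / 2.
have -> : f (t + s) - f t - f1 t * s - f2 t * s ^+ 2 / 2 = g (t + s) - g t.
  by rewrite /g (addrC t s) addrK !subrr expr0n /= !mulr0 mul0r !subr0 addrC.
apply: (@le_trans _ _ (C * `|s| * `|s| * `|t + s - t|)).
  apply: (@mean_value_le _ (fun x => f1 x - f1 t - f2 t * (x - t))) => x xb; last exact: A1.
    pose Dt := derivS (derivI x) (derivC (- t) x).
    apply: (deriv_eq (derivS (D0 x (Ib _ xb)) (derivS (derivC (- f t) x)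
      (derivS (derivP (derivC (- f1 t) x) Dt) (derivP (derivC (- (f2 t / 2)) x) (derivP Dt Dt)))))).
      by move=> y; rewrite /g; ring.
    by field.
rewrite addrAC subrr add0r -2!mulrA -expr2 mulrA -(real_normK (num_real s)) ler_wpM2r ?sqr_ge0//.
apply: (@le_trans _ _ ((C + 1) * `|s|)); first by rewrite ler_wpM2r// lerDl.
by rewrite mulrC -ler_pdivlMr.
Qed.

(** The shift by 1 serves the two uses: powers of 1 + |x|^2 and powers of the cutoff variable t = 1
    + tau. *)
Definition pw (a t : R) : R := (1 + t) `^ a.

Lemma pw_derive (a t : R) : 0 <= t -> is_derive t (1:R) (pw a) (a * pw (a - 1) t).
Proof.
move=> t0; have t1 : 0 < 1 + t by rewrite ltr_wpDr.
have D := is_derive1_powR a t1.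
have D2 : is_derive t (1:R) (fun x : R => 1 + x) 1.
  by apply: (deriv_eq (derivS (derivC 1 t) (derivI t))); rewrite ?add0r.
have := @is_derive1_comp R (fun x => x `^ a) (fun x : R => 1 + x) t _ _ D D2.
by move=> D3; apply: (deriv_eq D3); rewrite ?mulr1.
Qed.

Lemma pw_bound (a M t : R) : 0 <= t -> `|t| <= M -> `|pw a t| <= (1 + M) `^ `|a|.
Proof.
move=> t0 tM; rewrite ger0_norm ?powR_ge0//.
have t1 : 1 <= 1 + t by rewrite lerDl.
apply: (@le_trans _ _ ((1 + t) `^ `|a|)); first by rewrite /pw ler_powR// ler_norm.
apply: ge0_ler_powR => //; rewrite ?nnegrE ?addr_ge0//.
  by apply: le_trans tM; exact: normr_ge0.
by rewrite lerD2l (le_trans _ tM)// ler_norm.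
Qed.

Lemma pw_C2on a : C2on [set t | 0 <= t] (pw a) (fun t => a * pw (a - 1) t)
  (fun t => a * ((a - 1) * pw (a - 1 - 1) t)).
Proof.
have Dc (c g' t : R) (g : R -> R) : is_derive t (1:R) g g' -> is_derive t (1:R) (fun x => c * g x) (c * g').
  by move=> D; apply: (deriv_eq (derivP (derivC c t) D)) => //; ring.
apply: (@C2on_derive _ _ _ _ (fun t => a * ((a - 1) * ((a - 1 - 1) * pw (a - 1 - 1 - 1) t)))).
- move=> x y c /= x0 y0 /andP[+ _]; apply: le_trans; by rewrite le_min x0 y0.
- by move=> t /= t0; exact: pw_derive.
- by move=> t /= t0; apply: Dc; exact: pw_derive.
- by move=> t /= t0; apply: (Dc); apply: (Dc); exact: pw_derive.
move=> M M0.
pose p (b : R) := (1 + M) `^ `|b|.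
have p0 (b : R) : 0 <= p b by exact: powR_ge0.
exists (p a + `|a| * p (a - 1) + `|a| * (`|a - 1| * p (a - 1 - 1)) +
    `|a| * (`|a - 1| * (`|a - 1 - 1| * p (a - 1 - 1 - 1)))).
  by rewrite !addr_ge0 ?mulr_ge0.
move=> t /= t0 tM; have H (b : R) : `|pw b t| <= p b by exact: pw_bound.
have H0 := H a; have H1 : `|a * pw (a - 1) t| <= `|a| * p (a - 1) by rewrite normrM ler_wpM2l.
have H2 : `|a * ((a - 1) * pw (a - 1 - 1) t)| <= `|a| * (`|a - 1| * p (a - 1 - 1)).
  by rewrite !normrM !ler_wpM2l.
have H3 : `|a * ((a - 1) * ((a - 1 - 1) * pw (a - 1 - 1 - 1) t))| <=
   `|a| * (`|a - 1| * (`|a - 1 - 1| * p (a - 1 - 1 - 1))).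
  by rewrite !normrM !ler_wpM2l.
move: (le_trans (normr_ge0 _) H0) (le_trans (normr_ge0 _) H1) (le_trans (normr_ge0 _) H2) (le_trans (normr_ge0 _) H3).
by split; lra.
Qed.

Definition datan (t : R) : R := (1 + t ^+ 2)^-1.
Definition ddatan (t : R) : R := - 2 * t * (datan t * datan t).

Lemma oneDsqr_gt0 (t : R) : 0 < 1 + t ^+ 2.
Proof. by rewrite ltr_wpDr// sqr_ge0. Qed.

Lemma datan_01 t : 0 < datan t <= 1.
Proof. by rewrite /datan invr_gt0 oneDsqr_gt0 /= invf_le1 ?oneDsqr_gt0// lerDl sqr_ge0. Qed.

Lemma ddatan_le t : `|ddatan t| <= 1.
Proof.
have t1 := oneDsqr_gt0 t.
have t2 : `|- 2 * t| <= 1 + t ^+ 2 by have := sqr_ge0 (t - 1); have := sqr_ge0 (t + 1); rewrite ler_norml; lra.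
rewrite /ddatan /datan normrM [X in _ * X]ger0_norm; last by rewrite mulr_ge0// invr_ge0 ltW.
rewrite mulrA -ler_pdivlMr ?invr_gt0// invrK mul1r ler_pdivrMr//.
apply: le_trans t2 _; rewrite ler_peMr ?(ltW t1)// lerDl; exact: sqr_ge0.
Qed.

Lemma atan_C2on : C2on setT (@atan R) datan ddatan.
Proof.
have D1 (t : R) : is_derive t (1:R) datan (ddatan t).
  have t0 : 1 + t ^+ 2 != 0 by rewrite gt_eqF ?oneDsqr_gt0.
  have D2 := is_deriveV (f := fun x : R => 1 + x * x) _ (derivS (derivC 1 t) (derivP (derivI t) (derivI t))).
  have {}D2 : is_derive t (1:R) (fun x : R => (1 + x * x)^-1) (- (1 + t * t) ^- 2 *: (0 + (t * 1 + t * 1))).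
    by apply: D2; rewrite -expr2.
  apply: (deriv_eq D2); first by move=> x; rewrite /datan expr2.
  by rewrite /GRing.scale /= /ddatan /datan -?expr2; field.
apply: (@C2on_derive setT (@atan R) datan ddatan (fun t : R => - 2 * (datan t * datan t) + - 2 * t * (2 * (datan t * ddatan t)))).
- by [].
- move=> t _; apply: (deriv_eq (derivP (derivP (derivC (- 2) t) (derivI t)) (derivP (D1 t) (D1 t)))) => //.
  by ring.
move=> M M0; exists (pi + 4 * M + 4); first by have := pi_ge0 R; lra.
move=> t _ tM; have p0 : 0 <= pi :> R by exact: pi_ge0.
have /andP[a0 a1] := datan_01 t; have a2 := ddatan_le t.
split.
- rewrite ler_norml; have := atan_gtNpi2 t; have := atan_ltpi2 t; lra.
- rewrite ger0_norm ?(ltW a0)//; lra.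
- lra.
- move: (ddatan t) a2 (datan t) a0 a1 => z z1 a a0 a1.
  have n2 : `|2| = 2 :> R by rewrite ger0_norm.
  apply: le_trans (ler_normD _ _) _; rewrite !normrM !normrN n2 (gtr0_norm a0).
  have : a * a <= 1 by rewrite mulr_ile1// ltW.
  have y1 : a * `|z| <= 1 by rewrite mulr_ile1// ltW.
  have y0 : 0 <= a * `|z| by rewrite mulr_ge0// ltW.
  have := ler_pM (normr_ge0 t) y0 tM y1.
  by move: (a * a) (a * `|_|) (`|t|) => x y w; lra.
Qed.

End smooth_functions.

(** * Integral equations *)

Section epsilon_delta.
Context (R : realType) (W W' : normedModType R).
Implicit Types (f : W -> W') (x : W).

Lemma eps_cont f x :
  (forall e : R, 0 < e -> exists2 d, 0 < d & forall y, `|x - y| < d -> `|f x - f y| <= e) ->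
  {for x, continuous f}.
Proof.
move=> H; apply/cvgrPdist_le => e e0; have [d d0 K] := H e e0.
by apply/nbhs_ballP; exists d => // y; rewrite -ball_normE /ball_ /=; exact: K.
Qed.

Lemma cont_eps f x : {for x, continuous f} ->
  forall e : R, 0 < e -> exists2 d, 0 < d & forall y, `|x - y| < d -> `|f x - f y| <= e.
Proof.
move=> /cvgrPdist_le H e /H/nbhs_ballP[d d0 K]; exists d => // y yd.
by apply: K; rewrite -ball_normE.
Qed.

End epsilon_delta.

Section integrals.
Context (R : realType).
Local Notation mu := (@lebesgue_measure R).
Implicit Types (f g : R -> R) (a b s t T : R).

Lemma cont_integrable f a b : continuous f -> mu.-integrable `[a, b] (EFin \o f).
Proof.
move=> cf; apply: continuous_compact_integrable; first exact: segment_compact.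
exact: continuous_subspaceT.
Qed.

Lemma cont_bounded f T : continuous f -> exists2 M, 0 <= M & forall t, 0 <= t <= T -> `|f t| <= M.
Proof.
move=> cf; have [T0|T0] := leP 0 T; last first.
  by exists 0 => // t /andP[t0 tT]; have := le_lt_trans (le_trans t0 tT) T0; rewrite ltxx.
have cnf : {within `[0, T], continuous (fun t => `|f t|)}.
  by apply: continuous_subspaceT => t; apply: cvg_norm; exact: cf.
have [c _ H] := EVT_max T0 cnf.
by exists `|f c| => // t tT; apply: H; rewrite in_itv.
Qed.

Lemma int_split f s t : continuous f -> 0 <= s -> s <= t ->
  \int[mu]_(x in `[0, t]) f x = \int[mu]_(x in `[0, s]) f x + \int[mu]_(x in `[s, t]) f x.
Proof.
move=> cf s0 st; have := @Rintegral_itvB R f (BLeft 0) (BRight t) s (cont_integrable _ _ cf).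
rewrite !bnd_simp => /(_ s0 st).
rewrite Rintegral_itv_obnd_cbnd => [<-|]; first by rewrite addrC subrK.
apply: integrableS (cont_integrable s t cf) => //.
by move=> x /=; rewrite !in_itv /= => /andP[/ltW -> ->].
Qed.

Lemma int_bound f s t M : continuous f -> s <= t ->
  (forall x, s <= x <= t -> `|f x| <= M) -> `|\int[mu]_(x in `[s, t]) f x| <= M * (t - s).
Proof.
move=> cf st H; apply: le_trans (le_normr_Rintegral _ _) _ => //; first exact: cont_integrable.
apply: (@le_trans _ _ (\int[mu]_(x in `[s, t]) M)).
  apply: le_Rintegral => //.
  - by apply: cont_integrable => x; apply: cvg_norm; exact: cf.
  - by apply: cont_integrable => x; exact: cvg_cst.
rewrite Rintegral_cst//= lebesgue_measure_itv /= lte_fin; case: ltP => //= ts.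
by have -> : s = t by [apply/eqP; rewrite eq_le st ts]; rewrite subrr mulr0.
Qed.

Lemma int_lip f T M s t : continuous f -> (forall x, 0 <= x <= T -> `|f x| <= M) ->
  0 <= s -> s <= t -> t <= T ->
  `|\int[mu]_(x in `[0, t]) f x - \int[mu]_(x in `[0, s]) f x| <= M * (t - s).
Proof.
move=> cf H s0 st tT; rewrite (int_split cf s0 st) addrAC subrr add0r.
apply: int_bound => // x /andP[sx xt]; apply: H.
by rewrite (le_trans s0 sx) (le_trans xt tT).
Qed.

Lemma int_neg f t : t <= 0 -> \int[mu]_(x in `[0, t]) f x = 0.
Proof.
rewrite le_eqVlt => /orP[/eqP ->|t0].
  by rewrite set_itv1 Rintegral_set1.
by rewrite set_itv_ge ?Rintegral_set0// -leNgt bnd_simp.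
Qed.

Lemma int_continuous f : continuous f -> continuous (fun t => \int[mu]_(x in `[0, t]) f x).
Proof.
(* For negative [s] the interval is empty, so the integral depends on the positive part of [s] only,
   which is 1-Lipschitz. *)
move=> cf t; pose m (s : R) := (`|s| + s) / 2.
have Em s : \int[mu]_(x in `[0, s]) f x = \int[mu]_(x in `[0, m s]) f x.
  rewrite /m; have [s0|s0] := leP s 0.
    by rewrite ler0_norm// addNr mul0r !int_neg.
  by rewrite gtr0_norm//; have -> : (s + s) / 2 = s by field.
have [M M0 H] := cont_bounded (m t + 1) cf.
have L s : `|t - s| <= 1 ->
    `|\int[mu]_(x in `[0, t]) f x - \int[mu]_(x in `[0, s]) f x| <= M * `|t - s|.
  move=> ts1; rewrite (Em t) (Em s).
  have ms : `|m t - m s| <= `|t - s|.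
    have -> : m t - m s = (`|t| - `|s| + (t - s)) / 2 by rewrite /m; field.
    rewrite normrM [`|2^-1|]ger0_norm ?invr_ge0// ler_pdivrMr//.
    apply: le_trans (ler_normD _ _) _; rewrite mulr_natr mulr2n lerD2r.
    exact: ler_dist_dist.
  have m0 s' : 0 <= m s' by rewrite /m; case: (ger0P s'); lra.
  have m1 : m s <= m t + 1.
    have : `|m t - m s| <= 1 by exact: le_trans ms ts1.
    by rewrite ler_norml => /andP[]; lra.
  apply: (@le_trans _ _ (M * `|m t - m s|)); last by rewrite ler_wpM2l.
  have [st|st] := leP (m s) (m t).
    rewrite (ger0_norm (_ : 0 <= m t - m s)) ?subr_ge0//.
    by apply: (int_lip cf H) => //; rewrite lerDl.
  rewrite distrC (distrC (m t)) (ger0_norm (_ : 0 <= m s - m t)) ?subr_ge0 ?(ltW st)//.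
  by apply: (int_lip cf H) => //; exact: ltW.
have M1 : 0 < M + 1 by rewrite ltr_wpDl.
apply: eps_cont => e e0; exists (Num.min 1 (e / (M + 1))); first by rewrite lt_min ltr01 divr_gt0.
move=> s; rewrite lt_min => /andP[s1 s2]; apply: le_trans (L s (ltW s1)) _.
apply: (@le_trans _ _ ((M + 1) * `|t - s|)); first by rewrite ler_wpM2r// lerDl.
by rewrite mulrC -ler_pdivlMr// ltW.
Qed.

Lemma int_derive f t : continuous f -> 0 < t ->
  is_derive t (1 : R) (fun t => \int[mu]_(x in `[0, t]) f x) (f t).
Proof.
move=> cf t0.
have [|dF F'] := @continuous_FTC1_closed R f 0 t (t + 1) _ (cont_integrable _ _ cf) t0 (cf t).
  by rewrite ltrDl.
rewrite -F' derive1E; exact/derivableP.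
Qed.

Lemma int_exp_le (c t : R) : 0 < c -> 0 <= t ->
  \int[mu]_(x in `[0, t]) expR (c * x) <= expR (c * t) / c.
Proof.
move=> c0 t0; have ce : continuous (fun x => expR (c * x)).
  by move=> x; apply: continuous_comp; [exact: mulrl_continuous|exact: continuous_expR].
have [->|tn0] := eqVneq t 0; first by rewrite int_neg// divr_ge0 ?expR_ge0// ltW.
have tp : 0 < t by rewrite lt_def tn0 t0.
pose F x := \int[mu]_(x in `[0, x]) expR (c * x) - expR (c * x) / c.
have dF x : x \in `]0, t[ -> is_derive x (1:R) F 0.
  rewrite in_itv /= => /andP[x0 _].
  have D1 := int_derive ce x0.
  apply: is_derive_eq.
  by rewrite /GRing.scale /= !mulr1 mulr0 add0r; field; rewrite gt_eqF.
have cF : {within `[0, t], continuous F}.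
  apply: continuous_subspaceT => x; apply: cvgB; first exact: int_continuous.
  by apply: cvgMr_tmp; exact: ce.
have [z _] := MVT_segment t0 dF cF.
have F0 : F 0 = - (1 / c) by rewrite /F int_neg// mulr0 expR0 sub0r.
rewrite mul0r F0 /F => E.
have : 0 <= 1 / c by rewrite divr_ge0// ltW.
lra.
Qed.

(** Let S be the maximum of f(t) exp (- c t) with c = 2 (L + 1). Integrating the exponential gains a
    factor 1 / c, so the inequality at the maximum point gives S <= a + S / 2. The factor 2 in the
    bound is the price for differentiating nothing. *)
Lemma gronwall (f : R -> R) (a L T : R) : continuous f -> (forall t, 0 <= t <= T -> 0 <= f t) ->
  0 <= a -> 0 <= L ->
  (forall t, 0 <= t <= T -> f t <= a + L * \int[mu]_(x in `[0, t]) f x) ->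
  forall t, 0 <= t <= T -> f t <= 2 * a * expR (2 * (L + 1) * t).
Proof.
move=> cf f0 a0 L0 H t tT.
have T0 : 0 <= T by have /andP[t0 /(le_trans t0)] := tT.
pose c := 2 * (L + 1).
have c0 : 0 < c by rewrite mulr_gt0// ltr_wpDl.
have cE k : continuous (fun x : R => expR (k * x)).
  by move=> x; apply: continuous_comp; [exact: mulrl_continuous|exact: continuous_expR].
have [z zT Hz] : exists2 z, z \in `[0, T] & forall t, t \in `[0, T] -> f t * expR (- c * t) <= f z * expR (- c * z).
  apply: EVT_max => //; apply: continuous_subspaceT => x; apply: cvgM; [exact: cf|exact: cE].
set S := f z * _ in Hz.
have fS s : 0 <= s <= T -> f s <= S * expR (c * s).
  move=> sT; have := Hz s; rewrite in_itv /= => /(_ sT).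
  by rewrite mulNr expRN ler_pdivrMr ?expR_gt0.
have zT' : 0 <= z <= T by move: zT; rewrite in_itv.
have [z0 zT2] := andP zT'.
have S0 : 0 <= S by rewrite mulr_ge0 ?expR_ge0// f0.
have Sle : S <= a + S / 2.
  have I : \int[mu]_(x in `[0, z]) f x <= S * (expR (c * z) / c).
    apply: (@le_trans _ _ (\int[mu]_(x in `[0, z]) (S * expR (c * x)))).
      apply: le_Rintegral => //; first exact: cont_integrable.
        apply: cont_integrable => x; apply: cvgMl_tmp; exact: cE.
      move=> x; rewrite /= in_itv /= => /andP[x0 xz]; apply: fS.
      by rewrite x0 (le_trans xz).
    rewrite RintegralZl//; last exact: cont_integrable.
    by rewrite ler_wpM2l// int_exp_le.
  have K := H z zT'.
  have E1 : 1 <= expR (c * z) by rewrite -expR0 ler_expR mulr_ge0// ltW.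
  have fz : f z <= a * expR (c * z) + S / 2 * expR (c * z).
    apply: le_trans K _; apply: lerD; first by rewrite ler_peMr.
    apply: (@le_trans _ _ (L * (S * (expR (c * z) / c)))); first by rewrite ler_wpM2l.
    have -> : L * (S * (expR (c * z) / c)) = (L / (L + 1)) * (S / 2 * expR (c * z)).
      by rewrite /c; field; rewrite gt_eqF// ltr_wpDl.
    rewrite ler_piMl ?mulr_ge0 ?expR_ge0 ?divr_ge0 ?f0//.
    by rewrite ler_pdivrMr ?mul1r ?lerDl// ltr_wpDl.
  have -> : S = f z / expR (c * z) by rewrite /S mulNr expRN.
  rewrite ler_pdivrMr ?expR_gt0// mulrDl; apply: le_trans fz _.
  rewrite lerD2l; have -> : f z / expR (c * z) = S by rewrite /S mulNr expRN.
  by [].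
apply: le_trans (fS _ tT) _; rewrite ler_wpM2r ?expR_ge0//; lra.
Qed.

End integrals.

(** * Picard iteration and stability of integral equations *)

Section ode.
Context (R : realType) (n : nat).
Local Notation mu := (@lebesgue_measure R).
Local Notation V := 'cV[R]_n.
Implicit Types (c : V -> V) (u v g : R -> V).

Lemma norm_col_le (x : V) (e : R) : 0 <= e -> (forall i, `|x i 0| <= e) -> `|x| <= e.
Proof.
move=> e0 H; rewrite /Num.Def.normr /= mx_normrE; apply/bigmax_leP; split => // -[i j] _ /=.
by rewrite ord1.
Qed.

Lemma cont_col u : (forall i, continuous (fun t => u t i 0)) -> continuous u.
Proof.
move=> H t; apply: eps_cont => e e0.
have K i := cont_eps (H i t) e0.
have K' i : exists d : R, 0 < d /\ forall y, `|t - y| < d -> `|u t i 0 - u y i 0| <= e.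
  by have [d d0 Hd] := K i; exists d.
have [d Hd] := choice K'.
exists (\big[Num.min/1]_i d i); first by apply/bigmin_gtP; split => // i _; have [] := Hd i.
move=> y /bigmin_gtP[_ yd]; apply: norm_col_le; first exact: ltW.
by move=> i; rewrite !mxE; have [_] := Hd i; apply; exact: yd.
Qed.

Lemma cont_coord u i : continuous u -> continuous (fun t => u t i 0).
Proof. move=> cu t; apply: (@continuous_comp _ _ _ u (fun M : V => M i 0)); first exact: cu.
exact: coord_continuous. Qed.

Lemma cont_norm u : continuous u -> continuous (fun t => `|u t|).
Proof. by move=> cu t; apply: cvg_norm; exact: cu. Qed.

Lemma cont_norm_bounded u T : continuous u -> exists2 M, 0 < M & forall t, 0 <= t <= T -> `|u t| <= M.
Proof.
move=> cu; have [M M0 H] := cont_bounded T (cont_norm cu).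
exists (M + 1); first by rewrite ltr_wpDl.
by move=> t /H; rewrite normr_id => /le_trans; apply; rewrite lerDl.
Qed.

Definition ivec c u t : V := \col_i \int[mu]_(s in `[0, t]) (c (u s)) i 0.

Lemma cont_comp c u : continuous c -> continuous u -> continuous (c \o u).
Proof. by move=> cc cu t; apply: continuous_comp; [exact: cu|exact: cc]. Qed.

Lemma ivec_cont c u : continuous c -> continuous u -> continuous (ivec c u).
Proof.
move=> cc cu; apply: cont_col => i.
have -> : (fun t => ivec c u t i 0) = (fun t => \int[mu]_(s in `[0, t]) (c (u s)) i 0).
  by apply/funext => t; rewrite mxE.
by apply: int_continuous; exact: cont_coord (cont_comp cc cu).
Qed.

Lemma ivec_diff c u v (f : R -> R) t : continuous c -> continuous u -> continuous v -> continuous f ->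
  (forall s, 0 <= s <= t -> `|c (u s) - c (v s)| <= f s) -> 0 <= t ->
  `|ivec c u t - ivec c v t| <= \int[mu]_(s in `[0, t]) f s.
Proof.
move=> cc cu cv cf H t0.
have f0 s : 0 <= s <= t -> 0 <= f s by move=> /H; exact: le_trans.
apply: norm_col_le.
  by apply: Rintegral_ge0 => s /=; rewrite in_itv /=; exact: f0.
move=> i; rewrite !mxE -RintegralB//; last 2 first.
- exact/cont_integrable/(@cont_coord (c \o u) i (cont_comp cc cu)).
- exact/cont_integrable/(@cont_coord (c \o v) i (cont_comp cc cv)).
have ci : continuous (fun s => c (u s) i 0 - c (v s) i 0).
  by move=> s; apply: cvgB; exact: (@cont_coord (c \o _) i (cont_comp cc _)).
apply: le_trans (le_normr_Rintegral _ _) _ => //; first exact: cont_integrable.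
apply: le_Rintegral => //.
- by apply: cont_integrable => s; apply: cvg_norm; exact: ci.
- exact: cont_integrable.
- move=> s /=; rewrite in_itv /= => sT; apply: le_trans (H s sT).
  by have := mxcoord_le (c (u s) - c (v s)) i; rewrite !mxE.
Qed.

Definition lip_on (M L : R) c := forall x y : V, `|x| <= M -> `|y| <= M -> `|c x - c y| <= L * `|x - y|.

Definition loc_lip c := forall M : R, 0 < M -> exists2 L, 0 <= L & lip_on M L c.

Lemma loc_lip_cont c : loc_lip c -> continuous c.
Proof.
move=> lc x; have M0 : 0 < `|x| + 1 by rewrite ltr_wpDl.
have [L L0 H] := lc _ M0.
apply: eps_cont => e e0.
have L1 : 0 < L + 1 by rewrite ltr_wpDl.
exists (Num.min 1 (e / (L + 1))); first by rewrite lt_min ltr01 divr_gt0.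
move=> y; rewrite lt_min => /andP[y1 y2].
have yM : `|y| <= `|x| + 1.
  by rewrite -[y](subrKC x) (le_trans (ler_normD _ _))// lerD2l distrC ltW.
apply: le_trans (H x y _ yM) _; first by rewrite lerDl.
apply: (@le_trans _ _ ((L + 1) * `|x - y|)); first by rewrite ler_wpM2r// lerDl.
by rewrite mulrC -ler_pdivlMr// ltW.
Qed.

(** The forcing [g] carries the initial value and the noise. Continuity is asked on the whole line,
    although the equation concerns t >= 0 only, so that no subspace topology appears in the
    analysis. *)
Definition isol c g u := continuous u /\ forall t, 0 <= t -> u t = g t + ivec c u t.

Lemma isol_stable c g g' u v (M L a T : R) : continuous c -> continuous u -> continuous v ->
  0 <= L -> lip_on M L c ->
  (forall t, 0 <= t <= T -> u t = g t + ivec c u t) ->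
  (forall t, 0 <= t <= T -> v t = g' t + ivec c v t) ->
  (forall t, 0 <= t <= T -> `|u t| <= M /\ `|v t| <= M) ->
  0 <= a -> (forall t, 0 <= t <= T -> `|g t - g' t| <= a) ->
  forall t, 0 <= t <= T -> `|u t - v t| <= 2 * a * expR (2 * (L + 1) * t).
Proof.
move=> cc cu cv L0 lc Hu Hv HM a0 Ha t tT.
have cuv : continuous (fun s => `|u s - v s|).
  by move=> s; apply: cvg_norm; apply: cvgB; [exact: cu|exact: cv].
apply: (gronwall cuv (T := T) _ a0 L0) => // s sT; rewrite ?normr_ge0//.
have /andP[s0 s1] := sT.
rewrite Hu// Hv// opprD addrACA; apply: le_trans (ler_normD _ _) _.
apply: lerD; first exact: Ha.
rewrite -RintegralZl//; last exact: cont_integrable.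
apply: ivec_diff => //.
- by move=> x; apply: cvgMl_tmp; exact: cuv.
- move=> x /andP[x0 xs]; have xT : 0 <= x <= T by rewrite x0 (le_trans xs).
  by have [] := HM x xT; exact: lc.
Qed.

(** The intervals around [a j] of radius 2 K / 2^j are nested; the limit is the supremum of their
    left ends. *)
Lemma geo_cvg (a : nat -> R) (K : R) : (forall j, `|a j.+1 - a j| <= K / 2 ^+ j) ->
  exists l, forall j, `|a j - l| <= 2 * K / 2 ^+ j.
Proof.
move=> H.
have K0 : 0 <= K by have := le_trans (normr_ge0 _) (H 0%N); rewrite expr0 divr1.
pose e j := 2 * K / 2 ^+ j.
have eS j : e j = e j.+1 + K / 2 ^+ j by rewrite /e exprS; field; rewrite expf_neq0.
have up j k : a (j + k)%N - e (j + k)%N >= a j - e j.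
  elim: k => [|k IH]; first by rewrite addn0.
  apply: le_trans IH _; rewrite addnS (eS (j + k)%N).
  have := H (j + k)%N; rewrite ler_norml => /andP[]; lra.
have dn j k : a (j + k)%N + e (j + k)%N <= a j + e j.
  elim: k => [|k IH]; first by rewrite addn0.
  apply: le_trans IH; rewrite addnS (eS (j + k)%N).
  have := H (j + k)%N; rewrite ler_norml => /andP[]; lra.
have e0 j : 0 <= e j by rewrite /e divr_ge0 ?mulr_ge0 ?exprn_ge0.
have cross j k : a j - e j <= a k + e k.
  case: (leqP j k) => [jk|/ltnW kj].
    have := up j (k - j)%N; rewrite subnKC// => /le_trans; apply.
    by have := e0 k; lra.
  have := dn k (j - k)%N; rewrite subnKC// => H'; apply: le_trans H'.
  by have := e0 j; lra.
pose S := [set a j - e j | j in setT].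
have hs : has_sup S.
  by split; [exists (a 0%N - e 0%N); exists 0%N|exists (a 0%N + e 0%N) => _ [j _ <-]].
exists (sup S) => j; rewrite ler_norml -/(e j); apply/andP; split.
  have : sup S <= a j + e j by apply: ge_sup; [exact: (proj1 hs)|move=> _ [k _ <-]].
  lra.
have : a j - e j <= sup S by apply: ub_le_sup; [exact: (proj2 hs)|exists j].
lra.
Qed.

(** Consecutive iterates differ by at most K 2^-j exp (2 L t): integrating L exp (2 L s) gives at
    most half of exp (2 L t). The weight makes the iteration contract on every interval [0, T]
    without any condition on T. *)
Lemma picard c g (L : R) : 0 < L -> (forall x y, `|c x - c y| <= L * `|x - y|) ->
  continuous g -> exists u, isol c g u.
Proof.
move=> L0 lc cg.
have cc : continuous c.
  apply: loc_lip_cont => M M0; exists L; first exact: ltW.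
  by move=> x y _ _; exact: lc.
pose u := fix u j t : V := if j is j.+1 then g t + ivec c (u j) t else g t.
have cu j : continuous (u j).
  elim: j => [//|j IH] t /=; apply: cvgD; [exact: cg|exact: ivec_cont].
have cuB j : continuous (fun s => `|u j.+1 s - u j s|).
  by move=> s; apply: cvg_norm; apply: cvgB; exact: cu.
have cE k : continuous (fun x : R => expR (k * x)).
  by move=> x; apply: continuous_comp; [exact: mulrl_continuous|exact: continuous_expR].
have step T : exists2 K, 0 <= K & forall j t, 0 <= t <= T -> `|u j.+1 t - u j t| <= K / 2 ^+ j * expR (2 * L * t).
  have [K K0 HK] := cont_bounded T (cuB 0%N); exists K => //.
  elim=> [|j IH] t tT.
    rewrite expr0 divr1; have := HK t tT; rewrite normr_id => /le_trans; apply.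
    rewrite ler_peMr// -expR0 ler_expR mulr_ge0// ?mulr_ge0 ?(ltW L0)//; by case/andP: tT.
  have /andP[t0 t1] := tT.
  rewrite [u j.+2 t]/= [X in _ - X]/= opprD addrACA subrr add0r.
  apply: le_trans (ivec_diff (f := fun s => L * (K / 2 ^+ j * expR (2 * L * s))) _ _ _ _ _ _) _ => //.
  - exact: (cu j.+1).
  - by move=> s; apply: cvgMl_tmp; apply: cvgMl_tmp; exact: cE.
  - move=> s /andP[s0 st]; apply: le_trans (lc _ _) _; rewrite ler_pM2l//.
    by apply: IH; rewrite s0 (le_trans st).
  rewrite RintegralZl//; last by apply: cont_integrable => s; apply: cvgMl_tmp; exact: cE.
  rewrite RintegralZl//; last exact: cont_integrable.
  apply: (@le_trans _ _ (L * (K / 2 ^+ j * (expR (2 * L * t) / (2 * L))))).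
    rewrite ler_pM2l// ler_wpM2l ?divr_ge0 ?exprn_ge0// int_exp_le// mulr_gt0//.
  rewrite le_eqVlt; apply/orP; left; apply/eqP; rewrite exprS; field.
  by rewrite expf_neq0// gt_eqF.
have lims t : exists l : V, forall i, exists K, forall j, `|u j t i 0 - l i 0| <= 2 * K / 2 ^+ j.
  have H i : exists l, exists K, forall j, `|u j t i 0 - l| <= 2 * K / 2 ^+ j.
    have [t0|t0] := leP 0 t.
      have [K K0 HK] := step t.
      have tt : 0 <= t <= t by rewrite t0 lexx.
      have [|l Hl] := @geo_cvg (fun j => u j t i 0) (K * expR (2 * L * t)).
        move=> j; have := mxcoord_le (u j.+1 t - u j t) i; rewrite !mxE => /le_trans; apply.
        by apply: le_trans (HK j t tt) _; rewrite mulrAC.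
      by exists l, (K * expR (2 * L * t)).
    (* For t < 0 the integrals vanish and every iterate equals [g t]. *)
    exists (g t i 0), 0 => j; rewrite mulr0 mul0r.
    case: j => [|j]; first by rewrite subrr normr0.
    have -> : u j.+1 t i 0 = g t i 0.
      by rewrite /= mxE [X in _ + X]mxE int_neg; [rewrite addr0|exact: ltW].
    by rewrite subrr normr0.
  have [l Hl] := choice H; exists (\col_i l i) => i.
  by have [K HK] := Hl i; exists K => j; rewrite mxE; exact: HK.
have [w Hw] := choice lims.
have unif T : exists2 K, 0 <= K & forall j t, t <= T -> `|u j t - w t| <= K / 2 ^+ j.
  have [K K0 HK] := step T.
  pose K' := 2 * (K * expR (2 * L * `|T|)); exists K'.
    by rewrite /K' !mulr_ge0 ?expR_ge0.
  have LT t : t <= T -> expR (2 * L * t) <= expR (2 * L * `|T|).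
    move=> tT; rewrite ler_expR ler_pM2l ?mulr_gt0//; exact: le_trans tT (ler_norm _).
  move=> j t tT; apply: norm_col_le.
    by rewrite divr_ge0 ?exprn_ge0// /K' !mulr_ge0 ?expR_ge0.
  move=> i; rewrite !mxE.
  have uniq (l l' : R) (A B : R) : (forall j, `|u j t i 0 - l| <= A / 2 ^+ j) -> (forall j, `|u j t i 0 - l'| <= B / 2 ^+ j) -> l = l'.
    move=> HA HB; apply/eqP; rewrite -subr_eq0 -normr_eq0 eq_le normr_ge0 andbT.
    apply/ler_addgt0Pr => e e0; rewrite add0r.
    have AB0 : 0 <= `|A| + `|B| by rewrite addr_ge0.
    have [k Hk] : exists k, (`|A| + `|B|) / e < 2 ^+ k.
      exists (Num.truncn ((`|A| + `|B|) / e)).+1.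
      apply: lt_le_trans (truncnS_gt _) _.
      by rewrite -natrX ler_nat ltnW// ltn_expl.
    rewrite distrC -[X in `|X|](subrKA (u k t i 0)) (le_trans (ler_normD _ _))//.
    rewrite (distrC l'); apply: le_trans (lerD (HB k) (HA k)) _.
    rewrite -mulrDl ler_pdivrMr ?exprn_gt0//.
    move: Hk; rewrite ltr_pdivrMr// => Hk; rewrite mulrC; apply: le_trans (ltW Hk).
    by rewrite addrC lerD// ler_norm.
  have [t0|t0] := leP 0 t.
    have [|l Hl] := @geo_cvg (fun j => u j t i 0) (K * expR (2 * L * `|T|)).
      move=> k; have := mxcoord_le (u k.+1 t - u k t) i; rewrite !mxE => /le_trans; apply.
      apply: le_trans (HK k t _) _; first by rewrite t0 tT.
      by rewrite mulrAC ler_wpM2r ?invr_ge0 ?exprn_ge0// ler_wpM2l// LT.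
    have [K2 HK2] := Hw t i.
    by rewrite -(uniq _ _ _ _ Hl HK2); exact: Hl.
  have [K2 HK2] := Hw t i.
  have Eg k : u k t i 0 = g t i 0 by case: k => // k; rewrite /= mxE [X in _ + X]mxE int_neg; [rewrite addr0|exact: ltW].
  rewrite -(uniq (g t i 0) _ 0 _ _ HK2).
    by rewrite Eg subrr normr0 divr_ge0 ?exprn_ge0// /K' !mulr_ge0 ?expR_ge0.
  by move=> k; rewrite Eg subrr normr0 mul0r.
have small (K e : R) : 0 <= K -> 0 < e -> exists k : nat, K / 2 ^+ k <= e.
  move=> K0 e0; exists (Num.truncn (K / e)).+1.
  rewrite ler_pdivrMr ?exprn_gt0// mulrC -ler_pdivrMr//.
  apply: ltW; apply: lt_le_trans (truncnS_gt _) _.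
  by rewrite -natrX ler_nat ltnW// ltn_expl.
have cw : continuous w.
  move=> t; apply: eps_cont => e e0.
  have e3 : 0 < e / 3 by rewrite divr_gt0.
  have [K K0 HK] := unif (t + 1); have [k Hk] := small K _ K0 e3.
  have [d d0 Hd] := cont_eps (cu k t) e3.
  exists (Num.min 1 d); first by rewrite lt_min ltr01.
  move=> s; rewrite lt_min => /andP[s1 sd].
  have st : s <= t + 1 by move: s1; rewrite ltr_norml => /andP[]; lra.
  have -> : w t - w s = (w t - u k t) + (u k t - u k s) + (u k s - w s) by rewrite !addrA !subrK.
  have -> : e = e / 3 + e / 3 + e / 3 by field.
  apply: le_trans (ler_normD _ _) _; apply: lerD; last exact: le_trans (HK k s st) Hk.
  apply: le_trans (ler_normD _ _) _; apply: lerD; last exact: Hd.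
  by rewrite distrC; apply: le_trans (HK k t _) Hk; rewrite lerDl.
exists w; split => // t t0.
apply/eqP; rewrite -subr_eq0 -normr_eq0 eq_le normr_ge0 andbT.
apply/ler_addgt0Pr => e e0; rewrite add0r.
have [K K0 HK] := unif t.
have C0 : 0 <= K + L * K * t by rewrite addr_ge0// !mulr_ge0// ltW.
have [k Hk] := small _ _ C0 e0.
apply: le_trans Hk.
have -> : w t - (g t + ivec c w t) = (w t - u k.+1 t) + (ivec c (u k) t - ivec c w t).
  by rewrite -[u k.+1 t]/(g t + ivec c (u k) t) !opprD !addrA subrK.
apply: le_trans (ler_normD _ _) _; rewrite mulrDl; apply: lerD.
  rewrite distrC; apply: le_trans (HK _ _ (lexx _)) _.
  by rewrite ler_wpM2l// lef_pV2 ?posrE ?exprn_gt0// ler_eXn2l// ltr1n.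
apply: le_trans (ivec_diff (f := fun=> L * (K / 2 ^+ k)) _ _ _ _ _ _) _ => //.
- by move=> s; exact: cvg_cst.
- by move=> s /andP[s0 st]; apply: le_trans (lc _ _) _; rewrite ler_pM2l// HK.
rewrite Rintegral_cst//= lebesgue_measure_itv /= lte_fin; case: ltP => //= t0'; last first.
  by rewrite mulr0 divr_ge0 ?exprn_ge0// !mulr_ge0// ltW.
by rewrite subr0 mulrA mulrAC.
Qed.

End ode.

(** * Global solutions under an energy bound, and the Euler scheme *)

Section global_solutions.
Context (R : realType) (n : nat).
Local Notation mu := (@lebesgue_measure R).
Local Notation V := 'cV[R]_n.
Implicit Types (c b : V -> V) (u v g z : R -> V).

(** A radial Lipschitz cutoff, 1 on the ball of radius M and 0 outside the ball of radius 2 M: it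
    makes a locally Lipschitz drift globally Lipschitz. *)
Definition cut_fun (M : R) (x : V) : R := Num.max 0 (Num.min 1 (2 - `|x| / M)).

Lemma cut_fun01 M x : 0 <= cut_fun M x <= 1.
Proof. by rewrite /cut_fun le_max lexx /= ge_max ler01 ge_min lexx. Qed.

Lemma cut_fun1 M x : 0 < M -> `|x| <= M -> cut_fun M x = 1.
Proof.
move=> M0 xM; have : `|x| / M <= 1 by rewrite ler_pdivrMr// mul1r.
by rewrite /cut_fun /Num.max /Num.min; do !case: ifPn; rewrite -?leNgt; lra.
Qed.

Lemma cut_fun0 M x : 0 < M -> 2 * M <= `|x| -> cut_fun M x = 0.
Proof.
move=> M0 xM; have : 2 <= `|x| / M by rewrite ler_pdivlMr.
by rewrite /cut_fun /Num.max /Num.min; do !case: ifPn; rewrite -?leNgt; lra.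
Qed.

Lemma cut_fun_lip M x y : 0 < M -> `|cut_fun M x - cut_fun M y| <= `|x - y| / M.
Proof.
move=> M0; have H : `|(`|x| / M - `|y| / M)| <= `|x - y| / M.
  rewrite -mulrBl normrM [`|M^-1|]ger0_norm ?invr_ge0 ?(ltW M0)//.
  by rewrite ler_wpM2r ?invr_ge0 ?(ltW M0)// ler_dist_dist.
apply: le_trans H; rewrite /cut_fun; move: (`|x| / M) (`|y| / M) => r r'.
rewrite ler_norml /Num.max /Num.min.
by case: (ger0P (r - r')); do !case: ifPn; rewrite -?leNgt; lra.
Qed.

Lemma cut_lip b M : loc_lip b -> 0 < M ->
  exists2 L, 0 < L & forall x y, `|cut_fun M x *: b x - cut_fun M y *: b y| <= L * `|x - y|.
Proof.
move=> lb M0; have M2 : 0 < 2 * M by rewrite mulr_gt0.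
have [L L0 HL] := lb _ M2.
pose B := `|b 0| + L * (2 * M).
have B0 : 0 <= B by rewrite addr_ge0// mulr_ge0// ltW.
have bB x : `|x| <= 2 * M -> `|b x| <= B.
  move=> xM; rewrite -[b x](subrK (b 0)) (le_trans (ler_normD _ _))// addrC lerD2l.
  apply: le_trans (HL _ _ xM _) _; first by rewrite normr0 ltW.
  by rewrite subr0 ler_wpM2l.
exists (L + B / M + 1); first by rewrite ltr_wpDl// addr_ge0// divr_ge0// ltW.
(* Only [x] is assumed to lie in the ball: by symmetry this covers all pairs except two points
   outside, where both values vanish. *)
have key x y : `|x| <= 2 * M -> `|cut_fun M x *: b x - cut_fun M y *: b y| <= (L + B / M) * `|x - y|.
  move=> xM; have [yM|yM] := leP `|y| (2 * M).
    have -> : cut_fun M x *: b x - cut_fun M y *: b y =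
       cut_fun M y *: (b x - b y) + (cut_fun M x - cut_fun M y) *: b x.
      by rewrite [RHS]addrC scalerBr scalerBl addrA subrK.
    apply: le_trans (ler_normD _ _) _; rewrite !normrZ mulrDl; apply: lerD.
      apply: le_trans (HL _ _ xM yM); rewrite ler_piMl//.
      by have /andP[c0 c1] := cut_fun01 M y; rewrite ger0_norm.
    have -> : B / M * `|x - y| = `|x - y| / M * B by field; rewrite gt_eqF.
    by rewrite ler_pM// ?bB//; exact: cut_fun_lip.
  rewrite (cut_fun0 M0 (ltW yM)) scale0r subr0 normrZ mulrDl.
  rewrite ler_wpDl ?mulr_ge0//.
  have -> : B / M * `|x - y| = `|x - y| / M * B by field; rewrite gt_eqF.
  rewrite ler_pM// ?bB//; have := cut_fun_lip x y M0.
  by rewrite (cut_fun0 M0 (ltW yM)) subr0.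
move=> x y; apply: (@le_trans _ _ ((L + B / M) * `|x - y|)); last by rewrite ler_wpM2r// lerDl.
have [xM|xM] := leP `|x| (2 * M); first exact: key.
have [yM|yM] := leP `|y| (2 * M); first by rewrite distrC (distrC x); exact: key.
rewrite (cut_fun0 M0 (ltW xM)) (cut_fun0 M0 (ltW yM)) !scale0r subrr normr0.
by rewrite mulr_ge0// addr_ge0// divr_ge0// ltW.
Qed.

Definition nrm2 (x : V) : R := \sum_i x i 0 ^+ 2.

Lemma nrm2_ge0 x : 0 <= nrm2 x.
Proof. by apply: sumr_ge0 => i _; exact: sqr_ge0. Qed.

Lemma norm_nrm2 x : `|x| <= 1 + nrm2 x.
Proof.
apply: norm_col_le; first by rewrite addr_ge0// nrm2_ge0.
move=> i; rewrite /nrm2 (bigD1 i)//=.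
have : 0 <= \sum_(j < n | j != i) x j 0 ^+ 2 by apply: sumr_ge0 => j _; exact: sqr_ge0.
rewrite -(real_normK (num_real (x i 0))).
move: (\sum_(j < n | _) _) (`|x i 0|) (normr_ge0 (x i 0)) => s y; nra.
Qed.

(** Non-explosion criterion for v = u - z, where z is the noise path: a one-sided quadratic bound,
    uniform over bounded values of z. *)
Definition energy_bound b := forall Z : R, 0 <= Z -> exists2 C, 0 <= C &
  forall v z : V, `|z| <= Z -> \sum_i v i 0 * (b (v + z)) i 0 <= C * (1 + nrm2 v).

Lemma cont_sum (I : Type) (r : seq I) (f : I -> R -> R) :
  (forall i, continuous (f i)) -> continuous (fun s => \sum_(i <- r) f i s).
Proof.
move=> cf; elim: r => [|i r IH].
  have -> : (fun s => \sum_(i <- [::]) f i s) = cst 0 by apply/funext => s; rewrite big_nil.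
  by move=> s; exact: cvg_cst.
have -> : (fun s => \sum_(j <- i :: r) f j s) = (fun s => f i s + \sum_(j <- r) f j s).
  by apply/funext => s; rewrite big_cons.
by move=> s; apply: cvgD; [exact: cf|exact: IH].
Qed.

(** The solution u is not differentiable, but v = u - z is, and (1 + |v|^2) exp (- 2 C t) has a
    nonpositive derivative. *)
Lemma apriori c z u (x : V) (C T : R) : continuous c -> continuous z -> 0 <= C ->
  continuous u -> (forall t, 0 <= t -> u t = x + z t + ivec c u t) ->
  (forall t, 0 <= t <= T -> forall v : V, \sum_i v i 0 * (c (v + z t)) i 0 <= C * (1 + nrm2 v)) ->
  forall t, 0 <= t <= T -> 1 + nrm2 (u t - z t) <= (1 + nrm2 x) * expR (2 * C * t).
Proof.
move=> cc cz C0 cu Hu Hc t /andP[t0 tT].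
pose v s : V := x + ivec c u s.
have uE s : 0 <= s -> u s = v s + z s by move=> s0; rewrite Hu// /v addrAC.
have -> : u t - z t = v t by rewrite uE// addrK.
have [->|tn0] := eqVneq t 0.
  rewrite mulr0 expR0 mulr1 /v.
  have -> : ivec c u 0 = 0 by apply/colP => i; rewrite !mxE int_neg.
  by rewrite addr0.
have tp : 0 < t by rewrite lt_def tn0.
pose E s := (1 + nrm2 (v s)) * expR (- (2 * C) * s).
have cv : continuous v by move=> s; apply: cvgD; [exact: cvg_cst|exact: ivec_cont].
have cE : continuous E.
  move=> s; apply: cvgM.
    apply: cvgD; first exact: cvg_cst.
    rewrite /nrm2; apply: (@cont_sum _ _ (fun i s => v s i 0 ^+ 2)) => i r.
    have cvi := @cont_coord R n v i cv.
    by apply: (@continuous_comp _ _ _ (fun s => v s i 0) (fun y : R => y ^+ 2)); [exact: cvi|exact: exprn_continuous].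
  by apply: continuous_comp; [exact: mulrl_continuous|exact: continuous_expR].
have dv (s : R) (i : 'I_n) : 0 < s -> is_derive s (1:R) (fun s => v s i 0) (c (u s) i 0).
  move=> s0; have -> : (fun s => v s i 0) = cst (x i 0) + (fun s => \int[mu]_(r in `[0, s]) (c (u r)) i 0).
    by apply/funext => r; rewrite /v !mxE.
  have D := int_derive (@cont_coord _ _ (c \o u) i (cont_comp cc cu)) s0.
  by apply: is_derive_eq; rewrite add0r.
have dE (s : R) : 0 < s -> is_derive s (1:R) E
   ((2 * \sum_i v s i 0 * c (u s) i 0 - 2 * C * (1 + nrm2 (v s))) * expR (- (2 * C) * s)).
  move=> s0.
  have D1 : is_derive s (1:R) (fun s => 1 + nrm2 (v s)) (2 * \sum_i v s i 0 * c (u s) i 0).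
    have -> : (fun s => 1 + nrm2 (v s)) = cst 1 + \sum_i (fun s => v s i 0 ^+ 2).
      apply/funext => r; rewrite /nrm2 /=; congr (1 + _).
      by rewrite fct_sumE.
    have D2 i : is_derive s (1:R) (fun s => v s i 0 ^+ 2) (2 * (v s i 0 * c (u s) i 0)).
      have D3 := dv s i s0.
      have -> : (fun s => v s i 0 ^+ 2) = (fun s => v s i 0) * (fun s => v s i 0).
        by apply/funext => r; rewrite expr2.
      by apply: is_derive_eq; rewrite /GRing.scale /=; ring.
    have D4 := is_derive_sum D2.
    by apply: is_derive_eq; rewrite add0r mulr_sumr.
  have -> : E = (fun s => 1 + nrm2 (v s)) * (expR \o ( *%R (- (2 * C)))) by [].
  have D5 : is_derive s (1:R) ( *%R (- (2 * C))) (- (2 * C)).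
    have -> : *%R (- (2 * C)) = (- (2 * C)) *: (@id R) by [].
    by apply: is_derive_eq; rewrite /GRing.scale /= mulr1.
  have D6 := @is_derive1_comp _ expR _ s _ _ (is_derive_expR _) D5.
  by apply: is_derive_eq; rewrite /GRing.scale /=; ring.
have /ler0_derive1_le_cc : forall r, r \in `]0, t[ -> derivable E r 1.
  by move=> r; rewrite in_itv /= => /andP[r0 _]; have D := dE r r0; exact: ex_derive.
move=> /(_ _ (continuous_subspaceT cE)) K.
have : E t <= E 0.
  apply: K; rewrite ?in_itv /= ?lexx ?t0//.
  move=> r; rewrite in_itv /= => /andP[r0 rt]; rewrite derive1E.
  have D := dE r r0; rewrite derive_val.
  rewrite mulr_le0_ge0 ?expR_ge0// subr_le0 -mulrA ler_pM2l//.
  by rewrite uE ?(ltW r0)//; apply: Hc; rewrite (ltW r0) (le_trans (ltW rt)).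
rewrite /E mulr0 expR0 mulr1 mulNr expRN ler_pdivrMr ?expR_gt0//.
have -> // : v 0 = x.
rewrite /v; have -> : ivec c u 0 = 0 by apply/colP => i; rewrite !mxE int_neg.
by rewrite addr0.
Qed.

Lemma isol_unique b g u u' : loc_lip b -> isol b g u -> isol b g u' ->
  forall t, 0 <= t -> u t = u' t.
Proof.
move=> lb [cu Hu] [cu' Hu'] t t0; have cb := loc_lip_cont lb.
have [M M0 HM] := cont_norm_bounded t cu; have [M' M'0 HM'] := cont_norm_bounded t cu'.
have MM0 : 0 < M + M' by exact: addr_gt0.
have [L L0 HL] := lb _ MM0.
have := @isol_stable _ _ b g g u u' (M + M') L 0 t cb cu cu' L0 HL _ _ _ (lexx 0) _ t.
rewrite mulr0 mul0r => H; apply/eqP; rewrite -subr_eq0 -normr_le0; apply: H.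
- by move=> s /andP[s0 _]; exact: Hu.
- by move=> s /andP[s0 _]; exact: Hu'.
- move=> s sT; split; first by apply: le_trans (HM s sT) _; rewrite lerDl ltW.
  by apply: le_trans (HM' s sT) _; rewrite lerDr ltW.
- by move=> s _; rewrite subrr normr0.
- by rewrite t0 lexx.
Qed.

(** The positive part extends a path given for t >= 0 to a path on the whole line, constant for t <=
    0. *)
Definition ppart (t : R) : R := (`|t| + t) / 2.

Lemma ppart_ge0 t : 0 <= ppart t.
Proof. by rewrite /ppart; case: (ger0P t); lra. Qed.

Lemma ppart_id t : 0 <= t -> ppart t = t.
Proof. by move=> t0; rewrite /ppart ger0_norm//; field. Qed.

Lemma ppart_le t : ppart t <= `|t|.
Proof. by rewrite /ppart; case: (ger0P t); lra. Qed.

Lemma ppart_cont : continuous ppart.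
Proof. by move=> t; apply: cvgMr_tmp; apply: cvgD; [apply: cvg_norm|]; exact: cvg_id. Qed.

(** Up to time N the equation is solved with a drift cut off at a radius that the solution does not
    reach. By uniqueness the solutions for different N agree, and they are glued. *)
Lemma ode_exists b z (x : V) : loc_lip b -> energy_bound b -> continuous z ->
  exists u, isol b (fun t => x + z t) u.
Proof.
move=> lb eb cz; have cb := loc_lip_cont lb.
have cg : continuous (fun t => x + z t) by move=> t; apply: cvgD; [exact: cvg_cst|exact: cz].
have H (N : nat) : exists u, continuous u /\ forall t, 0 <= t <= N%:R -> u t = x + z t + ivec b u t.
  have [Z Z0 HZ] := cont_norm_bounded N%:R cz.
  have [C C0 HC] := eb Z (ltW Z0).
  (* The drift is multiplied by a number in [0, 1], which preserves the energy bound. The a priori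
     bound is therefore independent of the cutoff radius, which can be chosen beyond it. *)
  pose M := (1 + nrm2 x) * expR (2 * C * N%:R) + Z.
  have M0 : 0 < M by rewrite ltr_wpDl// mulr_ge0 ?expR_ge0// addr_ge0// nrm2_ge0.
  have [L L0 HL] := cut_lip lb M0.
  have [u [cu Hu]] := picard L0 HL cg.
  have cc : continuous (fun y => cut_fun M y *: b y).
    apply: loc_lip_cont => K K0; exists L; first exact: ltW.
    by move=> y y' _ _; exact: HL.
  have uM t : 0 <= t <= N%:R -> `|u t| <= M.
    move=> tN; have /andP[t0 t1] := tN.
    have A := @apriori _ z u x C N%:R cc cz C0 cu Hu _ t tN.
    rewrite -[u t](subrK (z t)) (le_trans (ler_normD _ _))// lerD ?HZ//.
    apply: le_trans (norm_nrm2 _) _; apply: le_trans (A _) _; last first.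
      rewrite ler_wpM2l ?addr_ge0 ?nrm2_ge0// ler_expR ler_wpM2l// mulr_ge0//.
    move=> s sN v; have /andP[l0 l1] := cut_fun01 M (v + z s).
    have := HC v (z s) (HZ s sN).
    have -> : \sum_i v i 0 * (cut_fun M (v + z s) *: b (v + z s)) i 0 =
        cut_fun M (v + z s) * \sum_i v i 0 * (b (v + z s)) i 0.
      by rewrite mulr_sumr; apply: eq_bigr => i _; rewrite !mxE; ring.
    have : 0 <= C * (1 + nrm2 v) by rewrite mulr_ge0// addr_ge0// nrm2_ge0.
    move: (\sum_i _) (C * _) l0 l1 => S D; move: (cut_fun _ _) => l; nra.
  exists u; split => // t tN; have /andP[t0 t1] := tN.
  rewrite {1}Hu//; congr (_ + _); apply/colP => i; rewrite !mxE.
  apply: eq_Rintegral => s; rewrite inE /= in_itv /= => /andP[s0 st].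
  by rewrite cut_fun1 ?scale1r// uM// s0 (le_trans st).
have [U HU] := choice H.
have agree0 N N' s : (N <= N')%N -> 0 <= s <= N%:R -> U N s = U N' s.
  move=> NN' sN; have [cu Hu] := HU N; have [cu' Hu'] := HU N'.
  have [M M0 HM] := cont_norm_bounded N%:R cu; have [M' M'0 HM'] := cont_norm_bounded N%:R cu'.
  have MM0 : 0 < M + M' by exact: addr_gt0.
  have [L L0 HL] := lb _ MM0.
  have := @isol_stable _ _ b _ _ _ _ (M + M') L 0 N%:R cb cu cu' L0 HL Hu _ _ (lexx 0) _ s sN.
  rewrite mulr0 mul0r => K; apply/eqP; rewrite -subr_eq0 -normr_le0; apply: (K (fun t => x + z t)).
  - by move=> r /andP[r0 r1]; apply: Hu'; rewrite r0 (le_trans r1)// ler_nat.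
  - move=> r sT; split; first by apply: le_trans (HM r sT) _; rewrite lerDl ltW.
    by apply: le_trans (HM' r sT) _; rewrite lerDr ltW.
  - by move=> r _; rewrite subrr normr0.
have agree N N' s : 0 <= s <= N%:R -> s <= N'%:R -> U N s = U N' s.
  move=> sN sN'; have [NN|/ltnW NN] := leqP N N'; first exact: agree0.
  by apply/esym/agree0 => //; rewrite sN'; case/andP: sN => ->.
pose Nt (t : R) := (Num.truncn `|t|).+1.
have NtP t : `|t| <= (Nt t)%:R by apply: ltW; exact: truncnS_gt.
pose u t := U (Nt t) (ppart t).
have uE N t : ppart t <= N%:R -> u t = U N (ppart t).
  move=> tN; apply: agree => //; rewrite ppart_ge0 (le_trans (ppart_le t))//.
have cu : continuous u.
  move=> t; apply: eps_cont => e e0.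
  have [cUN _] := HU (Nt t).+1.
  have cUp : {for t, continuous (U (Nt t).+1 \o ppart)}.
    by apply: continuous_comp; [exact: ppart_cont|exact: cUN].
  have [d d0 Hd] := cont_eps cUp e0.
  exists (Num.min d 1); first by rewrite lt_min d0 ltr01.
  move=> s; rewrite lt_min => /andP[sd s1].
  rewrite (uE (Nt t).+1) ?(uE (Nt t).+1); first exact: Hd.
    apply: le_trans (ppart_le s) _; rewrite -natr1.
    rewrite -[s](subKr t) (le_trans (ler_normB _ _))// lerD// ltW//.
  by apply: le_trans (ppart_le t) _; apply: le_trans (NtP t) _; rewrite ler_nat.
exists u; split => // t t0.
have tN : 0 <= t <= (Nt t)%:R by rewrite t0 -{1}(ger0_norm t0) NtP.
have [cUN HUN] := HU (Nt t).
rewrite (uE (Nt t)) ppart_id//; last by case/andP: tN.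
rewrite {1}HUN//; congr (_ + _); apply/colP => i; rewrite !mxE.
apply: eq_Rintegral => s; rewrite inE /= in_itv /= => /andP[s0 st].
by rewrite (uE (Nt t)) ppart_id//; apply: le_trans st _; case/andP: tN.
Qed.

(** Discrete Gronwall with a bootstrap: as long as the error is at most 1, the scheme stays in the
    ball of radius M + 1, where the drift is L-Lipschitz and the recursion is assumed. The initial
    points may differ, which later gives uniformity in the starting point. *)
Lemma euler_close b z (x x' : V) u (e : nat -> V) (h T M L w : R) :
  continuous b -> continuous u -> 0 < h -> 0 <= L -> 0 <= w -> lip_on (M + 1) L b ->
  (forall t, 0 <= t <= T -> u t = x + z t + ivec b u t) -> z 0 = 0 ->
  (forall t, 0 <= t <= T -> `|u t| <= M) ->
  (forall s t, 0 <= s <= T -> 0 <= t <= T -> `|s - t| <= h -> `|u s - u t| <= w) ->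
  e 0%N = x' ->
  (forall k, k.+1%:R * h <= T -> `|e k| <= M + 1 ->
     e k.+1 = e k + h *: b (e k) + (z (k.+1%:R * h) - z (k%:R * h))) ->
  (`|x' - x| + T * L * w) * expR (L * T) <= 1 ->
  forall k, k%:R * h <= T -> `|e k - u (k%:R * h)| <= (`|x' - x| + T * L * w) * expR (L * T).
Proof.
move=> cb cu h0 L0 w0 lb Hu z0 HM Hw e0 He D1.
have hL0 : 0 <= h * L by rewrite mulr_ge0// ltW.
have main k : k%:R * h <= T -> `|e k - u (k%:R * h)| <= (`|x' - x| + k%:R * h * L * w) * (1 + h * L) ^+ k.
  elim: k => [|k IH] kT.
    rewrite mul0r e0 !mul0r addr0 expr0 mulr1.
    have T0 : 0 <= (0 : R) <= T by rewrite lexx /=; move: kT; rewrite mul0r.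
    rewrite Hu// z0 addr0; have -> : ivec b u 0 = 0 by apply/colP => i; rewrite !mxE int_neg.
    by rewrite addr0.
  have kT' : k%:R * h <= T by apply: le_trans kT; rewrite ler_wpM2r ?(ltW h0)// ler_nat.
  have kI : 0 <= k%:R * h <= T by rewrite kT' mulr_ge0// ltW.
  have kI' : 0 <= k.+1%:R * h <= T by rewrite kT mulr_ge0// ltW.
  have kS : k.+1%:R * h = k%:R * h + h by rewrite -natr1 mulrDl mul1r.
  have IHk := IH kT'.
  have bnd : (`|x' - x| + k%:R * h * L * w) * (1 + h * L) ^+ k <= (`|x' - x| + T * L * w) * expR (L * T).
    rewrite ler_pM ?exprn_ge0 ?addr_ge0 ?mulr_ge0 ?(ltW h0)//.
      by rewrite lerD2l ler_wpM2r// ler_wpM2r.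
    apply: (@le_trans _ _ (expR (h * L) ^+ k)); first by rewrite lerXn2r ?nnegrE ?expR_ge0 ?addr_ge0// expR_ge1Dx.
    rewrite -expRM_natl ler_expR mulrA mulrC ler_wpM2l//.
  have ekM : `|e k| <= M + 1.
    rewrite -[e k](subrK (u (k%:R * h))) addrC (le_trans (ler_normD _ _))// lerD ?HM//.
    by apply: le_trans IHk _; apply: le_trans bnd _.
  pose I := ivec b u (k.+1%:R * h) - ivec b u (k%:R * h).
  have -> : e k.+1 - u (k.+1%:R * h) =
     (e k - u (k%:R * h)) + h *: (b (e k) - b (u (k%:R * h))) + (h *: b (u (k%:R * h)) - I).
    rewrite (He _ kT ekM) (Hu _ kI') [in RHS](Hu _ kI) /I scalerBr.
    by apply/colP => i; rewrite !mxE; ring.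
  have Ib : `|h *: b (u (k%:R * h)) - I| <= h * L * w.
    apply: norm_col_le; first by rewrite mulr_ge0.
    move=> i; rewrite /I !mxE.
    have cbi := @cont_coord _ _ (b \o u) i (cont_comp cb cu).
    have kh0 : 0 <= k%:R * h by case/andP: kI.
    have kk : k%:R * h <= k.+1%:R * h by rewrite kS lerDl ltW.
    rewrite (int_split cbi kh0 kk) [X in _ - X]addrAC subrr add0r.
    have -> : h * b (u (k%:R * h)) i 0 = \int[mu]_(s in `[k%:R * h, k.+1%:R * h]) (b (u (k%:R * h)) i 0).
      rewrite Rintegral_cst//= lebesgue_measure_itv /= lte_fin kS ltrDl h0 /= addrAC subrr add0r.
      by rewrite mulrC.
    rewrite -RintegralB//; last 2 first.
    - by apply: cont_integrable => s; exact: cvg_cst.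
    - exact: cont_integrable cbi.
    have -> : h * L * w = (L * w) * (k.+1%:R * h - k%:R * h) by rewrite kS; ring.
    apply: int_bound => //.
      by move=> s; apply: cvgB; [exact: cvg_cst|exact: cbi].
    move=> s /andP[s1 s2].
    have sI : 0 <= s <= T by rewrite (le_trans kh0 s1) (le_trans s2 kT).
    have := mxcoord_le (b (u (k%:R * h)) - b (u s)) i; rewrite !mxE => /le_trans; apply.
    apply: le_trans (lb _ _ _ _) _.
    - by apply: le_trans (HM _ kI) _; rewrite lerDl.
    - by apply: le_trans (HM _ sI) _; rewrite lerDl.
    rewrite ler_wpM2l// Hw// ler_norml; apply/andP; split; move: s1 s2; rewrite kS; lra.
  apply: le_trans (ler_normD _ _) _.
  apply: (@le_trans _ _ ((1 + h * L) * `|e k - u (k%:R * h)| + h * L * w)).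
    apply: lerD => //; apply: le_trans (ler_normD _ _) _.
    rewrite mulrDl mul1r lerD2l normrZ (gtr0_norm h0) -mulrA ler_pM2l//.
    by apply: lb => //; apply: le_trans (HM _ kI) _; rewrite lerDl.
  apply: (@le_trans _ _ ((1 + h * L) * ((`|x' - x| + k%:R * h * L * w) * (1 + h * L) ^+ k) + h * L * w)).
    by rewrite lerD2r ler_wpM2l// addr_ge0.
  rewrite mulrCA -exprS kS.
  have E1 : 1 <= (1 + h * L) ^+ k.+1 by rewrite exprn_ege1// lerDl.
  have hLw : 0 <= h * L * w by rewrite mulr_ge0.
  have -> : (`|x' - x| + (k%:R * h + h) * L * w) * (1 + h * L) ^+ k.+1 =
    (`|x' - x| + k%:R * h * L * w) * (1 + h * L) ^+ k.+1 + h * L * w * (1 + h * L) ^+ k.+1 by ring.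
  by rewrite lerD2l ler_peMr.
move=> k kT; apply: le_trans (main k kT) _.
rewrite ler_pM ?exprn_ge0 ?addr_ge0 ?mulr_ge0 ?(ltW h0)//.
  by rewrite lerD2l ler_wpM2r// ler_wpM2r.
apply: (@le_trans _ _ (expR (h * L) ^+ k)); first by rewrite lerXn2r ?nnegrE ?expR_ge0 ?addr_ge0// expR_ge1Dx.
by rewrite -expRM_natl ler_expR mulrA mulrC ler_wpM2l.
Qed.

End global_solutions.

(** * Weak limits along an ultrafilter *)

Section ultralimits.
Context (R : realType) (U : set_system nat) (UU : UltraFilter U).

Definition ulim (a : nat -> R) : R := xget 0 [set l : R | a @ U --> l].

(** By compactness the image ultrafilter has a cluster point, and a cluster point of an ultrafilter
    is a limit. *)
Lemma ulimP a : (forall j, 0 <= a j <= 1) -> a @ U --> ulim a.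
Proof.
move=> a01; have [|l [_ cl]] := @segment_compact R 0 1 (a @ U) _.
  apply: (@filterS _ U _ setT) => [j _ /=|]; [by rewrite in_itv /=; exact: a01|exact: filterT].
suff Hl : a @ U --> l by apply: (@xgetPex _ 0 [set l : R | a @ U --> l]); exists l.
move=> B lB; have [//|UB] := in_ultra_setVsetC (a @^-1` B) UU.
by have [y [/= nBy By]] := cl (~` B) B UB lB.
Qed.

Lemma ulim_eq a l : a @ U --> l -> ulim a = l.
Proof. by move=> Hl; apply: xget_unique => // l' Hl'; exact: cvg_unique Hl' Hl. Qed.

Lemma ulim_le a b : (forall j, 0 <= a j <= 1) -> (forall j, 0 <= b j <= 1) ->
  (\forall j \near U, a j <= b j) -> ulim a <= ulim b.
Proof. by move=> a01 b01 ab; apply: ler_cvg_to ab; exact: ulimP. Qed.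

Lemma ulim_ge0 a : (forall j, 0 <= a j <= 1) -> 0 <= ulim a.
Proof.
move=> a01; have H : (fun=> 0) @ U --> (0 : R) by exact: cvg_cst.
by apply: (ler_cvg_to H (ulimP a01)); apply: nearW => j; have /andP[] := a01 j.
Qed.

Lemma ulim_le1 a : (forall j, 0 <= a j <= 1) -> ulim a <= 1.
Proof.
move=> a01; have H : (fun=> 1) @ U --> (1 : R) by exact: cvg_cst.
by apply: (ler_cvg_to (ulimP a01) H); apply: nearW => j; have /andP[] := a01 j.
Qed.

End ultralimits.

Section weak_limit.
Context (R : realType) (n : nat).
Local Notation V := 'cV[R]_n.
Local Notation T := (Rn R n).
Variables (mu_ : nat -> probability T R) (U : set_system nat).
Context (UU : UltraFilter U).
Hypothesis tight : forall e : R, 0 < e -> exists M : R,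
  \forall j \near U, (mu_ j [set u : V | (`|u| > M)%R] <= e%:E)%E.

Lemma open_measurable (D : set V) : open D -> measurable (D : set T).
Proof. by move=> oO; exact: sub_sigma_algebra. Qed.

Lemma closed_measurable (D : set V) : closed D -> measurable (D : set T).
Proof. by move=> cO; rewrite -[D]setCK; apply: measurableC; apply: open_measurable; exact: closed_openC. Qed.

(* The setwise limit [nu] is only finitely additive. Its regularization from inside
   on open sets, [mo], then from outside, [mout], is a measure. *)
Definition nu (A : set T) : R := ulim U (fun j => fine (mu_ j A)).

Lemma pr01 j (A : set T) : measurable A -> 0 <= fine (mu_ j A) <= 1.
Proof.
by move=> mA; rewrite fine_ge0//= -lee_fin fineK ?fin_num_measure// probability_le1.
Qed.

Lemma nu_cvg A : measurable A -> (fun j => fine (mu_ j A)) @ U --> nu A.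
Proof. by move=> mA; apply: ulimP => j; exact: pr01. Qed.

Lemma nu_ge0 A : measurable A -> 0 <= nu A.
Proof. by move=> mA; apply: ulim_ge0 => j; exact: pr01. Qed.

Lemma nu_le1 A : measurable A -> nu A <= 1.
Proof. by move=> mA; apply: ulim_le1 => j; exact: pr01. Qed.

Lemma nu_le A B : measurable A -> measurable B -> A `<=` B -> nu A <= nu B.
Proof.
move=> mA mB AB; apply: ulim_le; [by move=> j; exact: pr01|by move=> j; exact: pr01|].
by apply: nearW => j; rewrite fine_le ?fin_num_measure// le_measure// inE.
Qed.

Lemma nuU A B : measurable A -> measurable B -> [disjoint A & B] -> nu (A `|` B) = nu A + nu B.
Proof.
move=> mA mB AB; apply: ulim_eq.
have -> : (fun j => fine (mu_ j (A `|` B))) = (fun j => fine (mu_ j A) + fine (mu_ j B)).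
  apply/funext => j; rewrite measureU ?fineD ?fin_num_measure//.
  exact/disj_set2P.
by apply: cvgD; exact: nu_cvg.
Qed.

Lemma nu_leU A B : measurable A -> measurable B -> nu (A `|` B) <= nu A + nu B.
Proof.
move=> mA mB; rewrite -(setDUK (@subsetUl _ A B)) nuU//.
- rewrite lerD2l; apply: nu_le => //.
    by apply: measurableD => //; exact: measurableU.
  by rewrite setDUl setDv set0U; exact: subDsetl.
- by apply: measurableD => //; exact: measurableU.
- by apply/disj_setPS => x [Ax [_ /(_ Ax)]].
Qed.

Lemma nuT : nu setT = 1.
Proof.
apply: ulim_eq.
have -> : (fun j => fine (mu_ j setT)) = cst 1 by apply/funext => j; rewrite probability_setT.
exact: cvg_cst.
Qed.

(** An explicit exhaustion of an open set by compact sets, monotone both in [D] and in [N]. *)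
Definition inner (D : set V) (N : nat) : set V :=
  [set x | `|x| <= N%:R /\ forall y, `|x - y| < N.+1%:R^-1 -> D y].

Lemma inner_sub D N : inner D N `<=` D.
Proof. by move=> x [_]; apply; rewrite subrr normr0. Qed.

Lemma inner_le D D' N N' : D `<=` D' -> (N <= N')%N -> inner D N `<=` inner D' N'.
Proof.
move=> OO NN x [xN H]; split; first by apply: le_trans xN _; rewrite ler_nat.
move=> y xy; apply/OO/H; apply: lt_le_trans xy _.
by rewrite lef_pV2 ?posrE// ler_nat.
Qed.

Lemma inner_closed D N : closed (inner D N).
Proof.
have -> : inner D N = (fun x : V => `|x|) @^-1` [set r | r <= N%:R] `&`
    \bigcap_(y in ~` D) ((fun x : V => `|x - y|) @^-1` [set r | N.+1%:R^-1 <= r]).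
  apply/seteqP; split => [x [xN H]|x [xN H]]; split => //.
    by move=> y Oy /=; rewrite leNgt; apply/negP => /H.
  move=> y xy; apply: contrapT => Oy; have := H y Oy; rewrite /= leNgt xy //.
apply: closedI.
  apply: (@preimage_closed _ _ (fun x : V => `|x|)).
    by move=> x _; exact: norm_continuous.
  exact: closed_le.
apply: closed_bigI => y _.
apply: (@preimage_closed _ _ (fun x : V => `|x - y|)); last exact: closed_ge.
move=> x _; apply: eps_cont => e e0; exists e => // w xw.
apply: le_trans (ler_dist_dist _ _) _; rewrite opprB addrA subrK; exact: ltW.
Qed.

(** Heine-Borel, transported from row vectors by transposition. *)
Lemma closed_bounded_compact (A : set V) (M : R) : closed A -> (forall x, A x -> `|x| <= M) -> compact A.
Proof.
move=> cA AM.
pose B := [set v : 'rV[R]_n | A (v^T)].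
have trc : continuous (fun v : 'rV[R]_n => v^T).
  move=> v; apply: eps_cont => e e0; exists e => // w vw.
  apply: norm_col_le; first exact: ltW.
  move=> i; rewrite !mxE; apply: ltW; apply: le_lt_trans vw.
  rewrite /Num.Def.normr /= mx_normrE; apply/bigmax_geP; right => /=.
  by exists (0, i) => //; rewrite !mxE.
have cB : compact B.
  apply: bounded_closed_compact.
    exists M; split; first exact: num_real.
    move=> K MK v Bv; apply: le_trans (ltW MK).
    apply: le_trans (AM _ Bv).
    rewrite {1}/Num.Def.normr /= mx_normrE; apply/bigmax_leP; split => // -[i j] _ /=.
    by have := mxcoord_le v^T j; rewrite mxE ord1.
  by apply: (@preimage_closed _ _ (fun v : 'rV[R]_n => v^T)) => // x _; exact: trc.
have -> : A = (fun v : 'rV[R]_n => v^T) @` B.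
  apply/seteqP; split => [x Ax|_ [v Bv <-] //].
  by exists x^T; rewrite /B /= trmxK.
apply: continuous_compact => //; exact: continuous_subspaceT.
Qed.

Lemma inner_compact D N : compact (inner D N).
Proof. by apply: (@closed_bounded_compact _ N%:R); [exact: inner_closed|move=> x []]. Qed.

Lemma inner_measurable D N : measurable (inner D N : set T).
Proof. by apply: closed_measurable; exact: inner_closed. Qed.

Definition mo (D : set V) : \bar R := ereal_sup [set (nu (inner D N))%:E | N in setT].

Lemma mo_ge D N : ((nu (inner D N))%:E <= mo D)%E.
Proof. by apply: ereal_sup_ubound; exists N. Qed.

Lemma mo_ge0 D : (0 <= mo D)%E.
Proof. by apply: le_trans (mo_ge D 0); rewrite lee_fin nu_ge0//; exact: inner_measurable. Qed.

Lemma mo_le D D' : D `<=` D' -> (mo D <= mo D')%E.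
Proof.
move=> OO; apply: ge_ereal_sup => _ [N _ <-]; apply: le_trans (mo_ge D' N).
by rewrite lee_fin nu_le//; [exact: inner_measurable|exact: inner_measurable|exact: inner_le].
Qed.

Lemma mo_le_nu D : open D -> (mo D <= (nu D)%:E)%E.
Proof.
move=> oO; apply: ge_ereal_sup => _ [N _ <-]; rewrite lee_fin nu_le//.
- exact: inner_measurable.
- exact: open_measurable.
- exact: inner_sub.
Qed.

(** A point of [D k] has a neighbourhood inside [inner (D k) i] for all large i. Compactness makes
    one index serve both as the number of sets and as the level of exhaustion, as the subadditivity
    of [mo] requires. *)
Lemma cover_inner (D : nat -> set V) (K : set V) : (forall i, open (D i)) -> compact K ->
  K `<=` \bigcup_i D i -> exists i, forall x, K x -> exists2 k, (k < i)%N & inner (D k) i x.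
Proof.
move=> oO cK KO; move: cK; rewrite compact_near_coveringP.
move=> /(_ nat \oo (fun i x => exists2 k, (k < i)%N & inner (D k) i x) _)[].
  move=> x Kx; have [k _ Okx] := KO x Kx.
  have /nbhs_ballP[e /= e0 He] : nbhs x (D k) by exact: open_nbhs_nbhs.
  have e2 : 0 < e / 2 by rewrite divr_gt0.
  have [m _ Hm] := near_infty_natSinv_lt (PosNum e2).
  exists (ball x (e / 2), [set i | (maxn (maxn m k.+1) (Num.truncn (`|x| + e)).+1 <= i)%N]).
    split => /=; first exact: nbhsx_ballx.
    by exists (maxn (maxn m k.+1) (Num.truncn (`|x| + e)).+1).
  move=> [y i] /= [xy]; rewrite !geq_max => /andP[/andP[mi ki] ti]; exists k => //.
  move: xy; rewrite mx_norm_ball /ball_ /= => xy; split.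
    apply: (@le_trans _ _ (`|x| + e)).
      rewrite -[y](subrKC x) (le_trans (ler_normD _ _))// lerD2l distrC.
      by apply: ltW; apply: lt_trans xy _; rewrite ltr_pdivrMr// ltr_pMr// ltr1n.
    by apply: ltW; apply: lt_le_trans (truncnS_gt _) _; rewrite ler_nat.
  move=> w yw; apply: He; rewrite mx_norm_ball /ball_ /=.
  rewrite -(subrKA y) (splitr e); apply: le_lt_trans (ler_normD _ _) _.
  by apply: ltrD => //; apply: lt_trans yw _; exact: (Hm i mi).
move=> m _ Hm; exists m => x Kx; exact: Hm (leqnn m) x Kx.
Qed.

Lemma nu_leUn (A : nat -> set T) k : (forall i, measurable (A i)) ->
  nu (\bigcup_(i < k) A i) <= \sum_(i < k) nu (A i).
Proof.
move=> mA; elim: k => [|k IH].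
  rewrite big_ord0 bigcup_mkord big_ord0.
  rewrite (_ : nu set0 = 0)//; apply: ulim_eq.
  have -> : (fun j => fine (mu_ j set0)) = cst 0 by apply/funext => j; rewrite measure0.
  exact: cvg_cst.
rewrite bigcup_mkord big_ord_recr big_ord_recr /=; apply: le_trans (nu_leU _ _) _ => //.
  by apply: bigsetU_measurable.
by rewrite lerD2r -bigcup_mkord.
Qed.

Lemma mo_sigma_subadd (D : nat -> set V) : (forall i, open (D i)) ->
  (mo (\bigcup_i D i) <= \sum_(i <oo) mo (D i))%E.
Proof.
move=> oO; apply: ge_ereal_sup => _ [N _ <-].
have [i Hi] := cover_inner oO (@inner_compact (\bigcup_i D i) N) (@inner_sub _ N).
apply: (@le_trans _ _ (\sum_(k < i) nu (inner (D k) i))%:E).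
  rewrite lee_fin; apply: le_trans (nu_leUn _ (fun k => inner_measurable (D k) i)).
  apply: nu_le; first exact: inner_measurable.
    by apply: bigcup_measurable => k _; exact: inner_measurable.
  by move=> x /Hi[k ki Hk]; exists k.
rewrite -sumEFin; apply: (@le_trans _ _ (\sum_(k < i) mo (D k))%E).
  by apply: lee_sum => k _; exact: mo_ge.
rewrite -(big_mkord xpredT (fun k => mo (D k))).
by apply: nneseries_lim_ge => *; exact: mo_ge0.
Qed.

Definition mout (A : set V) : \bar R := ereal_inf [set mo D | D in [set D | open D /\ A `<=` D]].

Lemma mout_ge0 A : (0 <= mout A)%E.
Proof. by apply: le_ereal_inf_tmp => _ [D _ <-]; exact: mo_ge0. Qed.

Lemma mout_le A B : A `<=` B -> (mout A <= mout B)%E.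
Proof. by move=> AB; apply: ereal_inf_le_tmp => _ [D [oO BO] <-]; exists D => //; split => //; exact: subset_trans BO. Qed.

Lemma mout_open D : open D -> mout D = mo D.
Proof.
move=> oO; apply/eqP; rewrite eq_le; apply/andP; split.
  by apply: ereal_inf_lbound; exists D => //=; split.
by apply: le_ereal_inf_tmp => _ [D' [_ OO] <-]; exact: mo_le.
Qed.

Lemma mo_le1 D : (mo D <= 1)%E.
Proof. by apply: ge_ereal_sup => _ [N _ <-]; rewrite lee_fin nu_le1//; exact: inner_measurable. Qed.

Lemma mout0 : mout set0 = 0%E.
Proof.
rewrite mout_open; last exact: open0.
apply/eqP; rewrite eq_le mo_ge0 andbT; apply: ge_ereal_sup => _ [N _ <-].
have -> : inner set0 N = set0 by apply/seteqP; split => // x /inner_sub.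
rewrite lee_fin (_ : nu set0 = 0)//; apply: ulim_eq.
have -> : (fun j => fine (mu_ j set0)) = cst 0 by apply/funext => j; rewrite measure0.
exact: cvg_cst.
Qed.

Lemma mout_sigma_subadd : sigma_subadditive mout.
Proof.
move=> A; apply/lee_addgt0Pr => e e0.
have H i : exists D, [/\ open D, A i `<=` D & (mo D <= mout (A i) + (e / (2 ^ i.+1)%:R)%:E)%E].
  have ei : 0 < e / (2 ^ i.+1)%:R by rewrite divr_gt0// ltr0n expn_gt0.
  have fi : mout (A i) \is a fin_num.
    rewrite ge0_fin_numE ?mout_ge0//; apply: (@le_lt_trans _ _ (mo setT)).
      by apply: ereal_inf_lbound; exists setT => //; split => //; exact: openT.
    by apply: le_lt_trans (mo_le1 _) _; rewrite ltry.
  have [_ [D [oO AO] <-] HO] := lb_ereal_inf_adherent ei fi.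
  by exists D; split => //; exact: ltW.
have [D HO] := choice H.
have oO i : open (D i) by have [] := HO i.
apply: (@le_trans _ _ (mo (\bigcup_i D i))).
  apply: ereal_inf_lbound; exists (\bigcup_i D i) => //; split; first exact: bigcup_open.
  by apply: subset_bigcup => i _; have [] := HO i.
apply: le_trans (mo_sigma_subadd oO) _.
apply: le_trans (epsilon_trick xpredT _ (ltW e0)); last by move=> i; exact: mout_ge0.
apply: lee_nneseries => i _; first by move=> _; exact: mo_ge0.
by have [] := HO i.
Qed.

HB.instance Definition _ := isOuterMeasure.Build R V mout mout0 mout_ge0 mout_le mout_sigma_subadd.

(** For an open G, a compact K in the exhaustion of the intersection of G and D, and a compact set
    in that of G \ K, are disjoint and lie in one member of the exhaustion of G. Finite additivity
    of [nu] gives the inequality. *)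
Lemma open_caratheodory D : open D -> caratheodory_measurable mout D.
Proof.
move=> oO; apply: le_caratheodory_measurable => X.
apply: le_ereal_inf_tmp => _ [G [oG XG] <-].
apply: (@le_trans _ _ (mout (G `&` D) + mout (G `&` ~` D))%E).
  by apply: leeD; apply: mout_le; exact: setSI.
rewrite mout_open; last exact: openI.
rewrite addeC -leeBrDl; last by rewrite ge0_fin_numE ?mout_ge0//; apply: (@le_lt_trans _ _ (mo setT)); [apply: ereal_inf_lbound; exists setT => //; split => //; exact: openT|apply: le_lt_trans (mo_le1 _) _; rewrite ltry].
apply: ge_ereal_sup => _ [N _ <-].
set K := inner (G `&` D) N.
have mK : measurable (K : set T) by exact: inner_measurable.
have oGK : open (G `\` K) by rewrite setDE; apply: openI => //; apply: closed_openC; exact: inner_closed.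
have fm : mout (G `&` ~` D) \is a fin_num.
  rewrite ge0_fin_numE ?mout_ge0//; apply: (@le_lt_trans _ _ (mo setT)).
    by apply: ereal_inf_lbound; exists setT => //; split => //; exact: openT.
  by apply: le_lt_trans (mo_le1 _) _; rewrite ltry.
rewrite leeBrDr//; apply: (@le_trans _ _ ((nu K)%:E + mo (G `\` K))%E).
  rewrite leeD2l// -mout_open//; apply: mout_le => x [Gx Ox]; split => // /inner_sub[].
  by [].
rewrite addeC -leeBrDr//; apply: ge_ereal_sup => _ [M _ <-].
rewrite leeBrDr// -EFinD addrC -nuU//.
- apply: le_trans (mo_ge G (maxn N M)); rewrite lee_fin nu_le//.
  + by apply: measurableU => //; exact: inner_measurable.
  + exact: inner_measurable.
  + by move=> x [|]; apply: inner_le => //; rewrite ?leq_maxl ?leq_maxr.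
- exact: inner_measurable.
- by apply/disj_setPS => x [Kx /inner_sub[_ /(_ Kx)]].
Qed.

Lemma measurable_caratheodory (A : set T) : measurable A -> caratheodory_measurable mout A.
Proof.
move=> mA; have : (@measurable _ (caratheodory_type mout)) A.
  apply: (@smallest_sub _ _ (@open V)) mA; last by move=> D oO; exact: open_caratheodory.
  split; [exact: measurable0|by move=> B mB; rewrite setTD; exact: measurableC|].
  by move=> F mF; exact: bigcupT_measurable.
exact.
Qed.

Definition wlim (A : set T) : \bar R := mout A.

Let wlim0 : wlim set0 = 0%E. Proof. exact: mout0. Qed.
Let wlim_ge0 A : (0 <= wlim A)%E. Proof. exact: mout_ge0. Qed.
Let wlim_sigma_additive : semi_sigma_additive wlim.
Proof.
move=> F mF tF mUF.
apply: (@caratheodory_measure_sigma_additive R V mout F) => //.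
- by move=> i; exact: measurable_caratheodory.
- exact: measurable_caratheodory.
Qed.

HB.instance Definition _ := isMeasure.Build _ _ _ wlim wlim0 wlim_ge0 wlim_sigma_additive.

(** Tightness prevents the loss of mass at infinity: a large ball, which is a set [inner setT N],
    carries [nu]-mass at least 1 - e. *)
Lemma wlimT : wlim setT = 1%E.
Proof.
rewrite /wlim mout_open; last exact: openT.
apply/eqP; rewrite eq_le mo_le1 /=; apply/lee_addgt0Pr => e e0.
have [M HM] := tight e0.
have mM : measurable ([set u : V | `|u| > M] : set T).
  apply: open_measurable; rewrite (_ : [set _ | _] = (fun u : V => `|u|) @^-1` [set r | r > M])//.
  apply: open_comp; [by move=> x _; exact: norm_continuous|exact: open_gt].
have nM : nu [set u : V | `|u| > M] <= e.
  have H : (fun=> e) @ U --> e by exact: cvg_cst.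
  apply: (ler_cvg_to (nu_cvg mM) H).
  by apply: filterS HM => j; rewrite -{1}(@fineK _ (mu_ j _)) ?fin_num_measure// lee_fin.
pose N := (Num.truncn `|M|).+1.
have K1 : nu setT <= nu (inner setT N) + nu [set u : V | `|u| > M].
  apply: (@le_trans _ _ (nu (~` [set u : V | `|u| > M] `|` [set u : V | `|u| > M]))).
    by rewrite setvU.
  apply: le_trans (nu_leU _ _) _ => //; first exact: measurableC.
  rewrite lerD2r nu_le//; [exact: measurableC|exact: inner_measurable|].
  move=> x /= /negP; rewrite -leNgt => xM; split => //.
  apply: le_trans xM _; apply: le_trans (ler_norm _) _; apply: ltW; exact: truncnS_gt.
rewrite nuT -lee_fin EFinD in K1; apply: le_trans K1 _.
by rewrite leeD ?mo_ge// lee_fin.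
Qed.

HB.instance Definition _ := Measure_isProbability.Build _ _ _ wlim wlimT.

Lemma count_lt (y : R) N : 0 <= y -> let s := \sum_(i < N) (i.+1%:R < y)%R%:R : R in
  [/\ s <= y, s <= N%:R, N%:R < y -> s = N%:R & y <= N.+1%:R -> y <= 1 + s].
Proof.
move=> y0; elim: N => [|N]; first by rewrite big_ord0; split => //; lra.
rewrite big_ord_recr /=; set s := \sum_(i < N) _; rewrite /= -!natr1.
by move=> [H1 H2 H3 H4]; case: (ltP (N%:R + 1) y) => Ny /=; split; move=> *; move: H3 H4;
  (try have := H3 ltac:(lra)); (try have := H4 ltac:(lra)); lra.
Qed.

(** The number of levels 1, ..., N below N f(x) equals N f(x) up to 1. The integral of f is thus
    determined up to 1 / N by the masses of N open sets. *)
Lemma layer_cake (m : probability T R) (f : V -> R) N : continuous f -> (forall x, 0 <= f x <= 1) ->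
  \sum_(i < N) fine (m [set x : V | (i.+1%:R < N%:R * f x)%R]) <= N%:R * \int[m]_x f x <=
  1 + \sum_(i < N) fine (m [set x : V | (i.+1%:R < N%:R * f x)%R]).
Proof.
move=> cf f01; set s := \sum_(i < N) _.
have oA i : open [set x : V | i.+1%:R < N%:R * f x].
  apply: (@open_comp _ _ (fun x => N%:R * f x) [set r | i.+1%:R < r]); last exact: open_gt.
  by move=> x _; exact: (continuous_comp (cf x) (@mulrl_continuous R N%:R (f x))).
have mA i := open_measurable (oA i).
have mf : measurable_fun setT (fun x : T => (f x)%:E).
  by apply/measurable_EFinP; exact: continuous_Rn_measurable.
pose g (x : T) := (\sum_(i < N) (\1_[set x : V | (i.+1%:R < N%:R * f x)%R] x)%:E)%E : \bar R.
have gE x : g x = (\sum_(i < N) (i.+1%:R < N%:R * f x)%R%:R)%:E.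
  by rewrite /g sumEFin; congr EFin; apply: eq_bigr => i _; rewrite indicE mem_setE.
have mg : measurable_fun setT g.
  by apply: emeasurable_sum => i; apply/measurable_EFinP; exact: measurable_indic.
have Ig : (\int[m]_x g x)%E = s%:E.
  rewrite ge0_integral_sum//; last first.
    by move=> i; apply/measurable_EFinP; exact: measurable_indic.
  rewrite /s -sumEFin; apply: eq_bigr => i _.
  by rewrite integral_indic// setIT fineK// fin_num_measure.
have fi : m.-integrable setT (fun x : T => (f x)%:E).
  apply/integrableP; split => //; apply: (@le_lt_trans _ _ (\int[m]_x (cst 1%:E x))%E).
    apply: ge0_le_integral => //; first exact: measurableT_comp.
    by move=> x _; rewrite lee_fin ger0_norm; case/andP: (f01 x).
  by rewrite integral_cst// mul1e; apply: le_lt_trans (probability_le1 _ _) _; rewrite ?ltry.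
have If : (\int[m]_x (N%:R * f x)%:E)%E = (N%:R * \int[m]_x f x)%:E.
  under eq_integral do rewrite EFinM.
  by rewrite integralZl// EFinM fineK//; exact: integrable_fin_num.
have mNf : measurable_fun setT (fun x : T => (N%:R * f x)%:E).
  by apply/measurable_EFinP; apply: continuous_Rn_measurable => x; exact: (continuous_comp (cf x) (@mulrl_continuous R N%:R (f x))).
have f0 x : 0 <= N%:R * f x by rewrite mulr_ge0//; case/andP: (f01 x).
apply/andP; split; rewrite -lee_fin -If.
  rewrite -Ig; apply: ge0_le_integral => //.
  - by move=> x _; rewrite gE lee_fin sumr_ge0.
  - by move=> x _; rewrite gE lee_fin; have [] := count_lt N (f0 x).
have -> : (1 + s)%:E = (\int[m]_x (1 + g x))%E.
  rewrite ge0_integralD//; last by move=> x _; rewrite gE lee_fin sumr_ge0.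
  by rewrite integral_cst//= mul1e probability_setT Ig.
apply: ge0_le_integral => //.
- by move=> x _; rewrite lee_fin.
- exact: emeasurable_funD.
- move=> x _; rewrite gE lee_fin; have [_ _ _] := count_lt N (f0 x); apply.
  by rewrite -natr1 ler_wpDr// ler_piMr//; case/andP: (f01 x).
Qed.

(** On open sets the regularized measure is at most [nu], the limit of the masses; the superlevel
    sets of f are open. *)
Lemma wlim_portmanteau_ge (f : V -> R) (e : R) : continuous f -> (forall x, 0 <= f x <= 1) -> 0 < e ->
  \forall j \near U, \int[(wlim : probability T R)]_x f x - e <= \int[mu_ j]_x f x.
Proof.
move=> cf f01 e0.
(* One unit is lost in discretizing the limit integral and one in the convergence of the N masses,
   together less than N e. *)
pose N := (Num.truncn (2 / e)).+1.
have N0 : (0 : R) < N%:R by rewrite ltr0n.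
have Ne : 2 < N%:R * e by rewrite -ltr_pdivrMr// truncnS_gt.
pose A i := [set x : V | i.+1%:R < N%:R * f x].
have oA i : open (A i).
  apply: (@open_comp _ _ (fun x => N%:R * f x) [set r | i.+1%:R < r]); last exact: open_gt.
  by move=> x _; exact: (continuous_comp (cf x) (@mulrl_continuous R N%:R (f x))).
have mA i := open_measurable (oA i).
have /andP[_ K1] := layer_cake (wlim : probability T R) N cf f01.
have K2 : \sum_(i < N) fine (wlim (A i)) <= \sum_(i < N) nu (A i).
  apply: ler_sum => i _; rewrite -lee_fin fineK; last by rewrite (fin_num_measure (wlim : probability T R)).
  by rewrite /wlim mout_open// mo_le_nu.
have K3 k : (fun j => \sum_(i < k) fine (mu_ j (A i))) @ U --> \sum_(i < k) nu (A i).
  elim: k => [|k IH].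
    have -> : (fun j => \sum_(i < 0) fine (mu_ j (A i))) = cst 0 by apply/funext => j; rewrite big_ord0.
    by rewrite big_ord0; exact: cvg_cst.
  have -> : (fun j => \sum_(i < k.+1) fine (mu_ j (A i))) =
      (fun j => \sum_(i < k) fine (mu_ j (A i)) + fine (mu_ j (A k))).
    by apply/funext => j; rewrite big_ord_recr.
  by rewrite big_ord_recr; apply: cvgD => //; exact: nu_cvg.
have K4 : \forall j \near U, \sum_(i < N) nu (A i) - 1 < \sum_(i < N) fine (mu_ j (A i)).
  by apply: (cvgr_gt _ (K3 N)); rewrite ltrBlDr ltrDl.
apply: filterS K4 => j K5.
have /andP[K6 _] := layer_cake (mu_ j) N cf f01.
rewrite -(ler_pM2l N0) mulrBr; move: K1 K2 K5 K6; rewrite /A; lra.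
Qed.

(** The lower bound for 1 - f is the upper bound for f. *)
Lemma wlim_portmanteau (f : V -> R) : continuous f -> (forall x, 0 <= f x <= 1) ->
  (fun j => \int[mu_ j]_x f x) @ U --> \int[(wlim : probability T R)]_x f x.
Proof.
move=> cf f01; apply/cvgrPdist_le => e e0.
have c1 : continuous (fun x => 1 - f x).
  move=> x; have cs : continuous (fun y : R => 1 - y) by move=> y; apply: cvgB; [exact: cvg_cst|exact: cvg_id].
  exact: (continuous_comp (cf x) (cs (f x))).
have f1 x : 0 <= 1 - f x <= 1 by have := f01 x; lra.
have E (m : probability T R) : \int[m]_x (1 - f x) = 1 - \int[m]_x f x.
  have fi : m.-integrable setT (fun x : T => (f x)%:E).
    apply/integrableP; split; first by apply/measurable_EFinP; exact: continuous_Rn_measurable.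
    apply: (@le_lt_trans _ _ (\int[m]_x (cst 1%:E x))%E).
      apply: ge0_le_integral => //.
        by apply: measurableT_comp => //; apply/measurable_EFinP; exact: continuous_Rn_measurable.
      by move=> x _; rewrite lee_fin ger0_norm; case/andP: (f01 x).
    by rewrite integral_cst// mul1e; apply: le_lt_trans (probability_le1 _ _) _; rewrite ?ltry.
  rewrite RintegralB//; last exact: finite_measure_integrable_cst.
  congr (_ - _); rewrite /Rintegral integral_cst// mul1e.
  exact: (congr1 fine (probability_setT m)).
have H1 := wlim_portmanteau_ge cf f01 e0.
have H2 := wlim_portmanteau_ge c1 f1 e0.
apply: filterS2 H1 H2 => j; rewrite !E ler_norml; lra.
Qed.

Lemma weak_limit : exists mu : probability T R, forall f : V -> R,
  continuous f -> (forall x, 0 <= f x <= 1) -> (fun j => \int[mu_ j]_x f x) @ U --> \int[mu]_x f x.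
Proof. by exists (wlim : probability T R) => f; exact: wlim_portmanteau. Qed.

End weak_limit.

(** * Expectations of bounded variables *)

Section bounded_measurable.
Context (R : realType) d (T : measurableType d) (m : probability T R).
Implicit Types f g : T -> R.

(** Integrability under a probability is automatic for this class, so that real-valued integrals
    suffice for the chain. *)
Definition bounded_meas f := measurable_fun setT f /\ exists M : R, forall x, `|f x| <= M.

Lemma bm_integrable f : bounded_meas f -> m.-integrable setT (EFin \o f).
Proof.
move=> [mf [M HM]]; apply: (@le_integrable _ _ _ _ _ _ _ (EFin \o cst M)) => //.
- exact/measurable_EFinP.
- by move=> x _ /=; rewrite lee_fin (le_trans (HM x))// ler_norm.
- exact: finite_measure_integrable_cst.
Qed.

Lemma bm_cst (c : R) : bounded_meas (fun=> c).
Proof. by split; [exact: measurable_cst|exists `|c|]. Qed.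

Lemma bmD f g : bounded_meas f -> bounded_meas g -> bounded_meas (fun x => f x + g x).
Proof.
move=> [mf [M HM]] [mg [N HN]]; split; first exact: measurable_funD.
by exists (M + N) => x; rewrite (le_trans (ler_normD _ _))// lerD.
Qed.

Lemma bmM f g : bounded_meas f -> bounded_meas g -> bounded_meas (fun x => f x * g x).
Proof.
move=> [mf [M HM]] [mg [N HN]]; split; first exact: measurable_funM.
by exists (M * N) => x; rewrite normrM ler_pM.
Qed.

Lemma bm_sum (I : Type) (s : seq I) (f : I -> T -> R) :
  (forall i, bounded_meas (f i)) -> bounded_meas (fun x => \sum_(i <- s) f i x).
Proof.
move=> H; elim: s => [|i s IH].
  have -> : (fun x => \sum_(i <- [::]) f i x) = (fun=> 0) by apply/funext => x; rewrite big_nil.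
  exact: bm_cst.
have -> : (fun x => \sum_(j <- i :: s) f j x) = (fun x => f i x + \sum_(j <- s) f j x).
  by apply/funext => x; rewrite big_cons.
exact: bmD.
Qed.

Local Notation E f := (\int[m]_x f x).

Lemma mean_cst (c : R) : \int[m]_x c = c.
Proof. by rewrite Rintegral_cst// [X in c * X](congr1 fine (probability_setT m)) mulr1. Qed.

Lemma meanD f g : bounded_meas f -> bounded_meas g -> \int[m]_x (f x + g x) = E f + E g.
Proof. by move=> bf bg; rewrite RintegralD//; exact: bm_integrable. Qed.

Lemma meanZ (c : R) f : bounded_meas f -> \int[m]_x (c * f x) = c * E f.
Proof. by move=> bf; rewrite RintegralZl//; exact: bm_integrable. Qed.

Lemma mean_sum (I : Type) (s : seq I) (f : I -> T -> R) : (forall i, bounded_meas (f i)) ->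
  \int[m]_x (\sum_(i <- s) f i x) = \sum_(i <- s) E (f i).
Proof.
move=> H; elim: s => [|i s IH].
  under eq_Rintegral do rewrite big_nil.
  by rewrite mean_cst big_nil.
under eq_Rintegral do rewrite big_cons.
by rewrite meanD//; [rewrite IH big_cons|exact: bm_sum].
Qed.

Lemma mean_le f g : bounded_meas f -> bounded_meas g -> (forall x, f x <= g x) -> E f <= E g.
Proof. by move=> bf bg fg; apply: le_Rintegral => //; exact: bm_integrable. Qed.

Lemma mean_bound f (M : R) : measurable_fun setT f -> (forall x, `|f x| <= M) -> `|E f| <= M.
Proof.
move=> mf HM; have bf : bounded_meas f by split => //; exists M.
rewrite ler_norml -[X in X <= _ <= _]mean_cst -[X in _ <= _ <= X]mean_cst.
by rewrite !mean_le//; try (exact: bm_cst); move=> x; have := HM x; rewrite ler_norml => /andP[].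
Qed.

Lemma mean01 f : measurable_fun setT f -> (forall x, 0 <= f x <= 1) -> 0 <= E f <= 1.
Proof.
move=> mf f01; have bf : bounded_meas f.
  by split => //; exists 1 => x; have /andP[f0 f1] := f01 x; rewrite ger0_norm.
apply/andP; split; first by apply: Rintegral_ge0 => x _; have /andP[] := f01 x.
by rewrite -[leRHS]mean_cst; apply: mean_le => //; [exact: bm_cst|move=> x; have /andP[] := f01 x].
Qed.

Lemma EFin_mean f : bounded_meas f -> ((E f)%:E = \int[m]_x (f x)%:E)%E.
Proof. by move=> bf; rewrite /Rintegral fineK//; apply: integrable_fin_num => //; exact: bm_integrable. Qed.

End bounded_measurable.

Lemma bm_comp (R : realType) d1 d2 (T1 : measurableType d1) (T2 : measurableType d2) (f : T2 -> R) (g : T1 -> T2) :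
  bounded_meas f -> measurable_fun setT g -> bounded_meas (fun x => f (g x)).
Proof. by move=> [mf [M HM]] mg; split; [exact: measurableT_comp mf mg|exists M]. Qed.

Section fubini_bounded.
Context (R : realType) d1 d2 (T1 : measurableType d1) (T2 : measurableType d2).
Variables (m2 : probability T2 R) (g : T1 * T2 -> R).
Hypothesis bg : bounded_meas g.

Lemma bm_section1 x : bounded_meas (fun y => g (x, y)).
Proof.
have [mg [M HM]] := bg; split; last by exists M.
by apply: measurableT_comp mg _; exact: measurable_pair1.
Qed.

Lemma bm_param : bounded_meas (fun x => \int[m2]_y g (x, y)).
Proof.
have [mg [M HM]] := bg; split; last first.
  by exists M => x; apply: mean_bound => //; have [] := bm_section1 x.
have M0 (z : T1 * T2) : 0 <= g z + M.
  by have := HM z; rewrite ler_norml => /andP[]; lra.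
(* Measurability of a parametric integral is Tonelli's, so the bound M is added to make the
   integrand nonnegative. *)
have -> : (fun x => \int[m2]_y g (x, y)) = (fun x => fine (\int[m2]_y (g (x, y) + M)%:E)%E - M).
  apply/funext => x; rewrite -[fine _]/(\int[m2]_y (g (x, y) + M)).
  by rewrite meanD ?mean_cst ?addrK//; [exact: bm_section1|exact: bm_cst].
apply: measurable_funB => //; apply: measurableT_comp; first exact: fine_measurable.
apply: (@measurable_fun_fubini_tonelli_F _ _ _ _ _ m2 (fun z => (g z + M)%:E)).
- by apply/measurable_EFinP; exact: measurable_funD.
- by move=> z; rewrite lee_fin.
Qed.

End fubini_bounded.

Section bounded_joint_law.
Context (R : realType) d (Omega : measurableType d) (P : probability Omega R).
Context d1 d2 (T1 : measurableType d1) (T2 : measurableType d2).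

Lemma bounded_joint_law (X : {RV P >-> T1}) (Y : {RV P >-> T2}) :
  (forall A B, measurable A -> measurable B ->
     P (X @^-1` A `&` Y @^-1` B) = (P (X @^-1` A) * P (Y @^-1` B))%E) ->
  forall g : T1 * T2 -> R, bounded_meas g ->
  \int[P]_w g (X w, Y w) = \int[P]_w \int[P]_w' g (X w, Y w').
Proof.
move=> H g bg; have [mg [M HM]] := bg.
have mX : measurable_fun setT X by exact: measurable_funPT.
have mY : measurable_fun setT Y by exact: measurable_funPT.
have M0 (z : T1 * T2) : 0 <= g z + M.
  by have := HM z; rewrite ler_norml => /andP[]; lra.
have bgXY : bounded_meas (fun w => g (X w, Y w)).
  split; last by exists M.
  by apply: measurableT_comp mg _; exact: measurable_fun_pair.
have bg2 : bounded_meas (fun z : T1 * Omega => g (z.1, Y z.2)).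
  split; last by exists M.
  apply: measurableT_comp mg _; apply: measurable_fun_pair; first exact: measurable_fst.
  by apply: measurableT_comp mY _; exact: measurable_snd.
have bg1 : bounded_meas (fun w => \int[P]_w' g (X w, Y w')).
  have [mp [N HN]] := bm_param P bg2; split; last by exists N => w; exact: HN.
  exact: measurableT_comp mp mX.
have := joint_law H (g := fun z => (g z + M)%:E).
have mgM : measurable_fun setT (fun z => (g z + M)%:E).
  by apply/measurable_EFinP; exact: measurable_funD.
move=> /(_ mgM (fun z => M0 z)).
have bM : bounded_meas (fun _ : Omega => M) by exact: bm_cst.
rewrite -EFin_mean; last exact: bmD.
have -> : (\int[P]_w \int[P]_w' (g (X w, Y w') + M)%:E = \int[P]_w (\int[P]_w' g (X w, Y w') + M)%:E)%E.
  apply: eq_integral => w _; rewrite -EFin_mean; last exact: (bmD (bm_section1 bg2 (X w)) bM).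
  by rewrite meanD// ?mean_cst//; exact: (bm_section1 bg2 (X w)).
rewrite -EFin_mean; last exact: bmD.
by move=> [] ; rewrite !meanD// => /addIr.
Qed.

End bounded_joint_law.

(** * The Lyapunov function near a large coordinate *)

Lemma sqr_le_near (R : realType) (l v : R) : 4 * (l - v) ^+ 2 < l ^+ 2 -> l ^+ 2 <= 4 * v ^+ 2.
Proof. by have := sqr_ge0 (l - 2 * v); lra. Qed.

(** The bookkeeping of [gen_E], isolated from its large atoms: g1 and g2 are the generators of the
    two localized multipliers, a1 and a2 their gains, C1 a3 the error of the second one, and a2 + a4
    the gain that is kept. *)
Lemma gen_E_arith (R : realType) (C1 C2 g1 g2 a1 a2 a3 a4 D : R) :
  g2 + a2 <= C1 * (a3 + D) ->
  4 * (2 * C1 + 1) * g1 <= 4 * (2 * C1 + 1) * (- a1 + C2 * D) ->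
  C1 * a3 <= C1 * (2 * D + 2 * a4) ->
  (2 * C1 + 1) * a4 <= (2 * C1 + 1) * (4 * a1 + 4 * D) ->
  g2 + 4 * (2 * C1 + 1) * g1 <=
  (C1 + 2 * C1 + 4 * (2 * C1 + 1) + 4 * (2 * C1 + 1) * C2) * D - (a2 + a4).
Proof. lra. Qed.

Section generator.
Context (R : realType) (n : nat).
Local Notation V := 'cV[R]_n.
Implicit Types (F G H : fn R n).

Implicit Types (f g m : V -> R).

Definition dominated f m := exists2 C : R, 0 <= C & forall x, `|f x| <= C * m x.

Lemma dominated_eq f g m : (forall x, f x = g x) -> dominated g m -> dominated f m.
Proof. by move=> fg [C C0 H]; exists C => // x; rewrite fg. Qed.

Lemma dominated_add f g m : dominated f m -> dominated g m -> dominated (fun x => f x + g x) m.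
Proof.
move=> [C C0 HC] [D D0 HD]; exists (C + D); first exact: addr_ge0.
by move=> x; rewrite (le_trans (ler_normD _ _))// mulrDl lerD.
Qed.

Lemma dominated_opp f m : dominated f m -> dominated (fun x => - f x) m.
Proof. by move=> [C C0 H]; exists C => // x; rewrite normrN. Qed.

Lemma dominated_mul f g m m' : dominated f m -> dominated g m' -> dominated (fun x => f x * g x) (fun x => m x * m' x).
Proof.
move=> [C C0 HC] [D D0 HD]; exists (C * D); first exact: mulr_ge0.
by move=> x; rewrite normrM mulrACA ler_pM.
Qed.

Lemma dominated_le f m m' : (exists2 C : R, 0 <= C & forall x, m x <= C * m' x) -> dominated f m -> dominated f m'.
Proof.
move=> [C C0 HC] [D D0 HD]; exists (D * C); first exact: mulr_ge0.
by move=> x; rewrite (le_trans (HD x))// -mulrA ler_wpM2l.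
Qed.

Lemma dominated_sum (I : Type) (r : seq I) (f : I -> V -> R) m : (forall x, 0 <= m x) ->
  (forall i, dominated (f i) m) -> dominated (fun x => \sum_(i <- r) f i x) m.
Proof.
move=> m0 H; elim: r => [|i r IH].
  by exists 0 => // x; rewrite big_nil normr0 mul0r.
apply: (dominated_eq (g := fun x => f i x + \sum_(j <- r) f j x)); first by move=> x; rewrite big_cons.
exact: dominated_add.
Qed.

(** * Calculus of the generator *)

Variables (b : V -> V) (w : 'I_n -> R).

(** The gradient in the noise directions, whose scalar products form the carré du champ [carre] of
    the generator [gen]. *)
Definition sgrad F (x : V) (i : 'I_n) : R := w i * gr F x i.
Definition carre F G (x : V) : R := \sum_i sgrad F x i * sgrad G x i.
Definition gen F (x : V) : R := d1 F x (b x) + (\sum_i w i ^+ 2 * hs F x i i) / 2.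

Lemma gamC F G x : carre F G x = carre G F x.
Proof. by apply: eq_bigr => i _; rewrite mulrC. Qed.

Lemma gam_mul F G H x : carre (mul_fn F G) H x = fv F x * carre G H x + fv G x * carre F H x.
Proof. by rewrite !mulr_sumr -big_split; apply: eq_bigr => i _; rewrite /sgrad /=; ring. Qed.

Lemma gam_comp (f f1 f2 : R -> R) F H x : carre (comp_fn f f1 f2 F) H x = f1 (fv F x) * carre F H x.
Proof. by rewrite mulr_sumr; apply: eq_bigr => i _; rewrite /sgrad /=; ring. Qed.

Lemma gen_cst c x : gen (cst_fn n c) x = 0.
Proof.
rewrite /gen /d1 /= big1 => [|i _]; last by rewrite mul0r.
by rewrite big1 ?mul0r ?addr0// => i _; rewrite mulr0.
Qed.

Lemma sg_cst c x i : sgrad (cst_fn n c) x i = 0.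
Proof. by rewrite /sgrad /= mulr0. Qed.

Lemma gam_cst c G x : carre (cst_fn n c) G x = 0.
Proof. by rewrite /carre big1// => i _; rewrite sg_cst mul0r. Qed.

Lemma gen_coord k x : gen (coord_fn R k) x = b x k 0.
Proof.
rewrite /gen /d1 /= (bigD1 k)//= eqxx mul1r big1 => [|i /negbTE ->]; last by rewrite mul0r.
by rewrite big1 ?mul0r ?addr0// => i _; rewrite mulr0.
Qed.

Lemma gam_coord k x : carre (coord_fn R k) (coord_fn R k) x = w k ^+ 2.
Proof.
rewrite /carre (bigD1 k)//= big1 => [|i /negbTE ik]; last by rewrite /sgrad /= ik mulr0 mul0r.
by rewrite /sgrad /= eqxx addr0 mulr1 expr2.
Qed.

Lemma gen_add F G x : gen (add_fn F G) x = gen F x + gen G x.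
Proof.
rewrite /gen /d1 /=; under eq_bigr do rewrite mulrDl.
under [X in _ + X / 2]eq_bigr do rewrite mulrDr.
by rewrite !big_split /=; field.
Qed.

Lemma gen_mul F G x :
  gen (mul_fn F G) x = fv F x * gen G x + fv G x * gen F x + carre F G x.
Proof.
rewrite /gen /carre.
have -> : d1 (mul_fn F G) x (b x) = fv F x * d1 G x (b x) + fv G x * d1 F x (b x).
  by rewrite /d1 !mulr_sumr -big_split; apply: eq_bigr => i _ /=; ring.
have -> : \sum_i w i ^+ 2 * hs (mul_fn F G) x i i = fv F x * (\sum_i w i ^+ 2 * hs G x i i) +
    fv G x * (\sum_i w i ^+ 2 * hs F x i i) + 2 * \sum_i sgrad F x i * sgrad G x i.
  by rewrite !mulr_sumr -!big_split; apply: eq_bigr => i _ /=; rewrite /sgrad; ring.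
by field.
Qed.

Lemma gen_comp (f f1 f2 : R -> R) F x :
  gen (comp_fn f f1 f2 F) x = f1 (fv F x) * gen F x + f2 (fv F x) / 2 * carre F F x.
Proof.
rewrite /gen /carre.
have -> : d1 (comp_fn f f1 f2 F) x (b x) = f1 (fv F x) * d1 F x (b x).
  by rewrite /d1 !mulr_sumr; apply: eq_bigr => i _ /=; ring.
have -> : \sum_i w i ^+ 2 * hs (comp_fn f f1 f2 F) x i i =
    f1 (fv F x) * (\sum_i w i ^+ 2 * hs F x i i) + f2 (fv F x) * \sum_i sgrad F x i * sgrad F x i.
  by rewrite !mulr_sumr -!big_split; apply: eq_bigr => i _ /=; rewrite /sgrad; ring.
by field.
Qed.

Definition n2_fn : fn R n :=
  Fn (fun x => \sum_i x i 0 ^+ 2) (fun x i => 2 * x i 0) (fun x i j => 2 * (i == j)%:R).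

Lemma C2_n2 : C2 n2_fn.
Proof.
split.
- move=> M M0; exists (\sum_(i < n) M ^+ 2); first by rewrite sumr_ge0// => i _; exact: sqr_ge0.
  move=> x xM /=; rewrite ger0_norm; last by rewrite sumr_ge0// => i _; exact: sqr_ge0.
  apply: ler_sum => i _; rewrite -(real_normK (num_real (x i 0))).
  by rewrite lerXn2r ?nnegrE ?(ltW M0)//; exact: le_trans (mxcoord_le _ _) xM.
- move=> i M M0; exists (2 * M); first by rewrite mulr_ge0// ltW.
  by move=> x xM /=; rewrite normrM ger0_norm// ler_wpM2l// (le_trans (mxcoord_le _ _)).
- by move=> i j; exact: loc_bounded_cst.
- apply: (@eq_remo _ _ _ (fun _ _ => 0)); last first.
    by move=> M e M0 e0; exists 1 => // x d _ _; rewrite normr0 mulr_ge0 ?sqr_ge0// ltW.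
  move=> x d; rewrite /rem2 /d1 /d2 /=.
  have -> : \sum_i \sum_j 2 * (i == j)%:R * d i 0 * d j 0 = \sum_i 2 * d i 0 ^+ 2.
    apply: eq_bigr => i _; rewrite (bigD1 i)//= eqxx big1 => [|j /negbTE ji]; last first.
      by rewrite eq_sym ji mulr0 !mul0r.
    by rewrite mulr1 addr0 expr2 mulrA.
  rewrite -mulr_sumr mulrAC divff// mul1r -!sumrB big1// => i _.
  by rewrite !mxE; ring.
Qed.

Lemma gen_n2 x : gen n2_fn x = 2 * (\sum_i x i 0 * b x i 0) + \sum_i w i ^+ 2.
Proof.
rewrite /gen /d1 /= mulr_sumr; congr (_ + _).
  by apply: eq_bigr => i _; rewrite mulrA.
by rewrite mulr_suml; apply: eq_bigr => i _; rewrite eqxx mulr1 mulfK.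
Qed.

(* Weights are the monomials [s^h e^a r^b t^c] in four size functions: [r] will be
   the cube root of the bracket of [x], [e] the size of the coordinates other than
   the [k]-th, [t] and [s] are given by [tE] and [sE]. As [lew] is decidable, most
   dominations are proved by computation. *)
Record weight := Wt { wh : int ; wa : int ; wb : int ; wc : int }.
Definition addw p q := Wt (wh p + wh q) (wa p + wa q) (wb p + wb q) (wc p + wc q).
Definition posi (z : int) : int := if z is Posz k then Posz k else 0.
Definition lew p q : bool :=
  let h := wh p - wh q in let a := wa p - wa q in
  ((wc p - wc q <= 0) && (wb p - wb q + 3 * posi h + 3 * posi (a - posi (- h)) <= 0))%R.

(** * Domination by monomials in the size functions *)

Variables s e r t : V -> R.
Hypothesis e1 : forall x, 1 <= e x.
Hypothesis es : forall x, e x <= s x.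
Hypothesis er : forall x, e x <= r x ^+ 3.
Hypothesis r1 : forall x, 1 <= r x.
Hypothesis t1 : forall x, 1 <= t x.
Hypothesis sr : exists2 C : R, 1 <= C & forall x, s x <= C * r x ^+ 3.

Definition mon p x := s x ^ (wh p) * e x ^ (wa p) * r x ^ (wb p) * t x ^ (wc p).

Let e0 x : 0 < e x. Proof. exact: lt_le_trans (e1 x). Qed.
Let s1 x : 1 <= s x. Proof. exact: le_trans (e1 x) (es x). Qed.
Let s0 x : 0 < s x. Proof. exact: lt_le_trans (s1 x). Qed.
Let r0 x : 0 < r x. Proof. exact: lt_le_trans (r1 x). Qed.
Let t0 x : 0 < t x. Proof. exact: lt_le_trans (t1 x). Qed.

Lemma mon_gt0 p x : 0 < mon p x.
Proof. by rewrite /mon !mulr_gt0 ?exprz_gt0. Qed.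

Lemma monM p q x : mon p x * mon q x = mon (addw p q) x.
Proof. by rewrite /mon /addw /= !expfzDr ?gt_eqF//; ring. Qed.

(** In the quotient, s is replaced by r^3 or by e according to the sign of its exponent, then e by
    r^3 or by 1. As r and t are at least 1, what remains is bounded if their exponents are
    nonpositive, and this is what [lew] tests. *)
Lemma mon_le p q : lew p q -> exists2 C : R, 0 <= C & forall x, mon p x <= C * mon q x.
Proof.
rewrite /lew => /andP[lc lb]; have [C C1 HC] := sr.
have C0 : 0 < C by exact: lt_le_trans C1.
pose h := wh p - wh q; pose a := wa p - wa q; pose b' := wb p - wb q; pose c := wc p - wc q.
suff H : exists2 C : R, 0 <= C & forall x, mon (Wt h a b' c) x <= C.
  have [D D0 HD] := H; exists D => // x.
  have -> : mon p x = mon (Wt h a b' c) x * mon q x.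
    by rewrite monM /addw /= /h /a /b' /c !subrK; case: (p).
  by rewrite ler_wpM2r// ltW// mon_gt0.
have posi0 z : 0 <= posi z by case: z.
have posiE z : z = posi z - posi (- z).
  by case: z => [[|k]|k] //=; rewrite ?subr0 ?sub0r.
have C3 x : 1 <= C * r x ^+ 3 by apply: le_trans (s1 x) _.
exists (C ^ posi h); first by rewrite exprz_ge0// ltW.
move=> x.
have S1 : s x ^ h <= (C * r x ^+ 3) ^ posi h * e x ^ (- posi (- h)).
  rewrite {1}(posiE h) expfzDr ?gt_eqF// ler_pM ?exprz_ge0 ?(ltW (s0 x))//.
    by apply: (ler_wpXz2r (posi0 h)); [rewrite nnegrE ltW|rewrite nnegrE (le_trans ler01)|exact: HC].
  by apply: ler_wnXz2r; rewrite ?oppr_le0 ?posrE ?inE ?s0 ?e0 ?es ?posi0.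
have S2 : e x ^ (a - posi (- h)) <= r x ^ (3 * posi (a - posi (- h))).
  set k := a - _; apply: (@le_trans _ _ (e x ^ posi k)).
    apply: ler_weXz2l => //; rewrite {1}(posiE k) gerBl; exact: posi0.
  rewrite -exprz_exp; apply: ler_wpXz2r; rewrite ?nnegrE ?exprz_ge0 ?(ltW (e0 x)) ?(ltW (r0 x))//; exact: er.
have S3 : t x ^ c <= 1 by rewrite -[leRHS](expr0z (t x)) ler_weXz2l.
have S4 : r x ^ (b' + 3 * posi h + 3 * posi (a - posi (- h))) <= 1.
  by rewrite -[leRHS](expr0z (r x)) ler_weXz2l.
rewrite /mon /=; apply: (@le_trans _ _ (s x ^ h * e x ^ a * r x ^ b')).
  by rewrite ler_piMr// !mulr_ge0 ?exprz_ge0// ltW.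
apply: (@le_trans _ _ ((C * r x ^+ 3) ^ posi h * e x ^ (- posi (- h)) * e x ^ a * r x ^ b')).
  by rewrite !ler_wpM2r ?exprz_ge0// ltW.
rewrite -(mulrA ((C * r x ^+ 3) ^ posi h)) -expfzDr ?gt_eqF// (addrC _ a).
apply: (@le_trans _ _ ((C * r x ^+ 3) ^ posi h * r x ^ (3 * posi (a - posi (- h))) * r x ^ b')).
  by rewrite ler_wpM2r ?exprz_ge0 ?(ltW (r0 x))// ler_wpM2l// exprz_ge0// (le_trans ler01).
rewrite expfzMl -mulrA -mulrA ler_piMr ?exprz_ge0 ?(ltW C0)//.
have -> : (r x ^+ 3) ^ posi h = r x ^ (3 * posi h) by rewrite -exprz_exp.
by rewrite -!expfzDr ?gt_eqF// addrA addrC addrA.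
Qed.

Definition Og (f : V -> R) p := dominated f (mon p).

Lemma Ow f p q : Og f p -> lew p q -> Og f q.
Proof. by move=> Of pq; apply: dominated_le Of; exact: mon_le. Qed.

Lemma OM f g p q u : Og f p -> Og g q -> lew (addw p q) u -> Og (fun x => f x * g x) u.
Proof.
move=> Of Og pq; apply: (Ow _ pq); have [C C0 H] := dominated_mul Of Og.
by exists C => // x; rewrite -monM.
Qed.

Lemma ON f p : Og f p -> Og (fun x => - f x) p.
Proof. exact: dominated_opp. Qed.

Lemma Oc (c : R) : Og (fun=> c) (Wt 0 0 0 0).
Proof. by exists `|c| => // x; rewrite /mon /= !expr0z !mulr1. Qed.

Lemma OZ (c : R) f p : Og f p -> Og (fun x => c * f x) p.
Proof.
move=> [C C0 H]; exists (`|c| * C); first by rewrite mulr_ge0.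
by move=> x; rewrite normrM -mulrA ler_wpM2l.
Qed.

Lemma Osum (I : Type) (l : seq I) (f : I -> V -> R) p :
  (forall i, Og (f i) p) -> Og (fun x => \sum_(i <- l) f i x) p.
Proof. by move=> H; apply: dominated_sum => // x; rewrite ltW// mon_gt0. Qed.

(** Bounds on the value, the generator and the noise gradient: exactly the data that the product and
    chain rules of [gen] propagate. *)
Definition cls F (m g u : weight) := [/\ Og (fv F) m, Og (gen F) g & forall i, Og (fun x => sgrad F x i) u].

Lemma Ogam F G (m g u m' g' u' p : weight) : cls F m g u -> cls G m' g' u' -> lew (addw u u') p ->
  Og (carre F G) p.
Proof. by move=> [_ _ HF] [_ _ HG] l; apply: Osum => i; exact: OM (HF i) (HG i) l. Qed.

Lemma cls_mul F G (m g u m' g' u' p q v : weight) : cls F m g u -> cls G m' g' u' ->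
  [&& lew (addw m m') p, lew (addw m g') q, lew (addw m' g) q, lew (addw u u') q,
      lew (addw m u') v & lew (addw m' u) v] -> cls (mul_fn F G) p q v.
Proof.
move=> cF cG /and5P[l1 l2 l3 l4 /andP[l5 l6]].
have [F1 F2 F3] := cF; have [G1 G2 G3] := cG; split; first exact: OM l1.
  apply: (dominated_eq (gen_mul F G)); apply: dominated_add; last exact: (Ogam cF cG l4).
  by apply: dominated_add; [exact: OM l2|exact: OM l3].
move=> i; apply: (dominated_eq (g := fun x => fv F x * sgrad G x i + fv G x * sgrad F x i)).
  by move=> x; rewrite /sgrad /=; ring.
by apply: dominated_add; [exact: OM l5|exact: OM l6].
Qed.

Lemma cls_comp (f f1 f2 : R -> R) F (m g u p p1 p2 q v : weight) : Og (fun x => f (fv F x)) p ->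
  Og (fun x => f1 (fv F x)) p1 -> Og (fun x => f2 (fv F x)) p2 -> cls F m g u ->
  [&& lew (addw p1 g) q, lew (addw p2 (addw u u)) q & lew (addw p1 u) v] ->
  cls (comp_fn f f1 f2 F) p q v.
Proof.
move=> f0 Of1 Of2 cF /and3P[l1 l2 l3]; have [F1 F2 F3] := cF; split => //.
  apply: (dominated_eq (gen_comp f f1 f2 F)); apply: dominated_add; first exact: OM l1.
  apply: OM (Ogam cF cF (_ : lew (addw u u) _)) l2; last by rewrite /lew !subrr.
  by apply: (dominated_eq (g := fun x => 2^-1 * f2 (fv F x))); [move=> x; rewrite mulrC|exact: OZ].
move=> i; apply: (dominated_eq (g := fun x => f1 (fv F x) * sgrad F x i)); first by move=> x; rewrite /sgrad /=; ring.
exact: OM l3.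
Qed.

Hypothesis rE : forall x, r x = (1 + fv n2_fn x) `^ 6^-1.

Lemma n2_ge0 x : 0 <= fv n2_fn x.
Proof. by apply: sumr_ge0 => i _; exact: sqr_ge0. Qed.

Lemma pw_r (z : int) x : pw (z%:~R / 6) (fv n2_fn x) = r x ^ z.
Proof.
rewrite /pw rE -powR_intmul ?powR_ge0// -powRrM; congr (_ `^ _); exact: mulrC.
Qed.

Lemma r6 x : r x ^+ 6 = 1 + fv n2_fn x.
Proof.
by rewrite -[r x ^+ 6]/(r x ^ (6 : int)) -pw_r divff// /pw powRr1// addr_ge0// n2_ge0.
Qed.

Definition rp_fn (z : int) : fn R n := comp_fn (pw (z%:~R / 6))
  (fun y => z%:~R / 6 * pw (z%:~R / 6 - 1) y)
  (fun y => z%:~R / 6 * ((z%:~R / 6 - 1) * pw (z%:~R / 6 - 1 - 1) y)) n2_fn.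

Lemma rp_val z x : fv (rp_fn z) x = r x ^ z.
Proof. by rewrite /= pw_r. Qed.

Lemma C2_rp z : C2 (rp_fn z).
Proof. apply: (C2_comp (@pw_C2on R _)) C2_n2 => x; exact: n2_ge0. Qed.

Lemma pw_r6 (z : int) x : pw (z%:~R / 6 - 1) (fv n2_fn x) = r x ^ (z - 6).
Proof. by rewrite -pw_r rmorphB /= mulrBl divff. Qed.

Lemma pw_r12 (z : int) x : pw (z%:~R / 6 - 1 - 1) (fv n2_fn x) = r x ^ (z - 6 - 6).
Proof. by rewrite -pw_r !rmorphB /= !mulrBl divff. Qed.

Lemma O_r z : Og (fun x => r x ^ z) (Wt 0 0 z 0).
Proof.
exists 1 => // x; rewrite /mon /= !expr0z !mul1r mulr1 ger0_norm// exprz_ge0//.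
by rewrite ltW.
Qed.

Lemma O_coord3 i : Og (fun x => x i 0) (Wt 0 0 3 0).
Proof.
exists 1 => // x; rewrite /mon /= !expr0z !mul1r mulr1.
rewrite -(ler_pXn2r (n := 2)) ?nnegrE ?exprz_ge0 ?(ltW (r0 x))//.
rewrite real_normK ?num_real// -exprnP -exprM r6 /= (bigD1 i)//=.
have : 0 <= \sum_(j < n | j != i) x j 0 ^+ 2 by apply: sumr_ge0 => j _; exact: sqr_ge0.
lra.
Qed.

Lemma sg_n2 i : Og (fun x => sgrad n2_fn x i) (Wt 0 0 3 0).
Proof.
apply: (dominated_eq (g := fun x => (w i * 2) * x i 0)); first by move=> x; rewrite /sgrad /=; ring.
by apply: OZ; exact: O_coord3.
Qed.

(** Powers of r are slow variables: since the generator of |x|^2 is O(e^2), the generator costs them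
    only a factor e^2 r^-6. *)
Lemma cls_rp z : Og (gen n2_fn) (Wt 0 2 0 0) ->
  cls (rp_fn z) (Wt 0 0 z 0) (Wt 0 2 (z - 6) 0) (Wt 0 0 (z - 3) 0).
Proof.
move=> gn; have cn : cls n2_fn (Wt 0 0 6 0) (Wt 0 2 0 0) (Wt 0 0 3 0).
  split => //; last exact: sg_n2.
  apply: Osum => i; apply: (OM (O_coord3 i) (O_coord3 i)) => //.
apply: (cls_comp (p1 := Wt 0 0 (z - 6) 0) (p2 := Wt 0 0 (z - 6 - 6) 0)) cn _.
- by apply: (dominated_eq (g := fun x => r x ^ z)); [move=> x; exact: pw_r|exact: O_r].
- apply: (dominated_eq (g := fun x => (z%:~R / 6) * r x ^ (z - 6))); first by move=> x; rewrite pw_r6.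
  by apply: OZ; exact: O_r.
- apply: (dominated_eq (g := fun x => (z%:~R / 6) * ((z%:~R / 6 - 1) * r x ^ (z - 6 - 6)))).
    by move=> x; rewrite pw_r12.
  by do 2!apply: OZ; exact: O_r.
- rewrite /lew /addw /=; apply/and3P; split; lia.
Qed.

Lemma Omul f g p q : Og f p -> Og g q -> Og (fun x => f x * g x) (addw p q).
Proof. by move=> Of Og'; apply: OM Of Og' _; rewrite /lew !subrr. Qed.

(** * The large coordinate and its neighbours *)

Variables (A : 'M[R]_n) (k : 'I_n).
Hypothesis bE : forall x i, b x i 0 =
  (x (ordS i) 0 - x (ord_pred (ord_pred i)) 0) * x (ord_pred i) 0 - (A *m x) i 0.
Hypothesis Ak : forall i, A i k = 0.
Hypothesis kA : forall i, A k i = 0.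
Hypothesis eE : forall x, e x ^+ 2 = 1 + \sum_(i < n | i != k) x i 0 ^+ 2.
Hypothesis n6 : (6 <= n)%N.

Local Notation U := (coord_fn R).
(* In the comments, B, l, Y, X, v, s are the coordinates k+1, k, ..., k-4, where [l]
   is the large one. To leading order, dX = (Y - s) v and dY = l X. *)
Let kB := ordS k.
Let kY := ord_pred k.
Let kX := ord_pred kY.
Let kv := ord_pred kX.
Let ks := ord_pred kv.
Let k5 := ord_pred ks.

Lemma iter_pred j (i : 'I_n) : (j <= n)%N -> val (iter j (@ord_pred n) i) = ((i + (n - j)) %% n)%N.
Proof.
elim: j => [|j IH] jn.
  by rewrite subn0 /= modnDr modn_small.
have n0 : (0 < n)%N by apply: leq_trans n6.
rewrite iterS /= (IH (ltnW jn)); have := ltn_pmod (i + (n - j)) n0.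
have -> : (n - j = (n - j.+1).+1)%N by rewrite -subSn// subSS.
rewrite addnS; set m := (i + _)%N.
move=> _; apply/eqP; rewrite -(eqn_modDr 1) !addn1 prednK ?modnDr ?modn_mod//.
by rewrite ltn_addl.
Qed.

Lemma pred_neq j (i : 'I_n) : (0 < j < n)%N -> iter j (@ord_pred n) i != i.
Proof.
move=> /andP[j0 jn]; apply/eqP => /(congr1 val); rewrite iter_pred ?(ltnW jn)//= => H.
have := ltn_ord i; move: {i}(nat_of_ord i) H => i H; have [lt|ge] := ltnP (i + (n - j)) n.
  by move: H; rewrite modn_small//; lia.
have E : (i + (n - j) = (i - j) + n)%N by lia.
by move=> lt; rewrite E modnDr modn_small in H; lia.
Qed.

(** With six sites the coordinates k-1, ..., k-5 all differ from k, hence are bounded by [e]. *)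
Lemma k_neq : [/\ kY != k, kX != k, kv != k, ks != k & k5 != k].
Proof.
by split; [apply: (@pred_neq 1)|apply: (@pred_neq 2)|apply: (@pred_neq 3)|apply: (@pred_neq 4)|apply: (@pred_neq 5)];
  rewrite /=; apply: leq_trans n6.
Qed.

Lemma kB_neq : kB != k.
Proof.
have -> : k = ord_pred kB by rewrite /kB ordSK.
by rewrite eq_sym; apply: (@pred_neq 1); apply: leq_trans n6.
Qed.

Lemma O_e i : i != k -> Og (fun x => x i 0) (Wt 0 1 0 0).
Proof.
move=> ik; exists 1 => // x; rewrite /mon /= !expr0z !mul1r !mulr1.
rewrite -(ler_pXn2r (n := 2)) ?nnegrE ?(ltW (e0 x))//.
rewrite real_normK ?num_real// eE (bigD1 i)//=.
have : 0 <= \sum_(j < n | (j != k) && (j != i)) x j 0 ^+ 2 by apply: sumr_ge0 => j _; exact: sqr_ge0.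
lra.
Qed.

Lemma O_A i : Og (fun x => (A *m x) i 0) (Wt 0 1 0 0).
Proof.
apply: (dominated_eq (g := fun x => \sum_j A i j * x j 0)); first by move=> x; rewrite mxE.
apply: Osum => j; have [->|jk] := eqVneq j k; last by apply: OZ; exact: O_e.
by apply: (dominated_eq (g := fun=> 0)); [move=> x; rewrite Ak mul0r|exact: (Ow (Oc 0))].
Qed.

Lemma Ak0 (x : V) : (A *m x) k 0 = 0.
Proof. by rewrite mxE big1// => j _; rewrite kA mul0r. Qed.

Lemma gen_k x : gen (U k) x = (x kB 0 - x kX 0) * x kY 0.
Proof. by rewrite gen_coord bE Ak0 subr0. Qed.

Lemma gen_Y x : gen (U kY) x = (x k 0 - x kv 0) * x kX 0 - (A *m x) kY 0.
Proof. by rewrite gen_coord bE /kY ord_predK. Qed.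

Lemma gen_X x : gen (U kX) x = (x kY 0 - x ks 0) * x kv 0 - (A *m x) kX 0.
Proof. by rewrite gen_coord bE [in ordS kX]/kX ord_predK. Qed.

Lemma gen_v x : gen (U kv) x = (x kX 0 - x k5 0) * x ks 0 - (A *m x) kv 0.
Proof. by rewrite gen_coord bE [in ordS kv]/kv ord_predK. Qed.

Lemma sg_coord j i : Og (fun x => sgrad (U j) x i) (Wt 0 0 0 0).
Proof.
by apply: (dominated_eq (g := fun=> w i * (i == j)%:R)); [|exact: Oc].
Qed.

(** The cubic terms cancel after a cyclic shift of the indices, and the large coordinate does not
    enter x . A x because row and column k of A vanish. *)
Lemma O_n2 : Og (gen n2_fn) (Wt 0 2 0 0).
Proof.
apply: (dominated_eq (gen_n2)); apply: dominated_add; last by apply: (Ow (Oc _)).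
apply: OZ; apply: (dominated_eq (g := fun x => \sum_i - (x i 0 * (A *m x) i 0))).
  move=> x; under eq_bigr do rewrite bE mulrBr.
  rewrite sumrB -[RHS]add0r sumrN; congr (_ - _).
  under eq_bigr do rewrite mulrBl mulrBr.
  rewrite sumrB; apply/eqP; rewrite subr_eq0; apply/eqP.
  rewrite (reindex_inj (@ord_pred_inj n)) /=; apply: eq_bigr => i _.
  by rewrite ord_predK; ring.
apply: Osum => i; apply: ON; have [->|ik] := eqVneq i k.
  by apply: (dominated_eq (g := fun=> 0)); [move=> x; rewrite Ak0 mulr0|exact: (Ow (Oc 0))].
by apply: (Ow (Omul (O_e ik) (O_A i))).
Qed.

Lemma O_genk : Og (gen (U k)) (Wt 0 2 0 0).
Proof.
have [Y X _ _ _] := k_neq; apply: (dominated_eq gen_k).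
by apply: (Ow (Omul (dominated_add (O_e kB_neq) (dominated_opp (O_e X))) (O_e Y))).
Qed.

Lemma O_genv : Og (gen (U kv)) (Wt 0 2 0 0).
Proof.
have [_ X _ s' k5'] := k_neq; apply: (dominated_eq gen_v); apply: dominated_add.
  by apply: (Ow (Omul (dominated_add (O_e X) (dominated_opp (O_e k5'))) (O_e s'))).
by apply: dominated_opp; by apply: (Ow (O_A _)).
Qed.

Lemma O_genX : Og (gen (U kX)) (Wt 0 2 0 0).
Proof.
have [Y _ v s' _] := k_neq; apply: (dominated_eq gen_X); apply: dominated_add.
  by apply: (Ow (Omul (dominated_add (O_e Y) (dominated_opp (O_e s'))) (O_e v))).
by apply: dominated_opp; by apply: (Ow (O_A _)).
Qed.

Lemma cls_X : cls (U kX) (Wt 0 1 0 0) (Wt 0 2 0 0) (Wt 0 0 0 0).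
Proof. by have [_ X _ _ _] := k_neq; split; [exact: O_e|exact: O_genX|exact: sg_coord]. Qed.

Definition sub_fn F G := add_fn F (mul_fn (cst_fn n (-1)) G).

Lemma gen_sub F G x : gen (sub_fn F G) x = gen F x - gen G x.
Proof. by rewrite gen_add gen_mul gen_cst gam_cst /=; ring. Qed.

Lemma cls_sub F G (m g u : weight) : cls F m g u -> cls G m g u -> cls (sub_fn F G) m g u.
Proof.
move=> [F1 F2 F3] [G1 G2 G3]; split.
- by apply: dominated_eq (dominated_add F1 (dominated_opp G1)) => x /=; ring.
- by apply: dominated_eq (dominated_add F2 (dominated_opp G2)) => x; exact: gen_sub.
- by move=> i; apply: dominated_eq (dominated_add (F3 i) (dominated_opp (G3 i))) => x; rewrite /sgrad /=; ring.
Qed.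

Definition L_fn := mul_fn (sub_fn (U k) (U kv)) (rp_fn (-3)).

Lemma cls_lv : cls (sub_fn (U k) (U kv)) (Wt 0 0 3 0) (Wt 0 2 0 0) (Wt 0 0 0 0).
Proof.
by apply: cls_sub; split; (exact: O_coord3 || exact: O_genk || exact: O_genv || exact: sg_coord).
Qed.

Lemma cls_L : cls L_fn (Wt 0 0 0 0) (Wt 0 2 (-3) 0) (Wt 0 0 (-3) 0).
Proof. by apply: cls_mul cls_lv (cls_rp _ O_n2) _. Qed.

Definition LX_fn := mul_fn L_fn (U kX).

Lemma cls_LX : cls LX_fn (Wt 0 1 0 0) (Wt 0 2 0 0) (Wt 0 0 0 0).
Proof. by apply: cls_mul cls_L cls_X _. Qed.

Definition q_fn := mul_fn (U kY) (rp_fn (-1)).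
Definition N_fn := comp_fn (@atan R) (@datan R) (@ddatan R) q_fn.

Lemma O_bounded (f : V -> R) (C : R) : (forall x, `|f x| <= C) -> Og f (Wt 0 0 0 0).
Proof.
move=> fC; exists `|C| => // x; rewrite /mon /= !expr0z !mulr1.
exact: le_trans (fC x) (ler_norm _).
Qed.

Lemma O_atan f : Og (fun x => atan (f x)) (Wt 0 0 0 0).
Proof.
apply: (@O_bounded _ pi) => x; rewrite ler_norml.
have := atan_gtNpi2 (f x); have := atan_ltpi2 (f x); have := pi_ge0 R; lra.
Qed.

Lemma O_atan1 f : Og (fun x => datan (f x)) (Wt 0 0 0 0).
Proof.
by apply: (@O_bounded _ 1) => x; have /andP[a0 a1] := datan_01 (f x); rewrite ger0_norm ?(ltW a0).
Qed.

Lemma O_atan2 f : Og (fun x => ddatan (f x)) (Wt 0 0 0 0).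
Proof. by apply: (@O_bounded _ 1) => x; exact: ddatan_le. Qed.

Lemma sg_mul F G (m u m' u' v : weight) i : Og (fv F) m -> Og (fv G) m' ->
  Og (fun x => sgrad F x i) u -> Og (fun x => sgrad G x i) u' ->
  lew (addw m u') v && lew (addw m' u) v -> Og (fun x => sgrad (mul_fn F G) x i) v.
Proof.
move=> F1 G1 F2 G2 /andP[l1 l2].
apply: (dominated_eq (g := fun x => fv F x * sgrad G x i + fv G x * sgrad F x i)).
  by move=> x; rewrite /sgrad /=; ring.
by apply: dominated_add; [exact: OM l1|exact: OM l2].
Qed.

Lemma sg_comp (f f1 f2 : R -> R) F (p u : weight) i : Og (fun x => f1 (fv F x)) p -> Og (fun x => sgrad F x i) u ->
  Og (fun x => sgrad (comp_fn f f1 f2 F) x i) (addw p u).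
Proof.
move=> F1 F2; apply: dominated_eq (Omul F1 F2) => x; rewrite /sgrad /=; ring.
Qed.

Lemma sg_q i : Og (fun x => sgrad q_fn x i) (Wt 0 0 (-1) 0).
Proof.
have [Y _ _ _ _] := k_neq; have [r1' r2 r3] := cls_rp (-1) O_n2.
by apply: (@sg_mul (U kY) (rp_fn (-1)) _ _ _ _ _ i (O_e Y) r1' (sg_coord _ i) (r3 i)).
Qed.

Lemma sg_N i : Og (fun x => sgrad N_fn x i) (Wt 0 0 (-1) 0).
Proof. exact: (sg_comp _ _ (O_atan1 _) (sg_q i)). Qed.

(* - (l - v) r^-3 X atan (Y / r): through dY = (l - v) X + ..., differentiating the
   arctangent dissipates [gain2]; all other terms are O(e^2). *)
Definition F2_fn := mul_fn (cst_fn n (-1)) (mul_fn LX_fn N_fn).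

Definition gain2 (x : V) : R := (x k 0 - x kv 0) ^+ 2 * x kX 0 ^+ 2 * datan (x kY 0 * r x ^ (-1)) *
   (r x ^ (-3) * r x ^ (-1)).

Lemma gen_F2 : Og (fun x => gen F2_fn x + gain2 x) (Wt 0 2 0 0).
Proof.
have [Y X v s' k5'] := k_neq; have [L1 L2 L3] := cls_LX; have [r1' r2 r3] := cls_rp (-1) O_n2.
have gq : Og (carre q_fn q_fn) (Wt 0 0 (-2) 0).
  by apply: Osum => i; by apply: (Ow (Omul (sg_q i) (sg_q i))).
have gYr : Og (carre (U kY) (rp_fn (-1))) (Wt 0 0 (-4) 0).
  by apply: Osum => i; by apply: (Ow (Omul (sg_coord _ i) (r3 i))).
have gLN : Og (carre LX_fn N_fn) (Wt 0 0 0 0).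
  by apply: Osum => i; by apply: (Ow (Omul (L3 i) (sg_N i))).
pose q (x : V) : R := x kY 0 * r x ^ (-1).
apply: (dominated_eq (g := fun x => - (fv LX_fn x * datan (q x) *
      (x kY 0 * gen (rp_fn (-1)) x + carre (U kY) (rp_fn (-1)) x - r x ^ (-1) * (A *m x) kY 0) +
    fv LX_fn x * (2^-1 * ddatan (q x)) * carre q_fn q_fn x +
    atan (q x) * gen LX_fn x + carre LX_fn N_fn x))).
  move=> x; rewrite {1}/F2_fn gen_mul gen_cst gam_cst gen_mul [gen N_fn x]gen_comp.
  rewrite [gen q_fn x]gen_mul gen_Y /gain2 [fv (cst_fn _ _) x]/=.
  have -> : fv q_fn x = q x by rewrite /= pw_r.
  have -> : fv N_fn x = atan (q x) by rewrite /q -rp_val.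
  rewrite rp_val.
  have -> : fv LX_fn x = (x k 0 - x kv 0) * r x ^ (-3) * x kX 0.
    by rewrite -[r x ^ (-3)]rp_val /=; ring.
  rewrite [fv (U kY) x]/= -/(q x); move: (gen _ _) (gen _ _) (carre _ _ _) (r x ^ (-3)) (r x ^ (-1)) => a1 a2 a3 a4 a5.
  by field.
apply: dominated_opp; apply: dominated_add; last by apply: (Ow gLN).
apply: dominated_add; last by apply: (Ow (Omul (O_atan _) L2)).
apply: dominated_add; last by apply: (Ow (Omul (Omul L1 (OZ _ (O_atan2 _))) gq)).
apply: (Ow (p := addw (addw (Wt 0 1 0 0) (Wt 0 0 0 0)) (Wt 0 1 0 0))) => //.
apply: Omul; first exact: Omul L1 (O_atan1 _).
apply: dominated_add; last by apply: dominated_opp; by apply: (Ow (Omul (O_r _) (O_A _))).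
apply: dominated_add; last by apply: (Ow gYr).
by apply: (Ow (Omul (O_e Y) r2)).
Qed.

Lemma O_F2 : Og (fv F2_fn) (Wt 0 1 0 0).
Proof.
have [L1 L2 L3] := cls_LX.
apply: dominated_eq (OZ (-1) (Omul L1 (O_atan (fv q_fn)))) => x /=; ring.
Qed.

Lemma sg_F2 i : Og (fun x => sgrad F2_fn x i) (Wt 0 1 0 0).
Proof.
have [L1 L2 L3] := cls_LX.
have H : Og (fun x => sgrad (mul_fn LX_fn N_fn) x i) (Wt 0 1 0 0).
  by apply: (@sg_mul LX_fn N_fn _ _ _ _ _ i L1 (O_atan _) (L3 i) (sg_N i)).
by apply: dominated_eq (dominated_opp H) => x; rewrite /sgrad /=; ring.
Qed.

(* [Wf] compensates the resonant term l X (Y - s) v of d(X^2), up to errors that are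
   affordable where the coordinates counted by [T_fn] are large. *)
Variables (Wf Rf : fn R n).
Hypothesis R0 : forall x, 0 <= fv Rf x.
Hypothesis R1 : Og (fv Rf) (Wt 0 2 0 0).
Hypothesis R2 : Og (gen Rf) (Wt 0 2 2 2).
Hypothesis R3 : forall i, Og (fun x => sgrad Rf x i) (Wt 0 0 2 2).
Hypothesis W0 : Og (fv Wf) (Wt 0 0 3 3).
Hypothesis W1 : Og (fv Wf) (Wt 0 3 0 0).
Hypothesis W2 : Og (fun x => gen Wf x - x k 0 * x kX 0 * (x kY 0 - x ks 0) * x kv 0) (Wt 0 2 2 3).
Hypothesis W3 : forall i, Og (fun x => sgrad Wf x i) (Wt 0 0 2 2).
Hypothesis y1 : Og (fun x => x kY 0 - x ks 0) (Wt 0 0 1 2).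

(** Collects the squares of the quantities that have to be at most of order r for the noise
    argument; t = 1 + T r^-2 is large where one of them is not. *)
Definition T_fn := add_fn (add_fn (mul_fn (U kX) (U kX)) (mul_fn (U kY) (U kY)))
  (add_fn (mul_fn (U kv) (U kv)) Rf).

Hypothesis tE : forall x, t x = 1 + fv T_fn x * r x ^ (-2).
(** The errors of the noise multiplier are O(s^2). After localization they are affordable: e^2
    through [theta_e], and (r X / t)^2 through [key_gain]. *)
Hypothesis sE : forall x, s x = e x + r x * `|x kX 0| / t x.

Lemma O_rt f : (forall x, f x ^+ 2 <= fv T_fn x) -> Og f (Wt 0 0 1 1).
Proof.
move=> fT; exists 1 => // x; rewrite /mon /= !expr0z !mul1r !expr1z tE.
have rx := r0 x; have -> : r x ^ (-2) = (r x * r x)^-1 by rewrite -expr2 exprnN.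
have -> : r x * (1 + fv T_fn x * (r x * r x)^-1) = (r x * r x + fv T_fn x) / r x.
  by field; rewrite gt_eqF.
rewrite ler_pdivlMr//; apply: (@le_trans _ _ (r x * r x + `|f x| ^+ 2)).
  have := sqr_ge0 (r x - `|f x|); have := sqr_ge0 (r x); have := sqr_ge0 `|f x|; lra.
by rewrite lerD2l real_normK ?num_real.
Qed.

Lemma T_ge0 x : 0 <= fv T_fn x.
Proof. by have := R0 x; rewrite /= -!expr2; have := sqr_ge0 (x kX 0); have := sqr_ge0 (x kY 0); have := sqr_ge0 (x kv 0); lra. Qed.

Lemma X_rt : Og (fun x => x kX 0) (Wt 0 0 1 1).
Proof.
apply: O_rt => x /=; have := R0 x; rewrite -!expr2.
by have := sqr_ge0 (x kX 0); have := sqr_ge0 (x kY 0); have := sqr_ge0 (x kv 0); lra.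
Qed.

Lemma Y_rt : Og (fun x => x kY 0) (Wt 0 0 1 1).
Proof.
apply: O_rt => x /=; have := R0 x; rewrite -!expr2.
by have := sqr_ge0 (x kX 0); have := sqr_ge0 (x kY 0); have := sqr_ge0 (x kv 0); lra.
Qed.

Lemma v_rt : Og (fun x => x kv 0) (Wt 0 0 1 1).
Proof.
apply: O_rt => x /=; have := R0 x; rewrite -!expr2.
by have := sqr_ge0 (x kX 0); have := sqr_ge0 (x kY 0); have := sqr_ge0 (x kv 0); lra.
Qed.

Lemma X_s : Og (fun x => x kX 0) (Wt 1 0 (-1) 1).
Proof.
exists 1 => // x; rewrite /mon /= expr0z !mul1r mulr1 !expr1z sE -exprN1.
have -> : (e x + r x * `|x kX 0| / t x) * (r x)^-1 * t x = e x * (r x)^-1 * t x + `|x kX 0|.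
  by field; rewrite !gt_eqF.
by rewrite lerDr !mulr_ge0 ?invr_ge0// ltW.
Qed.

Lemma O_T : Og (fv T_fn) (Wt 0 2 0 0).
Proof.
have [Y X v _ _] := k_neq; apply: dominated_add; apply: dominated_add => //.
- by apply: (Ow (Omul (O_e X) (O_e X))).
- by apply: (Ow (Omul (O_e Y) (O_e Y))).
- by apply: (Ow (Omul (O_e v) (O_e v))).
Qed.

Lemma O_T' : Og (fv T_fn) (Wt 0 0 2 1).
Proof.
exists 1 => // x; rewrite /mon /= !expr0z !mul1r expr1z tE.
rewrite ger0_norm ?T_ge0//; have rx := r0 x.
have -> : r x ^ (2 : int) * (1 + fv T_fn x * r x ^ (-2)) = r x ^ (2 : int) + fv T_fn x * (r x ^ (2 : int) * r x ^ (-2)).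
  by ring.
by rewrite -expfzDr ?gt_eqF// subrr expr0z mulr1 lerDr exprz_ge0// ltW.
Qed.

Lemma gen_sqr F x : gen (mul_fn F F) x = 2 * (fv F x * gen F x) + carre F F x.
Proof. by rewrite gen_mul; ring. Qed.

Lemma sg_sqr F i p : Og (fun x => fv F x * sgrad F x i) p -> Og (fun x => sgrad (mul_fn F F) x i) p.
Proof. by move=> H; apply: dominated_eq (OZ 2 H) => x; rewrite /sgrad /=; ring. Qed.

Lemma O_gam_coord i : Og (carre (U i) (U i)) (Wt 0 0 0 0).
Proof. by apply: (dominated_eq (@gam_coord i)); exact: Oc. Qed.

Lemma gX_rt : Og (gen (U kX)) (Wt 0 1 1 2).
Proof.
have [Y X v _ _] := k_neq; apply: (dominated_eq gen_X); apply: dominated_add.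
  by apply: (Ow (Omul y1 (O_e v))).
by apply: dominated_opp; apply: (Ow (O_A _)).
Qed.

Lemma gX2 : Og (gen (mul_fn (U kX) (U kX))) (Wt 0 2 2 3).
Proof.
apply: (dominated_eq (@gen_sqr _)); apply: dominated_add; last by apply: (Ow (O_gam_coord _)).
by apply: OZ; apply: (Ow (Omul X_rt gX_rt)).
Qed.

(** Y is not slow, as its drift contains l X. Since X = O(s t / r), this costs a factor s in place
    of e, which is why s is among the size functions. *)
Lemma gY2 : Og (gen (mul_fn (U kY) (U kY))) (Wt 2 0 2 1).
Proof.
have [Y X v _ _] := k_neq.
apply: (dominated_eq (@gen_sqr _)); apply: dominated_add; last by apply: (Ow (O_gam_coord _)).
apply: OZ; apply: (Ow (p := addw (Wt 0 1 0 0) (Wt 1 0 2 1))) => //; apply: Omul; first exact: O_e.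
apply: (dominated_eq gen_Y); apply: dominated_add.
  apply: (Ow (p := addw (Wt 0 0 3 0) (Wt 1 0 (-1) 1))) => //; apply: Omul X_s.
  by apply: dominated_add; [exact: O_coord3|apply: dominated_opp; exact: O_coord3].
by apply: dominated_opp; apply: (Ow (O_A _)).
Qed.

Lemma gv2 : Og (gen (mul_fn (U kv) (U kv))) (Wt 0 2 1 1).
Proof.
apply: (dominated_eq (@gen_sqr _)); apply: dominated_add; last by apply: (Ow (O_gam_coord _)).
by apply: OZ; apply: (Ow (Omul v_rt O_genv)).
Qed.

Lemma gT : Og (gen T_fn) (Wt 2 0 2 3).
Proof.
apply: (dominated_eq (g := fun x => (gen (mul_fn (U kX) (U kX)) x + gen (mul_fn (U kY) (U kY)) x) +
   (gen (mul_fn (U kv) (U kv)) x + gen Rf x))); first by move=> x; rewrite !gen_add.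
apply: dominated_add; apply: dominated_add.
- by apply: (Ow gX2).
- by apply: (Ow gY2).
- by apply: (Ow gv2).
- by apply: (Ow R2).
Qed.

Lemma sT i : Og (fun x => sgrad T_fn x i) (Wt 0 0 2 2).
Proof.
apply: (dominated_eq (g := fun x => (sgrad (mul_fn (U kX) (U kX)) x i + sgrad (mul_fn (U kY) (U kY)) x i) +
   (sgrad (mul_fn (U kv) (U kv)) x i + sgrad Rf x i))); first by move=> x; rewrite /sgrad /=; ring.
apply: dominated_add; apply: dominated_add; last exact: R3.
- by apply: sg_sqr; apply: (Ow (Omul X_rt (sg_coord _ _))).
- by apply: sg_sqr; apply: (Ow (Omul Y_rt (sg_coord _ _))).
- by apply: sg_sqr; apply: (Ow (Omul v_rt (sg_coord _ _))).
Qed.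

Definition tau_fn := mul_fn T_fn (rp_fn (-2)).

Lemma tau_val x : fv tau_fn x = t x - 1.
Proof. by rewrite tE -rp_val /tau_fn /=; ring. Qed.

Lemma g_tau : Og (gen tau_fn) (Wt 2 0 0 3).
Proof.
have [r1' r2 r3] := cls_rp (-2) O_n2; apply: (dominated_eq (gen_mul _ _)); apply: dominated_add.
  by apply: dominated_add; [apply: (Ow (Omul O_T' r2))|apply: (Ow (Omul r1' gT))].
by apply: Osum => i; apply: (Ow (Omul (sT i) (r3 i))).
Qed.

Lemma s_tau i : Og (fun x => sgrad tau_fn x i) (Wt 0 0 0 2).
Proof.
have [r1' r2 r3] := cls_rp (-2) O_n2.
by apply: (@sg_mul T_fn (rp_fn (-2)) _ _ _ _ _ i O_T' r1' (sT i) (r3 i)).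
Qed.

Lemma pw_t (z : int) x : pw z%:~R (fv tau_fn x) = t x ^ z.
Proof. by rewrite tau_val /pw subrKC powR_intmul// ltW. Qed.

Lemma O_t z : Og (fun x => t x ^ z) (Wt 0 0 0 z).
Proof.
by exists 1 => // x; rewrite /mon /= !expr0z !mul1r ger0_norm// exprz_ge0// ltW.
Qed.

(** The smooth cutoff t^-6. The exponent is that of t in the carré du champ of [P_fn], the worst
    error in [gen_G]. *)
Definition chi_fn := comp_fn (pw (-6)%:~R) (fun y : R => (-6)%:~R * pw ((-6)%:~R - 1) y)
  (fun y => (-6)%:~R * (((-6)%:~R - 1) * pw ((-6)%:~R - 1 - 1) y)) tau_fn.

Lemma chi_val x : fv chi_fn x = t x ^ (-6).
Proof. exact: pw_t. Qed.

Lemma cls_chi : cls chi_fn (Wt 0 0 0 (-6)) (Wt 2 0 0 (-4)) (Wt 0 0 0 (-5)).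
Proof.
have E1 : (-6)%:~R - 1 = (-7)%:~R :> R by rewrite -[X in _ - X]/(1%:~R : R) -rmorphB.
have E2 : (-6)%:~R - 1 - 1 = (-8)%:~R :> R by rewrite E1 -[X in _ - X]/(1%:~R : R) -rmorphB.
have c0 : Og (fun x => pw (-6)%:~R (fv tau_fn x)) (Wt 0 0 0 (-6)).
  by apply: (dominated_eq (@pw_t _)); exact: O_t.
have c1 : Og (fun x => (-6)%:~R * pw ((-6)%:~R - 1) (fv tau_fn x)) (Wt 0 0 0 (-7)).
  by apply: OZ; rewrite E1; apply: (dominated_eq (@pw_t _)); exact: O_t.
have c2 : Og (fun x => (-6)%:~R * (((-6)%:~R - 1) * pw ((-6)%:~R - 1 - 1) (fv tau_fn x))) (Wt 0 0 0 (-8)).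
  by do 2!apply: OZ; rewrite E2; apply: (dominated_eq (@pw_t _)); exact: O_t.
split => //.
  apply: (dominated_eq (gen_comp _ _ _ _)); apply: dominated_add.
    by apply: (Ow (Omul c1 g_tau)).
  apply: (Ow (p := addw (Wt 0 0 0 (-8)) (Wt 0 0 0 4))) => //; apply: Omul.
    by apply: dominated_eq (OZ 2^-1 c2) => x; rewrite mulrC.
  by apply: Osum => i; apply: (Ow (Omul (s_tau i) (s_tau i))).
by move=> i; apply: (Ow (sg_comp _ _ c1 (s_tau i))).
Qed.

Definition lr_fn := mul_fn (U k) (rp_fn (-5)).

Lemma cls_lr : cls lr_fn (Wt 0 0 (-2) 0) (Wt 0 2 (-5) 0) (Wt 0 0 (-5) 0).
Proof.
have lk : cls (U k) (Wt 0 0 3 0) (Wt 0 2 0 0) (Wt 0 0 0 0).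
  by split; [exact: O_coord3|exact: O_genk|exact: sg_coord].
by apply: cls_mul lk (cls_rp _ O_n2) _.
Qed.

Definition X2_fn := mul_fn (U kX) (U kX).
(** The factor l r^-5 stands for r / l but is not singular at l = 0. As 1 - l^2 r^-6 = e^2 r^-6, the
    resonant drift 2 r X (Y - s) v cancels up to this small factor. *)
Definition P_fn := add_fn (mul_fn (rp_fn 1) X2_fn) (mul_fn (cst_fn n (-2)) (mul_fn lr_fn Wf)).

Lemma sX2 i : Og (fun x => sgrad X2_fn x i) (Wt 0 0 1 1).
Proof. by apply: sg_sqr; apply: (Ow (Omul X_rt (sg_coord _ _))). Qed.

Lemma sP i : Og (fun x => sgrad P_fn x i) (Wt 1 0 0 3).
Proof.
have [l1 l2 l3] := cls_lr; have [r1' r2 r3] := cls_rp 1 O_n2.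
apply: (dominated_eq (g := fun x => (r x * (2 * (x kX 0 * sgrad (U kX) x i)) + x kX 0 * x kX 0 * sgrad (rp_fn 1) x i) +
    - 2 * (fv lr_fn x * sgrad Wf x i + fv Wf x * sgrad lr_fn x i))).
  by move=> x; rewrite -[r x in RHS]expr1z -rp_val /sgrad /=; ring.
apply: dominated_add; last first.
  by apply: OZ; apply: dominated_add; [apply: (Ow (Omul l1 (W3 i)))|apply: (Ow (Omul W0 (l3 i)))].
apply: dominated_add; last by apply: (Ow (Omul (Omul X_rt X_rt) (r3 i))).
by apply: (Ow (Omul (O_r 1) (OZ 2 (Omul X_s (sg_coord kX i))))).
Qed.

Lemma gP : Og (fun x => gen P_fn x - r x * w kX ^+ 2) (Wt 2 0 0 4).
Proof.
have [Y X v s' k5'] := k_neq.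
have [l1 l2 l3] := cls_lr; have [r1' r2 r3] := cls_rp 1 O_n2.
pose y (x : V) : R := x kY 0 - x ks 0.
apply: (dominated_eq (g := fun x => 2 * (r x * x kX 0 * y x * x kv 0 * (e x ^+ 2 * r x ^ (-6))) -
    2 * (r x ^ 1 * x kX 0 * (A *m x) kX 0) + x kX 0 * x kX 0 * gen (rp_fn 1) x +
    carre (rp_fn 1) X2_fn x - 2 * (fv lr_fn x * (gen Wf x - x k 0 * x kX 0 * y x * x kv 0) +
    fv Wf x * gen lr_fn x + carre lr_fn Wf x))).
  move=> x; rewrite gen_add gen_mul [gen (mul_fn (cst_fn _ _) _) x]gen_mul gen_cst gam_cst gen_mul.
  rewrite [gen X2_fn x]gen_sqr gen_X gam_coord rp_val.
  rewrite [fv (cst_fn _ _) x]/= [fv X2_fn x]/= [fv (U kX) x]/= -/(y x).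
  have E : e x ^+ 2 = r x ^+ 6 - x k 0 ^+ 2.
    by rewrite r6 eE /= [in RHS](bigD1 k)//=; ring.
  have E2 : e x ^+ 2 * r x ^ (-6) = 1 - x k 0 ^+ 2 * r x ^ (-6).
    by rewrite E mulrBl -exprnN mulfV ?expf_neq0// gt_eqF.
  rewrite E2; have -> : fv lr_fn x = x k 0 * r x ^ (-5) by rewrite -[r x ^ _]rp_val.
  have -> : r x ^ (-5) = r x * r x ^ (-6).
    by rewrite -{2}[r x]expr1z -expfzDr// gt_eqF.
  rewrite expr1z; move: (gen _ _) (gen _ _) (gen _ _) (carre _ _ _) (carre _ _ _) (r x ^ (-6)) => a1 a2 a3 a4 a5 a6.
  ring.
apply: dominated_add; last first.
  apply: dominated_opp; apply: OZ; apply: dominated_add; last by apply: Osum => i; apply: (Ow (Omul (l3 i) (W3 i))).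
  by apply: dominated_add; [apply: (Ow (Omul l1 W2))|apply: (Ow (Omul W0 l2))].
apply: dominated_add; last by apply: Osum => i; apply: (Ow (Omul (r3 i) (sX2 i))).
apply: dominated_add; last by apply: (Ow (Omul (Omul X_rt X_rt) r2)).
apply: dominated_add; last by apply: dominated_opp; apply: OZ; apply: (Ow (Omul (Omul (O_r 1) X_s) (O_A _))).
have O_r1 : Og r (Wt 0 0 1 0) by apply: dominated_eq (O_r 1) => x; rewrite expr1z.
have O_e2 : Og (fun x => e x ^+ 2) (Wt 0 2 0 0).
  by exists 1 => // x; rewrite /mon /= !expr0z !mul1r !mulr1 ger0_norm// sqr_ge0.
by apply: OZ; apply: (Ow (Omul (Omul (Omul (Omul O_r1 X_rt) y1) v_rt) (Omul O_e2 (O_r _)))).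
Qed.

(** The arctangent makes the multiplier bounded. In the region of [gain_lb], P differs from r X^2 by
    a bounded amount: its derivative [datan] stays away from 0 unless r X^2 is large, and then
    [gain2] takes over. *)
Definition NP_fn := comp_fn (@atan R) (@datan R) (@ddatan R) P_fn.
(* The dissipation [gainG] is the Ito correction in the generator of r X^2: it comes
   from the noise acting on X. *)
Definition G_fn := mul_fn (cst_fn n (-1)) (mul_fn chi_fn NP_fn).

Definition gainG (x : V) : R := t x ^ (-6) * datan (fv P_fn x) * (r x * w kX ^+ 2).

Lemma gen_G : Og (fun x => gen G_fn x + gainG x) (Wt 2 0 0 0).
Proof.
have [c1 c2 c3] := cls_chi.
apply: (dominated_eq (g := fun x => - (t x ^ (-6) * datan (fv P_fn x) * (gen P_fn x - r x * w kX ^+ 2) +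
   t x ^ (-6) * (2^-1 * ddatan (fv P_fn x)) * carre P_fn P_fn x +
   atan (fv P_fn x) * gen chi_fn x + carre chi_fn NP_fn x))).
  move=> x; rewrite gen_mul gen_cst gam_cst gen_mul [gen NP_fn x]gen_comp chi_val.
  rewrite [fv (cst_fn _ _) x]/= /gainG; have -> : fv NP_fn x = atan (fv P_fn x) by [].
  move: (fv P_fn x) (gen _ _) (gen _ _) (carre _ _ _) (carre _ _ _) (t x ^ (-6)) => p a1 a2 a3 a4 a5.
  by field.
apply: dominated_opp; apply: dominated_add; last first.
  by apply: Osum => i; apply: (Ow (Omul (c3 i) (sg_comp _ _ (O_atan1 _) (sP i)))).
apply: dominated_add; last by apply: (Ow (Omul (O_atan _) c2)).
apply: dominated_add; first by apply: (Ow (Omul (Omul (O_t _) (O_atan1 _)) gP)).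
have gPP : Og (carre P_fn P_fn) (Wt 2 0 0 6) by apply: Osum => i; apply: (Ow (Omul (sP i) (sP i))).
by apply: (Ow (Omul (Omul (O_t _) (OZ _ (O_atan2 _))) gPP)).
Qed.

Lemma O_G : Og (fv G_fn) (Wt 0 0 0 0).
Proof.
have [c1 c2 c3] := cls_chi.
have H : Og (fun x => fv chi_fn x * atan (fv P_fn x)) (Wt 0 0 0 0).
  by apply: (Ow (Omul c1 (O_atan _))).
by apply: dominated_eq (OZ (-1) H).
Qed.

Lemma sG i : Og (fun x => sgrad G_fn x i) (Wt 1 0 0 0).
Proof.
have [c1 c2 c3] := cls_chi.
have H : Og (fun x => sgrad (mul_fn chi_fn NP_fn) x i) (Wt 1 0 0 0).
  by apply: (@sg_mul chi_fn NP_fn _ _ _ _ _ i c1 (O_atan _) (c3 i) (sg_comp _ _ (O_atan1 _) (sP i))).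
by apply: dominated_eq (dominated_opp H) => x; rewrite /sgrad /=; ring.
Qed.

(** * Localization to the region where the k-th coordinate dominates *)

Variable k' : 'I_n.
Hypothesis Ak' : forall i, A i k' = 0.
Hypothesis kA' : forall i, A k' i = 0.
Hypothesis kk' : k' != k.
Hypothesis Xk' : kX != k'.
(** The other undamped coordinate is the predecessor Y of k when k is the second coordinate, and its
    successor B when k is the first. *)
Hypothesis YBk' : (k' = kY /\ kB != k') \/ (k' = kB /\ kY != k').

(** What the first two terms of the Lyapunov function dissipate: the damped coordinates and (u_1
    u_2)^2 / <u>^2, since r^6 = <u>^2. The square root [dd] allows products to be bounded factor by
    factor. *)
Definition Dp (x : V) : R :=
  1 + \sum_(i < n | (i != k) && (i != k')) x i 0 ^+ 2 + (x k 0 * x k' 0) ^+ 2 * r x ^ (-6).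
Definition dd (x : V) : R := Num.sqrt (Dp x).

Lemma Dp_ge1 x : 1 <= Dp x.
Proof.
rewrite /Dp -addrA lerDl addr_ge0//; first by apply: sumr_ge0 => i _; exact: sqr_ge0.
by rewrite mulr_ge0 ?sqr_ge0 ?exprz_ge0// ltW.
Qed.

Lemma dd2 x : dd x * dd x = Dp x.
Proof. by rewrite -expr2 sqr_sqrtr// (le_trans ler01)// Dp_ge1. Qed.

Lemma dd_ge1 x : 1 <= dd x.
Proof. by rewrite -[leLHS]sqrtr1 ler_wsqrtr// Dp_ge1. Qed.

Lemma dd_bound f x : f x ^+ 2 <= Dp x -> `|f x| <= dd x.
Proof. by move=> H; rewrite -sqrtr_sqr ler_wsqrtr. Qed.

Lemma dominated_d i : i != k -> i != k' -> dominated (fun x => x i 0) dd.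
Proof.
move=> ik ik'; exists 1 => // x; rewrite mul1r; apply: (@dd_bound (fun x => x i 0)).
rewrite /Dp (bigD1 i) ?ik//= -!addrA addrCA lerDl.
have H1 : 0 <= \sum_(j < n | (j != k) && (j != k') && (j != i)) x j 0 ^+ 2.
  by apply: sumr_ge0 => j _; exact: sqr_ge0.
have H2 : 0 <= (x k 0 * x k' 0) ^+ 2 * r x ^ (-6) by rewrite mulr_ge0 ?sqr_ge0 ?exprz_ge0// ltW.
by rewrite !addr_ge0.
Qed.

Lemma r_inv x z : r x ^ z * r x ^ (- z) = 1.
Proof. by rewrite -expfzDr ?gt_eqF// subrr expr0z. Qed.

Lemma dominated_kk : dominated (fun x => x k 0 * x k' 0) (fun x => dd x * r x ^ (3 : int)).
Proof.
exists 1 => // x; rewrite mul1r -ler_pdivrMr ?exprz_gt0//.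
have -> : `|x k 0 * x k' 0| / r x ^ (3 : int) = `|x k 0 * x k' 0 / r x ^ (3 : int)|.
  by rewrite [RHS]normrM normfV (ger0_norm (exprz_ge0 _ (ltW (r0 x)))).
apply: (@dd_bound (fun x => x k 0 * x k' 0 / r x ^ (3 : int))).
have -> : (x k 0 * x k' 0 / r x ^ (3 : int)) ^+ 2 = (x k 0 * x k' 0) ^+ 2 * r x ^ (-6).
  by rewrite expr_div_n; congr (_ * _); rewrite exprnP exprz_exp invr_expz.
rewrite /Dp lerDr addr_ge0//; apply: sumr_ge0 => i _; exact: sqr_ge0.
Qed.

Lemma dominated_1d f : dominated f (fun=> 1) -> dominated f (fun x => dd x * dd x).
Proof. by apply: dominated_le; exists 1 => // x; rewrite mul1r dd2 Dp_ge1. Qed.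

Lemma Dp_n2 : dominated (gen n2_fn) (fun x => dd x * dd x).
Proof.
apply: (dominated_eq (gen_n2)); apply: dominated_add; last first.
  by apply: dominated_1d; exists `|\sum_(i < n) w i ^+ 2| => // x; rewrite mulr1.
have zero : dominated (fun=> 0) (fun x => dd x * dd x).
  by exists 0 => // x; rewrite normr0 mul0r.
have zero' : dominated (fun=> 0) dd by exists 0 => // x; rewrite normr0 mul0r.
have bA i : dominated (fun x => (A *m x) i 0) dd.
  apply: (dominated_eq (g := fun x => \sum_j A i j * x j 0)); first by move=> x; rewrite mxE.
  apply: dominated_sum => [x|j]; first by rewrite (le_trans ler01)// dd_ge1.
  have [->|jk] := eqVneq j k; first by apply: dominated_eq zero' => x; rewrite Ak mul0r.
  have [->|jk'] := eqVneq j k'; first by apply: dominated_eq zero' => x; rewrite Ak' mul0r.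
  have [C C0 H] := dominated_d jk jk'; exists (`|A i j| * C); first by rewrite mulr_ge0.
  by move=> x; rewrite normrM -mulrA ler_wpM2l.
have H : dominated (fun x => \sum_i - (x i 0 * (A *m x) i 0)) (fun x => dd x * dd x).
  apply: dominated_sum => [x|i]; first by rewrite dd2 (le_trans ler01)// Dp_ge1.
  apply: dominated_opp; have [->|ik] := eqVneq i k.
    by apply: dominated_eq zero => x; rewrite Ak0 mulr0.
  have [->|ik'] := eqVneq i k'; last exact: dominated_mul (dominated_d ik ik') (bA i).
  by apply: dominated_eq zero => x; rewrite mxE big1 ?mulr0// => j _; rewrite kA' mul0r.
have [C C0 HC] := H; exists (2 * C); first by rewrite mulr_ge0.
move=> x; rewrite normrM ger0_norm// -mulrA ler_wpM2l//; apply: le_trans (HC x).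
under eq_bigr do rewrite bE mulrBr.
rewrite sumrB sumrN (_ : \sum_i _ = 0) ?sub0r//.
under eq_bigr do rewrite mulrBl mulrBr.
rewrite sumrB; apply/eqP; rewrite subr_eq0; apply/eqP.
rewrite (reindex_inj (@ord_pred_inj n)) /=; apply: eq_bigr => i _.
by rewrite ord_predK; ring.
Qed.

Definition theta_fn := mul_fn (mul_fn (U k) (U k)) (rp_fn (-6)).

Lemma theta_val x : fv theta_fn x = x k 0 ^+ 2 * r x ^ (-6).
Proof. by rewrite -rp_val /theta_fn /= expr2. Qed.

Lemma theta01 x : 0 <= fv theta_fn x <= 1.
Proof.
rewrite theta_val mulr_ge0 ?sqr_ge0 ?exprz_ge0 ?(ltW (r0 x))//=.
have -> : 1 = r x ^ (6 : int) * r x ^ (-6) by rewrite r_inv.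
rewrite ler_wpM2r ?exprz_ge0 ?(ltW (r0 x))// -[r x ^ (6 : int)]/(r x ^+ 6) r6 /= (bigD1 k)//=.
have : 0 <= \sum_(i < n | i != k) x i 0 ^+ 2 by apply: sumr_ge0 => i _; exact: sqr_ge0.
lra.
Qed.

Lemma O_theta : Og (fv theta_fn) (Wt 0 0 0 0).
Proof. by apply: (@O_bounded _ 1) => x; have /andP[a0 a1] := theta01 x; rewrite ger0_norm. Qed.

Lemma s_theta i : Og (fun x => sgrad theta_fn x i) (Wt 0 0 (-3) 0).
Proof.
have [r1' r2 r3] := cls_rp (-6) O_n2.
have l2 : Og (fun x => sgrad (mul_fn (U k) (U k)) x i) (Wt 0 0 3 0).
  by apply: sg_sqr; apply: (Ow (Omul (O_coord3 k) (sg_coord k i))).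
by apply: (@sg_mul (mul_fn (U k) (U k)) (rp_fn (-6)) _ _ _ _ _ i (Omul (O_coord3 k) (O_coord3 k)) r1' l2 (r3 i)).
Qed.

(** e^2 contains the square of the undamped coordinate k', but theta times it is (x_k x_k')^2 r^-6,
    a part of [Dp]. This is the reason for localizing with [theta_fn]. *)
Lemma theta_e x : fv theta_fn x * e x ^+ 2 <= Dp x.
Proof.
have /andP[a0 a1] := theta01 x.
have -> : e x ^+ 2 = (1 + \sum_(i < n | (i != k) && (i != k')) x i 0 ^+ 2) + x k' 0 ^+ 2.
  by rewrite eE (bigD1 k')//= addrCA addrC.
rewrite mulrDr; apply: lerD.
  by rewrite ler_piMl// addr_ge0// sumr_ge0// => i _; exact: sqr_ge0.
by rewrite theta_val exprMn mulrAC.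
Qed.

Lemma O_bo f m p : Og f p -> (exists2 C : R, 0 <= C & forall x, mon p x <= C * m x) -> dominated f m.
Proof. by move=> H1 H2; exact: dominated_le H2 H1. Qed.

Lemma O_Dr f : Og f (Wt 0 0 (-3) 0) -> dominated f (fun x => dd x * dd x * r x ^ (-3)).
Proof.
move=> H; apply: (O_bo H); exists 1 => // x; rewrite mul1r /mon /= !expr0z !mul1r mulr1.
by rewrite ler_peMl ?exprz_ge0 ?(ltW (r0 x))// dd2 Dp_ge1.
Qed.

Lemma O_D1 f : Og f (Wt 0 0 0 0) -> dominated f (fun x => dd x * dd x).
Proof.
move=> H; apply: (O_bo H); exists 1 => // x; rewrite mul1r /mon /= !expr0z !mulr1.
by rewrite dd2 Dp_ge1.
Qed.

Lemma g_theta : dominated (gen theta_fn) (fun x => dd x * dd x * r x ^ (-3)).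
Proof.
have [Y X v s' k5'] := k_neq; have [r1' r2 r3] := cls_rp (-6) O_n2.
have D0 x : 0 <= dd x * dd x by rewrite dd2 (le_trans ler01)// Dp_ge1.
apply: (dominated_eq (gen_mul _ _)); apply: dominated_add; last first.
  apply: O_Dr; apply: Osum => i; apply: (Ow (p := addw (Wt 0 0 3 0) (Wt 0 0 (-9) 0))) => //.
  apply: Omul (r3 i); apply: sg_sqr; by apply: (Ow (Omul (O_coord3 k) (sg_coord k i))).
(* The drift (B - X) Y of l, multiplied by l, contains the product l x_k', which is controlled by
   [Dp]; which of the factors Y and B is x_k' decides between the two cases. *)
have K : dominated (fun x => x k 0 * gen (U k) x) (fun x => dd x * dd x * r x ^ (3 : int)).
  case: YBk' => -[E E'].
    apply: (dominated_eq (g := fun x => (x k 0 * x k' 0) * (x kB 0 - x kX 0))).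
      by move=> x; rewrite gen_k E; ring.
    apply: dominated_le (dominated_mul dominated_kk (dominated_add (dominated_d kB_neq E') (dominated_opp (dominated_d X Xk')))).
    by exists 1 => // x; rewrite mul1r mulrAC.
  apply: (dominated_eq (g := fun x => (x k 0 * x k' 0) * x kY 0 + - (x k 0 * (x kX 0 * x kY 0)))).
    by move=> x; rewrite gen_k E; ring.
  apply: dominated_add.
    apply: dominated_le (dominated_mul dominated_kk (dominated_d Y E')).
    by exists 1 => // x; rewrite mul1r mulrAC.
  apply: dominated_opp; have k3 : dominated (fun x => x k 0) (fun x => r x ^ (3 : int)).
    by apply: (O_bo (O_coord3 k)); exists 1 => // x; rewrite mul1r /mon /= !expr0z !mul1r mulr1.
  apply: dominated_le (dominated_mul k3 (dominated_mul (dominated_d X Xk') (dominated_d Y E'))).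
  by exists 1 => // x; rewrite mul1r mulrC.
have Or3 f : Og f (Wt 0 0 (-3) 0) -> dominated f (fun x => r x ^ (-3)).
  by move=> H; apply: (O_bo H); exists 1 => // x; rewrite mul1r /mon /= !expr0z !mul1r mulr1.
have gn2 : Og (carre n2_fn n2_fn) (Wt 0 0 6 0).
  by apply: Osum => i; exact: Omul (sg_n2 i) (sg_n2 i).
pose c := (-6)%:~R / 6 : R.
apply: dominated_add.
  apply: (dominated_eq (g := fun x => (x k 0 * x k 0 * (c * r x ^ (-6 - 6))) * gen n2_fn x +
    x k 0 * x k 0 * (c * ((c - 1) * r x ^ (-6 - 6 - 6)) / 2) * carre n2_fn n2_fn x)).
    by move=> x; rewrite gen_comp pw_r6 pw_r12 -/c /=; ring.
  apply: dominated_add.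
    apply: dominated_le (dominated_mul (Or3 _ (_ : Og _ (Wt 0 0 (-3) 0))) Dp_n2).
      by exists 1 => // x; rewrite mul1r mulrC.
    by apply: (Ow (Omul (Omul (O_coord3 k) (O_coord3 k)) (OZ _ (O_r _)))).
  apply: O_Dr; apply: (Ow (p := addw (addw (addw (Wt 0 0 3 0) (Wt 0 0 3 0)) (Wt 0 0 (-18) 0)) (Wt 0 0 6 0))) => //.
  apply: Omul gn2; apply: Omul; first exact: Omul (O_coord3 k) (O_coord3 k).
  by apply: (dominated_eq (g := fun x => (c * (c - 1) / 2) * r x ^ (-6 - 6 - 6))); [move=> x; ring|apply: OZ; exact: O_r].
apply: (dominated_eq (g := fun x => r x ^ (-6) * (2 * (x k 0 * gen (U k) x)) + r x ^ (-6) * w k ^+ 2)).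
  by move=> x; rewrite gen_sqr gam_coord rp_val; rewrite [fv (U k) x]/=; ring.
apply: dominated_add; last by apply: O_Dr; apply: (Ow (Omul (O_r _) (Oc _))).
have [C C0 H] := K; exists (2 * C); first by rewrite mulr_ge0.
move=> x; rewrite normrM (ger0_norm (exprz_ge0 _ (ltW (r0 x)))) normrM ger0_norm//.
have -> : 2 * C * (dd x * dd x * r x ^ (-3)) = r x ^ (-6) * (2 * (C * (dd x * dd x * r x ^ (3 : int)))).
  have -> : r x ^ (-3) = r x ^ (-6) * r x ^ (3 : int) by rewrite -expfzDr ?gt_eqF.
  by ring.
by rewrite ler_wpM2l ?exprz_ge0 ?(ltW (r0 x))// ler_wpM2l.
Qed.

Definition gain (x : V) : R :=
  fv theta_fn x ^+ 2 * (gainG x + (r x * x kX 0) ^+ 2 * t x ^ (-2)).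

Lemma s2_le x : s x ^+ 2 <= 2 * e x ^+ 2 + 2 * ((r x * x kX 0) ^+ 2 * t x ^ (-2)).
Proof.
have -> : (r x * x kX 0) ^+ 2 * t x ^ (-2) = (r x * `|x kX 0| / t x) ^+ 2.
  by rewrite expr_div_n [in RHS]exprMn (real_normK (num_real _)) -exprMn exprnN.
rewrite sE; move: (e x) (_ / _) => a b'; have := sqr_ge0 (a - b').
by rewrite sqrrB sqrrD; move: (a ^+ 2) (b' ^+ 2) (a * b') => *; lra.
Qed.

Lemma T_ge (x : V) : [/\ x kX 0 ^+ 2 <= fv T_fn x, x kY 0 ^+ 2 <= fv T_fn x & x kv 0 ^+ 2 <= fv T_fn x].
Proof.
rewrite /= -!expr2; have := R0 x.
by have := sqr_ge0 (x kX 0); have := sqr_ge0 (x kY 0); have := sqr_ge0 (x kv 0); split; lra.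
Qed.

(** One factor theta turns (r X)^2 into l^2 X^2 r^-4, the other one is the localization of [F2_fn].
    As t >= 1 + (Y / r)^2, the factor [datan] in [gain2] is at least 1 / t. If l^2 > 4 (l - v)^2,
    then l^2 <= 4 v^2; now v^2 r^-2 <= t, and the left side is at most 4 X^2, a part of 4 [Dp]. *)
Lemma key_gain x : fv theta_fn x ^+ 2 * ((r x * x kX 0) ^+ 2 * t x ^ (-2)) <=
  4 * (fv theta_fn x * gain2 x) + 4 * Dp x.
Proof.
have /andP[th0 th1] := theta01 x; have [Y X v s' k5'] := k_neq.
have X2 : x kX 0 ^+ 2 <= Dp x.
  rewrite /Dp (bigD1 kX) ?X//= -!addrA addrCA lerDl !addr_ge0//.
    by apply: sumr_ge0 => j _; exact: sqr_ge0.
  by rewrite mulr_ge0 ?sqr_ge0 ?exprz_ge0// ltW.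
have [i i0 [ri E]] : exists2 i : R, 0 < i & r x * i = 1 /\ forall z : nat, r x ^ (- z%:Z) = i ^+ z.
  exists (r x)^-1; first by rewrite invr_gt0.
  split; first by rewrite mulfV// gt_eqF.
  by move=> z; rewrite -exprnN exprVn.
have [j j0 [tj Ej]] : exists2 j : R, 0 < j & t x * j = 1 /\ t x ^ (-2) = j ^+ 2.
  exists (t x)^-1; first by rewrite invr_gt0.
  by split; [rewrite mulfV// gt_eqF|rewrite -exprnN exprVn].
have j1 : j <= 1 by rewrite -tj ler_peMl// ltW.
have tT : t x = 1 + fv T_fn x * i ^+ 2 by rewrite tE (E 2%N).
have i1 : i <= 1 by rewrite -ri ler_peMl// ltW.
have vt : x kv 0 ^+ 2 * i ^+ 2 * j <= 1.
  rewrite -tj ler_wpM2r ?(ltW j0)// tT; apply: (@le_trans _ _ (fv T_fn x * i ^+ 2)); last by rewrite lerDr.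
  by rewrite ler_wpM2r ?sqr_ge0//; have [] := T_ge x.
have dj : j <= datan (x kY 0 * i ^+ 1).
  rewrite /datan expr1 -[leRHS]mul1r ler_pdivlMr ?oneDsqr_gt0//.
  rewrite -[leRHS]tj [leLHS]mulrC ler_wpM2r ?(ltW j0)// tT lerD2l exprMn ler_wpM2r ?sqr_ge0//.
  by have [] := T_ge x.
rewrite /gain2 Ej (E 3%N) (E 1%N).
have -> : fv theta_fn x ^+ 2 * ((r x * x kX 0) ^+ 2 * j ^+ 2) =
    fv theta_fn x * (x k 0 ^+ 2 * i ^+ 4 * x kX 0 ^+ 2 * j ^+ 2).
  have -> : x k 0 ^+ 2 * i ^+ 4 * x kX 0 ^+ 2 * j ^+ 2 =
     x k 0 ^+ 2 * i ^+ 6 * (r x * x kX 0) ^+ 2 * j ^+ 2.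
    rewrite -[LHS]mulr1 -[X in _ * X](expr1n _ 2) -ri; ring.
  by rewrite theta_val (E 6%N); ring.
have j2 : j ^+ 2 <= j by rewrite expr2 ler_piMl// ltW.
move: (datan _) dj => a dj; move: (fv theta_fn x) th0 th1 => th th0 th1.
have Xi0 : 0 <= i ^+ 4 * x kX 0 ^+ 2 by rewrite mulr_ge0 ?sqr_ge0// exprn_ge0// ltW.
have [lv|lv] := leP (x k 0 ^+ 2) (4 * (x k 0 - x kv 0) ^+ 2).
  rewrite -[leLHS]addr0; apply: lerD; last by rewrite mulr_ge0// (le_trans ler01)// Dp_ge1.
  rewrite [leRHS]mulrCA ler_wpM2l//.
  have -> : x k 0 ^+ 2 * i ^+ 4 * x kX 0 ^+ 2 * j ^+ 2 = (i ^+ 4 * x kX 0 ^+ 2) * (x k 0 ^+ 2 * j ^+ 2) by ring.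
  have -> : 4 * ((x k 0 - x kv 0) ^+ 2 * x kX 0 ^+ 2 * a * (i ^+ 3 * i ^+ 1)) =
     (i ^+ 4 * x kX 0 ^+ 2) * ((4 * (x k 0 - x kv 0) ^+ 2) * a) by ring.
  by rewrite ler_wpM2l// ler_pM ?sqr_ge0//; exact: le_trans j2 dj.
have l4 : x k 0 ^+ 2 <= 4 * x kv 0 ^+ 2.
  exact: sqr_le_near lv.
have a0 : 0 <= a by exact: le_trans (ltW j0) dj.
rewrite -[leLHS]add0r; apply: lerD.
  apply: mulr_ge0 => //; apply: mulr_ge0 => //; apply: mulr_ge0; last first.
    by apply: mulr_ge0; apply: exprn_ge0; exact: ltW.
  by apply: mulr_ge0 => //; apply: mulr_ge0; exact: sqr_ge0.
apply: (@le_trans _ _ (x k 0 ^+ 2 * i ^+ 4 * x kX 0 ^+ 2 * j ^+ 2)).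
  rewrite ler_piMl// -(mulrA (x k 0 ^+ 2)).
  by apply: mulr_ge0; [apply: mulr_ge0 => //; exact: sqr_ge0|exact: sqr_ge0].
apply: (@le_trans _ _ (4 * x kX 0 ^+ 2)); last by rewrite ler_wpM2l.
have -> : x k 0 ^+ 2 * i ^+ 4 * x kX 0 ^+ 2 * j ^+ 2 = (x k 0 ^+ 2 * i ^+ 2 * j) * (i ^+ 2 * j) * x kX 0 ^+ 2.
  by ring.
rewrite ler_wpM2r ?sqr_ge0//.
apply: (@le_trans _ _ (4 * (x kv 0 ^+ 2 * i ^+ 2 * j) * 1)).
  have ij0 : 0 <= i ^+ 2 * j by apply: mulr_ge0; [exact: sqr_ge0|exact: ltW].
  apply: ler_pM => //.
  - by rewrite -mulrA; apply: mulr_ge0 => //; exact: sqr_ge0.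
  - have -> : 4 * (x kv 0 ^+ 2 * i ^+ 2 * j) = 4 * x kv 0 ^+ 2 * (i ^+ 2 * j) by ring.
    by rewrite -mulrA ler_wpM2r.
  - by apply: mulr_ile1 => //; [exact: sqr_ge0|exact: ltW|apply: exprn_ile1 => //; exact: ltW].
by rewrite mulr1 -[leRHS]mulr1 ler_wpM2l.
Qed.

(* [theta_fn] localizes to the region where l is comparable with the norm. *)
Definition E_fn (K : R) := add_fn (mul_fn (mul_fn theta_fn theta_fn) G_fn)
  (mul_fn (cst_fn n K) (mul_fn theta_fn F2_fn)).

Lemma gen_E1 : exists2 C : R, 0 <= C & forall x,
  `|gen (mul_fn (mul_fn theta_fn theta_fn) G_fn) x + fv theta_fn x ^+ 2 * gainG x| <=
  C * (fv theta_fn x ^+ 2 * s x ^+ 2 + Dp x).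
Proof.
have [C1 C10 H1] := gen_G.
have H2 : dominated (fun x => fv G_fn x * gen (mul_fn theta_fn theta_fn) x + carre (mul_fn theta_fn theta_fn) G_fn x) (fun x => dd x * dd x).
  apply: dominated_add; last first.
    apply: O_D1; apply: Osum => i; apply: (Ow (p := addw (Wt 0 0 (-3) 0) (Wt 1 0 0 0))) => //.
    apply: Omul (sG i); apply: sg_sqr; by apply: (Ow (Omul O_theta (s_theta i))).
  have one f : Og f (Wt 0 0 0 0) -> dominated f (fun=> 1).
    by move=> H; apply: (O_bo H); exists 1 => // x; rewrite /mon /= !expr0z !mulr1.
  apply: dominated_le (dominated_mul (one _ O_G) (_ : dominated _ (fun x => dd x * dd x))).
    by exists 1 => // x; rewrite !mul1r.
  apply: (dominated_eq (@gen_sqr _)); apply: dominated_add; last first.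
    by apply: O_D1; apply: Osum => i; apply: (Ow (Omul (s_theta i) (s_theta i))).
  have [C C0 H] := dominated_mul (one _ O_theta) g_theta; exists (2 * C); first by rewrite mulr_ge0.
  move=> x; rewrite normrM ger0_norm// -mulrA ler_wpM2l//; apply: le_trans (H x) _.
  rewrite mul1r ler_wpM2l// ler_piMr ?dd2 ?(le_trans ler01 (Dp_ge1 _))//.
  by rewrite -[leRHS](expr0z (r x)) ler_weXz2l.
have [C2 C20 H2'] := H2.
exists (C1 + C2) => [|x]; first exact: addr_ge0.
have th20 : 0 <= fv theta_fn x ^+ 2 by exact: sqr_ge0.
have -> : gen (mul_fn (mul_fn theta_fn theta_fn) G_fn) x + fv theta_fn x ^+ 2 * gainG x =
  fv theta_fn x ^+ 2 * (gen G_fn x + gainG x) +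
  (fv G_fn x * gen (mul_fn theta_fn theta_fn) x + carre (mul_fn theta_fn theta_fn) G_fn x).
  rewrite gen_mul; have -> : fv (mul_fn theta_fn theta_fn) x = fv theta_fn x ^+ 2 by rewrite expr2.
  by ring.
apply: le_trans (ler_normD _ _) _; rewrite normrM (ger0_norm th20).
have K1 : fv theta_fn x ^+ 2 * `|gen G_fn x + gainG x| <= C1 * (fv theta_fn x ^+ 2 * s x ^+ 2).
  rewrite mulrCA ler_wpM2l//; apply: le_trans (H1 x) _.
  by rewrite /mon /= !expr0z !mulr1.
have K2 := H2' x; rewrite dd2 in K2.
have s20 : 0 <= fv theta_fn x ^+ 2 * s x ^+ 2 by rewrite mulr_ge0 ?sqr_ge0.
have D0 : 0 <= Dp x by apply: le_trans ler01 (Dp_ge1 x).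
apply: le_trans (lerD K1 K2) _; rewrite mulrDl [C1 * (_ + _)]mulrDr [C2 * (_ + _)]mulrDr.
by rewrite lerD// ?lerDl ?lerDr mulr_ge0.
Qed.

Lemma gen_E2 : exists2 C : R, 0 <= C & forall x,
  gen (mul_fn theta_fn F2_fn) x <= - (fv theta_fn x * gain2 x) + C * Dp x.
Proof.
have [C1 C10 H1] := gen_F2.
have H2 : dominated (fun x => fv F2_fn x * gen theta_fn x + carre theta_fn F2_fn x) (fun x => dd x * dd x).
  apply: dominated_add; last first.
    by apply: O_D1; apply: Osum => i; apply: (Ow (Omul (s_theta i) (sg_F2 i))).
  (* [F2_fn] is only O(r^3), which is compensated exactly by the factor r^-3 in [g_theta]. *)
  have H : dominated (fv F2_fn) (fun x => r x ^ (3 : int)).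
    apply: (O_bo (Ow O_F2 (_ : lew _ (Wt 0 0 3 0)))) => //.
    by exists 1 => // x; rewrite mul1r /mon /= !expr0z !mul1r mulr1.
  apply: dominated_le (dominated_mul H g_theta); exists 1 => // x.
  by rewrite mul1r mulrCA r_inv mulr1.
have [C2 C20 H2'] := H2.
exists (C1 + C2) => [|x]; first exact: addr_ge0.
have /andP[th0 th1] := theta01 x.
rewrite gen_mul -addrA.
have -> : fv theta_fn x * gen F2_fn x = fv theta_fn x * (gen F2_fn x + gain2 x) - fv theta_fn x * gain2 x by ring.
have K1 : fv theta_fn x * (gen F2_fn x + gain2 x) <= C1 * Dp x.
  apply: (@le_trans _ _ (fv theta_fn x * (C1 * e x ^+ 2))).
    rewrite ler_wpM2l//; apply: le_trans (ler_norm _) _; apply: le_trans (H1 x) _.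
    by rewrite /mon /= !expr0z !mulr1 mul1r.
  by rewrite mulrCA ler_wpM2l// theta_e.
have K2 := le_trans (ler_norm _) (H2' x); rewrite dd2 in K2.
by move: K1 K2; lra.
Qed.

Lemma gen_E : exists K : R, exists2 C : R, 0 <= C & forall x, gen (E_fn K) x <= C * Dp x - gain x.
Proof.
have [C1 C10 H1] := gen_E1; have [C2 C20 H2] := gen_E2.
(* The arctangent multiplier has to pay 2 C1 times the X-part of s^2 for the error of [G_fn], and
   once more for the gain; the factor 4 is that of [key_gain]. *)
pose K := 4 * (2 * C1 + 1); have K0 : 0 <= K by rewrite mulr_ge0// addr_ge0// mulr_ge0.
exists K; exists (C1 + 2 * C1 + K + K * C2).
  by apply: addr_ge0; [apply: addr_ge0 K0; apply: addr_ge0 => //; exact: mulr_ge0|exact: mulr_ge0].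
move=> x; rewrite gen_add [gen (mul_fn (cst_fn _ _) _) x]gen_mul gen_cst gam_cst mulr0 !addr0.
rewrite [fv (cst_fn _ _) x]/= /gain.
have -> : fv theta_fn x ^+ 2 * (gainG x + (r x * x kX 0) ^+ 2 * t x ^ (-2)) =
  fv theta_fn x ^+ 2 * gainG x + fv theta_fn x ^+ 2 * ((r x * x kX 0) ^+ 2 * t x ^ (-2)) by exact: mulrDr.
have K1 := le_trans (ler_norm _) (H1 x).
have K2 := ler_wpM2l K0 (H2 x).
have K3 := key_gain x.
have K4 : fv theta_fn x ^+ 2 * s x ^+ 2 <= 2 * Dp x + 2 * (fv theta_fn x ^+ 2 * ((r x * x kX 0) ^+ 2 * t x ^ (-2))).
  have /andP[th0 th1] := theta01 x.
  apply: (@le_trans _ _ (fv theta_fn x ^+ 2 * (2 * e x ^+ 2 + 2 * ((r x * x kX 0) ^+ 2 * t x ^ (-2))))).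
    by rewrite ler_wpM2l ?sqr_ge0 ?s2_le.
  rewrite mulrDr mulrCA [X in _ + X]mulrCA lerD2r ler_wpM2l//.
  apply: le_trans (theta_e x); have te : 0 <= fv theta_fn x * e x ^+ 2 by apply: mulr_ge0 th0 (sqr_ge0 _).
  by rewrite expr2 -mulrA ler_piMl.
have K5 := ler_wpM2l C10 K4.
have C11 : 0 <= 2 * C1 + 1 by rewrite addr_ge0// mulr_ge0.
have K6 := ler_wpM2l C11 K3.
move: K1 K2 K5 K6; rewrite /K.
move: (gen _ x) (gen _ x) (fv theta_fn x * gain2 x) (fv theta_fn x ^+ 2 * gainG x) (fv theta_fn x ^+ 2 * s x ^+ 2) => g1 g2 a1 a2 a3.
move: (fv theta_fn x ^+ 2 * _) => a4; move: (Dp x) => D.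
exact: gen_E_arith.
Qed.

Lemma O_E K : Og (fv (E_fn K)) (Wt 0 1 0 0).
Proof.
apply: dominated_add; first by apply: (Ow (Omul (Omul O_theta O_theta) O_G)).
by apply: OZ; apply: (Ow (Omul O_theta O_F2)).
Qed.

Hypothesis CW : C2 Wf.
Hypothesis CR : C2 Rf.

Lemma C2_E K : C2 (E_fn K).
Proof.
have cth : C2 theta_fn by apply: C2_mul (C2_rp _); apply: C2_mul; exact: C2_coord.
have cT : C2 T_fn.
  by apply: C2_add; apply: C2_add => //; apply: C2_mul; exact: C2_coord.
have cP : C2 P_fn.
  apply: C2_add; first by apply: C2_mul (C2_rp _) _; apply: C2_mul; exact: C2_coord.
  apply: C2_mul; first exact: C2_cst.
  by apply: C2_mul CW; apply: C2_mul (C2_rp _); exact: C2_coord.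
have at2 F : C2 F -> C2 (comp_fn (@atan R) (@datan R) (@ddatan R) F).
  by move=> cF; apply: (C2_comp (@atan_C2on R)).
have cchi : C2 chi_fn.
  apply: (C2_comp (@pw_C2on R _)); last by apply: C2_mul cT (C2_rp _).
  by move=> x; change (0 <= fv tau_fn x); rewrite tau_val subr_ge0.
apply: C2_add.
  apply: C2_mul; first exact: C2_mul.
  by apply: C2_mul; [exact: C2_cst|apply: C2_mul cchi (at2 _ cP)].
apply: C2_mul; first exact: C2_cst.
apply: C2_mul cth _; apply: C2_mul; first exact: C2_cst.
apply: C2_mul.
  apply: C2_mul (C2_coord _ _); apply: C2_mul (C2_rp _).
  by apply: C2_add; [exact: C2_coord|apply: C2_mul; [exact: C2_cst|exact: C2_coord]].
by apply: at2; apply: C2_mul (C2_rp _); exact: C2_coord.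
Qed.

Lemma gainG_ge0 x : 0 <= gainG x.
Proof.
have /andP[d0 _] := datan_01 (fv P_fn x).
by apply: mulr_ge0; apply: mulr_ge0; [exact: exprz_ge0 (ltW (t0 x))|exact: ltW|exact: ltW|exact: sqr_ge0].
Qed.

Lemma gain_ge0 x : 0 <= gain x.
Proof.
rewrite /gain mulr_ge0 ?sqr_ge0// addr_ge0 ?gainG_ge0// mulr_ge0 ?sqr_ge0//.
exact: exprz_ge0 (ltW (t0 x)).
Qed.

Lemma gain_lb : w kX != 0 -> exists2 c : R, 0 < c &
  forall x, e x ^+ 2 <= 5 * r x -> 4^-1 <= fv theta_fn x -> c * r x <= gain x.
Proof.
move=> wX; have [CT CT0 HT] := O_T; have [CW' CW0 HW] := W1.
pose t' := 1 + CT * 5; have t'1 : 1 <= t' by rewrite lerDl mulr_ge0.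
have t'0 : 0 < t' by exact: lt_le_trans t'1.
(* A bound for |P|: 1 for r X^2, and for the compensator e^3 = e^2 e <= 5 r * 3 r = 15 r^2 against l
   r^-5 <= r^-2. *)
pose p' := 1 + 2 * (CW' * 15); have p'0 : 0 <= p' by rewrite addr_ge0// mulr_ge0// mulr_ge0.
pose c1 := (t' ^+ 6)^-1 * (1 + p' ^+ 2)^-1 * w kX ^+ 2.
pose c2 := (t' ^+ 2)^-1.
have c10 : 0 < c1.
  apply: mulr_gt0; last by rewrite exprn_even_gt0.
  by apply: mulr_gt0; rewrite invr_gt0 ?exprn_gt0 ?oneDsqr_gt0.
have c20 : 0 < c2 by rewrite invr_gt0 exprn_gt0.
exists (4^-1 ^+ 2 * Num.min c1 c2); first by rewrite mulr_gt0 ?exprn_gt0 ?invr_gt0// lt_min c10.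
move=> x ex th; have rx := r0 x; have rx1 := r1 x.
rewrite -mulrA /gain ler_pM//.
- by rewrite mulr_ge0 ?(ltW rx)// le_min !ltW.
- by rewrite lerXn2r ?nnegrE ?invr_ge0//; have /andP[] := theta01 x.
have tx : t x <= t'.
  rewrite tE lerD2l; have := HT x; rewrite /mon /= !expr0z mul1r !mulr1 ger0_norm ?T_ge0// => HTx.
  apply: (@le_trans _ _ (CT * (5 * r x) * r x ^ (-2))).
    rewrite ler_wpM2r ?exprz_ge0 ?(ltW rx)//; apply: le_trans HTx _.
    by rewrite ler_wpM2l//.
  have -> : CT * (5 * r x) * r x ^ (-2) = CT * 5 * (r x ^ (1 - 2)).
    by rewrite expfzDr ?gt_eqF// expr1z; ring.
  rewrite ler_piMr ?mulr_ge0//.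
  by rewrite -[leRHS](expr0z (r x)) ler_weXz2l.
have tz (z : nat) : (t' ^+ z)^-1 <= t x ^ (- z%:Z).
  by rewrite -exprnN lef_pV2 ?posrE ?exprn_gt0// lerXn2r ?nnegrE ?(ltW (t0 x)) ?(ltW t'0).
(* Either (r X)^2 >= r, with t bounded, or P is bounded by p' and the noise on X produces the
   gain. *)
have [rX|rX] := leP 1 (r x * x kX 0 ^+ 2).
  apply: (@le_trans _ _ ((r x * x kX 0) ^+ 2 * t x ^ (-2))).
    apply: (@le_trans _ _ (c2 * r x)); first by rewrite ler_wpM2r ?(ltW rx)// ge_min lexx orbT.
    rewrite mulrC ler_pM ?(ltW rx) ?(ltW c20)//; last exact: (tz 2%N).
    by rewrite exprMn expr2 -mulrA ler_peMr// ltW.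
  by rewrite lerDr gainG_ge0.
apply: (@le_trans _ _ (gainG x)); last first.
  by rewrite lerDl mulr_ge0 ?sqr_ge0 ?exprz_ge0 ?(ltW (t0 x)).
apply: (@le_trans _ _ (c1 * r x)); first by rewrite ler_wpM2r ?(ltW rx)// ge_min lexx.
have -> : c1 * r x = (t' ^+ 6)^-1 * ((1 + p' ^+ 2)^-1 * (r x * w kX ^+ 2)).
  by rewrite /c1; move: (_ ^-1) (_ ^-1) => y z; ring.
have rw0 : 0 <= r x * w kX ^+ 2 by apply: mulr_ge0; [exact: ltW|exact: sqr_ge0].
have p0 : 0 <= (1 + p' ^+ 2)^-1 by rewrite invr_ge0 ltW// oneDsqr_gt0.
rewrite /gainG -mulrA; apply: ler_pM; [|exact: mulr_ge0|exact: (tz 6%N)|].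
  by rewrite invr_ge0 exprn_ge0// ltW.
apply: ler_wpM2r => //.
rewrite /datan lef_pV2 ?posrE ?oneDsqr_gt0// lerD2l -(real_normK (num_real (fv P_fn x))).
rewrite lerXn2r ?nnegrE//.
have ex3 : e x ^+ 3 <= 15 * r x ^+ 2.
  have r5 : e x ^+ 2 <= (3 * r x) ^+ 2.
    apply: le_trans ex _; rewrite exprMn.
    apply: (@le_trans _ _ (9 * r x)); first by rewrite ler_wpM2r ?(ltW rx)// ler_nat.
    by rewrite -natrX ler_wpM2l// expr2 ler_peMl// ltW.
  have e3 : e x <= 3 * r x.
    by rewrite -(ler_pXn2r (n := 2)) ?nnegrE ?(ltW (e0 x))// mulr_ge0// ltW.
  rewrite exprSr; apply: (@le_trans _ _ (5 * r x * (3 * r x))).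
    by rewrite ler_pM ?sqr_ge0 ?(ltW (e0 x)).
  by rewrite le_eqVlt; apply/orP; left; apply/eqP; ring.
have -> : fv P_fn x = r x * x kX 0 ^+ 2 + - 2 * (x k 0 * r x ^ (-5) * fv Wf x).
  have E1 : fv (rp_fn 1) x = r x by rewrite rp_val expr1z.
  by rewrite -(rp_val (-5)) -E1 /P_fn /=; ring.
apply: le_trans (ler_normD _ _) _; apply: lerD.
  by rewrite ger0_norm ?(ltW rX)// mulr_ge0 ?sqr_ge0// ltW.
rewrite normrM normrN (ger0_norm (ler0n R 2)) ler_wpM2l// normrM.
have kl : `|x k 0 * r x ^ (-5)| <= r x ^ (-2).
  have [C C0 H] := O_coord3 k; rewrite normrM (ger0_norm (exprz_ge0 _ (ltW rx))).
  have -> : r x ^ (-2) = r x ^ (3 : int) * r x ^ (-5) by rewrite -expfzDr ?gt_eqF.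
  rewrite ler_wpM2r ?exprz_ge0 ?(ltW rx)//.
  rewrite -(ler_pXn2r (n := 2)) ?nnegrE ?exprz_ge0 ?(ltW rx)//.
  rewrite real_normK ?num_real// -exprnP -exprM r6 /= (bigD1 k)//=.
  have : 0 <= \sum_(j < n | j != k) x j 0 ^+ 2 by apply: sumr_ge0 => j _; exact: sqr_ge0.
  lra.
apply: (@le_trans _ _ (r x ^ (-2) * (CW' * (15 * r x ^+ 2)))).
  rewrite ler_pM//; apply: le_trans (HW x) _; rewrite /mon /= !expr0z mul1r !mulr1.
  by rewrite ler_wpM2l.
have -> : r x ^ (-2) * (CW' * (15 * r x ^+ 2)) = CW' * 15 * (r x ^ (2 : int) * r x ^ (-2)) by rewrite -exprnP; ring.
by rewrite r_inv mulr1.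
Qed.

End generator.

Lemma sqr_le_sum (R : realType) (a b c d z : R) :
  z ^+ 2 <= a * a + b * b + (c * c + (d * d + z * z)).
Proof.
rewrite -!expr2; have := sqr_ge0 a; have := sqr_ge0 b; have := sqr_ge0 c; have := sqr_ge0 d.
by move: (a ^+ 2) (b ^+ 2) (c ^+ 2) (d ^+ 2) (z ^+ 2) => *; lra.
Qed.

(** * Compensators of the resonant term *)

Section resonance.
Context (R : realType) (n : nat).
Local Notation V := 'cV[R]_n.
Variables (b : V -> V) (w : 'I_n -> R) (s e r t : V -> R).
Hypothesis e1 : forall x, 1 <= e x.
Hypothesis es : forall x, e x <= s x.
Hypothesis er : forall x, e x <= r x ^+ 3.
Hypothesis r1 : forall x, 1 <= r x.
Hypothesis t1 : forall x, 1 <= t x.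
Hypothesis sr : exists2 C : R, 1 <= C & forall x, s x <= C * r x ^+ 3.
Variables (A : 'M[R]_n) (k : 'I_n).
Hypothesis bE : forall x i, b x i 0 =
  (x (ordS i) 0 - x (ord_pred (ord_pred i)) 0) * x (ord_pred i) 0 - (A *m x) i 0.
Hypothesis Ak : forall i, A i k = 0.
Hypothesis eE : forall x, e x ^+ 2 = 1 + \sum_(i < n | i != k) x i 0 ^+ 2.
Hypothesis n6 : (6 <= n)%N.

Local Notation U := (coord_fn R).
Local Notation Og := (@Og R n s e r t).
Local Notation Ow := (Ow e1 es er r1 t1 sr).
Local Notation Omul := (Omul e1 es er r1 t1 sr).
Local Notation gen := (gen b w).
Local Notation sg := (sgrad w).
Local Notation gam := (carre w).
Local Notation O_e := (O_e s r t e1 eE).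
Local Notation O_A := (@O_A R n s e r t e1 es er r1 t1 sr A k Ak eE).
Local Notation O_genv := (@O_genv R n b w s e r t e1 es er r1 t1 sr A k bE Ak eE n6).
Local Notation O_genX := (@O_genX R n b w s e r t e1 es er r1 t1 sr A k bE Ak eE n6).
Let kB := ordS k.
Let kY := ord_pred k.
Let kX := ord_pred kY.
Let kv := ord_pred kX.
Let ks := ord_pred kv.
Let k5 := ord_pred ks.
Let k6 := ord_pred k5.

Local Notation sgc j := (sg_coord w s e r t j).

Lemma sg_sub F G p i : Og (fun x => sg F x i) p -> Og (fun x => sg G x i) p ->
  Og (fun x => sg (sub_fn F G) x i) p.
Proof.
by move=> F1 G1; apply: dominated_eq (dominated_add F1 (dominated_opp G1)) => x; rewrite /sgrad /=; ring.
Qed.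

Lemma O_gam F G u u' : (forall i, Og (fun x => sg F x i) u) -> (forall i, Og (fun x => sg G x i) u') ->
  Og (gam F G) (addw u u').
Proof. by move=> HF HG; apply: (Osum e1 es r1 t1) => i; exact: Omul. Qed.

Definition res_spec (Wf Rf : fn R n) :=
  [/\ Og (fv Rf) (Wt 0 2 0 0), Og (gen Rf) (Wt 0 2 2 2),
      forall i, Og (fun x => sg Rf x i) (Wt 0 0 2 2), Og (fv Wf) (Wt 0 0 3 3) & Og (fv Wf) (Wt 0 3 0 0)] /\
  [/\ Og (fun x => gen Wf x - x k 0 * x kX 0 * (x kY 0 - x ks 0) * x kv 0) (Wt 0 2 2 3),
      forall i, Og (fun x => sg Wf x i) (Wt 0 0 2 2) &
      Og (fun x => x kY 0 - x ks 0) (Wt 0 0 1 2)].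

(* As dY = l X + ..., the resonant term is the derivative of v (Y^2 / 2 - s Y). *)
Definition R7 := mul_fn (U ks) (U ks).
Definition h7 := sub_fn (mul_fn (cst_fn n 2^-1) (U kY)) (U ks).
Definition W7 := mul_fn (U kv) (mul_fn (U kY) h7).

(** For n >= 7 the site k - 6, which enters the drift of s, differs from k. Hence s is slow, and
    differentiating v Y (Y / 2 - s) produces the resonant term through dY only. *)
Lemma res7 : (7 <= n)%N -> (forall x, t x = 1 + fv (T_fn k R7) x * r x ^ (-2)) -> res_spec W7 R7.
Proof.
move=> n7 tE; have [Y X v s' k5'] := k_neq k n6.
have R0 x : 0 <= fv R7 x by rewrite /= -expr2 sqr_ge0.
have k6' : k6 != k by apply: (@pred_neq n n6 6).
have X' := X_rt s e r1 R0 tE; have Y' := Y_rt s e r1 R0 tE; have v' := v_rt s e r1 R0 tE.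
have s_ : Og (fun x => x ks 0) (Wt 0 0 1 1).
  apply: (O_rt s e r1 tE) => x /=; rewrite -!expr2.
  by have := sqr_ge0 (x kX 0); have := sqr_ge0 (x kY 0); have := sqr_ge0 (x kv 0); rewrite /kv /kX /kY; lra.
have gs : Og (gen (U ks)) (Wt 0 2 0 0).
  apply: (dominated_eq (g := fun x => (x kv 0 - x k6 0) * x k5 0 - (A *m x) ks 0)).
    by move=> x; rewrite gen_coord bE [in ordS ks]/ks ord_predK.
  apply: dominated_add; first by apply: (Ow (Omul (dominated_add (O_e v) (dominated_opp (O_e k6'))) (O_e k5'))).
  by apply: dominated_opp; apply: (Ow (O_A _)).
have y1 : Og (fun x => x kY 0 - x ks 0) (Wt 0 0 1 2).
  by apply: dominated_add; [apply: (Ow Y')|apply: dominated_opp; apply: (Ow s_)].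
have h_ : Og (fv h7) (Wt 0 0 1 1).
  by apply: dominated_eq (dominated_add (OZ 2^-1 Y') (dominated_opp s_)) => x /=; ring.
have he : Og (fv h7) (Wt 0 1 0 0).
  by apply: dominated_eq (dominated_add (OZ 2^-1 (O_e Y)) (dominated_opp (O_e s'))) => x /=; ring.
have sh i : Og (fun x => sg h7 x i) (Wt 0 0 0 0).
  apply: sg_sub (sgc _ _).
  by apply: dominated_eq (OZ 2^-1 (sgc kY i)) => x; rewrite /sgrad /=; ring.
have sYh i : Og (fun x => sg (mul_fn (U kY) h7) x i) (Wt 0 0 1 1).
  by apply: (@sg_mul R n w s e r t e1 es er r1 t1 sr (U kY) h7 _ _ _ _ _ i Y' h_ (sgc _ _) (sh i)).
split; split => //.
- by apply: (Ow (Omul (O_e s') (O_e s'))).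
- apply: (dominated_eq (@gen_sqr _ _ _ _ _)); apply: dominated_add; last by apply: (Ow (O_gam (sgc _) (sgc _))).
  by apply: OZ; apply: (Ow (Omul s_ gs)).
- by move=> i; apply: sg_sqr; apply: (Ow (Omul s_ (sgc _ _))).
- by apply: (Ow (Omul v' (Omul Y' h_))).
- by apply: (Ow (Omul (O_e v) (Omul (O_e Y) he))).
- apply: (dominated_eq (g := fun x => x kv 0 * (x kY 0 - x ks 0) * - (x kv 0 * x kX 0 + (A *m x) kY 0) +
     - (x kv 0 * x kY 0 * gen (U ks) x) + x kv 0 * gam (U kY) h7 x + x kY 0 * fv h7 x * gen (U kv) x +
     gam (U kv) (mul_fn (U kY) h7) x)).
    move=> x; rewrite gen_mul gen_mul gen_sub gen_mul gen_cst gam_cst (gen_Y _ _ bE).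
    rewrite -/kY -/kX -/kv; move: (gen _ _) (gen _ _) (gam _ _ _) (gam _ _ _) => a1 a2 a3 a4 /=.
    by field.
  apply: dominated_add; last by apply: (Ow (O_gam (sgc _) sYh)).
  apply: dominated_add; last by apply: (Ow (Omul (Omul Y' h_) O_genv)).
  apply: dominated_add; last by apply: (Ow (Omul (O_e v) (O_gam (sgc _) sh))).
  apply: dominated_add; last by apply: dominated_opp; apply: (Ow (Omul (Omul v' Y') gs)).
  apply: (Ow (p := addw (addw (Wt 0 0 1 1) (Wt 0 0 1 2)) (Wt 0 2 0 0))) => //.
  apply: Omul; first exact: Omul v' y1.
  by apply: dominated_opp; apply: dominated_add; [exact: Omul (O_e v) (O_e X)|apply: (Ow (O_A _))].
- move=> i.
  by apply: (@sg_mul R n w s e r t e1 es er r1 t1 sr (U kv) (mul_fn (U kY) h7) _ _ _ _ _ i v' (Omul Y' h_) (sgc _ _) (sYh i)).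
Qed.

(* For n = 6 the coordinate s is also the (k+2)-th one and moves fast as well: to
   leading order d(B + X) = - l (Y - s) and d(Y - s) = l (B + X). *)
Definition Z6 := add_fn (U kB) (U kX).
Definition y6 := sub_fn (U kY) (U ks).
Definition R6 := add_fn (mul_fn Z6 Z6) (mul_fn y6 y6).
Definition W6 := mul_fn (cst_fn n (-1)) (mul_fn (U kv) (mul_fn (U kX) Z6)).

(** The fast dynamics of the pair (B + X, Y - s) is a rotation with speed l - v, so the sum of their
    squares is slow. Moreover d(B + X) = - (l - v) (Y - s) + ..., so - v X (B + X) has the resonant
    term as its leading derivative. *)
Lemma res6 : (forall i : 'I_n, iter 6 (@ord_pred n) i = i) ->
  (forall x, t x = 1 + fv (T_fn k R6) x * r x ^ (-2)) -> res_spec W6 R6.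
Proof.
move=> p6 tE; have [Y X v s' k5'] := k_neq k n6; have B := kB_neq k n6.
have R0 x : 0 <= fv R6 x by rewrite /= -!expr2 addr_ge0// sqr_ge0.
have X' := X_rt s e r1 R0 tE; have Y' := Y_rt s e r1 R0 tE; have v' := v_rt s e r1 R0 tE.
have sB : ordS kB = ks by rewrite /kB -{1}(p6 k) /= !ord_predK.
have k5B : k5 = kB by rewrite /kB -[in RHS](p6 k) /= ord_predK.
have Z_ : Og (fv Z6) (Wt 0 0 1 1).
  apply: (O_rt s e r1 tE) => x; apply: le_trans (sqr_le_sum (x kX 0) (x kY 0) (x kv 0) (fv y6 x) (fv Z6 x)) _.
  by rewrite lerD2l lerD2l addrC.
have y_ : Og (fv y6) (Wt 0 0 1 1).
  apply: (O_rt s e r1 tE) => x; exact: (sqr_le_sum (x kX 0) (x kY 0) (x kv 0) (fv Z6 x) (fv y6 x)).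
have Ze : Og (fv Z6) (Wt 0 1 0 0) by apply: dominated_add; [exact: (O_e B)|exact: (O_e X)].
have ye : Og (fv y6) (Wt 0 1 0 0).
  by apply: dominated_eq (dominated_add (O_e Y) (dominated_opp (O_e s'))) => x /=; ring.
have sZ i : Og (fun x => sg Z6 x i) (Wt 0 0 0 0).
  by apply: dominated_eq (dominated_add (sgc kB i) (sgc kX i)) => x; rewrite /sgrad /=; ring.
have sy i : Og (fun x => sg y6 x i) (Wt 0 0 0 0) by apply: sg_sub (sgc _ _) (sgc _ _).
have gZ x : gen Z6 x = - ((x k 0 - x kv 0) * fv y6 x) - ((A *m x) kB 0 + (A *m x) kX 0).
  rewrite gen_add gen_coord bE sB (gen_X _ _ bE) -/kY -/kX -/kv -/ks ordSK -/kY /=; ring.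
have gy x : gen y6 x = (x k 0 - x kv 0) * fv Z6 x - ((A *m x) kY 0 - (A *m x) ks 0).
  rewrite gen_sub (gen_Y _ _ bE) gen_coord bE -/k5 k5B [ord_pred kB]ordSK.
  rewrite [in ordS ks]/ks ord_predK -/kY -/kX -/kv -/ks /=; ring.
have sXZ i : Og (fun x => sg (mul_fn (U kX) Z6) x i) (Wt 0 0 1 1).
  by apply: (@sg_mul R n w s e r t e1 es er r1 t1 sr (U kX) Z6 _ _ _ _ _ i X' Z_ (sgc _ _) (sZ i)).
have sV i : Og (fun x => sg (mul_fn (U kv) (mul_fn (U kX) Z6)) x i) (Wt 0 0 2 2).
  by apply: (@sg_mul R n w s e r t e1 es er r1 t1 sr (U kv) (mul_fn (U kX) Z6) _ _ _ _ _ i v' (Omul X' Z_) (sgc _ _) (sXZ i)).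
split; split.
- by apply: dominated_add; [apply: (Ow (Omul Ze Ze))|apply: (Ow (Omul ye ye))].
- apply: (dominated_eq (g := fun x => 2 * (fv Z6 x * - ((A *m x) kB 0 + (A *m x) kX 0)) + gam Z6 Z6 x +
     (2 * (fv y6 x * - ((A *m x) kY 0 - (A *m x) ks 0)) + gam y6 y6 x))).
    by move=> x; rewrite gen_add !gen_sqr gZ gy; ring.
  apply: dominated_add; apply: dominated_add.
  + apply: OZ; apply: (Ow (p := addw (Wt 0 0 1 1) (Wt 0 1 0 0))) => //; apply: Omul => //.
    by apply: dominated_opp; apply: dominated_add; exact: O_A.
  + by apply: (Ow (O_gam sZ sZ)).
  + apply: OZ; apply: (Ow (p := addw (Wt 0 0 1 1) (Wt 0 1 0 0))) => //; apply: Omul => //.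
    by apply: dominated_opp; apply: dominated_add; [exact: O_A|apply: dominated_opp; exact: O_A].
  + by apply: (Ow (O_gam sy sy)).
- move=> i; apply: (dominated_eq (g := fun x => sg (mul_fn Z6 Z6) x i + sg (mul_fn y6 y6) x i)).
    by move=> x; rewrite /sgrad /=; ring.
  apply: dominated_add; apply: sg_sqr; first by apply: (Ow (Omul Z_ (sZ i))).
  by apply: (Ow (Omul y_ (sy i))).
- by apply: (OZ (-1)); apply: (Ow (Omul v' (Omul X' Z_))).
- by apply: (OZ (-1)); apply: (Ow (Omul (O_e v) (Omul (O_e X) Ze))).
- apply: (dominated_eq (g := fun x => - (x kv 0 * x kX 0 * x kv 0 * fv y6 x) +
     x kv 0 * x kX 0 * ((A *m x) kB 0 + (A *m x) kX 0) - x kv 0 * fv Z6 x * gen (U kX) x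
     - x kv 0 * gam (U kX) Z6 x - x kX 0 * fv Z6 x * gen (U kv) x - gam (U kv) (mul_fn (U kX) Z6) x)).
    move=> x; rewrite gen_mul gen_cst gam_cst gen_mul gen_mul gZ.
    move: (gen _ _) (gen _ _) (gam _ _ _) (gam _ _ _) => a1 a2 a3 a4 /=.
    by ring.
  apply: dominated_add; last by apply: dominated_opp; apply: (Ow (O_gam (sgc _) sXZ)).
  apply: dominated_add; last by apply: dominated_opp; apply: (Ow (Omul (Omul X' Z_) O_genv)).
  apply: dominated_add; last by apply: dominated_opp; apply: (Ow (Omul (O_e v) (O_gam (sgc _) sZ))).
  apply: dominated_add; last by apply: dominated_opp; apply: (Ow (Omul (Omul v' Z_) O_genX)).
  apply: dominated_add; last by apply: (Ow (Omul (Omul v' X') (dominated_add (O_A _) (O_A _)))).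
  by apply: dominated_opp; apply: (Ow (Omul (Omul (Omul v' (O_e X)) (O_e v)) y_)).
- by move=> i; apply: dominated_eq (dominated_opp (sV i)) => x; rewrite /sgrad /=; ring.
- by apply: (Ow (p := Wt 0 0 1 1)) => //; apply: dominated_eq y_ => x /=; ring.
Qed.

End resonance.

(** * The Lyapunov function *)

Section lyapunov.
Context (R : realType) (n : nat).
Local Notation V := 'cV[R]_n.
Local Notation U := (coord_fn R).
Hypothesis n6 : (6 <= n)%N.
Variables (A : 'M[R]_n) (w : 'I_n -> R).
Hypothesis hA : psd A.
Hypothesis hker : forall u : 'cV[R]_n,
     A *m u = 0 <-> (forall i : 'I_n, (2 <= i)%N -> u i 0 = 0).
Hypothesis w1 : forall i : 'I_n, i.+2 = n -> w i != 0.
Hypothesis w2 : forall i : 'I_n, i.+1 = n -> w i != 0.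
Local Notation b := (lorenz96_drift A).
Local Notation gen := (gen b w).
Local Notation gam := (carre w).

Lemma driftE x i : b x i 0 =
  (x (ordS i) 0 - x (ord_pred (ord_pred i)) 0) * x (ord_pred i) 0 - (A *m x) i 0.
Proof. by rewrite /lorenz96_drift mxE. Qed.

Lemma energy (x : V) : \sum_i x i 0 * b x i 0 = - \sum_i x i 0 * (A *m x) i 0.
Proof.
under eq_bigr do rewrite driftE mulrBr.
rewrite sumrB (_ : \sum_i _ = 0) ?sub0r//.
under eq_bigr do rewrite mulrBl mulrBr.
rewrite sumrB; apply/eqP; rewrite subr_eq0; apply/eqP.
rewrite (reindex_inj (@ord_pred_inj n)) /=; apply: eq_bigr => i _.
by rewrite ord_predK; ring.
Qed.

Lemma A_col0 (k : 'I_n) i : (k < 2)%N -> A i k = 0.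
Proof.
move=> k2; have /hker : forall j : 'I_n, (2 <= j)%N -> (delta_mx k 0 : V) j 0 = 0.
  by move=> j j2; rewrite mxE; case: eqP => // jk; move: k2; rewrite -jk ltnNge j2.
move=> /(congr1 (fun M : V => M i 0)); rewrite !mxE (bigD1 k)//= big1.
  by rewrite mxE !eqxx mulr1 addr0.
by move=> j /negbTE jk; rewrite mxE jk mulr0.
Qed.

Lemma A_row0 (k : 'I_n) i : (k < 2)%N -> A k i = 0.
Proof. by move=> k2; have [+ _] := hA => <-; rewrite mxE A_col0. Qed.

Definition Pi (x : V) : R := \sum_(i < n | (2 <= i)%N) x i 0 ^+ 2.

Lemma Pi_ge0 x : 0 <= Pi x.
Proof. by apply: sumr_ge0 => i _; exact: sqr_ge0. Qed.

Lemma quad_bound (M : 'M[R]_n) : exists2 C : R, 0 < C & forall x : V,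
  \sum_i x i 0 * (M *m x) i 0 <= C * nrm2 x.
Proof.
exists (1 + \sum_i \sum_j `|M i j|).
  by rewrite ltr_wpDr// sumr_ge0// => i _; rewrite sumr_ge0.
move=> x; have n0 := nrm2_ge0 x.
have sq i : x i 0 ^+ 2 <= nrm2 x.
  rewrite /nrm2 (bigD1 i)//= lerDl; apply: sumr_ge0 => j _; exact: sqr_ge0.
apply: (@le_trans _ _ ((\sum_i \sum_j `|M i j|) * nrm2 x)); last by rewrite ler_wpM2r// lerDr.
rewrite mulr_suml; apply: ler_sum => i _; rewrite mxE mulr_sumr mulr_suml.
apply: ler_sum => j _; rewrite mulrCA.
apply: le_trans (ler_norm _) _; rewrite normrM ler_wpM2l// ler_norml.
have := sq i; have := sq j; have := sqr_ge0 (x i 0 - x j 0); have := sqr_ge0 (x i 0 + x j 0).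
move: (x i 0) (x j 0) => p q; lra.
Qed.

(* Completing the square in [0 <= (x - y)^T S (x - y)] with [S y = x / C]. *)
Lemma coercive : exists2 c : R, 0 < c & forall x : V, c * Pi x <= \sum_i x i 0 * (A *m x) i 0.
Proof.
have [Asym Apos] := hA.
have quadE (M : 'M[R]_n) (x y : V) : (x^T *m M *m y) 0 0 = \sum_i x i 0 * (M *m y) i 0.
  by rewrite -mulmxA mxE; apply: eq_bigr => i _; rewrite mxE.
(* [J] is the projection onto the kernel of A: S = A + J is still positive semi-definite, and
   injective. Vectors without kernel components do not see [J]. *)
pose J : 'M[R]_n := \matrix_(i, j) ((i == j) && (i < 2)%N)%:R.
pose S := A + J.
have JE (x : V) (i : 'I_n) : (J *m x) i 0 = (i < 2)%N%:R * x i 0.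
  rewrite mxE (bigD1 i)//= mxE eqxx big1 ?addr0// => j ji.
  by rewrite mxE eq_sym (negbTE ji) mul0r.
have SE (x : V) : \sum_i x i 0 * (S *m x) i 0 = \sum_i x i 0 * (A *m x) i 0 + \sum_(i < n) (i < 2)%N%:R * x i 0 ^+ 2.
  rewrite -big_split; apply: eq_bigr => i _ /=; rewrite mulmxDl mxE JE; ring.
have J0 (x : V) (i : 'I_n) : 0 <= (i < 2)%N%:R * x i 0 ^+ 2 by rewrite mulr_ge0 ?sqr_ge0.
have Spos (x : V) : 0 <= \sum_i x i 0 * (S *m x) i 0.
  by rewrite SE addr_ge0//; [rewrite -quadE; exact: Apos|apply: sumr_ge0].
have Ssym : S^T = S.
  rewrite /S linearD /= Asym; congr (_ + _); apply/matrixP => i j; rewrite !mxE eq_sym.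
  by case: eqP => [->|].
have Sunit : S \in unitmx.
  rewrite -unitmx_tr -row_free_unit; apply: inj_row_free => v vS.
  have Sv : S *m v^T = 0 by rewrite -[S]trmxK -trmx_mul vS trmx0.
  have q0 : \sum_i v^T i 0 * (A *m v^T) i 0 + \sum_(i < n) (i < 2)%N%:R * v^T i 0 ^+ 2 = 0.
    by rewrite -SE Sv big1// => i _; rewrite [X in _ * X]mxE mulr0.
  have a0 : 0 <= \sum_i v^T i 0 * (A *m v^T) i 0 by rewrite -quadE; exact: Apos.
  have b0 : \sum_(i < n) (i < 2)%N%:R * v^T i 0 ^+ 2 = 0.
    apply/eqP; rewrite eq_le; apply/andP; split; last by apply: sumr_ge0.
    by rewrite -[leRHS]q0 lerDr.
  have v2 (i : 'I_n) : (i < 2)%N -> v^T i 0 = 0.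
    move=> i2; have /eqP := b0; rewrite psumr_eq0; last by move=> j _; exact: J0.
    by move=> /allP/(_ i (mem_index_enum _)); rewrite i2 mul1r sqrf_eq0 => /eqP.
  have Av : A *m v^T = 0.
    have : J *m v^T = 0.
      apply/colP => i; rewrite JE [RHS]mxE; case: (ltnP i 2) => i2; last by rewrite mul0r.
      by rewrite v2// mulr0.
    by move=> Jv; move: Sv; rewrite /S mulmxDl Jv addr0.
  have /hker v3 := Av.
  apply/rowP => j; have [j2|j2] := ltnP j 2.
    by have := v2 j j2; rewrite !mxE.
  by have := v3 j j2; rewrite !mxE.
have [C C0 HC] := quad_bound (invmx S).
exists C^-1; first by rewrite invr_gt0.
move=> x0; pose x : V := \col_i (if (i < 2)%N then 0 else x0 i 0).
have Ax : A *m x0 = A *m x.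
  apply/colP => i; rewrite !mxE; apply: eq_bigr => j _; rewrite mxE.
  by case: (ltnP j 2) => // j2; rewrite A_col0// !mul0r.
have -> : \sum_i x0 i 0 * (A *m x0) i 0 = \sum_i x i 0 * (S *m x) i 0.
  rewrite SE [X in _ = _ + X]big1 => [|i _]; last first.
    by rewrite mxE; case: ltnP; rewrite ?mul0r// expr0n mulr0.
  rewrite addr0; apply: eq_bigr => i _; rewrite Ax [X in _ = X * _]mxE.
  by case: ltnP => // i2; rewrite [_ *m _]lock mul0r -lock mxE big1 ?mulr0// => j _; rewrite A_row0// mul0r.
have -> : Pi x0 = nrm2 x.
  rewrite /Pi /nrm2 big_mkcond; apply: eq_bigr => i _; rewrite mxE.
  by rewrite leqNgt; case: (i < 2)%N => //=; rewrite expr0n.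
pose y : V := C^-1 *: (invmx S *m x).
have Sy : S *m y = C^-1 *: x by rewrite /y -scalemxAr mulmxA mulmxV// mul1mx.
have K1 := Spos (x - y).
have E1 : \sum_i (x - y) i 0 * (S *m (x - y)) i 0 =
   \sum_i x i 0 * (S *m x) i 0 - \sum_i x i 0 * (S *m y) i 0 - \sum_i y i 0 * (S *m x) i 0
   + \sum_i y i 0 * (S *m y) i 0.
  rewrite -!sumrB -big_split; apply: eq_bigr => i _ /=; rewrite mulmxBr !mxE; ring.
have E2 : \sum_i y i 0 * (S *m x) i 0 = \sum_i x i 0 * (S *m y) i 0.
  have E3 : (y^T *m S *m x)^T = x^T *m S *m y by rewrite !trmx_mul Ssym trmxK mulmxA.
  by rewrite -!quadE -E3 [RHS]mxE.
have E4 : \sum_i x i 0 * (S *m y) i 0 = C^-1 * nrm2 x.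
  by rewrite /nrm2 mulr_sumr; apply: eq_bigr => i _; rewrite Sy [X in _ * X]mxE; ring.
have E5 : \sum_i y i 0 * (S *m y) i 0 = C^-1 * (C^-1 * \sum_i x i 0 * (invmx S *m x) i 0).
  rewrite !mulr_sumr; apply: eq_bigr => i _; rewrite Sy [X in _ * X]mxE [y i 0]mxE; ring.
move: K1; rewrite E1 E2 E4 E5.
have : C^-1 * (C^-1 * \sum_i x i 0 * (invmx S *m x) i 0) <= C^-1 * nrm2 x.
  by rewrite ler_wpM2l ?invr_ge0 ?(ltW C0)// mulrC ler_pdivrMr// mulrC HC.
lra.
Qed.

(** The cube root of the Japanese bracket. *)
Definition cbracket (x : V) : R := (1 + fv (n2_fn R n) x) `^ 6^-1.

(** The index two places before k is n - 1 for k = 1 and n for k = 2: these are the sites whose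
    noise must not vanish. The lower bound on g is asked only in the region left over by the other
    two terms of the Lyapunov function. *)
Lemma E_exists (k k' : 'I_n) : (k < 2)%N -> (k' < 2)%N -> k' != k -> ord_pred (ord_pred k) != k' ->
  (k' = ord_pred k /\ ordS k != k') \/ (k' = ordS k /\ ord_pred k != k') ->
  w (ord_pred (ord_pred k)) != 0 ->
  let r := cbracket in
  exists E : fn R n, exists g : V -> R, [/\ C2 E,
    exists C : R, forall x, `|fv E x| <= C * r x ^+ 3,
    exists2 C : R, 0 <= C & forall x, gen E x <= C * Dp r k k' x - g x,
    forall x, 0 <= g x &
    exists2 c : R, 0 < c & forall x : V, 1 + \sum_(i < n | i != k) x i 0 ^+ 2 <= 5 * r x ->
      4^-1 <= x k 0 ^+ 2 * r x ^ (-6) -> c * r x <= g x].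
Proof.
move=> k2 k'2 kk' Xk' YB wX r.
have n20 x : 0 <= fv (n2_fn R n) x by apply: sumr_ge0 => i _; exact: sqr_ge0.
have r1 x : 1 <= r x.
  apply: (@le_trans _ _ (1 `^ 6^-1)); first by rewrite powR1.
  by apply: ge0_ler_powR; rewrite ?nnegrE ?invr_ge0 ?addr_ge0// lerDl.
have r0 x : 0 < r x by exact: lt_le_trans (r1 x).
have rE x : r x = (1 + fv (n2_fn R n) x) `^ 6^-1 by [].
have r6 x : r x ^+ 6 = 1 + fv (n2_fn R n) x := r6 rE x.
pose e (x : V) : R := Num.sqrt (1 + \sum_(i < n | i != k) x i 0 ^+ 2).
have S0 (x : V) : 0 <= \sum_(i < n | i != k) x i 0 ^+ 2 by apply: sumr_ge0 => i _; exact: sqr_ge0.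
have eE x : e x ^+ 2 = 1 + \sum_(i < n | i != k) x i 0 ^+ 2 by rewrite sqr_sqrtr// addr_ge0.
have e1 x : 1 <= e x by rewrite -[leLHS]sqrtr1 ler_wsqrtr// lerDl.
have e0 x : 0 < e x by exact: lt_le_trans (e1 x).
have er x : e x <= r x ^+ 3.
  rewrite -(ler_pXn2r (n := 2)) ?nnegrE ?exprn_ge0 ?(ltW (e0 x)) ?(ltW (r0 x))//.
  by rewrite -exprM r6 eE lerD2l /= [leRHS](bigD1 k)//= lerDr sqr_ge0.
(* The sizes t and s are defined from the compensator data, so [Wf] and [Rf] are chosen first, with
   a specification valid for all admissible s and t. *)
suff [Wf [Rf [R0 CW CR spec]]] : exists Wf Rf : fn R n, [/\ forall x, 0 <= fv Rf x, C2 Wf, C2 Rf &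
    forall s t : V -> R, (forall x, t x = 1 + fv (T_fn k Rf) x * r x ^ (-2)) ->
    (forall x, 1 <= t x) -> (forall x, e x <= s x) ->
    (exists2 C : R, 1 <= C & forall x, s x <= C * r x ^+ 3) -> res_spec b w s e r t k Wf Rf].
  pose t (x : V) : R := 1 + fv (T_fn k Rf) x * r x ^ (-2).
  pose s (x : V) : R := e x + r x * `|x (ord_pred (ord_pred k)) 0| / t x.
  have tE x : t x = 1 + fv (T_fn k Rf) x * r x ^ (-2) by [].
  have sE x : s x = e x + r x * `|x (ord_pred (ord_pred k)) 0| / t x by [].
  have t1 x : 1 <= t x by rewrite lerDl mulr_ge0 ?exprz_ge0 ?(ltW (r0 x))//; exact: T_ge0.
  have t0 x : 0 < t x by exact: lt_le_trans (t1 x).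
  have es x : e x <= s x by rewrite lerDl mulr_ge0 ?invr_ge0 ?mulr_ge0// ltW.
  have sr : exists2 C : R, 1 <= C & forall x, s x <= C * r x ^+ 3.
    have [C C0 H] := X_rt s e r1 R0 tE; exists (1 + C); first by rewrite lerDl.
    move=> x; rewrite /s mulrDl mul1r lerD// ler_pdivrMr//.
    have := H x; rewrite /mon /= !expr0z !mul1r !expr1z => Hx.
    apply: (@le_trans _ _ (r x * (C * (r x * t x)))); first by rewrite ler_wpM2l// ltW.
    have -> : r x * (C * (r x * t x)) = C * r x ^+ 2 * t x by ring.
    by rewrite ler_wpM2r ?(ltW (t0 x))// ler_wpM2l// ler_weXn2l.
  have [[R1 R2 R3 W0 W1] [W2 W3 y1]] := spec s t tE t1 es sr.
  have Ak i := A_col0 i k2; have kA i := A_row0 i k2.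
  have Ak' i := A_col0 i k'2; have kA' i := A_row0 i k'2.
  have [K [C C0 HE]] := gen_E e1 es er r1 t1 sr rE driftE Ak kA eE n6 R0 R2 R3 W0 W2 W3 y1 tE sE Ak' kA' kk' Xk' YB.
  exists (E_fn k Wf Rf K), (gain w r t k Wf); split.
  - exact: (@C2_E R n r t t1 rE k Wf Rf tE CW CR K).
  - have [D D0 HD] := O_E e1 es er r1 t1 sr rE driftE Ak kA eE n6 Wf R0 R2 R3 y1 tE sE K.
    exists D => x; apply: le_trans (HD x) _; rewrite /mon /= !expr0z expr1z mul1r !mulr1.
    by rewrite ler_wpM2l.
  - by exists C.
  - by move=> x; exact: gain_ge0.
  - have [c c0 Hc] := gain_lb e1 es er r1 t1 sr rE eE n6 R0 R1 W1 tE wX.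
    exists c => // x H1 H2; apply: Hc; first by rewrite eE.
    by rewrite (theta_val rE).
have Ak i := A_col0 i k2.
have [n7|] := ltnP 6 n.
  exists (W7 R k), (R7 R k); split.
  - by move=> x /=; rewrite -expr2 sqr_ge0.
  - do !(apply: C2_mul || apply: C2_add || exact: C2_coord || exact: C2_cst).
  - by apply: C2_mul; exact: C2_coord.
  - move=> s t tE t1 es sr.
    by apply: (res7 w e1 es er r1 t1 sr driftE Ak eE n6).
rewrite leq_eqVlt ltnNge n6 orbF => /eqP n6'.
exists (W6 R k), (R6 R k); split.
- by move=> x /=; rewrite -!expr2 addr_ge0// sqr_ge0.
- do !(apply: C2_mul || apply: C2_add || exact: C2_coord || exact: C2_cst).
- do !(apply: C2_mul || apply: C2_add || exact: C2_coord || exact: C2_cst).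
- move=> s t tE t1 es sr.
  apply: (res6 w e1 es er r1 t1 sr driftE Ak eE n6) => // i.
  apply/val_inj; rewrite (iter_pred n6 i n6).
  have -> : (n - 6 = 0)%N by rewrite n6'.
  by rewrite addn0 modn_small.
Qed.

Let n2 : (1 < n)%N := leq_trans (isT : (2 <= 6)%N) n6.
Let i0 := Ordinal (ltnW n2).
Let i1 := Ordinal n2.
Let i2 : 'I_n := Ordinal (leq_trans (isT : (3 <= 6)%N) n6).
Let i3 : 'I_n := Ordinal (leq_trans (isT : (4 <= 6)%N) n6).
Let m1 := ord_pred i0.
Let m2 := ord_pred m1.

Lemma val_m1 : val m1 = n.-1.
Proof. by rewrite (@iter_pred n n6 1 i0 (ltnW n2)) add0n modn_small ?subn1// prednK// ltnW. Qed.

Lemma val_m2 : val m2 = n.-2.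
Proof. by rewrite (@iter_pred n n6 2 i0 n2) add0n modn_small; have := n6; lia. Qed.

Lemma ordS_val (i : 'I_n) : (i.+1 < n)%N -> val (ordS i) = i.+1.
Proof. by move=> Hi; rewrite /= modn_small. Qed.

Lemma S0 : ordS i0 = i1. Proof. by apply: val_inj; rewrite ordS_val. Qed.
Lemma S1 : ordS i1 = i2.
Proof. by apply: val_inj; rewrite ordS_val//=; exact: leq_trans n6. Qed.
Lemma S2 : ordS i2 = i3.
Proof. by apply: val_inj; rewrite ordS_val//=; exact: leq_trans n6. Qed.
Lemma p1_0 : ord_pred i1 = i0. Proof. by rewrite -S0 ordSK. Qed.
Lemma p2_1 : ord_pred i2 = i1. Proof. by rewrite -S1 ordSK. Qed.

Lemma Pi_split (f : 'I_n -> R) : \sum_i f i = f i0 + f i1 + \sum_(i < n | (2 <= i)%N) f i.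
Proof.
rewrite (bigD1 i0)//= (bigD1 i1)//= -addrA; congr (_ + (_ + _)).
apply: eq_bigl => i; rewrite -!val_eqE /=.
by case: (val i) => [|[|m]].
Qed.

Local Notation r := cbracket.

Lemma DpE x : Dp r i0 i1 x = 1 + Pi x + (x i0 0 * x i1 0) ^+ 2 * r x ^ (-6).
Proof.
rewrite /Dp /Pi; congr (_ + _ + _); apply: eq_bigl => i; rewrite -!val_eqE /=.
by case: (val i) => [|[|m]].
Qed.

Lemma DpE' x : Dp r i1 i0 x = 1 + Pi x + (x i0 0 * x i1 0) ^+ 2 * r x ^ (-6).
Proof. by rewrite -DpE /Dp (mulrC (x i1 0)); congr (_ + _ + _); apply: eq_bigl => i; rewrite andbC. Qed.

Lemma E0_exists : exists E : fn R n, exists g : V -> R, [/\ C2 E,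
    exists C : R, forall x, `|fv E x| <= C * r x ^+ 3,
    exists2 C : R, 0 <= C & forall x, gen E x <= C * Dp r i0 i1 x - g x,
    forall x, 0 <= g x &
    exists2 c : R, 0 < c & forall x : V, 1 + \sum_(i < n | i != i0) x i 0 ^+ 2 <= 5 * r x ->
      4^-1 <= x i0 0 ^+ 2 * r x ^ (-6) -> c * r x <= g x].
Proof.
have n3 : (3 < n)%N by exact: leq_trans n6.
apply: E_exists => //.
- by rewrite -val_eqE val_m2 /=; lia.
- by right; rewrite S0; split => //; rewrite -val_eqE val_m1 /=; lia.
- by apply: w1; rewrite val_m2; lia.
Qed.

Lemma E1_exists : exists E : fn R n, exists g : V -> R, [/\ C2 E,
    exists C : R, forall x, `|fv E x| <= C * r x ^+ 3,
    exists2 C : R, 0 <= C & forall x, gen E x <= C * Dp r i1 i0 x - g x,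
    forall x, 0 <= g x &
    exists2 c : R, 0 < c & forall x : V, 1 + \sum_(i < n | i != i1) x i 0 ^+ 2 <= 5 * r x ->
      4^-1 <= x i1 0 ^+ 2 * r x ^ (-6) -> c * r x <= g x].
Proof.
have n3 : (3 < n)%N by exact: leq_trans n6.
apply: E_exists => //.
- by rewrite p1_0 -val_eqE val_m1 /=; lia.
- by left; rewrite p1_0 S1.
- by rewrite p1_0; apply: w2; rewrite val_m1; lia.
Qed.

Lemma r_ge1 x : 1 <= r x.
Proof.
have n20 : 0 <= fv (n2_fn R n) x by apply: sumr_ge0 => i _; exact: sqr_ge0.
apply: (@le_trans _ _ (1 `^ 6^-1)); first by rewrite powR1.
by apply: ge0_ler_powR; rewrite ?nnegrE ?invr_ge0 ?addr_ge0// lerDl.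
Qed.

Lemma r_6 x : r x ^+ 6 = 1 + nrm2 x.
Proof. by rewrite (@r6 R n r). Qed.

Definition M_fn := mul_fn (U i0) (mul_fn (U i1) (U i2)).
(* d(x_1 x_2 x_3) = - (x_1 x_2)^2 + ... *)
Definition F_fn := mul_fn M_fn (rp_fn R n (-6)).
Definition q (x : V) : R := x i0 0 * x i1 0 * r x ^ (-3).
Definition p1 (x : V) : R := 1 + Pi x.

Lemma p1_ge1 x : 1 <= p1 x. Proof. by rewrite /p1 lerDl Pi_ge0. Qed.

Lemma gam_coord2 i j x : i != j -> gam (U i) (U j) x = 0.
Proof.
move=> ij; rewrite /carre big1// => l _; rewrite /sgrad /=.
by have [->|] := eqVneq l i; rewrite ?(negbTE ij) ?mulr0// mul0r.
Qed.

Lemma gen_M x : gen M_fn x = x i1 0 * x i2 0 * ((x i1 0 - x m2 0) * x m1 0) +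
  x i0 0 * x i2 0 * ((x i2 0 - x m1 0) * x i0 0) +
  x i0 0 * x i1 0 * ((x i3 0 - x i0 0) * x i1 0 - (A *m x) i2 0).
Proof.
rewrite gen_mul gen_mul [gam (U i0) _ x]gamC gam_mul !gam_coord2//.
rewrite !gen_coord !driftE p2_1 p1_0 S0 S1 S2 -/m1 -/m2.
have A0 (k : 'I_n) : (k < 2)%N -> (A *m x) k 0 = 0.
  by move=> k2; rewrite mxE big1// => j _; rewrite A_row0// mul0r.
by rewrite (A0 i0)// (A0 i1)//=; ring.
Qed.

(** The weight calculus is reused with e = s = t = 1, so that only powers of r count. *)
Local Notation one := (fun _ : V => 1 : R).

Lemma one1 (x : V) : 1 <= one x. Proof. by []. Qed.
Lemma one_r x : one x <= r x ^+ 3. Proof. by rewrite exprn_ege1// r_ge1. Qed.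
Lemma one_sr : exists2 C : R, 1 <= C & forall x : V, one x <= C * r x ^+ 3.
Proof. by exists 1 => // x; rewrite mul1r one_r. Qed.

Local Notation Ow := (Ow one1 one1 one_r r_ge1 one1 one_sr).
Local Notation Omul := (Omul one1 one1 one_r r_ge1 one1 one_sr).
Local Notation Og := (@Og R n one one r one).
Local Notation O_c := (@O_coord3 R n one one r one r_ge1 (fun=> erefl)).
Local Notation O_r := (@O_r R n one one r one r_ge1).

Lemma Og_bo1 f : Og f (Wt 0 0 0 0) -> dominated f one.
Proof. by apply: dominated_le; exists 1 => // x; rewrite /mon /= !expr0z !mul1r. Qed.

Definition d1_ (x : V) : R := Num.sqrt (p1 x).

Lemma d1_2 x : d1_ x * d1_ x = p1 x.
Proof. by rewrite -expr2 sqr_sqrtr// (le_trans ler01)// p1_ge1. Qed.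

Lemma dominated_d1 (i : 'I_n) : (2 <= i)%N -> dominated (fun x => x i 0) d1_.
Proof.
move=> i2'; exists 1 => // x; rewrite mul1r -sqrtr_sqr ler_wsqrtr// /p1 /Pi (bigD1 i)//=.
rewrite addrCA lerDl addr_ge0//; apply: sumr_ge0 => j _; exact: sqr_ge0.
Qed.

Lemma dominated_one f : dominated f one -> dominated f (fun x => d1_ x * d1_ x).
Proof. by apply: dominated_le; exists 1 => // x; rewrite mul1r d1_2 p1_ge1. Qed.

Lemma dominated_Ad1 i : dominated (fun x => (A *m x) i 0) d1_.
Proof.
apply: (dominated_eq (g := fun x => \sum_j A i j * x j 0)); first by move=> x; rewrite mxE.
apply: dominated_sum => [x|j]; first exact: sqrtr_ge0.
have [j2|j2] := ltnP j 2.
  by exists 0 => // x; rewrite A_col0// mul0r normr0 mul0r.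
have [C C0 H] := dominated_d1 j2; exists (`|A i j| * C); first by rewrite mulr_ge0.
by move=> x; rewrite normrM -mulrA ler_wpM2l.
Qed.

Lemma dominated_gen_n2 : dominated (gen (n2_fn R n)) (fun x => d1_ x * d1_ x).
Proof.
apply: (dominated_eq (g := fun x => \sum_i (- 2) * (x i 0 * (A *m x) i 0) + \sum_i w i ^+ 2)).
  by move=> x; rewrite gen_n2 energy -mulr_sumr; ring.
apply: dominated_add; last by apply: dominated_one; exists `|\sum_i w i ^+ 2| => // x; rewrite mulr1.
apply: dominated_sum => [x|i]; first by rewrite d1_2 (le_trans ler01)// p1_ge1.
have [j2|j2] := ltnP i 2.
  exists 0 => // x; rewrite (_ : (A *m x) i 0 = 0) ?mulr0 ?normr0 ?mul0r//.
  by rewrite mxE big1// => j _; rewrite A_row0// mul0r.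
have [C C0 H] := dominated_mul (dominated_d1 j2) (dominated_Ad1 i); exists (2 * C); first by rewrite mulr_ge0.
by move=> x; rewrite normrM normrN (ger0_norm (ler0n R 2)) -mulrA ler_wpM2l.
Qed.

Lemma q2 x : q x ^+ 2 = (x i0 0 * x i1 0) ^+ 2 * r x ^ (-6).
Proof. by rewrite /q exprMn; congr (_ * _); rewrite exprnP exprz_exp. Qed.

(** The drift - x_1 x_2 of x_3 gives - q^2. Of the errors, one is q times O(sqrt p1) and is absorbed
    by half of q^2; each of the others contains two damped factors or is O(p1) because r is slow. *)
Lemma gen_F1 : exists2 C : R, 0 <= C & forall x, gen F_fn x <= - (q x ^+ 2 / 2) + C * p1 x.
Proof.
have O012 : Og (fv M_fn) (Wt 0 0 9 0) by apply: (Ow (Omul (O_c i0) (Omul (O_c i1) (O_c i2)))).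
have i2_2 : (2 <= i2)%N by [].
have i3_2 : (2 <= i3)%N by [].
have m1_2 : (2 <= m1)%N by rewrite [nat_of_ord m1]val_m1; have := n6; lia.
have r0 x : 0 < r x by exact: lt_le_trans (r_ge1 x).
have K1 : dominated (fun x => r x ^ (-6) * (x i1 0 * x i2 0 * ((x i1 0 - x m2 0) * x m1 0) +
    x i0 0 * x i2 0 * ((x i2 0 - x m1 0) * x i0 0))) (fun x => d1_ x * d1_ x).
  apply: (dominated_eq (g := fun x => (r x ^ (-6) * (x i1 0 * (x i1 0 - x m2 0))) * (x i2 0 * x m1 0) +
    (r x ^ (-6) * (x i0 0 * x i0 0)) * (x i2 0 * (x i2 0 - x m1 0)))); first by move=> x; ring.
  have mul1 f g : dominated f one -> dominated g (fun x => d1_ x * d1_ x) -> dominated (fun x => f x * g x) (fun x => d1_ x * d1_ x).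
    by move=> bf bg; apply: dominated_le (dominated_mul bf bg); exists 1 => // x; rewrite !mul1r.
  apply: dominated_add; apply: mul1.
  - apply: Og_bo1; apply: (Ow (p := addw (Wt 0 0 (-6) 0) (addw (Wt 0 0 3 0) (Wt 0 0 3 0)))) => //.
    apply: Omul; first exact: O_r.
    apply: Omul; first exact: O_c.
    apply: dominated_add; [exact: O_c|apply: dominated_opp; exact: O_c].
  - exact: dominated_mul (dominated_d1 i2_2) (dominated_d1 m1_2).
  - by apply: Og_bo1; apply: (Ow (Omul (O_r (-6)) (Omul (O_c i0) (O_c i0)))).
  - apply: dominated_mul (dominated_d1 i2_2) _; apply: dominated_add; [exact: dominated_d1|apply: dominated_opp; exact: dominated_d1].
have K2 : dominated (fun x => r x ^ (-3) * (x i3 0 * x i1 0 - (A *m x) i2 0)) d1_.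
  apply: (dominated_eq (g := fun x => (r x ^ (-3) * x i1 0) * x i3 0 + (- r x ^ (-3)) * (A *m x) i2 0)).
    by move=> x; ring.
  have mul1 f g : dominated f one -> dominated g d1_ -> dominated (fun x => f x * g x) d1_.
    by move=> bf bg; apply: dominated_le (dominated_mul bf bg); exists 1 => // x; rewrite !mul1r.
  apply: dominated_add; apply: mul1; [|exact: dominated_d1| |exact: dominated_Ad1].
    by apply: Og_bo1; apply: (Ow (Omul (O_r (-3)) (O_c i1))).
  by apply: dominated_opp; apply: Og_bo1; apply: (Ow (O_r (-3))).
have gn2 : Og (gam (n2_fn R n) (n2_fn R n)) (Wt 0 0 6 0).
  apply: (Osum one1 one1 r_ge1 one1) => i.
  have s2 := @sg_n2 R n w one one r one r_ge1 (fun=> erefl) i.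
  exact (Omul s2 s2).
have K3 : dominated (fun x => fv M_fn x * gen (rp_fn R n (-6)) x + gam M_fn (rp_fn R n (-6)) x) (fun x => d1_ x * d1_ x).
  have sM i : Og (fun x => sgrad w M_fn x i) (Wt 0 0 6 0).
    apply: (dominated_eq (g := fun x => x i1 0 * x i2 0 * sgrad w (U i0) x i + x i0 0 * x i2 0 * sgrad w (U i1) x i +
      x i0 0 * x i1 0 * sgrad w (U i2) x i)); first by move=> x; rewrite /sgrad /=; ring.
    have sc := sg_coord w one one r one.
    by apply: dominated_add; [apply: dominated_add|]; apply: (Ow (Omul (Omul (O_c _) (O_c _)) (sc _ i))).
  pose c := (-6)%:~R / 6 : R.
  apply: dominated_add; last first.
    apply: (dominated_eq (g := fun x => (c * r x ^ (-6 - 6)) * gam M_fn (n2_fn R n) x)).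
      by move=> x; rewrite gamC gam_comp (@pw_r6 R n r (fun=> erefl)) gamC.
    have gMn : Og (gam M_fn (n2_fn R n)) (Wt 0 0 9 0).
      apply: (Osum one1 one1 r_ge1 one1) => i.
      have s2 := @sg_n2 R n w one one r one r_ge1 (fun=> erefl) i.
      exact: Omul (sM i) s2.
    by apply: dominated_one; apply: Og_bo1; apply: (Ow (Omul (OZ c (O_r (-6 - 6))) gMn)).
  apply: (dominated_eq (g := fun x => (fv M_fn x * (c * r x ^ (-6 - 6))) * gen (n2_fn R n) x +
    (fv M_fn x * ((c * (c - 1) / 2) * r x ^ (-6 - 6 - 6))) * gam (n2_fn R n) (n2_fn R n) x)).
    by move=> x; rewrite gen_comp (@pw_r6 R n r (fun=> erefl)) (@pw_r12 R n r (fun=> erefl)) -/c; ring.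
  apply: dominated_add; last first.
    by apply: dominated_one; apply: Og_bo1; apply: (Ow (Omul (Omul O012 (OZ _ (O_r (-6 - 6 - 6)))) gn2)).
  have H1 : dominated (fun x => fv M_fn x * (c * r x ^ (-6 - 6))) one.
    by apply: Og_bo1; apply: (Ow (Omul O012 (OZ c (O_r (-6 - 6))))).
  by apply: dominated_le (dominated_mul H1 dominated_gen_n2); exists 1 => // x; rewrite !mul1r.
have [C1 C10 H1] := K1; have [C2 C20 H2] := K2; have [C3 C30 H3] := K3.
exists (C1 + C2 ^+ 2 / 2 + C3); first by rewrite !addr_ge0// divr_ge0// sqr_ge0.
move=> x; rewrite gen_mul gen_M (@rp_val R n r (fun=> erefl)).
have E3 : r x ^ (-6) = r x ^ (-3) * r x ^ (-3) by rewrite -expfzDr ?gt_eqF.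
set D := r x ^ (-3) * (x i3 0 * x i1 0 - (A *m x) i2 0).
have -> : fv M_fn x * gen (rp_fn R n (-6)) x + r x ^ (-6) *
    (x i1 0 * x i2 0 * ((x i1 0 - x m2 0) * x m1 0) +
     x i0 0 * x i2 0 * ((x i2 0 - x m1 0) * x i0 0) +
     x i0 0 * x i1 0 * ((x i3 0 - x i0 0) * x i1 0 - (A *m x) i2 0)) + gam M_fn (rp_fn R n (-6)) x =
   (fv M_fn x * gen (rp_fn R n (-6)) x + gam M_fn (rp_fn R n (-6)) x) +
   r x ^ (-6) * (x i1 0 * x i2 0 * ((x i1 0 - x m2 0) * x m1 0) +
     x i0 0 * x i2 0 * ((x i2 0 - x m1 0) * x i0 0)) + (- q x ^+ 2 + q x * D).
  by rewrite /q /D E3; move: (r x ^ (-3)) (gen _ _) (gam _ _ _) => a1 a2 a3; ring.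
have L1 := le_trans (ler_norm _) (H1 x); have L2 := H2 x; have L3 := le_trans (ler_norm _) (H3 x).
rewrite !d1_2 in L1 L3.
have L4 : D ^+ 2 <= C2 ^+ 2 * p1 x.
  rewrite -(real_normK (num_real D)) -d1_2 -expr2 -exprMn lerXn2r ?nnegrE// mulr_ge0//.
  exact: sqrtr_ge0.
have L5 := sqr_ge0 (q x - D).
move: L1 L3 L4 L5; rewrite sqrrB; move: (_ * _ + _) (r x ^ (-6) * _) (D) (q x) (p1 x) => a1 a2 a3 a4 a5.
clear E3 L2; lra.
Qed.

Lemma gen_scale (K : R) F x : gen (mul_fn (cst_fn n K) F) x = K * gen F x.
Proof. by rewrite gen_mul gen_cst gam_cst mulr0 !addr0. Qed.

Lemma q_le (x : V) : `|x i0 0 * x i1 0| <= r x ^+ 6.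
Proof.
rewrite r_6 ler_norml /nrm2 Pi_split; have := Pi_ge0 x; rewrite /Pi.
have := sqr_ge0 (x i0 0 + x i1 0); have := sqr_ge0 (x i0 0 - x i1 0).
have := sqr_ge0 (x i0 0); have := sqr_ge0 (x i1 0).
move: (\sum_(i < n | _) _) (x i0 0) (x i1 0) => s a1 a2; lra.
Qed.

Lemma lyapunov : exists F : fn R n, exists c C : R, [/\ 0 < c, C2 F,
  forall x, gen F x <= C - c * r x & forall x, nrm2 x <= fv F x + C].
Proof.
have r0 x : 0 < r x by exact: lt_le_trans (r_ge1 x).
have [Ea [ga [CEa [Ba HBa] [Ca Ca0 HCa] ga0 [ca ca0 Hca]]]] := E0_exists.
have [Eb [gb [CEb [Bb HBb] [Cb Cb0 HCb] gb0 [cb cb0 Hcb]]]] := E1_exists.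
have [c c0 Hc] := coercive; have [C1 C10 HF1] := gen_F1.
(* K1 makes half of q^2 pay the errors Ca and Cb of the two localized terms and leave q^2 once. K2
   makes the damping pay all errors in [Pi], and is at least 2 for coercivity. *)
pose K1 := 2 * (Ca + Cb + 1); pose K2 := 2 + (K1 * C1 + Ca + Cb + 1) / (2 * c).
have K10 : 0 <= K1 by rewrite /K1; lra.
have KC0 : 0 <= K1 * C1 by exact: mulr_ge0.
have K20 : 2 <= K2 by rewrite lerDl divr_ge0//; [move: KC0; lra|lra].
have K2c : K1 * C1 + Ca + Cb + 1 <= K2 * (2 * c).
  by rewrite /K2 mulrDl divfK ?gt_eqF ?mulr_gt0// lerDr; lra.
pose C0 := K2 * \sum_i w i ^+ 2 + K1 * C1 + Ca + Cb.
pose F := add_fn (add_fn (mul_fn (cst_fn n K2) (n2_fn R n)) (mul_fn (cst_fn n K1) F_fn)) (add_fn Ea Eb).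
have G1 x : gen F x <= C0 + 1 - (1 + Pi x + q x ^+ 2) - ga x - gb x.
  rewrite /F !gen_add !gen_scale gen_n2 energy.
  have L1 := HCa x; have L2 := HCb x; rewrite DpE -q2 -/(p1 x) in L1; rewrite DpE' -q2 -/(p1 x) in L2.
  have L3 := ler_wpM2l K10 (HF1 x).
  have L4 : K2 * (2 * - \sum_i x i 0 * (A *m x) i 0) <= - ((K1 * C1 + Ca + Cb + 1) * Pi x).
    have L5 := ler_wpM2r (Pi_ge0 x) K2c; have L6 := Hc x.
    have K2' : 0 <= K2 by lra.
    have L7 := ler_wpM2l K2' L6; move: L5 L7.
    move: (\sum_i _) (Pi x) => a1 a2; lra.
  move: L1 L2 L3 L4; rewrite /p1 /C0 /K1.
  move: (gen _ x) (gen _ x) (gen _ x) (Pi x) (q x ^+ 2) (ga x) (gb x) (\sum_i x i 0 * _) (\sum_i w i ^+ 2) => a1 a2 a3 a4 a5 a6 a7 a8 a9.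
  lra.
pose c' := Num.min 1 (Num.min ca cb).
have c'0 : 0 < c' by rewrite !lt_min ltr01 ca0.
have c'1 : c' <= 1 by rewrite ge_min lexx.
have c'a : c' <= ca by rewrite !ge_min lexx orbT.
have c'b : c' <= cb by rewrite !ge_min lexx !orbT.
have G2 x : gen F x <= C0 + 1 + 4 * c' - c' * r x.
  apply: le_trans (G1 x) _; have rx := r0 x; have ga0x := ga0 x; have gb0x := gb0 x.
  have P0 := Pi_ge0 x; have q0 := sqr_ge0 (q x).
  have [Dr|Dr] := leP (r x) (1 + Pi x + q x ^+ 2).
    have : c' * r x <= 1 * r x by rewrite ler_wpM2r// ltW.
    move: (1 + Pi x + q x ^+ 2) Dr => D; lra.
  have [r4|r4] := leP (r x) 4.
    have : c' * r x <= c' * 4 by rewrite ler_wpM2l// ltW.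
    lra.
  have E6 := r_6 x; rewrite /nrm2 Pi_split -/(Pi x) in E6.
  have r6r : 2 * r x <= r x ^+ 6.
    rewrite exprSr ler_wpM2r ?(ltW rx)//; apply: (@le_trans _ _ (r x)); first lra.
    by rewrite ler_eXnr// r_ge1.
  have q2r : q x ^+ 2 <= r x by lra.
  have kk : (x i0 0 * x i1 0) ^+ 2 <= r x * r x ^+ 6.
    have -> : (x i0 0 * x i1 0) ^+ 2 = q x ^+ 2 * r x ^+ 6.
      by rewrite (q2 x) -mulrA -[r x ^+ 6]/(r x ^ (6 : int)) -expfzDr ?gt_eqF// mulr1.
    by rewrite ler_wpM2r// exprn_ge0// ltW.
  (* Origin of the constants 1/4 and 5: as 1 + Pi <= r <= r^6 / 2, the larger of x_1^2 and x_2^2 is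
     at least r^6 / 4. Their product being at most r^7, the smaller one is at most 4 r, and 1 + Pi
     adds at most r. *)
  have fin (i j : 'I_n) (g : V -> R) (cg : R) : 0 < cg -> c' <= cg -> (x i 0 * x j 0) ^+ 2 <= r x * r x ^+ 6 ->
      r x ^+ 6 = 1 + (x i 0 ^+ 2 + x j 0 ^+ 2 + Pi x) -> x j 0 ^+ 2 <= x i 0 ^+ 2 ->
      1 + \sum_(l < n | l != i) x l 0 ^+ 2 = 1 + Pi x + x j 0 ^+ 2 ->
      (forall x : V, 1 + \sum_(l < n | l != i) x l 0 ^+ 2 <= 5 * r x ->
        4^-1 <= x i 0 ^+ 2 * r x ^ (-6) -> cg * r x <= g x) -> c' * r x <= g x.
    move=> cg0 ccg Hk HE ji Hs Hg.
    have i4 : r x ^+ 6 <= 4 * x i 0 ^+ 2 by move: q0; lra.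
    have r60 : 0 < r x ^+ 6 by rewrite exprn_gt0.
    apply: (@le_trans _ _ (cg * r x)); first by rewrite ler_wpM2r// ltW.
    apply: Hg.
      rewrite Hs; have : x j 0 ^+ 2 <= 4 * r x.
        rewrite -(ler_pM2r r60); apply: (@le_trans _ _ (x j 0 ^+ 2 * (4 * x i 0 ^+ 2))).
          by rewrite ler_wpM2l// sqr_ge0.
        by move: Hk; rewrite exprMn; move: (r x ^+ 6) (x i 0 ^+ 2) (x j 0 ^+ 2) (r x) => a1 a2 a3 a4; lra.
      move: q0; lra.
    have -> : r x ^ (-6) = (r x ^+ 6)^-1 by rewrite exprnN.
    by rewrite ler_pdivlMr// mulrC ler_pdivrMr// mulrC.
  have [ji|/ltW ji] := leP (x i1 0 ^+ 2) (x i0 0 ^+ 2).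
    have := fin i0 i1 ga ca ca0 c'a kk _ ji _ Hca.
    rewrite -E6 => /(_ erefl) K.
    have : c' * r x <= ga x.
      apply: K; have := Pi_split (fun i => x i 0 ^+ 2); rewrite (bigD1 i0)//= -/(Pi x).
      move: (\sum_(i < n | i != i0) _) (x i0 0 ^+ 2) => a1 a2; lra.
    lra.
  rewrite mulrC in kk; have := fin i1 i0 gb cb cb0 c'b kk _ ji _ Hcb.
  rewrite (addrC (x i1 0 ^+ 2)) -E6 => /(_ erefl) K.
  have : c' * r x <= gb x.
    apply: K; have := Pi_split (fun i => x i 0 ^+ 2); rewrite (bigD1 i1)//= -/(Pi x).
    move: (\sum_(i < n | i != i1) _) (x i0 0 ^+ 2) (x i1 0 ^+ 2) => a1 a2 a3; lra.
  lra.
(* All terms except K2 |x|^2 are at most B r^3 in absolute value, where r^6 = 1 + |x|^2; as K2 >= 2,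
   Young's inequality leaves |x|^2 up to a constant. *)
pose B := K1 + Ba + Bb.
pose C' := Num.max (C0 + 1 + 4 * c') (2 + B ^+ 2).
exists F, c', C'; split => //.
- have cF : C2 F_fn.
    apply: C2_mul; last exact: C2_rp.
    by apply: C2_mul; [exact: C2_coord|apply: C2_mul; exact: C2_coord].
  apply: C2_add; last exact: C2_add.
  by apply: C2_add; apply: C2_mul => //; (exact: C2_cst || exact: C2_n2).
- by move=> x; apply: le_trans (G2 x) _; rewrite lerD2r le_max lexx.
move=> x; have rx := r0 x; have HF : `|fv F_fn x| <= r x ^+ 3.
  have -> : fv F_fn x = x i0 0 * x i1 0 * r x ^ (-6) * x i2 0.
    by rewrite -(@rp_val R n r (fun=> erefl)) /F_fn /M_fn /=; ring.
  rewrite normrM -[leRHS]mul1r ler_pM//.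
    rewrite normrM (ger0_norm (exprz_ge0 _ (ltW rx))).
    have -> : 1 = r x ^+ 6 * r x ^ (-6) by rewrite -[r x ^+ 6]/(r x ^ (6 : int)) -expfzDr ?gt_eqF.
    by rewrite ler_wpM2r ?exprz_ge0 ?(ltW rx)// q_le.
  rewrite -(ler_pXn2r (n := 2)) ?nnegrE ?exprn_ge0 ?(ltW rx)//.
  rewrite real_normK ?num_real// -exprM r_6 /nrm2 (bigD1 i2)//=.
  have : 0 <= \sum_(j < n | j != i2) x j 0 ^+ 2 by apply: sumr_ge0 => j _; exact: sqr_ge0.
  lra.
have H3 := HBa x; have H4 := HBb x.
have H1 : 2 + B ^+ 2 <= C' by rewrite le_max lexx orbT.
have H2 : nrm2 x = r x ^+ 3 ^+ 2 - 1 by rewrite -exprM r_6 addrC addKr.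
have N0 := nrm2_ge0 x.
have H5 := ler_wpM2l K10 HF.
have H6 : 2 * nrm2 x <= K2 * nrm2 x by rewrite ler_wpM2r.
have -> : fv F x = K2 * nrm2 x + K1 * fv F_fn x + (fv Ea x + fv Eb x) by [].
have H7 : - (K1 * r x ^+ 3) <= K1 * fv F_fn x.
  by rewrite -mulrN ler_wpM2l//; move: HF; rewrite ler_norml => /andP[].
move: H3 H4; rewrite !ler_norml => /andP[H3 _] /andP[H4 _].
have BE : B * r x ^+ 3 = K1 * r x ^+ 3 + Ba * r x ^+ 3 + Bb * r x ^+ 3 by rewrite /B; ring.
have := sqr_ge0 (r x ^+ 3 - B); rewrite sqrrB -mulr_natl.
have z2 := sqr_ge0 (r x ^+ 3); have B2 := sqr_ge0 B.
have -> : r x ^+ 3 * B = B * r x ^+ 3 by rewrite mulrC.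
move: H3 H4 H7 H6 H2 H1 BE z2 B2; move: (K1 * fv F_fn x) (K2 * nrm2 x) (fv Ea x) (fv Eb x) (B * r x ^+ 3)
  (K1 * r x ^+ 3) (Ba * r x ^+ 3) (Bb * r x ^+ 3) (r x ^+ 3 ^+ 2) (B ^+ 2) C' (nrm2 x).
clear; move=> a1 a2 a3 a4 a5 a6 a7 a8 a9 a10 a11 a12; lra.
Qed.

End lyapunov.

(** * Brownian increments and Markov chains *)

Section increments.
Context (R : realType) (n : nat) d (Omega : measurableType d) (P : probability Omega R).
Variables (W : 'I_n -> R -> {RV P >-> R}) (h : R).
Hypothesis hW : indep_brownian_motions W.
Hypothesis h0 : 0 < h.
Local Notation V := 'cV[R]_n.
Local Notation T := (Rn R n).

Definition incr (k : nat) (i : 'I_n) (w : Omega) : R := W i (k.+1%:R * h) w - W i (k%:R * h) w.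

Lemma measurable_incr k i : measurable_fun setT (incr k i).
Proof. by apply: measurable_funB; exact: measurable_funPT. Qed.

Lemma incr_law k i (B : set R) : measurable B -> P (incr k i @^-1` B) = normal_prob 0 (Num.sqrt h) B.
Proof.
move=> mB; have [hB _] := hW; have [_ _ law _] := hB i.
have hh : k%:R * h < k.+1%:R * h by rewrite ltr_pM2r// ltr_nat.
rewrite [LHS](law _ _ _ hh B mB); last by rewrite mulr_ge0// ltW.
by congr (normal_prob 0 (Num.sqrt _) B); rewrite -natr1; ring.
Qed.

Definition path_event (N : nat) (E : nat -> 'I_n -> set R) : set Omega :=
  [set w | forall k, (k < N)%N -> forall i, E k i (incr k i w)].

(** Independence of the Brownian motions gives the product over [i], independence of the increments
    of each of them the product over [k]; together all increments are jointly independent. *)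
Lemma path_eventP N E : (forall k i, measurable (E k i)) ->
  P (path_event N E) = (\prod_(i < n) \prod_(k < N) P (incr k i @^-1` E k i))%E.
Proof.
move=> mE; have [hB hI] := hW.
pose C i := \bigcap_(k in [set: 'I_N]) (incr k i @^-1` E k i).
have -> : path_event N E = \bigcap_(i in [set: 'I_n]) C i.
  apply/seteqP; split => [w H i _ k _|w H k kN i]; first exact: H.
  exact: (H i I (Ordinal kN) I).
rewrite hI; last first.
  move=> i; pose G := \bigcup_(t in @time R) preimage_set_system setT (W i t) measurable.
  have mW t : 0 <= t -> measurable_fun setT (W i t : g_sigma_algebraType G -> R).
    move=> t0 _ B mB; apply: sub_sigma_algebra; exists t; first by rewrite /time /= in_itv /= t0.
    by exists B.
  have : measurable (C i : set (g_sigma_algebraType G)).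
    apply: fin_bigcap_measurable => // k _; rewrite -[X in measurable X]setTI.
    by apply: (measurable_funB (f := W i _ : g_sigma_algebraType G -> R)) => //;
      apply: mW; rewrite mulr_ge0// ltW.
  by [].
apply: eq_bigr => i _; have [_ _ _ hi] := hB i.
have t0 : 0 <= (0%N)%:R * h by rewrite mul0r.
have ht : {homo (fun j : nat => j%:R * h) : a b / (a <= b)%N >-> a <= b}.
  by move=> a b ab; rewrite ler_wpM2r ?(ltW h0)// ler_nat.
rewrite [LHS](hi N (fun j => j%:R * h) t0 ht (fun k : 'I_N => incr k i @^-1` E k i))//.
move=> k; apply: sub_sigma_algebra; exists tt => //; exists (E k i); first exact: mE.
by rewrite setTI.
Qed.

(* A pi-system generating the sigma-algebra of the first [k] increments. *)
Definition past (k : nat) : set (set Omega) :=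
  [set A | exists2 E : nat -> 'I_n -> set R, (forall k i, measurable (E k i)) & A = path_event k E].

Definition dW (k : nat) (w : Omega) : T := (\col_i incr k i w : V).

Lemma measurable_dW k : measurable_fun setT (dW k).
Proof.
apply: measurable_col => i.
have -> : (fun w => (\col_i0 incr k i0 w : V) i 0) = incr k i by apply/funext => w; rewrite mxE.
exact: measurable_incr.
Qed.

HB.instance Definition _ k := isMeasurableFun.Build _ _ _ _ (dW k) (measurable_dW k).

Lemma past_measurable k : past k `<=` measurable.
Proof.
move=> _ [E mE ->].
have -> : path_event k E = \bigcap_(j in [set: 'I_k]) \bigcap_(i in [set: 'I_n]) (incr j i @^-1` E j i).
  by apply/seteqP; split => [w H j _ i _|w H j jk i]; [exact: H|exact: (H (Ordinal jk) I i I)].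
apply: fin_bigcap_measurable => // j _; apply: fin_bigcap_measurable => // i _.
by rewrite -[X in measurable X]setTI; exact: measurable_incr.
Qed.

Lemma past_setI k : setI_closed (past k).
Proof.
move=> _ _ [E mE ->] [F mF ->]; exists (fun j i => E j i `&` F j i).
  by move=> j i; exact: measurableI.
apply/seteqP; split => [w [H1 H2] j jk i|w H]; first by split; [exact: H1|exact: H2].
by split => j jk i; have [] := H j jk i.
Qed.

Lemma past_setT k : past k setT.
Proof. by exists (fun _ _ => setT) => //; apply/seteqP; split. Qed.

Lemma past_next k : past k `<=` past k.+1.
Proof.
move=> _ [E mE ->]; exists (fun j i => if (j < k)%N then E j i else setT).
  by move=> j i; case: ifP.
apply/seteqP; split => [w H j _ i|w H j jk i]; first by case: ifP => // jk; exact: H.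
by have := H j (ltnW jk) i; rewrite jk.
Qed.

Lemma past_dW k : measurable_fun setT (dW k : g_sigma_algebraType (past k.+1) -> T).
Proof.
apply: measurable_col => i _ B mB; rewrite setTI; apply: sub_sigma_algebra.
exists (fun j l => if (j == k) && (l == i) then B else setT); first by move=> j l; case: ifP.
apply/seteqP; split => [w /= H j _ l|w /= H]; first by case: andP => // -[/eqP -> /eqP ->]; rewrite mxE in H.
by have := H k (ltnSn k) i; rewrite !eqxx mxE.
Qed.

Lemma prob_dW_rect k (F : 'I_n -> set R) : (forall i, measurable (F i)) ->
  P (dW k @^-1` [set u : V | forall i, F i (u i 0)]) = (\prod_(i < n) normal_prob 0 (Num.sqrt h) (F i))%E.
Proof.
move=> mF; pose E j i := if (j == k) then F i else setT : set R.
have mE j i : measurable (E j i) by rewrite /E; case: ifP.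
have -> : dW k @^-1` [set u : V | forall i, F i (u i 0)] = path_event k.+1 E.
  apply/seteqP; split => [w /= H j _ i|w /= H i]; last by have := H k (ltnSn k) i; rewrite mxE /E eqxx.
  by rewrite /E; case: eqP => // ->; have := H i; rewrite mxE.
rewrite path_eventP//; apply: eq_bigr => i _.
rewrite big_ord_recr /= {2}/E eqxx big1 ?mul1e ?incr_law// => j _.
by rewrite /E ltn_eqF// preimage_setT; exact: probability_setT.
Qed.

(** [indep_g_sigma] is applied twice, to the past and then to the increment, which reduces the claim
    to events prescribing finitely many coordinates of increments. *)
Lemma indep_dW k A (B : set T) : <<s past k >> A -> measurable B ->
  P (A `&` dW k @^-1` B) = (P A * P (dW k @^-1` B))%E.
Proof.
move=> GA mB; apply: (indep_g_sigma (@past_measurable k) (@past_setI k) (@past_setT k)) GA.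
  by rewrite -[X in measurable X]setTI; exact: measurable_dW.
move=> _ [E mE ->]; set A0 := path_event k E.
have mA0 : measurable A0 by apply: (@past_measurable k); exists E.
pose G : set (set Omega) := [set C | exists2 D, rectangles D & C = dW k @^-1` (D : set T)].
rewrite setIC muleC; apply: (@indep_g_sigma _ _ _ P G) => //.
- move=> _ [D rD ->]; rewrite -[X in measurable X]setTI; apply: measurable_dW => //.
  exact: rectangles_measurable.
- move=> _ _ [C rC ->] [D rD ->]; exists (C `&` D); last by rewrite preimage_setI.
  exact: rectangles_setI.
- by exists setT; [exact: rectanglesT|rewrite preimage_setT].
- move=> _ [_ [F mF ->] ->]; rewrite prob_dW_rect// path_eventP//.
  pose E' j i := if (j == k) then F i else E j i : set R.
  have -> : dW k @^-1` [set u : V | forall i, F i (u i 0)] `&` A0 = path_event k.+1 E'.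
    apply/seteqP; split => [w /= [H1 H2] j jk i|w /= H].
      rewrite /E'; case: eqP => [->|/eqP jk']; first by have := H1 i; rewrite mxE.
      by apply: H2; rewrite ltn_neqAle jk' -ltnS.
    split => [i|j jk i]; first by have := H k (ltnSn k) i; rewrite /E' eqxx mxE.
    by have := H j (ltnW jk) i; rewrite /E' ltn_eqF.
  rewrite path_eventP; last by move=> j i; rewrite /E'; case: ifP.
  rewrite -big_split /=; apply: eq_bigr => i _.
  rewrite big_ord_recr /= {2}/E' eqxx incr_law// muleC; congr (_ * _)%E.
  by apply: eq_bigr => j _; rewrite /E' ltn_eqF.
- have mid : measurable_fun setT (dW k : g_sigma_algebraType G -> T).
    apply: measurable_col => i _ C mC; rewrite setTI; apply: sub_sigma_algebra.
    exists [set u : V | forall j, (if j == i then C else setT) (u j 0)].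
      by exists (fun j => if j == i then C else setT) => // j; case: ifP.
    apply/seteqP; split => [w /= H j|w /= H]; first by case: eqP => // ->.
    by have := H i; rewrite eqxx.
  by have := mid measurableT B mB; rewrite setTI.
Qed.

Lemma law_dW k (B : set T) : measurable B -> P (dW k @^-1` B) = P (dW 0 @^-1` B).
Proof.
move=> mB; pose m j : {measure set T -> \bar R} := distribution P (dW j).
rewrite -[LHS]/(m k B) -[RHS]/(m 0%N B).
apply: (@g_sigma_algebra_measure_unique _ _ _ (@rectangles R n : set (set T)) _ (fun=> setT)) => //.
- exact: rectangles_measurable.
- by move=> i; exact: rectanglesT.
- by rewrite bigcup_const.
- exact: rectangles_setI.
- by move=> _ [F mF ->]; exact: etrans (prob_dW_rect k mF) (esym (prob_dW_rect 0 mF)).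
- by move=> _; apply: le_lt_trans (@probability_le1 _ _ _ (distribution P (dW k)) _ measurableT) (ltry _).
- exact: measurable_rectangles.
Qed.

End increments.

(** * The Markov property *)

Section markov_chain.
Context (R : realType) (n : nat) d (Omega : measurableType d) (P : probability Omega R).
Variables (W : 'I_n -> R -> {RV P >-> R}) (h : R).
Hypothesis hW : indep_brownian_motions W.
Hypothesis h0 : 0 < h.
Local Notation T := (Rn R n).
Variable st : T * T -> T.
Hypothesis mst : measurable_fun setT st.
Local Notation dW := (@dW R n d Omega P W h).

Fixpoint chain (x : T) (k : nat) (w : Omega) : T :=
  if k is k'.+1 then st (chain x k' w, dW k' w) else x.

Lemma chain_past x k : measurable_fun setT (chain x k : g_sigma_algebraType (past W h k) -> T).
Proof.
elim: k => [|k IH]; first exact: measurable_cst.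
apply: measurableT_comp mst _; apply: measurable_fun_pair; last exact: past_dW.
move=> _ B mB; apply: sub_sigma_algebra2 (IH measurableT B mB); exact: past_next.
Qed.

Lemma measurable_chain2 k : measurable_fun setT (fun z : T * Omega => chain z.1 k z.2).
Proof.
elim: k => [|k IH]; first exact: measurable_fst.
apply: measurableT_comp mst _; apply: measurable_fun_pair IH _.
by apply: measurableT_comp; [exact: measurable_dW|exact: measurable_snd].
Qed.

Lemma measurable_chain x k : measurable_fun setT (chain x k).
Proof.
by apply: (measurableT_comp (measurable_chain2 k) (g := pair x)); exact: measurable_pair1.
Qed.

HB.instance Definition _ x k := isMeasurableFun.Build _ _ _ _ (chain x k) (measurable_chain x k).

(** The transition operator of the chain. Increment number 0 represents all of them, as they have
    the same law. *)
Definition step_op (f : T -> R) (x : T) : R := \int[P]_w f (st (x, dW 0 w)).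

Lemma bm_step f : bounded_meas f -> bounded_meas (step_op f).
Proof.
move=> bf; apply: (bm_param P (g := fun z : T * Omega => f (st (z.1, dW 0 z.2)))).
apply: bm_comp bf _; apply: measurableT_comp mst _; apply: measurable_fun_pair; first exact: measurable_fst.
by apply: measurableT_comp; [exact: measurable_dW|exact: measurable_snd].
Qed.

Lemma mean_dW (f : T -> R) k : bounded_meas f -> \int[P]_w f (dW k w) = \int[P]_w f (dW 0 w).
Proof.
move=> bf.
have E j : \int[P]_w f (dW j w) = \int[distribution P (dW j)]_y f y.
  rewrite /Rintegral; congr fine; rewrite (integral_distribution (X := dW j) (f := EFin \o f))//.
    by apply/measurable_EFinP; have [] := bf.
  by apply: bm_integrable; apply: (bm_comp bf (measurable_dW W h j)).
rewrite !E /Rintegral; congr fine; apply: eq_measure_integral => B mB _.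
exact: (law_dW hW h0).
Qed.

(** The state after k steps depends on the past increments only, so the next increment can be
    averaged with the state frozen. *)
Lemma chain_step f x k : bounded_meas f ->
  \int[P]_w f (chain x k.+1 w) = \int[P]_w step_op f (chain x k w).
Proof.
move=> bf.
have bfs : bounded_meas (fun z : T * T => f (st z)) by exact: bm_comp.
have H A B : measurable A -> measurable B ->
    P (chain x k @^-1` A `&` dW k @^-1` B) = (P (chain x k @^-1` A) * P (dW k @^-1` B))%E.
  move=> mA mB; apply: indep_dW => //.
  by have := @chain_past x k measurableT A mA; rewrite setTI.
rewrite [LHS](bounded_joint_law H bfs); apply: eq_Rintegral => w _.
by apply: (mean_dW (f := fun y => f (st (chain x k w, y)))); exact: (bm_section1 bfs).
Qed.

Lemma chain_iter f x k : bounded_meas f -> \int[P]_w f (chain x k w) = iter k step_op f x.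
Proof.
elim: k f => [|k IH] f bf /=; first by rewrite mean_cst.
by rewrite -[LHS]/(\int[P]_w f (chain x k.+1 w)) chain_step// IH -?iterSr//; exact: bm_step.
Qed.

Lemma bm_iter k f : bounded_meas f -> bounded_meas (iter k step_op f).
Proof. by move=> bf; elim: k => // k IH; exact: bm_step. Qed.

Lemma chain_add f x i k : bounded_meas f ->
  \int[P]_w f (chain x (i + k) w) = \int[P]_w (\int[P]_w' f (chain (chain x i w) k w')).
Proof.
move=> bf; rewrite chain_iter// iterD -chain_iter; last exact: bm_iter.
by apply: eq_Rintegral => w _; rewrite chain_iter.
Qed.

End markov_chain.

(** * One step of the clipped Euler chain *)

Section norms.
Context (R : realType) (n : nat).
Local Notation V := 'cV[R]_n.

Lemma measurable_le_norm (a : R) : measurable_fun setT (fun x : Rn R n => `|x : V| <= a).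
Proof.
apply: (@measurable_fun_ler _ _ _ _ (fun x : Rn R n => `|x : V|) (fun=> a)) => //.
by apply: continuous_Rn_measurable; exact: norm_continuous.
Qed.

Lemma bm_if_norm (a u v : R) : bounded_meas (fun x : Rn R n => if `|x : V| <= a then u else v).
Proof.
split; last by exists (`|u| + `|v|) => x; case: ifP => _; rewrite ?lerDl ?lerDr.
by apply: measurable_fun_ifT => //; exact: measurable_le_norm.
Qed.

Lemma sqr_norm_le (v : V) (S : R) : 0 <= S -> (forall i, v i 0 ^+ 2 <= S) -> `|v| ^+ 2 <= S.
Proof.
move=> S0 H; rewrite -[S]sqr_sqrtr// lerXn2r ?nnegrE ?sqrtr_ge0//.
apply: norm_col_le; first exact: sqrtr_ge0.
by move=> i; rewrite -sqrtr_sqr ler_wsqrtr.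
Qed.

Lemma sqr_norm_nrm2 (v : V) : `|v| ^+ 2 <= nrm2 v.
Proof.
apply: sqr_norm_le => [|i]; first exact: nrm2_ge0.
by rewrite /nrm2 (bigD1 i)//= lerDl sumr_ge0// => j _; exact: sqr_ge0.
Qed.

End norms.

(** * Taylor remainders for bounded increments *)

Section remainder.
Context (R : realType) (n : nat).
Local Notation V := 'cV[R]_n.
Implicit Types (F : fn R n) (x d : V).

Lemma loc_bounded_d1 F (M K : R) : C2 F -> 0 < M -> 0 <= K ->
  exists2 C : R, 0 <= C & forall x d, `|x| <= M -> `|d| <= K -> `|d1 F x d| <= C.
Proof.
move=> [_ hg _ _] M0 K0.
have H i : exists C : R, 0 <= C /\ forall x, `|x| <= M -> `|gr F x i| <= C.
  by have [C C0 HC] := hg i M M0; exists C.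
have [C HC] := choice H.
exists (\sum_i C i * K); first by apply: sumr_ge0 => i _; rewrite mulr_ge0//; have [] := HC i.
move=> x d xM dK; apply: le_trans (ler_norm_sum _ _ _) _; apply: ler_sum => i _.
by rewrite normrM ler_pM//; [have [_] := HC i; exact|exact: le_trans (mxcoord_le _ _) dK].
Qed.

Lemma loc_bounded_d2 F (M K : R) : C2 F -> 0 < M -> 0 <= K ->
  exists2 C : R, 0 <= C & forall x d, `|x| <= M -> `|d| <= K -> `|d2 F x d| <= C.
Proof.
move=> [_ _ hh _] M0 K0.
have H (p : 'I_n * 'I_n) : exists C : R, 0 <= C /\ forall x, `|x| <= M -> `|hs F x p.1 p.2| <= C.
  by have [C C0 HC] := hh p.1 p.2 M M0; exists C.
have [C HC] := choice H.
exists (\sum_i \sum_j C (i, j) * K * K).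
  by apply: sumr_ge0 => i _; apply: sumr_ge0 => j _; rewrite !mulr_ge0//; have [] := HC (i, j).
move=> x d xM dK; apply: le_trans (ler_norm_sum _ _ _) _; apply: ler_sum => i _.
apply: le_trans (ler_norm_sum _ _ _) _; apply: ler_sum => j _; rewrite !normrM.
have dk l : `|d l 0| <= K by exact: le_trans (mxcoord_le _ _) dK.
by rewrite ler_pM// ?mulr_ge0// ler_pM//; have [_] := HC (i, j); exact.
Qed.

(** Clipped increments are bounded but not small. Beyond the radius f of the Taylor estimate the
    remainder is merely bounded, hence at most a constant times |d|^4 / f^4, whose expectation is
    O(h^2). *)
Lemma rem2_bound F (M K e : R) : C2 F -> 0 < M -> 0 < K -> 0 < e ->
  exists2 C : R, 0 <= C & forall x d, `|x| <= M -> `|d| <= K -> rem2 F x d <= e * `|d| ^+ 2 + C * `|d| ^+ 4.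
Proof.
move=> cF M0 K0 e0; have [lb _ _ sr] := cF.
have [f f0 Hf] := sr M e M0 e0; have [C0 C00 HC0] := lb _ (addr_gt0 M0 K0).
have [C1 C10 HC1] := loc_bounded_d1 cF M0 (ltW K0); have [D2 D20 HD2] := loc_bounded_d2 cF M0 (ltW K0).
pose C3 := C0 + C0 + C1 + D2; have C30 : 0 <= C3 by rewrite /C3 !addr_ge0.
exists (C3 / f ^+ 4); first by rewrite divr_ge0// exprn_ge0// ltW.
move=> x d xM dK; have d40 : 0 <= `|d| ^+ 4 by exact: exprn_ge0.
have [df|fd] := leP `|d| f.
  apply: le_trans (ler_norm _) _; apply: le_trans (Hf _ _ xM df) _.
  by rewrite lerDl mulr_ge0// divr_ge0// exprn_ge0// ltW.
apply: (@le_trans _ _ C3).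
  have xdM : `|x + d| <= M + K by rewrite (le_trans (ler_normD _ _))// lerD.
  have xM' : `|x| <= M + K by rewrite (le_trans xM)// lerDl ltW.
  move: (HC0 _ xdM) (HC0 _ xM') (HC1 _ _ xM dK) (HD2 _ _ xM dK); rewrite !ler_norml /rem2 /C3.
  by do 4 move=> /andP[? ?]; lra.
apply: (@le_trans _ _ (C3 / f ^+ 4 * `|d| ^+ 4)); last by rewrite lerDr mulr_ge0 ?(ltW e0)// exprn_ge0.
by rewrite mulrAC ler_pdivlMr ?exprn_gt0// ler_wpM2l// lerXn2r ?nnegrE// ltW.
Qed.

Lemma C2_cont F : C2 F -> continuous (fv F).
Proof.
move=> cF x; apply: eps_cont => e e0.
have [_ _ _ sr] := cF.
have x0 : 0 < `|x| + 1 by rewrite ltr_wpDl.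
have Hb : @remO R n 1 (fun x d => d1 F x d + (d2 F x d * 2^-1 + rem2 F x d)).
  apply: remOD (C2_big1 cF) _; apply: remOD; last exact: remO_leq (remo_remO sr).
  apply: (remO_leq (k := 2)) => //.
  by have := remOM (C2_big2 cF) (loc_bounded_remO (@loc_bounded_cst R n 2^-1)); rewrite addn0.
have [C [f [C0 f0 H]]] := Hb _ x0.
exists (Num.min f (e / (C + 1))); first by rewrite lt_min f0 divr_gt0// ltr_wpDl.
move=> y; rewrite lt_min => /andP[yf ye].
have := H x (y - x) _ _; rewrite lerDl ler01 distrC (ltW yf) expr1 => /(_ isT isT).
have -> : d1 F x (y - x) + (d2 F x (y - x) / 2 + rem2 F x (y - x)) = fv F y - fv F x.
  by rewrite /rem2 addrC [x + _]addrC subrK; field.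
rewrite [X in X <= _ -> _]distrC => H1; apply: le_trans H1 _.
move: ye; rewrite ltr_pdivlMr ?ltr_wpDl// => ye.
have : 0 <= `|x - y| by []. by move: (`|x - y|) ye => z; lra.
Qed.

End remainder.

Lemma step_arith (R : realFieldType) (fx d1 s1 s2 A2 A4 A4' B4 B4' D D' S e h : R) :
  s1 <= h * s2 + S -> A2 <= h * 2^-1 -> A4 <= A4' -> B4 <= B4' -> D <= D' ->
  D' / 2 + S / 2 + e + (B4' + A4') <= h * 2^-1 ->
  fx + h * d1 + (2^-1 * (D + s1) + (e + A2 + (B4 + A4))) <= fx + h * (d1 + s2 / 2 + 1).
Proof. lra. Qed.

Section one_step.
Context (R : realType) (n : nat) d (Omega : measurableType d) (P : probability Omega R).
Variables (W : 'I_n -> R -> {RV P >-> R}).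
Hypothesis hW : indep_brownian_motions W.
Local Notation V := 'cV[R]_n.
Local Notation T := (Rn R n).

Section noise.
Variable h : R.
Hypothesis h0 : 0 < h.

Definition xi (i : 'I_n) (w : Omega) : R := clip1 (incr W h 0 i w).
HB.instance Definition _ k i := isMeasurableFun.Build _ _ _ _ (incr W h k i) (measurable_incr W h k i).

Lemma bm_xi i : bounded_meas (xi i).
Proof.
split; last by exists 1 => w; exact: clip1_bound.
by apply: measurableT_comp; [exact: measurable_clip1|exact: measurable_incr].
Qed.

Lemma bm_xiX i k : bounded_meas (fun w => xi i w ^+ k).
Proof.
elim: k => [|k IH]; first exact: (bm_cst _ (1 : R)).
have -> : (fun w => xi i w ^+ k.+1) = (fun w => xi i w * xi i w ^+ k) by apply/funext => w; rewrite exprS.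
exact: bmM (bm_xi i) IH.
Qed.

Lemma mean_xi i : \int[P]_w xi i w = 0.
Proof.
by rewrite /Rintegral (clip1_mean0 h0 (X := incr W h 0 i))// => U mU; exact: incr_law.
Qed.

Lemma mean_xi2 i : h * gauss2 R - h ^+ 2 * gauss4 R <= \int[P]_w (xi i w ^+ 2) <= h * gauss2 R.
Proof. by apply: (clip1_moment2 h0 (X := incr W h 0 i)) => U mU; exact: incr_law. Qed.

Lemma mean_xi4 i : \int[P]_w (xi i w ^+ 4) <= h ^+ 2 * gauss4 R.
Proof. by apply: (clip1_moment4 h0 (X := incr W h 0 i)) => U mU; exact: incr_law. Qed.

Lemma mean_xiM i j : i != j -> \int[P]_w (xi i w * xi j w) = 0.
Proof.
move=> ij; have bt : bounded_meas (fun z : R * R => clip1 z.1 * clip1 z.2).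
  apply: bmM; (split; last by exists 1 => z; exact: clip1_bound).
    by apply: measurableT_comp; [exact: measurable_clip1|exact: measurable_fst].
  by apply: measurableT_comp; [exact: measurable_clip1|exact: measurable_snd].
have H A B : measurable A -> measurable B -> P (incr W h 0 i @^-1` A `&` incr W h 0 j @^-1` B) =
    (P (incr W h 0 i @^-1` A) * P (incr W h 0 j @^-1` B))%E.
  move=> mA mB; pose E (k : nat) l := if l == i then A else if l == j then B else setT.
  have ji : (j == i) = false by rewrite eq_sym (negbTE ij).
  have -> : incr W h 0 i @^-1` A `&` incr W h 0 j @^-1` B = path_event W h 1 E.
    apply/seteqP; split => [w [/= HA HB] [|//] _ l|w H].
      by rewrite /E; case: eqP => [->//|_]; case: eqP => // ->.
    split; first by have := H 0%N isT i; rewrite /E eqxx.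
    by have := H 0%N isT j; rewrite /E eqxx ji.
  rewrite path_eventP//; last by move=> k l; rewrite /E; do 2 case: ifP => //.
  rewrite (bigD1 i)//= (bigD1 j) 1?eq_sym//= !big_ord1 /E eqxx ji eqxx big1 ?mule1// => l /andP[li lj].
  by rewrite big_ord1 (negbTE li) (negbTE lj) preimage_setT; exact: probability_setT.
have := bounded_joint_law H bt; rewrite /= => ->.
rewrite [RHS](_ : 0 = \int[P]_w (0 : R)); last by rewrite mean_cst.
apply: eq_Rintegral => w _; rewrite (meanZ P _ (bm_xi j)).
by rewrite -[X in _ * X]/(\int[P]_x xi j x) mean_xi mulr0.
Qed.

End noise.

Variables (b : V -> V) (q : 'I_n -> R).
Hypothesis cb : continuous b.
Local Notation w_ := (fun i => Num.sqrt (gauss2 R) * q i).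

(* An Euler step with increments clipped to [-1, 1], frozen outside the ball of
   radius [M]: the chain is bounded and all moments are trivially finite. *)
Definition stp (h M : R) (z : T * T) : T :=
  ((z.1 : V) + (if `|z.1 : V| <= M then 1 else 0) *:
     (h *: b z.1 + \col_i (q i * clip1 ((z.2 : V) i 0))) : V).

Lemma measurable_stp h M : measurable_fun setT (stp h M).
Proof.
apply: measurable_col => i.
have -> : (fun z : T * T => (stp h M z : V) i 0) = (fun z : T * T => (z.1 : V) i 0 +
    (if `|z.1 : V| <= M then 1 else 0) * (h * b z.1 i 0 + q i * clip1 ((z.2 : V) i 0))).
  by apply/funext => z; rewrite /stp !mxE.
have mc j : measurable_fun setT (fun z : T * T => (z.1 : V) j 0).
  by apply: (measurableT_comp (measurable_coord j) (g := fst)); exact: measurable_fst.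
apply: measurable_funD => //; apply: measurable_funM.
  have [ml _] := @bm_if_norm R n M 1 0.
  by apply: (measurableT_comp ml (g := fst)); exact: measurable_fst.
apply: measurable_funD; apply: measurable_funM => //.
  apply: (@measurableT_comp _ _ _ _ _ _ (fun x : T => b x i 0) _ fst); last exact: measurable_fst.
  apply: continuous_Rn_measurable => x; apply: (@continuous_comp _ _ _ b (fun M : V => M i 0)); first exact: cb.
  exact: coord_continuous.
apply: measurableT_comp; first exact: measurable_clip1.
by apply: (measurableT_comp (measurable_coord i) (g := snd)); exact: measurable_snd.
Qed.

Lemma stp_in h M (x : T) w : `|x : V| <= M ->
  stp h M (x, dW W h 0 w) = (x : V) + (h *: b x + \col_i (q i * xi h i w)) :> V.
Proof.
move=> xM; rewrite /stp /= xM scale1r; congr (_ + (_ + _)).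
by apply/colP => i; rewrite !mxE.
Qed.

(** For k = 2 and k = 4, a bound for the k-th power of an Euler increment with an explicit
    expectation; by convexity the factor 8 = 2^3 serves both exponents. *)
Definition sizes (B h : R) (t : 'I_n -> R) (k : nat) : R :=
  8 * (B * h) ^+ k + 8 * (\sum_i `|q i|) ^+ k * \sum_i t i ^+ k.

Lemma step_size (B h : R) (x : V) (t : 'I_n -> R) : `|b x| <= B -> 0 <= h ->
  let e := h *: b x + \col_i (q i * t i) in
  `|e| ^+ 2 <= sizes B h t 2 /\ `|e| ^+ 4 <= sizes B h t 4.
Proof.
move=> bB h0 e; set Q := \sum_i `|q i|.
have Q0 : 0 <= Q by apply: sumr_ge0.
have B0 : 0 <= B by exact: le_trans bB.
pose v : V := \col_i t i.
have eN : `|e| <= B * h + Q * `|v|.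
  apply: le_trans (ler_normD _ _) _; rewrite lerD//.
    by rewrite normrZ mulrC (ger0_norm h0) ler_wpM2r.
  apply: norm_col_le; first by rewrite mulr_ge0.
  move=> i; rewrite mxE normrM ler_pM//; first by rewrite /Q (bigD1 i)//= lerDl sumr_ge0.
  by have := mxcoord_le v i; rewrite mxE.
have v2 : `|v| ^+ 2 <= \sum_i t i ^+ 2.
  apply: sqr_norm_le => [|i]; first by apply: sumr_ge0 => i _; exact: sqr_ge0.
  by rewrite mxE (bigD1 i)//= lerDl sumr_ge0// => j _; exact: sqr_ge0.
have t40 i : 0 <= t i ^+ 4 by rewrite -[4%N]/(2 * 2)%N exprM sqr_ge0.
have v4 : `|v| ^+ 4 <= \sum_i t i ^+ 4.
  have s40 : 0 <= \sum_i t i ^+ 4 by exact: sumr_ge0.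
  rewrite -[4%N in X in X <= _]/(2 * 2)%N exprM -[leRHS]sqr_sqrtr// lerXn2r ?nnegrE ?sqrtr_ge0 ?sqr_ge0//.
  apply: sqr_norm_le => [|i]; first exact: sqrtr_ge0.
  rewrite mxE -[leLHS]ger0_norm ?sqr_ge0// -sqrtr_sqr ler_wsqrtr// -exprM.
  by rewrite (bigD1 i)//= lerDl sumr_ge0.
have Bh : 0 <= B * h by rewrite mulr_ge0.
have Qv : 0 <= Q * `|v| by rewrite mulr_ge0.
rewrite /sizes -/Q; split.
  apply: (@le_trans _ _ ((B * h + Q * `|v|) ^+ 2)).
    by rewrite lerXn2r ?nnegrE// addr_ge0.
  apply: (@le_trans _ _ (8 * (B * h) ^+ 2 + 8 * (Q * `|v|) ^+ 2)).
    by move: (B * h) (Q * _) => a c; have := sqr_ge0 (a - c); have := sqr_ge0 a; have := sqr_ge0 c; nra.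
  by rewrite lerD2l exprMn mulrA ler_wpM2l// mulr_ge0// sqr_ge0.
apply: (@le_trans _ _ ((B * h + Q * `|v|) ^+ 4)).
  by rewrite lerXn2r ?nnegrE// addr_ge0.
apply: (@le_trans _ _ (8 * (B * h) ^+ 4 + 8 * (Q * `|v|) ^+ 4)).
  move: (B * h) (Q * _) => a c; have H (y z : R) : (y + z) ^+ 2 <= 2 * y ^+ 2 + 2 * z ^+ 2.
    by have := sqr_ge0 (y - z); nra.
  rewrite -[4%N]/(2 * 2)%N !exprM.
  apply: (@le_trans _ _ ((2 * a ^+ 2 + 2 * c ^+ 2) ^+ 2)).
    by rewrite lerXn2r ?nnegrE ?sqr_ge0// addr_ge0// mulr_ge0// sqr_ge0.
  by apply: le_trans (H _ _) _; rewrite !exprMn; lra.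
by rewrite lerD2l exprMn mulrA ler_wpM2l// mulr_ge0// exprn_ge0.
Qed.

Section quadratic_expectation.
Variables (h : R) (h0 : 0 < h).

Lemma mean_affine (c s : R) i : \int[P]_w (c + s * xi h i w) = c.
Proof.
have bx := bm_xi h i; rewrite meanD ?mean_cst ?(meanZ P _ bx) ?mean_xi ?mulr0 ?addr0//.
  exact: bm_cst.
exact: bmM (bm_cst _ s) bx.
Qed.

Lemma mean_quad (c c' s s' : R) i j : \int[P]_w ((c + s * xi h i w) * (c' + s' * xi h j w)) =
  c * c' + (if i == j then s * s' * \int[P]_w (xi h i w ^+ 2) else 0).
Proof.
have bx := bm_xi h; have bs a k := bmM (bm_cst _ a) (bx k).
have -> : (fun w => (c + s * xi h i w) * (c' + s' * xi h j w)) =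
   (fun w => (c * c' + (c * s') * xi h j w) + (((c' * s) * xi h i w) + (s * s') * (xi h i w * xi h j w))).
  by apply/funext => w; ring.
have bb := bmM (bx i) (bx j).
have b1 : bounded_meas (fun w => c * c' + (c * s') * xi h j w) by apply: bmD; [exact: bm_cst|exact: bs].
have b2 : bounded_meas (fun w => (s * s') * (xi h i w * xi h j w)) by exact: bmM (bm_cst _ _) bb.
rewrite (meanD P b1); last exact: bmD.
rewrite mean_affine (meanD P (bs _ _) b2) !meanZ// mean_xi// mulr0 add0r.
case: eqP => [->|/eqP ij]; last by rewrite mean_xiM// mulr0.
by congr (_ + _ * _); apply: eq_Rintegral => w _; rewrite expr2.
Qed.

Lemma mean_sizes (B : R) k : \int[P]_w sizes B h (xi h ^~ w) k =
  8 * (B * h) ^+ k + 8 * (\sum_i `|q i|) ^+ k * \sum_i \int[P]_w (xi h i w ^+ k).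
Proof.
have bs : bounded_meas (fun w => \sum_i xi h i w ^+ k) by apply: bm_sum => i; exact: bm_xiX.
rewrite meanD; [|exact: bm_cst|exact: bmM (bm_cst _ _) bs].
by rewrite mean_cst (meanZ P _ bs) mean_sum// => i; exact: bm_xiX.
Qed.

Lemma bm_sizes (B : R) k : bounded_meas (fun w => sizes B h (xi h ^~ w) k).
Proof.
apply: bmD; first exact: bm_cst.
by apply: bmM; [exact: bm_cst|apply: bm_sum => i; exact: bm_xiX].
Qed.

End quadratic_expectation.

(** The substitute for the Ito formula: in the mean of the Taylor expansion, centred uncorrelated
    increments of variance about h [gauss2] reproduce the second-order part of [gen]. All errors fit
    into the slack h. *)
Lemma step_lyapunov (F : fn R n) (M B : R) : C2 F -> 0 < M -> 0 < B ->
  (forall x : V, `|x| <= M -> `|b x| <= B) ->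
  exists2 h1 : R, 0 < h1 & forall h (x : V), 0 < h -> h < h1 -> `|x| <= M ->
    \int[P]_w fv F (stp h M (x, dW W h 0 w)) <= fv F x + h * (gen b w_ F x + 1).
Proof.
move=> cF M0 B0 bB; set Q := \sum_i `|q i|.
have Q0 : 0 <= Q by apply: sumr_ge0.
have g0 := gauss2_gt0 R; have g4 := gauss4_ge0 R.
pose c2 : R := 8 * Q ^+ 2 * n%:R * gauss2 R.
have c20 : 0 <= c2 by rewrite /c2 !mulr_ge0 ?exprn_ge0// ltW.
(* The slack h is split in two: with this e the quadratic part of the Taylor remainder costs at most
   h / 2, and the terms of order h^2, collected in K below, cost the other half once h K <= 1/2. *)
pose e := (2 * (c2 + 1))^-1; have e0 : 0 < e by rewrite invr_gt0; lra.
have ec2 : e * c2 <= 2^-1.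
  by rewrite mulrC ler_pdivrMr; lra.
have K0 : 0 < B + Q by rewrite ltr_wpDr.
have [C C0 HC] := rem2_bound cF M0 K0 e0.
have [D D0 HD] := loc_bounded_d2 cF M0 (ltW B0).
have [_ _ hh _] := cF.
have Hc i : exists c : R, 0 <= c /\ forall x, `|x| <= M -> `|hs F x i i| <= c.
  by have [c cc0 Hc] := hh i i M M0; exists c.
have [H HH] := choice Hc.
pose S := \sum_i H i * q i ^+ 2.
have S0 : 0 <= S by apply: sumr_ge0 => i _; rewrite mulr_ge0 ?sqr_ge0//; have [] := HH i.
pose K := D / 2 + S * gauss4 R / 2 + e * (8 * B ^+ 2) + C * (8 * B ^+ 4 + 8 * Q ^+ 4 * n%:R * gauss4 R).
have K0' : 0 <= K.
  have B2 : 0 <= B ^+ 2 by exact: sqr_ge0.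
  have B4 : 0 <= B ^+ 4 by rewrite exprn_ge0// ltW.
  have Q4 : 0 <= Q ^+ 4 by rewrite exprn_ge0.
  have Qn : 0 <= Q ^+ 4 * n%:R * gauss4 R by rewrite mulr_ge0// mulr_ge0.
  apply: addr_ge0; last by apply: mulr_ge0 => //; move: Qn B4; rewrite -!mulrA; lra.
  apply: addr_ge0; last by rewrite mulr_ge0 ?(ltW e0)// mulr_ge0.
  by apply: addr_ge0; rewrite divr_ge0// mulr_ge0.
exists (Num.min 1 (2 * (K + 1))^-1); first by rewrite lt_min ltr01 invr_gt0; lra.
move=> h x h0; rewrite lt_min => /andP[h1 hK] xM.
have hK' : h * K <= 2^-1.
  have : h * (2 * (K + 1)) < 1 by rewrite -ltr_pdivlMr ?div1r//; lra.
  by rewrite mulrCA -ltr_pdivlMl// mulr1 => /ltW H2; apply: le_trans H2; rewrite ler_pM2l// lerDl.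
pose t w i := xi h i w.
pose del w : V := h *: b x + \col_i (q i * xi h i w).
pose Z1 w := \sum_i gr F x i * (h * b x i 0 + q i * xi h i w).
pose Z2 w := \sum_i \sum_j hs F x i j * ((h * b x i 0 + q i * xi h i w) * (h * b x j 0 + q j * xi h j w)).
pose Z w := (fv F x + Z1 w) + (2^-1 * Z2 w + (e * sizes B h (xi h ^~ w) 2 + C * sizes B h (xi h ^~ w) 4)).
have baf i : bounded_meas (fun w => h * b x i 0 + q i * xi h i w).
  by apply: bmD; [exact: bm_cst|exact: bmM (bm_cst _ _) (bm_xi h i)].
have b1 : bounded_meas Z1 by apply: bm_sum => i; exact: bmM (bm_cst _ _) (baf i).
have b2' i j : bounded_meas (fun w => hs F x i j * ((h * b x i 0 + q i * xi h i w) * (h * b x j 0 + q j * xi h j w))).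
  by apply: bmM (bm_cst _ _) _; exact: bmM.
have b2 : bounded_meas Z2 by apply: bm_sum => i; apply: bm_sum => j.
have bs k a : bounded_meas (fun w => a * sizes B h (xi h ^~ w) k) by apply: bmM (bm_cst _ _) _; exact: bm_sizes.
have bF1 : bounded_meas (fun w => fv F x + Z1 w) by apply: bmD => //; exact: bm_cst.
have bs' : bounded_meas (fun w => e * sizes B h (xi h ^~ w) 2 + C * sizes B h (xi h ^~ w) 4) by exact: bmD.
have bZ2 : bounded_meas (fun w => 2^-1 * Z2 w) by apply: bmM => //; exact: bm_cst.
have bZ : bounded_meas Z by apply: bmD => //; exact: bmD.
have dE w i : del w i 0 = h * b x i 0 + q i * xi h i w by rewrite !mxE.
have dn w : `|del w| <= B + Q.
  apply: norm_col_le; first exact: ltW.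
  move=> i; rewrite dE; apply: le_trans (ler_normD _ _) _; rewrite (normrM h) (normrM (q i)) lerD//.
    rewrite (ger0_norm (ltW h0)) -[leRHS]mul1r ler_pM// ?(ltW h0) ?(ltW h1)//.
    exact: le_trans (mxcoord_le _ _) (bB _ xM).
  rewrite -[leRHS]mulr1 ler_pM// ?clip1_bound// /Q (bigD1 i)//= lerDl sumr_ge0//.
have pt w : fv F (x + del w) <= Z w.
  have := HC x (del w) xM (dn w); have [s2 s4] := @step_size B h x (xi h ^~ w) (bB _ xM) (ltW h0).
  have E1 : d1 F x (del w) = Z1 w by apply: eq_bigr => i _; rewrite dE.
  have E2 : d2 F x (del w) = Z2 w by apply: eq_bigr => i _; apply: eq_bigr => j _; rewrite (dE w i) (dE w j) -[LHS]mulrA.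
  rewrite /rem2 E1 E2 /Z -/(del w) in s2 s4 *.
  have := ler_wpM2l (ltW e0) s2; have := ler_wpM2l C0 s4.
  move: (fv F (x + del w)) (fv F x) (Z1 w) (Z2 w) (e * _) (C * _) (e * _) (C * _) => *; lra.
have [lb _ _ _] := cF; have [C' C'0 HC'] := lb _ (addr_gt0 M0 K0).
have EF : (fun w => fv F (x + del w)) = (fun w => fv F (stp h M (x, dW W h 0 w))).
  by apply/funext => w; rewrite stp_in.
have bFs : bounded_meas (fun w => fv F (x + del w)).
  split.
    rewrite EF; apply: (measurableT_comp (f := fv F : T -> R)).
      by apply: continuous_Rn_measurable; exact: C2_cont.
    apply: (measurableT_comp (measurable_stp h M) (g := fun w => (x : T, dW W h 0 w))).
    apply: measurable_fun_pair; [exact: measurable_cst|exact: measurable_dW].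
  exists C' => w; apply: HC'; apply: le_trans (ler_normD _ _) _; rewrite lerD// dn.
have -> : \int[P]_w fv F (stp h M (x, dW W h 0 w)) = \int[P]_w fv F (x + del w).
  by apply: eq_Rintegral => w _; rewrite stp_in.
have le1 : \int[P]_w fv F (x + del w) <= \int[P]_w Z w.
  exact: mean_le.
apply: le_trans le1 _.
have E1 : \int[P]_w Z1 w = h * d1 F x (b x).
  rewrite mean_sum; last by move=> i; exact: bmM (bm_cst _ _) (baf i).
  rewrite /d1 mulr_sumr; apply: eq_bigr => i _.
  by rewrite (meanZ P _ (baf i)) mean_affine// mulrCA.
have E2 : \int[P]_w Z2 w = h ^+ 2 * d2 F x (b x) + \sum_i hs F x i i * q i ^+ 2 * \int[P]_w (xi h i w ^+ 2).
  rewrite mean_sum; last by move=> i; apply: bm_sum => j.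
  rewrite /d2 mulr_sumr -big_split /=; apply: eq_bigr => i _.
  rewrite mean_sum; last by move=> j.
  transitivity (\sum_j (h ^+ 2 * (hs F x i j * b x i 0 * b x j 0) +
     (if j == i then hs F x i i * q i ^+ 2 * \int[P]_w (xi h i w ^+ 2) else 0))).
    apply: eq_bigr => j _; rewrite (meanZ P _ (bmM (baf i) (baf j))) mean_quad//.
    by rewrite [j == i]eq_sym; case: eqP => [->|_]; ring.
  by rewrite big_split /= -mulr_sumr -big_mkcond big_pred1_eq.
rewrite [leLHS](meanD P bF1 (bmD bZ2 bs')) (meanD P (bm_cst _ (fv F x)) b1) mean_cst (meanD P bZ2 bs').
rewrite (meanZ P _ b2) (meanD P (bs 2%N e) (bs 4%N C)) !(meanZ P _ (bm_sizes h B _)) !mean_sizes E1 E2 -/Q.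
have s2 : \sum_i \int[P]_w (xi h i w ^+ 2) <= n%:R * (h * gauss2 R).
  apply: (@le_trans _ _ (\sum_(i < n) h * gauss2 R)).
    by apply: ler_sum => i _; have /andP[] := mean_xi2 h0 i.
  by rewrite sumr_const card_ord mulr_natl.
have s4 : \sum_i \int[P]_w (xi h i w ^+ 4) <= n%:R * (h ^+ 2 * gauss4 R).
  apply: (@le_trans _ _ (\sum_(i < n) h ^+ 2 * gauss4 R)).
    by apply: ler_sum => i _; exact: mean_xi4.
  by rewrite sumr_const card_ord mulr_natl.
have s2' : \sum_i hs F x i i * q i ^+ 2 * \int[P]_w (xi h i w ^+ 2) <=
     h * (\sum_i w_ i ^+ 2 * hs F x i i) + S * (h ^+ 2 * gauss4 R).
  rewrite mulr_sumr mulr_suml -big_split /=; apply: ler_sum => i _.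
  rewrite exprMn sqr_sqrtr ?(ltW g0)//.
  have [Hi0 /(_ x xM)] := HH i; rewrite ler_norml => /andP[Hl Hu].
  have /andP[xl xu] := mean_xi2 h0 i; have qq := sqr_ge0 (q i).
  have : (hs F x i i) * (\int[P]_w (xi h i w ^+ 2) - h * gauss2 R) <= H i * (h ^+ 2 * gauss4 R).
    have hg : 0 <= h ^+ 2 * gauss4 R by rewrite mulr_ge0 ?sqr_ge0.
    move: (hs F x i i) (H i) (Rintegral _ _ _) (h * gauss2 R) (h ^+ 2 * _) Hi0 Hl Hu xl xu hg.
    by clear => *; nra.
  move=> /(ler_wpM2l qq); rewrite (mulrC (H i) (q i ^+ 2)) -(mulrA (q i ^+ 2)).
  set I := \int[P]_w (xi h i w ^+ 2) => H2.
  have -> : hs F x i i * q i ^+ 2 * I =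
      h * (gauss2 R * q i ^+ 2 * hs F x i i) + q i ^+ 2 * (hs F x i i * (I - h * gauss2 R)) by ring.
  by rewrite lerD2l.
have dB : d2 F x (b x) <= D by apply: le_trans (ler_norm _) _; apply: HD => //; exact: bB.
have h2 : 0 <= h ^+ 2 by exact: sqr_ge0.
have hh4 : h ^+ 4 <= h ^+ 2 by rewrite ler_wiXn2l// ltW.
rewrite /gen !exprMn.
have B4 : 0 <= B ^+ 4 by rewrite exprn_ge0// ltW.
have I1 : e * (8 * Q ^+ 2 * \sum_i \int[P]_w (xi h i w ^+ 2)) <= h * 2^-1.
  apply: (@le_trans _ _ (e * (8 * Q ^+ 2 * (n%:R * (h * gauss2 R))))).
    by rewrite ler_wpM2l ?(ltW e0)// ler_wpM2l// mulr_ge0 ?sqr_ge0.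
  have -> : e * (8 * Q ^+ 2 * (n%:R * (h * gauss2 R))) = h * (e * c2) by rewrite /c2; ring.
  by rewrite ler_wpM2l// ltW.
have I2 : C * (8 * Q ^+ 4 * \sum_i \int[P]_w (xi h i w ^+ 4)) <= C * (8 * Q ^+ 4 * (n%:R * (h ^+ 2 * gauss4 R))).
  by rewrite ler_wpM2l// ler_wpM2l// mulr_ge0// exprn_ge0.
have I3 : C * (8 * (B ^+ 4 * h ^+ 4)) <= C * (8 * (B ^+ 4 * h ^+ 2)).
  by rewrite ler_wpM2l// ler_wpM2l// ler_wpM2l.
have I4 : h ^+ 2 * d2 F x (b x) <= h ^+ 2 * D by rewrite ler_wpM2l.
have I5 : h * (h * K) <= h * 2^-1 by rewrite ler_wpM2l// ltW.
have I6 : h * (h * K) = h ^+ 2 * D / 2 + S * (h ^+ 2 * gauss4 R) / 2 + e * (8 * (B ^+ 2 * h ^+ 2)) +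
   (C * (8 * (B ^+ 4 * h ^+ 2)) + C * (8 * Q ^+ 4 * (n%:R * (h ^+ 2 * gauss4 R)))).
  by rewrite /K; ring.
rewrite !(mulrDr e) !(mulrDr C).
rewrite I6 in I5; exact: step_arith s2' I1 I2 I3 I4 I5.
Qed.

End one_step.

(** * Occupation of the Euler chain *)

Lemma energy_arith (R : realFieldType) (a e s z h c C N F : R) :
  a + h * c * s <= F + N * h * C -> e <= a + h * (C - c * z) ->
  e + h * c * (s + z) <= F + (N + 1) * h * C.
Proof. lra. Qed.

Section occupation.
Context (R : realType) (n : nat) d (Omega : measurableType d) (P : probability Omega R).
Variables (W : 'I_n -> R -> {RV P >-> R}).
Hypothesis hW : indep_brownian_motions W.
Local Notation V := 'cV[R]_n.
Local Notation T := (Rn R n).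
Variables (b : V -> V) (q : 'I_n -> R) (h M : R).
Hypotheses (cb : continuous b) (h0 : 0 < h) (h1 : h <= 1) (M0 : 0 < M).
Local Notation st := (stp b q h M).
Local Notation U k := (chain W h st (0 : V) k).

Variables (B : R) (F : fn R n) (r : V -> R) (c C C1 L : R).
Hypotheses (bB : forall x : V, `|x| <= M -> `|b x| <= B) (cF : C2 F).
Hypotheses (cr : continuous r) (r0 : forall x, 0 <= r x) (c0 : 0 < c) (C0 : 0 <= C) (L0 : 0 <= L).
Hypothesis drift : forall x : V, `|x| <= M ->
  \int[P]_w fv F (st (x, dW W h 0 w)) <= fv F x + h * (C - c * r x).
Hypothesis coer : forall x, nrm2 x <= fv F x + C1.

Let Q := \sum_i `|q i|.
Let Q0 : 0 <= Q. Proof. exact: sumr_ge0. Qed.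
Let B0 : 0 <= B. Proof. by apply: le_trans (bB (x := 0) _) => //; rewrite normr0 ltW. Qed.
Let K := M + (B + Q).
Let MK : M <= K. Proof. by rewrite /K lerDl addr_ge0. Qed.

Lemma stp_ball (z : T * T) : `|z.1 : V| <= K -> `|st z : V| <= K.
Proof.
move=> zK; rewrite /stp; case: ifPn => zM; last by rewrite scale0r addr0.
rewrite scale1r; apply: le_trans (ler_normD _ _) _; rewrite lerD//.
apply: norm_col_le; first exact: addr_ge0.
move=> i; rewrite !mxE; apply: le_trans (ler_normD _ _) _; rewrite (normrM h) (normrM (q i)) lerD//.
  rewrite (ger0_norm (ltW h0)) -[leRHS]mul1r ler_pM// ?(ltW h0)//.
  exact: le_trans (mxcoord_le _ _) (bB zM).
by rewrite -[leRHS]mulr1 ler_pM// ?clip1_bound// /Q (bigD1 i)//= lerDl sumr_ge0.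
Qed.

Lemma chain_ball k w : `|U k w : V| <= K.
Proof.
elim: k => [|k IH] /=; first by rewrite normr0 (le_trans (ltW M0)).
exact: stp_ball.
Qed.

(** A step from the ball of radius M moves by at most B + Q, and outside that ball the chain is
    frozen. It never leaves the ball of radius K, so this truncation makes F bounded without
    changing it along the chain. *)
Definition FK (x : T) : R := if `|x : V| <= K then fv F x else 0.

Lemma bm_FK : bounded_meas FK.
Proof.
have [lb _ _ _] := cF; have [D D0 HD] := lb K (lt_le_trans M0 MK).
split; last by exists D => x; rewrite /FK; case: ifP => [/HD //|_]; rewrite normr0.
apply: measurable_fun_ifT => //; first exact: measurable_le_norm.
by apply: continuous_Rn_measurable; exact: C2_cont.
Qed.

Let mst := measurable_stp q cb h M.
Let bmU (g : T -> R) k : bounded_meas g -> bounded_meas (fun w => g (U k w)).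
Proof. by move=> bg; apply: (bm_comp bg); exact: measurable_chain. Qed.

Definition cutr (x : T) : R := Num.min (r x) L.
Definition inM (x : T) : R := if `|x : V| <= M then 1 else 0.
Definition outM (x : T) : R := if `|x : V| <= M then 0 else 1.

Lemma bm_cutr : bounded_meas cutr.
Proof.
split.
  by apply: measurable_minr; [exact: continuous_Rn_measurable|exact: measurable_cst].
by exists L => x; rewrite /cutr ger0_norm ?le_min ?r0// ge_min lexx orbT.
Qed.

Lemma cutr01 x : 0 <= cutr x <= L.
Proof. by rewrite /cutr le_min r0 L0 ge_min lexx orbT. Qed.

Lemma bm_inM : bounded_meas inM.
Proof. exact: bm_if_norm. Qed.

Lemma bm_outM : bounded_meas outM.
Proof. exact: bm_if_norm. Qed.

(** In frozen states the energy neither grows nor dissipates, so the dissipation carries the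
    indicator [inM]. *)
Lemma energy_step k : \int[P]_w FK (U k.+1 w) <=
  \int[P]_w FK (U k w) + h * (C - c * \int[P]_w (inM (U k w) * cutr (U k w))).
Proof.
have bF := bm_FK; have bi := bm_inM; have bg := bm_cutr.
rewrite [leLHS](chain_step hW h0 mst (0 : V) k bF).
have bic : bounded_meas (fun x => inM x * cutr x) by exact: bmM.
have bh : bounded_meas (fun x => h * (C * inM x + - c * (inM x * cutr x))).
  by apply: bmM; [exact: bm_cst|apply: bmD; apply: bmM => //; exact: bm_cst].
apply: (@le_trans _ _ (\int[P]_w (FK (U k w) + h * (C * inM (U k w) + - c * (inM (U k w) * cutr (U k w)))))).
  apply: mean_le.
  - by apply: bmU; exact: bm_step.
  - by apply: bmD; [exact: bmU|exact: (bmU k bh)].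
  move=> w; have xK := chain_ball k w; move: (U k w) xK => x xK.
  rewrite /inM /cutr; case: (leP `|x : V| M) => xM.
    have -> : step_op W h st FK x = \int[P]_w fv F (st (x, dW W h 0 w)).
      by apply: eq_Rintegral => w' _; rewrite /FK stp_ball.
    apply: le_trans (drift xM) _; rewrite /FK xK mulr1 mul1r lerD2l ler_pM2l// lerD2l mulNr lerN2 ler_pM2l//.
    by rewrite ge_min lexx.
  have -> : step_op W h st FK x = FK x.
    rewrite -[RHS](mean_cst P); apply: eq_Rintegral => w' _; rewrite /stp /= leNgt xM /= scale0r addr0//.
  by rewrite mulr0 mul0r mulr0 addr0 mulr0 addr0.
have bi' := bmU k bi; have bic' := bmU k bic; have bh' := bmU k bh.
have bF' := bmU k bF.
rewrite meanD// lerD2l meanZ; last by apply: bmD; apply: bmM => //; exact: bm_cst.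
rewrite ler_pM2l// meanD; [|by apply: bmM => //; exact: bm_cst..].
rewrite !meanZ// mulNr lerD2r -[leRHS]mulr1 ler_wpM2l//.
rewrite -[leRHS](mean_cst P); apply: mean_le => //; first exact: bm_cst.
by move=> w; rewrite /inM; case: ifP.
Qed.

Lemma energy_sum N : \int[P]_w FK (U N w) + h * c * \sum_(k < N) \int[P]_w (inM (U k w) * cutr (U k w)) <=
  fv F 0 + N%:R * h * C.
Proof.
elim: N => [|N IH].
  rewrite big_ord0 mulr0 !addr0 !mul0r addr0 -[leLHS](mean_cst P) mean_cst /=.
  by rewrite mean_cst /FK normr0 (le_trans (ltW M0)).
have := energy_step N; rewrite big_ord_recr /= -natr1.
move: IH; set s := \sum_(k < N) _; set a := \int[P]_w FK (U N w); set e := \int[P]_w FK (U N.+1 w).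
set z := \int[P]_w (inM _ * _) => IH Hs; exact: energy_arith IH Hs.
Qed.

Lemma FK_coer k w : nrm2 (U k w : V) - C1 <= FK (U k w).
Proof. by rewrite /FK chain_ball lerBlDr; exact: coer. Qed.

(** Chebyshev's inequality: in a frozen state the energy is at least M^2 - C1, while its mean grows
    at most linearly in time. *)
Lemma escape k : M ^+ 2 * \int[P]_w outM (U k w) <= fv F 0 + C1 + k%:R * h * C.
Proof.
have bF := bmU k bm_FK; have bo := bmU k bm_outM.
have H : M ^+ 2 * \int[P]_w outM (U k w) <= \int[P]_w (FK (U k w) + C1).
  rewrite -meanZ//; apply: mean_le.
  - by apply: bmM => //; exact: bm_cst.
  - by apply: bmD => //; exact: bm_cst.
  move=> w; have := FK_coer k w; rewrite -lerBlDr; apply: le_trans; rewrite lerD2r /outM.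
  case: ifPn => [_|]; first by rewrite mulr0 nrm2_ge0.
  rewrite -ltNge mulr1 => xM; apply: (@le_trans _ _ (`|U k w : V| ^+ 2)).
    by rewrite lerXn2r ?nnegrE// ltW.
  exact: sqr_norm_nrm2.
apply: le_trans H _; rewrite meanD//; last exact: bm_cst.
rewrite mean_cst addrAC lerD2r; apply: le_trans (energy_sum k); rewrite lerDl.
apply: mulr_ge0; first by rewrite mulr_ge0// ltW.
apply: sumr_ge0 => j _; apply: Rintegral_ge0 => w _; have /andP[g0 _] := cutr01 (U j w).
by apply: mulr_ge0 => //; rewrite /inM; case: ifP.
Qed.

(** The dissipation controls only the unfrozen times. At the others the truncated function is at
    most L, and by [escape] they have probability at most D / M^2. *)
Lemma occupation N D : (0 < N)%N -> D = fv F 0 + C1 + N%:R * h * C ->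
  N%:R^-1 * \sum_(k < N) \int[P]_w cutr (U k w) <= D / (N%:R * h * c) + L * (D / M ^+ 2).
Proof.
move=> N0 DE; have n0 : (0 : R) < N%:R by rewrite ltr0n.
have bi := bm_inM; have bg := bm_cutr; have bo := bm_outM.
have H k : (k < N)%N -> \int[P]_w cutr (U k w) <= \int[P]_w (inM (U k w) * cutr (U k w)) + L * (D / M ^+ 2).
  move=> kN; apply: (@le_trans _ _ (\int[P]_w (inM (U k w) * cutr (U k w) + L * outM (U k w)))).
    apply: mean_le; first exact: bmU.
      by apply: bmD; [exact: bmM (bmU k bi) (bmU k bg)|apply: bmM; [exact: bm_cst|exact: bmU]].
    move=> w; rewrite /inM /outM; case: ifP => _; first by rewrite mul1r mulr0 addr0.
    by rewrite mul0r mulr1 add0r; have /andP[] := cutr01 (U k w).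
  rewrite meanD; [|exact: bmM (bmU k bi) (bmU k bg)|by apply: bmM; [exact: bm_cst|exact: bmU]].
  rewrite lerD2l meanZ; last exact: bmU.
  rewrite ler_wpM2l// ler_pdivlMr ?exprn_gt0// mulrC; apply: le_trans (escape k) _.
  by rewrite DE lerD2l ler_wpM2r// ler_wpM2r ?(ltW h0)// ler_nat ltnW.
have : \sum_(k < N) \int[P]_w cutr (U k w) <=
    \sum_(k < N) \int[P]_w (inM (U k w) * cutr (U k w)) + N%:R * (L * (D / M ^+ 2)).
  rewrite mulr_natl -[in X in _ + _ *+ X](card_ord N) -sumr_const -big_split /=.
  by apply: ler_sum => k _; exact: H.
have E := energy_sum N.
have F0 : - C1 <= \int[P]_w FK (U N w).
  rewrite -[leLHS](mean_cst P); apply: mean_le; [exact: bm_cst|exact: bmU bm_FK|].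
  move=> w; apply: le_trans (FK_coer N w); have := nrm2_ge0 (U N w : V); lra.
have E2 : h * c * \sum_(k < N) \int[P]_w (inM (U k w) * cutr (U k w)) <= D by rewrite DE; lra.
move=> S1; rewrite mulrC ler_pdivrMr// mulrDl; apply: le_trans S1 _.
rewrite (mulrC N%:R) lerD2r; have -> : D / (N%:R * h * c) * N%:R = D / (h * c).
  by field; rewrite !gt_eqF.
by rewrite ler_pdivlMr ?mulr_gt0// mulrC.
Qed.

End occupation.

(** * The Lorenz-96 drift *)

Section drift_properties.
Context (R : realType) (n : nat).
Local Notation V := 'cV[R]_n.
Variable A : 'M[R]_n.
Local Notation b := (lorenz96_drift A).

Let a : R := \sum_i \sum_j `|A i j|.
Let a0 : 0 <= a. Proof. by apply: sumr_ge0 => i _; exact: sumr_ge0. Qed.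

Lemma mulmx_coord_le (x : V) i : `|(A *m x) i 0| <= a * `|x|.
Proof.
rewrite mxE; apply: le_trans (ler_norm_sum _ _ _) _; rewrite mulr_suml [leRHS](bigD1 i)//=.
rewrite -[X in X <= _]addr0 lerD//; last by apply: sumr_ge0 => j _; rewrite mulr_ge0// sumr_ge0.
rewrite mulr_suml; apply: ler_sum => j _; rewrite normrM ler_wpM2l//; exact: mxcoord_le.
Qed.

Lemma lorenz96_loc_lip : loc_lip b.
Proof.
move=> M M0; exists (4 * M + a); first by rewrite addr_ge0// mulr_ge0// ltW.
move=> x y xM yM; apply: norm_col_le; first by rewrite mulr_ge0// addr_ge0// mulr_ge0// ltW.
move=> i; have -> : (b x - b y) i 0 =
   ((x (ordS i) 0 - x (ord_pred (ord_pred i)) 0) * (x - y) (ord_pred i) 0 +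
    ((x - y) (ordS i) 0 - (x - y) (ord_pred (ord_pred i)) 0) * y (ord_pred i) 0) - (A *m (x - y)) i 0.
  by rewrite mulmxBr !mxE; ring.
apply: le_trans (ler_normB _ _) _; rewrite [leRHS]mulrDl lerD ?mulmx_coord_le//.
have cx k : `|x k 0| <= M by exact: le_trans (mxcoord_le _ _) xM.
have cy k : `|y k 0| <= M by exact: le_trans (mxcoord_le _ _) yM.
have cd k : `|(x - y) k 0| <= `|x - y| by exact: mxcoord_le.
apply: le_trans (ler_normD _ _) _; rewrite (normrM (_ - x _ 0)) (normrM (_ - (x - y) _ 0)).
have -> : 4 * M * `|x - y| = (M + M) * `|x - y| + (`|x - y| + `|x - y|) * M by ring.
by rewrite lerD// ler_pM// (le_trans (ler_normB _ _))// lerD.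
Qed.

Lemma lorenz96_growth (x : V) i : `|b x i 0| <= (2 + a) * (1 + `|x| ^+ 2).
Proof.
rewrite driftE; apply: le_trans (ler_normB _ _) _; rewrite normrM.
have H k : `|x k 0| <= `|x| by exact: mxcoord_le.
have H1 : `|x (ordS i) 0 - x (ord_pred (ord_pred i)) 0| * `|x (ord_pred i) 0| <= 2 * `|x| ^+ 2.
  rewrite expr2 mulrA ler_pM// (le_trans (ler_normB _ _))// mulr2n mulrDl mul1r lerD//.
have H2 := mulmx_coord_le x i; have := normr_ge0 x; move: (`|x|) H1 H2 => y H1 H2 y0.
have : y <= 1 + y ^+ 2 by have := sqr_ge0 (y - 1); nra.
by move=> /(ler_wpM2l a0); nra.
Qed.

Hypothesis hA : psd A.
Hypothesis hker : forall u : 'cV[R]_n,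
     A *m u = 0 <-> (forall i : 'I_n, (2 <= i)%N -> u i 0 = 0).

(** Write v . b(v + z) as (v + z) . b(v + z) - z . b(v + z). The first term is nonpositive, since
    only the damping contributes; the second is quadratic in v because z is bounded. *)
Lemma lorenz96_energy_bound : energy_bound b.
Proof.
move=> Z Z0; pose C := n%:R * (Z * ((2 + a) * (2 + 2 * Z ^+ 2))).
have Z2 := sqr_ge0 Z.
have a2 : 0 <= 2 + a by rewrite addr_ge0.
have C0 : 0 <= C by rewrite /C mulr_ge0// mulr_ge0// mulr_ge0// addr_ge0// mulr_ge0.
exists C => // v z zZ.
have -> : \sum_i v i 0 * (b (v + z)) i 0 =
    \sum_i (v + z) i 0 * (b (v + z)) i 0 - \sum_i z i 0 * (b (v + z)) i 0.
  rewrite -sumrB; apply: eq_bigr => i _.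
  by have -> : (v + z) i 0 = v i 0 + z i 0; [rewrite mxE|rewrite mulrDl addrK].
rewrite energy; have [c c0 /(_ (v + z))] := coercive hA hker.
have := Pi_ge0 (v + z); move=> P0 /(le_trans (mulr_ge0 (ltW c0) P0)) H0.
have v2 := sqr_norm_nrm2 v.
have x2 : `|v + z| ^+ 2 <= 2 * nrm2 v + 2 * Z ^+ 2.
  apply: (@le_trans _ _ ((`|v| + Z) ^+ 2)).
    by rewrite lerXn2r ?nnegrE ?addr_ge0// (le_trans (ler_normD _ _))// lerD2l.
  by have := sqr_ge0 (`|v| - Z); move: v2; move: (`|v|) (nrm2 v) => y w; nra.
have N0 := nrm2_ge0 v.
suff H : - \sum_i z i 0 * b (v + z) i 0 <= C * (1 + nrm2 v) by lra.
rewrite -sumrN /C -mulrA mulr_natl -[in X in _ <= _ *+ X](card_ord n) -sumr_const.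
apply: ler_sum => i _; apply: le_trans (ler_norm _) _; rewrite normrN normrM -mulrA.
rewrite ler_pM//; first by rewrite (le_trans (mxcoord_le _ _)).
apply: le_trans (lorenz96_growth _ _) _; rewrite -mulrA ler_wpM2l//.
by have := mulr_ge0 Z2 N0; lra.
Qed.

End drift_properties.

(** * The flow *)

Section uniform_continuity.
Context (R : realType) (n : nat).
Local Notation V := 'cV[R]_n.

Lemma unif_cont (u : R -> V) (T e : R) : continuous u -> 0 < e ->
  exists2 d, 0 < d & forall s t, 0 <= s <= T -> 0 <= t <= T -> `|s - t| <= d -> `|u s - u t| <= e.
Proof.
move=> cu e0; have /compact_near_coveringP H := @segment_compact R 0 T.
have e2 : 0 < e / 2 by rewrite divr_gt0.
have := H R (0^'+) (fun d s => forall t, `|s - t| <= d -> `|u s - u t| <= e) _.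
have loc s : `[0, T]%classic s -> \forall s' \near s & d \near 0^'+,
    (fun d s' => forall t, `|s' - t| <= d -> `|u s' - u t| <= e) d s'.
  move=> _; have [d d0 Hd] := cont_eps (cu s) e2; have d2 : 0 < d / 2 by rewrite divr_gt0.
  exists (ball s (d / 2), [set d' | d' < d / 2]) => /=.
    split; first exact: nbhsx_ballx.
    exact: nbhs_right_lt.
  move=> [s' d'] [/= ss' dd'] t st.
  rewrite -(subrKA (u s)) (splitr e); apply: le_trans (ler_normD _ _) _; rewrite lerD//.
    rewrite distrC; apply: Hd; rewrite (lt_trans ss')// ltr_pdivrMr// mulrDr mulr1 ltrDl//.
  apply: Hd; rewrite -(subrKA s') (le_lt_trans (ler_normD _ _))//.
  by rewrite (splitr d) ltrD// (le_lt_trans st).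
have FF : Filter (0^'+ : set_system R) by typeclasses eauto.
move=> /(_ FF loc) K.
have PF : ProperFilter (0^'+ : set_system R) by typeclasses eauto.
have [d [Hd d0]] := @filter_ex R (0^'+) PF _ (@filterI R (0^'+) FF _ _ K (nbhs_right_gt (0 : R))).
exists d => // s t s0 _ st; exact: Hd.
Qed.

End uniform_continuity.

Lemma within_time_ppart (R : realType) (N : normedModType R) (f : R -> N) :
  {within @time R, continuous f} -> continuous (fun t => f (ppart t)).
Proof.
move=> /subspace_continuousP H t; apply/cvgrPdist_le => e e0.
have pt : @time R (ppart t) by rewrite /time /= in_itv /= ppart_ge0.
have /cvgrPdist_le /(_ e e0) := H _ pt.
rewrite /within /= => /nbhs_ballP[d' d'0 Hd'].
have [d1 d10 Hd1] := cont_eps (@ppart_cont R t) (divr_gt0 d'0 (ltr0n _ 2)).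
exists d1 => // y ty; apply: Hd'; last by rewrite /time /= in_itv /= ppart_ge0.
by rewrite /ball /= (le_lt_trans (Hd1 _ ty))// ltr_pdivrMr// mulrDr mulr1 ltrDl.
Qed.

Section flow.
Context (R : realType) (n : nat) d (Omega : measurableType d) (P : probability Omega R).
Variables (W : 'I_n -> R -> {RV P >-> R}).
Hypothesis hW : indep_brownian_motions W.
Local Notation V := 'cV[R]_n.
Local Notation T := (Rn R n).
Variables (b : V -> V) (q : 'I_n -> R).
Hypotheses (lb : loc_lip b) (eb : energy_bound b).
Let cb : continuous b := loc_lip_cont lb.

Definition good_path (w : Omega) : Prop := forall m,
  W m 0 w = 0 /\ {within @time R, continuous (fun t => W m t w)}.

Lemma good_path_ae : {ae P, forall w, good_path w}.
Proof.
apply: filter_forall => m; have [hB _] := hW; have [h1 h2 _ _] := hB m.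
by apply: filterS2 h1 h2.
Qed.

(** A measurable set of full probability consisting of good paths, fixed because the set of all good
    paths is not shown to be measurable. *)
Variable G0 : set Omega.
Hypotheses (mG0 : measurable G0) (PG0 : P (~` G0) = 0) (G0P : forall w, G0 w -> good_path w).

Definition wpath (w : Omega) (t : R) : V := \col_i W i (ppart t) w.
Definition noise (w : Omega) (t : R) : V := \col_i (q i * W i (ppart t) w).

Lemma wcoord_cont w i : G0 w -> continuous (fun t => W i (ppart t) w).
Proof. by move=> /G0P /(_ i) [_ H]; exact: (@within_time_ppart R R^o (fun t => W i t w) H). Qed.

Lemma wpath_cont w : G0 w -> continuous (wpath w).
Proof.
move=> Gw; apply: cont_col => i.
have -> : (fun t => wpath w t i 0) = (fun t => W i (ppart t) w) by apply/funext => t; rewrite mxE.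
exact: wcoord_cont.
Qed.

Lemma noise_cont w : G0 w -> continuous (noise w).
Proof.
move=> Gw; apply: cont_col => i.
have -> : (fun t => noise w t i 0) = (fun t => q i * W i (ppart t) w) by apply/funext => t; rewrite mxE.
by move=> t; apply: cvgM; [exact: cvg_cst|exact: wcoord_cont].
Qed.

Definition solution (x : V) (w : Omega) : R -> V :=
  xget (fun=> 0) [set u | isol b (fun t => x + noise w t) u].

Lemma solutionP x w : G0 w -> isol b (fun t => x + noise w t) (solution x w).
Proof.
move=> Gw; have [u Hu] := ode_exists x lb eb (noise_cont Gw).
exact: (@xgetPex _ (fun=> 0) [set u | isol b (fun t => x + noise w t) u] (ex_intro _ u Hu)).
Qed.

(* Zero outside the good event, where [solution] is a junk value. *)
Definition flow (t : R) (z : T * Omega) : T := \1_G0 z.2 *: solution z.1 z.2 t.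

Lemma flow_good t x w : G0 w -> flow t (x, w) = solution x w t.
Proof. by move=> Gw; rewrite /flow /= indicE mem_set// scale1r. Qed.

Variables (h_ M_ : nat -> R).
Hypotheses (h_0 : forall j, 0 < h_ j) (h_cvg : h_ @ \oo --> (0 : R)) (M_cvg : M_ @ \oo --> +oo).
Local Notation U j x k w := (chain W (h_ j) (stp b q (h_ j) (M_ j)) x k w).

Definition nsteps (t : R) (j : nat) : nat := Num.truncn (t / h_ j).

Lemma nsteps_bounds t j : 0 <= t ->
  (nsteps t j)%:R * h_ j <= t /\ t - (nsteps t j)%:R * h_ j <= h_ j.
Proof.
move=> t0; have /andP[H1 H2] := Num.Theory.truncn_itv (divr_ge0 t0 (ltW (h_0 j))).
have h0 := h_0 j; split; first by rewrite -ler_pdivlMr.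
move: H2; rewrite -/(nsteps t j) ltr_pdivrMr// -natr1 mulrDl mul1r => H2.
by rewrite lerBlDl ltW.
Qed.

(** On a good path and for large j, uniform continuity keeps the increments below 1 and the radius
    exceeds that of the solution by 1. The chain is then neither clipped nor frozen, and
    [euler_close] applies, also from nearby starting points. *)
Lemma euler_flow t x w e : 0 <= t -> G0 w -> 0 < e ->
  exists2 dl : R, 0 < dl & exists J, forall j (y : V), (J <= j)%N -> `|y - x| < dl ->
    `|(U j y (nsteps t j) w : V) - solution x w t| <= e.
Proof.
move=> t0 Gw e0; have [cu Hu] := solutionP x Gw; set u := solution x w in cu Hu *.
have [M M0 HM] := cont_norm_bounded t cu.
have [L L0 HL] := lb (addr_gt0 M0 ltr01).
pose X := expR (L * t); have X0 : 0 < X by exact: expR_gt0.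
(* The initial error and the accumulated local errors contribute e' each: at most e / 2 in total,
   and at most 1 as the bootstrap requires. The rest of e covers the time lost in rounding t to a
   multiple of the step. *)
pose e' := Num.min (e / 4) 2^-1; have e'0 : 0 < e' by rewrite lt_min divr_gt0//= invr_gt0.
pose om := Num.min (e / 2) (e' / (X * (t * L + 1))).
have tL : 0 <= t * L by exact: mulr_ge0.
have XtL : 0 < X * (t * L + 1) by rewrite mulr_gt0// ltr_wpDl.
have om0 : 0 < om by rewrite lt_min !divr_gt0.
have [d1 d10 Hd1] := unif_cont t cu om0.
have [d2 d20 Hd2] := unif_cont t (wpath_cont Gw) ltr01.
have d12 : 0 < Num.min d1 d2 by rewrite lt_min d10.
have /cvgrPdist_lt /(_ _ d12) [J1 _ HJ1] := h_cvg.
have /cvgryPge /(_ (M + 1)) [J2 _ HJ2] := M_cvg.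
exists (e' / X); first by rewrite divr_gt0.
exists (maxn J1 J2) => j y; rewrite geq_max => /andP[/HJ1 /= j1 /HJ2 /= j2] yx.
move: j1; rewrite sub0r normrN (gtr0_norm (h_0 j)) lt_min => /andP[/ltW hd1 /ltW hd2].
have tX : t * L * om * X <= e'.
  have : om <= e' / (X * (t * L + 1)) by rewrite ge_min lexx orbT.
  rewrite ler_pdivlMr// => H; apply: le_trans H; rewrite mulrC mulrA (mulrC om) ler_wpM2r ?(ltW om0)//.
  by rewrite ler_pM2l// lerDl.
have yX : `|y - x| * X <= e' by rewrite -ler_pdivlMr// ltW.
have small : (`|y - x| + t * L * om) * X <= e' + e' by rewrite mulrDl lerD.
have e2 : e' + e' <= e / 2.
  have : e' <= e / 4 by rewrite ge_min lexx.
  lra.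
have e1 : e' + e' <= 1.
  have : e' <= 2^-1 by rewrite ge_min lexx orbT.
  lra.
have [k1 k2] := nsteps_bounds j t0.
have := @euler_close R n b (noise w) x y u (fun k => U j y k w) (h_ j) t M L om cb cu (h_0 j) L0 (ltW om0) HL.
move=> H.
have {}H : `|(U j y (nsteps t j) w : V) - u ((nsteps t j)%:R * h_ j)| <= (`|y - x| + t * L * om) * X.
  apply: H => //.
  - by move=> s /andP[s0 _]; exact: Hu.
  - apply/colP => i; rewrite !mxE ppart_id//; have /(_ i) [-> _] := G0P Gw; exact: mulr0.
  - by move=> s s' Hs Hs' ss; apply: Hd1 => //; exact: le_trans hd1.
  - move=> k kt ek; have kt' : k%:R * h_ j <= t.
      by apply: le_trans kt; rewrite ler_wpM2r ?(ltW (h_0 j))// ler_nat.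
    have kk : 0 <= k%:R * h_ j by rewrite mulr_ge0// ltW.
    have kk1 : 0 <= k.+1%:R * h_ j by rewrite mulr_ge0// ltW.
    rewrite /= {1}/stp /= (le_trans ek j2) scale1r -addrA; congr (_ + (_ + _)).
    apply/colP => i; rewrite !mxE clip1_id; first by rewrite /incr !ppart_id// mulrBr.
    have := Hd2 (k.+1%:R * h_ j) (k%:R * h_ j).
    rewrite kk kk1 kt kt' => /(_ isT isT) H2; apply: le_trans (H2 _).
      by apply: le_trans (mxcoord_le _ i); rewrite !mxE !ppart_id.
    by rewrite -natr1 mulrDl mul1r addrC addKr (gtr0_norm (h_0 j)).
  - exact: le_trans small e1.
rewrite -(subrKA (u ((nsteps t j)%:R * h_ j))) (splitr e); apply: le_trans (ler_normD _ _) _; rewrite lerD//.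
  exact: le_trans H (le_trans small e2).
apply: (@le_trans _ _ om); last by rewrite ge_min lexx.
apply: Hd1; rewrite ?t0 ?lexx ?k1 ?mulr_ge0 ?(ltW (h_0 j))//.
by rewrite distrC ger0_norm ?subr_ge0//; apply: le_trans k2 hd1.
Qed.

(** Joint measurability in the starting point and the sample is inherited from the chains, whose
    pointwise limit is the flow. *)
Lemma measurable_flow t : 0 <= t -> measurable_fun setT (flow t).
Proof.
move=> t0; apply: measurable_col => i.
pose F j (z : T * Omega) : R := \1_G0 z.2 * (U j z.1 (nsteps t j) z.2 : V) i 0.
apply: (@measurable_fun_cvg _ _ _ setT F).
- move=> j; apply: measurable_funM.
    apply: (measurableT_comp (f := \1_G0 : Omega -> R)); last exact: measurable_snd.
    exact: measurable_indic.
  apply: (measurableT_comp (measurable_coord i)).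
  exact: (measurable_chain2 W (h_ j) (measurable_stp q cb (h_ j) (M_ j))).
- move=> [x w] _; rewrite /F /flow /=; case: (pselect (G0 w)) => Gw; last first.
    rewrite indicE memNset// scale0r mxE.
    by under eq_fun do rewrite mul0r; exact: cvg_cst.
  rewrite indicE mem_set// scale1r.
  apply/cvgrPdist_le => e e0; have [dl dl0 [J HJ]] := euler_flow x t0 Gw e0.
  exists J => // j /= Jj; rewrite mul1r.
  have := HJ j x Jj; rewrite subrr normr0 dl0 => /(_ isT); apply: le_trans.
  by rewrite distrC; apply: le_trans (mxcoord_le _ i); rewrite !mxE.
Qed.

Lemma aeG0 (Q : Omega -> Prop) : (forall w, G0 w -> Q w) -> {ae P, forall w, Q w}.
Proof.
move=> H; exists (~` G0); split => //; first exact: measurableC.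
by move=> w nQ Gw; apply: nQ; exact: H.
Qed.

Lemma measurable_flow1 t (x : T) : 0 <= t -> measurable_fun setT (fun w => flow t (x, w)).
Proof.
by move=> t0; apply: (measurableT_comp (measurable_flow t0) (g := pair x)); exact: measurable_pair1.
Qed.

Lemma flow_solution x : sde_solution b q W x (fun t w => flow t (x, w)).
Proof.
split => [t t0|]; first exact: measurable_flow1.
apply: aeG0 => w Gw; have [cu Hu] := solutionP x Gw.
have E : (fun t => flow t (x, w) : V) = solution x w by apply/funext => t; exact: flow_good.
split; first by rewrite E; exact: continuous_subspaceT.
move=> t t0 m; rewrite flow_good// [in LHS]Hu// !mxE ppart_id// addrAC.
congr (_ + _ + _); apply: eq_Rintegral => s _.
by rewrite flow_good.
Qed.

Lemma flow_unique x u : sde_solution b q W x u ->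
  forall t, 0 <= t -> {ae P, forall w, u t w = flow t (x, w)}.
Proof.
move=> [mu Hu] t t0; have HG := aeG0 (fun w Gw => Gw).
apply: filterS2 HG Hu => w Gw [cu eu]; rewrite flow_good//.
pose v s : V := u (ppart s) w.
suff Hv : isol b (fun t => x + noise w t) v.
  by have := isol_unique lb Hv (solutionP x Gw) t0; rewrite /v ppart_id.
split.
  exact: (@within_time_ppart R V (fun t => u t w) cu).
move=> s s0; apply/colP => i; rewrite /v ppart_id// eu// !mxE ppart_id// addrAC; congr (_ + _ + _).
by apply: eq_Rintegral => r; rewrite inE /= in_itv /= => /andP[r0 _]; rewrite ppart_id.
Qed.

Definition semigroup (t : R) (f : T -> R) (x : T) : R := \int[P]_w f (flow t (x, w)).

Lemma bm_flow t (f : T -> R) : 0 <= t -> bounded_meas f -> bounded_meas (fun z : T * Omega => f (flow t z)).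
Proof. by move=> t0 bf; apply: bm_comp bf _; exact: measurable_flow. Qed.

Lemma bounded_funE (f : T -> R) : bounded_fun f -> exists M : R, forall x, `|f x| <= M.
Proof.
move=> [M [_ HM]]; exists (M + 1) => x; apply: HM => //; by rewrite ltrDl.
Qed.

Lemma semigroupP : sde_semigroup b q W semigroup.
Proof.
move=> x; split; first by exists (fun t w => flow t (x, w)); exact: flow_solution.
move=> u Hu t f t0 mf /bounded_funE bf'; have bf : bounded_meas f by [].
have bfl := bm_section1 (bm_flow t0 bf) x.
rewrite /semigroup EFin_mean// unlock; apply: ae_eq_integral => //.
- by apply/measurable_EFinP; have [] := bfl.
- by apply/measurable_EFinP; apply: measurableT_comp mf _; have [+ _] := Hu; exact.
- by have := flow_unique Hu t0; apply: filterS => w Hw _; rewrite Hw.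
Qed.

(* A failure provides a sequence y_m -> x to which dominated convergence applies. *)
Lemma semigroup_lim t (f : V -> R) (x : V) (e : R) : 0 <= t -> continuous f -> (forall y, 0 <= f y <= 1) ->
  0 < e -> exists2 dl : R, 0 < dl & exists J, forall j (y : V), (J <= j)%N -> `|y - x| < dl ->
    `|\int[P]_w f (U j y (nsteps t j) w) - semigroup t f x| <= e.
Proof.
move=> t0 cf f01 e0; apply: contrapT => H.
have bf : bounded_meas (f : T -> R).
  split; first exact: continuous_Rn_measurable.
  by exists 1 => y; have /andP[f0 f1] := f01 y; rewrite ger0_norm.
have Hm (m : nat) : exists s : nat * V, [/\ (m <= s.1)%N, `|s.2 - x| < m.+1%:R^-1 &
    e < `|\int[P]_w f (U s.1 s.2 (nsteps t s.1) w) - semigroup t f x| ].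
  apply: contrapT => Hn; apply: H; exists m.+1%:R^-1; first by rewrite invr_gt0.
  exists m => j y mj yx; rewrite leNgt; apply/negP => He; apply: Hn; by exists (j, y).
have [s Hs] := choice Hm.
pose F m w := f (U (s m).1 (s m).2 (nsteps t (s m).1) w).
have bU j (y : T) : bounded_meas (fun w => f (U j y (nsteps t j) w)).
  by apply: bm_comp bf _; exact: (measurable_chain W (h_ j) (measurable_stp q cb (h_ j) (M_ j))).
have bF m : bounded_meas (F m) by exact: bU.
have bfl := bm_section1 (bm_flow t0 bf) x.
have [_ _ cvgI] : [/\ P.-integrable setT (fun w => (f (flow t (x : T, w)))%:E),
    ((fun m => \int[P]_w `| (F m w)%:E - (f (flow t (x : T, w)))%:E|)%E @ \oo --> 0%E) &
    ((fun m => \int[P]_w (F m w)%:E)%E @ \oo --> (\int[P]_w (f (flow t (x : T, w)))%:E)%E)].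
  apply: (@dominated_convergence _ _ _ P setT measurableT (fun m w => (F m w)%:E)
    (fun w => (f (flow t (x : T, w)))%:E) (cst 1%E)).
  - by move=> m; apply/measurable_EFinP; have [] := bF m.
  - by apply/measurable_EFinP; have [] := bfl.
  - apply: aeG0 => w Gw _; apply: cvg_EFin; first exact: nearW.
    rewrite flow_good//; apply/cvgrPdist_le => e' e'0.
    have [d1 d10 Hd1] := cont_eps (cf (solution x w t)) e'0.
    have [dl dl0 [J HJ]] := euler_flow x t0 Gw (divr_gt0 d10 (ltr0n _ 2)).
    have [k _ /(_ _ _) Hk] := near_infty_natSinv_lt (PosNum dl0).
    exists (maxn J k) => // m /=; rewrite geq_max => /andP[Jm km]; apply: Hd1.
    have [ms ys _] := Hs m; have yd : `|(s m).2 - x| < dl by apply: lt_trans ys _; exact: Hk.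
    have := HJ _ _ (leq_trans Jm ms) yd; rewrite distrC => /le_lt_trans; apply.
    by rewrite ltr_pdivrMr// mulrDr mulr1 ltrDl.
  - exact: finite_measure_integrable_cst.
  - apply: nearW => w m _ /=; rewrite lee_fin; have /andP[f0 f1] := f01 (U (s m).1 (s m).2 (nsteps t (s m).1) w).
    by rewrite /F ger0_norm.
move: cvgI; rewrite -(EFin_mean P bfl) => /fine_cvg /cvgrPdist_le /(_ e e0) [m _ /(_ m (leqnn m)) /=].
have [_ _] := Hs m; rewrite distrC => /lt_le_trans /[apply].
by rewrite ltxx.
Qed.

End flow.

(** * Limits of occupation measures *)

Section average_law.
Context (R : realType) d (Omega : measurableType d) (P : probability Omega R).
Context d' (T : measurableType d') (X : nat -> {RV P >-> T}) (N : nat).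

Let N0 : 0 <= N.+1%:R^-1 :> R. Proof. by rewrite invr_ge0. Qed.

(** The occupation measure of the times 0, ..., N, that is, the law of X at a uniformly chosen time;
    having N + 1 terms avoids an empty average. *)
Definition avg_law : set T -> \bar R :=
  mscale (NngNum N0) (msum (fun k => distribution P (X k)) N.+1).

HB.instance Definition _ := Measure.on avg_law.

Lemma avg_lawT : avg_law setT = 1%E.
Proof.
rewrite /avg_law /mscale /= /msum /=.
rewrite (eq_bigr (fun=> 1%E)) => [|k _]; last exact: probability_setT.
rewrite sumEFin sumr_const card_ord -EFinM mulVf//.
Qed.

HB.instance Definition _ := Measure_isProbability.Build _ _ _ avg_law avg_lawT.

Lemma avg_law_integral (g : T -> R) : bounded_meas g -> (forall x, 0 <= g x) ->
  \int[avg_law]_x g x = N.+1%:R^-1 * \sum_(k < N.+1) \int[P]_w g (X k w).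
Proof.
move=> bg g0; have mg : measurable_fun setT (fun x => (g x)%:E) by apply/measurable_EFinP; have [] := bg.
rewrite /Rintegral [X in fine X]ge0_integral_mscale//; last by move=> x _; rewrite lee_fin.
rewrite ge0_integral_measure_sum//; last by move=> x _; rewrite lee_fin.
rewrite (eq_bigr (fun k : 'I_N.+1 => (\int[P]_w g (X k w))%:E)); first by rewrite sumEFin.
move=> k _; rewrite ge0_integral_distribution//.
by rewrite EFin_mean//; apply: (bm_comp bg); exact: measurable_funPT.
Qed.

End average_law.

(** * Continuous functions determine a measure *)

Section determined_by_continuous.
Context (R : realType) (n : nat).
Local Notation V := 'cV[R]_n.
Local Notation T := (Rn R n).

(** Continuous approximations of the indicator of a half-line; [None] stands for the absence of a
    constraint. *)
Definition ramp (k : nat) (a : option R) (y : R) : R :=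
  if a is Some a then Num.max 0 (Num.min 1 (k%:R * (y - a))) else 1.

Lemma ramp01 k a y : 0 <= ramp k a y <= 1.
Proof.
case: a => [a|] /=; last by rewrite ler01 lexx.
by rewrite le_max lexx /= ge_max ler01 ge_min lexx.
Qed.

Lemma ramp_cont k a : continuous (ramp k a).
Proof.
case: a => [a|] y; last exact: cvg_cst.
have -> : ramp k (Some a) = (fun=> 0) \max ((fun=> 1) \min (fun y => k%:R * (y - a))) by [].
apply: continuous_max; first exact: cvg_cst.
apply: continuous_min; first exact: cvg_cst.
by apply: cvgM; [exact: cvg_cst|apply: cvgB; [exact: cvg_id|exact: cvg_cst]].
Qed.

Definition above (a : option R) : set R := if a is Some a then `]a, +oo[%classic else setT.

Lemma ramp_lim a y : (fun k => ramp k a y) @ \oo --> (\1_(above a) y : R).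
Proof.
case: a => [a|] /=; last by rewrite indicT; exact: cvg_cst.
rewrite indicE /=; have [ya|ya] := leP y a.
  rewrite memNset; last by rewrite /= in_itv /= andbT ltNge ya.
  have -> : (fun k => ramp k (Some a) y) = (fun=> 0); last exact: cvg_cst.
  apply/funext => k /=; apply/max_idPl; rewrite ge_min; apply/orP; right.
  by rewrite mulr_ge0_le0// subr_le0.
rewrite mem_set; last by rewrite /= in_itv /= andbT.
have ya0 : 0 < (y - a)^-1 by rewrite invr_gt0 subr_gt0.
apply/cvgrPdist_le => e e0; exists (Num.truncn (y - a)^-1).+1 => // k /= kk.
have -> : Num.max 0 (Num.min 1 (k%:R * (y - a))) = 1; last by rewrite subrr normr0 ltW.
have k1 : 1 <= k%:R * (y - a).
  rewrite -ler_pdivrMr ?subr_gt0// div1r ltW// (lt_le_trans (truncnS_gt _))//.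
  by rewrite ler_nat.
by rewrite (min_idPl k1); apply/max_idPr.
Qed.

(** Orthants open from below: a generating pi-system whose indicators are pointwise limits of
    continuous functions, namely of products of ramps. *)
Definition boxes : set (set T) :=
  [set B | exists a : 'I_n -> option R, B = [set u : V | forall i, above (a i) (u i 0)]].

Lemma above_setI a a' : exists c, above a `&` above a' = above c.
Proof.
case: a a' => [a|] [a'|] /=; last by exists None; rewrite setIT.
- exists (Some (Num.max a a')); apply/seteqP; split => y /=; rewrite !in_itv /= !andbT gt_max.
    by move=> [-> ->].
  by move=> /andP.
- by exists (Some a); rewrite setIT.
- by exists (Some a'); rewrite setTI.
Qed.

Lemma boxes_rect B : boxes B -> rectangles (B : set V).
Proof.
move=> [a ->]; exists (fun i => above (a i)) => // i.
by case: (a i) => [c|] //=; exact: measurable_itv.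
Qed.

Lemma measurable_boxes (B : set T) : measurable B -> <<s boxes >> B.
Proof.
move=> mB; have mid : measurable_fun setT ((fun u => u) : g_sigma_algebraType boxes -> T).
  apply: measurable_col => i.
  apply: (measurability _ (measurable_realfun.RGenOInfty.measurableE R)).
  move=> _ [_ [c ->] <-]; rewrite setTI; apply: sub_sigma_algebra.
  exists (fun j => if j == i then Some c else None).
  apply/seteqP; split => [u /= H j|u /= /(_ i)]; last by rewrite eqxx.
  by case: eqP => // ->.
by have := mid measurableT B mB; rewrite setTI.
Qed.

Lemma prod_cont (I : Type) (s : seq I) (f : I -> V -> R) : (forall i, continuous (f i)) ->
  continuous (fun x => \prod_(i <- s) f i x).
Proof.
move=> H; elim: s => [|i s IH] x.
  have -> : (fun x => \prod_(i <- [::]) f i x) = (fun=> 1) by apply/funext => y; rewrite big_nil.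
  exact: (@cst_continuous V R 1 x).
have -> : (fun x => \prod_(j <- i :: s) f j x) = (fun x => f i x * \prod_(j <- s) f j x).
  by apply/funext => y; rewrite big_cons.
exact: cvgM (H i x) (IH x).
Qed.

Lemma prod01 (I : Type) (s : seq I) (f : I -> R) : (forall i, 0 <= f i <= 1) -> 0 <= \prod_(i <- s) f i <= 1.
Proof.
move=> H; elim: s => [|i s /andP[IH1 IH2]]; first by rewrite big_nil ler01 lexx.
have /andP[f0 f1] := H i; rewrite big_cons mulr_ge0//= -[leRHS]mulr1 ler_pM//.
Qed.

Lemma prod_cvg (I : Type) (s : seq I) (f : nat -> I -> R) (l : I -> R) :
  (forall i, f ^~ i @ \oo --> l i) -> (fun k => \prod_(i <- s) f k i) @ \oo --> \prod_(i <- s) l i.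
Proof.
move=> H; elim: s => [|i s IH].
  rewrite big_nil (_ : (fun k => _) = (fun=> 1)); [exact: cvg_cst|by apply/funext => k; rewrite big_nil].
rewrite big_cons (_ : (fun k => _) = (fun k => f k i * \prod_(j <- s) f k j)).
  by apply: cvgM; [exact: H|exact: IH].
by apply/funext => k; rewrite big_cons.
Qed.

Lemma cont_bm (f : V -> R) : continuous f -> (forall x, 0 <= f x <= 1) -> bounded_meas (f : T -> R).
Proof.
move=> cf f01; split; first exact: continuous_Rn_measurable.
by exists 1 => x; have /andP[f0 f1] := f01 x; rewrite ger0_norm.
Qed.

Lemma eq_measure_cont (m1 m2 : probability T R) :
  (forall f : V -> R, continuous f -> (forall x, 0 <= f x <= 1) -> \int[m1]_x f x = \int[m2]_x f x) ->
  forall B : set T, measurable B -> m1 B = m2 B.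
Proof.
move=> H B mB.
apply: (@g_sigma_algebra_measure_unique _ _ _ boxes _ (fun=> setT)) => //.
- by move=> C /boxes_rect; exact: rectangles_measurable.
- move=> _; exists (fun=> None); apply/seteqP; split => // u _ i //.
- by rewrite bigcup_const.
- move=> _ _ [a ->] [a' ->]; have [c Hc] := choice (fun i => above_setI (a i) (a' i)).
  exists c; apply/seteqP; split => [u [H1 H2] i|u /= Hu]; first by rewrite -Hc; split; [exact: H1|exact: H2].
  by split => i; have := Hu i; rewrite -Hc => -[].
- move=> C bC; have mC : measurable C by exact: rectangles_measurable (boxes_rect bC).
  have [a Ea] := bC.
  pose f k (x : V) : R := \prod_(i < n) ramp k (a i) (x i 0).
  have cf k : continuous (f k).
    apply: prod_cont => i x.
    apply: (@continuous_comp _ _ _ (fun M : V => M i 0) (ramp k (a i))); first exact: coord_continuous.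
    exact: ramp_cont.
  have f01 k x : 0 <= f k x <= 1 by apply: prod01 => i; exact: ramp01.
  have fl x : (fun k => f k x) @ \oo --> (\1_C x : R).
    have -> : (\1_C x : R) = \prod_(i < n) (\1_(above (a i)) (x i 0) : R).
      rewrite Ea !indicE; case: (pselect (forall i, above (a i) (x i 0))) => Hx.
        by rewrite mem_set// big1// => i _; rewrite indicE mem_set//; exact: Hx.
      rewrite memNset//; apply/esym/eqP/prodf_eq0.
      have [i Hi] : exists i, ~ above (a i) (x i 0) by apply: contrapT => H'; apply: Hx => i; apply: contrapT => ?; apply: H'; exists i.
      by exists i => //; rewrite indicE memNset.
    by apply: prod_cvg => i; exact: ramp_lim.
  have L (m : probability T R) : (fun k => \int[m]_x f k x) @ \oo --> fine (m C).
    have [_ _ cvgI] : [/\ m.-integrable setT (fun x => (\1_C x)%:E),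
       ((fun k => \int[m]_x `| (f k x)%:E - (\1_C x)%:E|)%E @ \oo --> 0%E) &
       ((fun k => \int[m]_x (f k x)%:E)%E @ \oo --> (\int[m]_x (\1_C x)%:E)%E)].
      apply: (@dominated_convergence _ _ _ m setT measurableT (fun k x => (f k x)%:E) (fun x => (\1_C x)%:E) (cst 1%E)).
      - by move=> k; apply/measurable_EFinP; exact: continuous_Rn_measurable.
      - by apply/measurable_EFinP; exact: measurable_indic.
      - by apply: nearW => x _; apply: cvg_EFin; [exact: nearW|exact: fl].
      - exact: finite_measure_integrable_cst.
      - by apply: nearW => x k _ /=; rewrite lee_fin; have /andP[f0 f1] := f01 k x; rewrite ger0_norm.
    have mCE : m C = (fine (m C))%:E by rewrite fineK// fin_num_measure.
    have iE : (\int[m]_x (\1_C x)%:E = (fine (m C))%:E)%E by rewrite integral_indic// setIT.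
    by rewrite iE in cvgI; exact: fine_cvg cvgI.
  have E : fine (m1 C) = fine (m2 C).
    apply: (norm_cvg_unique (L m1)).
    have -> : (fun k => \int[m1]_x f k x) = (fun k => \int[m2]_x f k x) by apply/funext => k; exact: H.
    exact: L.
  have fm (m : probability T R) : m C = (fine (m C))%:E by rewrite fineK// fin_num_measure.
  by apply: etrans (fm m1) _; rewrite E; apply/esym; exact: fm.
- by move=> _; apply: le_lt_trans (@probability_le1 _ _ _ m1 _ measurableT) (ltry _).
- exact: measurable_boxes.
Qed.

End determined_by_continuous.

(** Each shift by one step drops one term of [0, 1] and adds another. *)
Lemma shift_sum (R : realFieldType) (a : nat -> R) (m k : nat) : (forall i, 0 <= a i <= 1) ->
  `|\sum_(i < m) a (i + k)%N - \sum_(i < m) a i| <= k%:R.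
Proof.
move=> a01; elim: k => [|k IH].
  by rewrite (eq_bigr (fun i : 'I_m => a i)) ?subrr ?normr0// => i _; rewrite addn0.
have E : \sum_(i < m) a (i + k.+1)%N = \sum_(i < m) a (i + k)%N + a (m + k)%N - a k.
  have := big_ord_recl m (fun i : 'I_m.+1 => a (i + k)%N) (idx := 0) (op := +%R).
  rewrite /= big_ord_recr /= add0n => ->; rewrite [a k + _]addrC addrK.
  by apply: eq_bigr => i _; rewrite /bump /= add1n addSnnS.
rewrite E -natr1; have /andP[x0 x1] := a01 (m + k)%N; have /andP[y0 y1] := a01 k.
move: IH; rewrite !ler_norml => /andP[H1 H2]; apply/andP; split; lra.
Qed.

Lemma dist_chain (R : realFieldType) (m1 m2 o1 o2 g e : R) :
  `|m1 - o1| <= e / 5 -> `|m2 - o2| <= e / 5 -> `|g - o2| <= e / 5 -> `|o1 - g| <= e / 5 + e / 5 ->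
  `|m1 - m2| <= e.
Proof.
rewrite !ler_norml; do 4 move=> /andP[? ?].
by apply/andP; split; lra.
Qed.

Lemma unit_dist (R : realFieldType) (x y : R) : 0 <= x <= 1 -> 0 <= y <= 1 -> `|x - y| <= 1.
Proof. by rewrite ler_norml => /andP[? ?] /andP[? ?]; apply/andP; split; lra. Qed.

(** * Invariance and moments of the limit measure *)

Section invariant_measure.
Context (R : realType) (n : nat) d (Omega : measurableType d) (P : probability Omega R).
Variables (W : 'I_n -> R -> {RV P >-> R}).
Hypothesis hW : indep_brownian_motions W.
Local Notation V := 'cV[R]_n.
Local Notation T := (Rn R n).
Variables (b : V -> V) (q : 'I_n -> R).
Hypotheses (lb : loc_lip b) (eb : energy_bound b).
Let cb : continuous b := loc_lip_cont lb.
Variables (h_ M_ : nat -> R) (N_ : nat -> nat).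
Hypotheses (h_0 : forall j, 0 < h_ j) (h_cvg : h_ @ \oo --> (0 : R)) (M_cvg : M_ @ \oo --> +oo).
(** The time horizon tends to infinity, whence asymptotic invariance under a fixed time shift. *)
Hypothesis N_h : forall j, j.+1%:R <= (N_ j).+1%:R * h_ j.
Local Notation st j := (stp b q (h_ j) (M_ j)).
Local Notation mst j := (measurable_stp q cb (h_ j) (M_ j)).

Definition state (j k : nat) : Omega -> T := chain W (h_ j) (st j) (0 : V) k.

Lemma measurable_state j k : measurable_fun setT (state j k).
Proof. exact: (measurable_chain W (h_ j) (mst j)). Qed.

HB.instance Definition _ j k := isMeasurableFun.Build _ _ _ _ (state j k) (measurable_state j k).

Definition occ (j : nat) : probability T R := @avg_law R d Omega P _ T (fun k => state j k) (N_ j).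

Variables (r : V -> R) (A0 A1 : R) (rho : R -> R).
Hypotheses (cr : continuous r) (r0 : forall x, 0 <= r x) (A00 : 0 <= A0) (A10 : 0 <= A1).
Hypothesis r_large : forall (L : R) x, 0 <= L -> rho L < `|x| -> L <= r x.
Hypothesis occ_bound : forall j L, 0 <= L -> \int[occ j]_x Num.min (r x) L <= A0 + L * (A1 / j.+1%:R).

Lemma bm_min L : 0 <= L -> bounded_meas (fun x : T => Num.min (r x) L).
Proof.
move=> L0; split; last by exists L => x; rewrite ger0_norm ?le_min ?r0// ge_min lexx orbT.
by apply: measurable_minr; [exact: continuous_Rn_measurable|exact: measurable_cst].
Qed.

Lemma inv_small (A e : R) : 0 <= A -> 0 < e -> exists J, forall j, (J <= j)%N -> A / j.+1%:R <= e.
Proof.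
move=> A0' e0; exists (Num.truncn (A / e)).+1 => j jJ.
rewrite ler_pdivrMr ?ltr0n// mulrC -ler_pdivrMr// ltW// (lt_le_trans (truncnS_gt _))//.
by rewrite ler_nat ltnW// ltnS.
Qed.

Lemma occ_tail e : 0 < e -> exists M : R, exists J, forall j, (J <= j)%N ->
  \int[occ j]_x (if `|x : V| <= M then 0 else 1) <= e.
Proof.
move=> e0; pose L := 2 * A0 / e + 1.
have L0 : 0 < L by rewrite ltr_wpDl// divr_ge0 ?(ltW e0)// mulr_ge0.
have [J HJ] := inv_small A10 (divr_gt0 e0 (ltr0n R 2)).
exists (rho L), J => j /HJ Aj.
have bo := @bm_if_norm R n (rho L) 0 1.
have : L * \int[occ j]_x (if `|x : V| <= rho L then 0 else 1) <= A0 + L * (A1 / j.+1%:R).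
  apply: le_trans (occ_bound j (ltW L0)); rewrite -meanZ//; apply: mean_le.
  - exact: bmM (bm_cst _ L) bo.
  - exact: bm_min (ltW L0).
  move=> x; case: ifPn => [_|]; first by rewrite mulr0 le_min r0 ltW.
  by rewrite -ltNge mulr1 le_min lexx andbT; apply: r_large; exact: ltW.
set I := Rintegral _ _ _ => H.
have A0e : A0 <= L * (e / 2).
  rewrite /L mulrDl mul1r; have -> : 2 * A0 / e * (e / 2) = A0 by field; rewrite gt_eqF.
  by rewrite lerDl divr_ge0// ltW.
have : L * I <= L * e.
  apply: le_trans H _; have -> : L * e = L * (e / 2) + L * (e / 2) by field.
  by rewrite lerD// ler_wpM2l// ltW.
by rewrite ler_pM2l.
Qed.

Lemma occ_tight (U : set_system nat) : UltraFilter U -> \oo `<=` U -> forall e : R, 0 < e ->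
  exists M : R, \forall j \near U, (occ j [set u : V | (`|u| > M)%R] <= e%:E)%E.
Proof.
move=> UU oU e e0; have [M [J HJ]] := occ_tail e0; exists M; apply: oU; exists J => // j /= /HJ H.
have mM : measurable ([set u : V | `|u| > M] : set T).
  apply: sub_sigma_algebra; rewrite (_ : [set _ | _] = (fun u : V => `|u|) @^-1` [set r | r > M])//.
  apply: open_comp; [by move=> x _; exact: norm_continuous|exact: open_gt].
rewrite -[occ j _]fineK ?fin_num_measure// lee_fin; apply: le_trans H.
rewrite [leLHS](_ : _ = \int[occ j]_x (\1_([set u : V | `|u| > M] : set T) x)); last first.
  by rewrite /Rintegral integral_indic// setIT.
rewrite le_eqVlt; apply/orP; left; apply/eqP; apply: eq_Rintegral => x _.
rewrite indicE; case: ifPn => xM; last by rewrite mem_set//= ltNge.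
by rewrite memNset//= ltNge xM.
Qed.

Section limit.
Variable G0 : set Omega.
Hypotheses (mG0 : measurable G0) (PG0 : P (~` G0) = 0) (G0P : forall w, G0 w -> good_path W w).
Variable U : set_system nat.
Context (UU : UltraFilter U).
Hypothesis oU : \oo `<=` U.
Variable mu : probability T R.
Hypothesis portmanteau : forall f : V -> R, continuous f -> (forall x, 0 <= f x <= 1) ->
  (fun j => \int[occ j]_x f x) @ U --> \int[mu]_x f x.

Let near_close (f : V -> R) e : continuous f -> (forall x, 0 <= f x <= 1) -> 0 < e ->
  U [set j | `|\int[mu]_x f x - \int[occ j]_x f x| <= e].
Proof. by move=> cf f01 e0; have /cvgrPdist_le /(_ e e0) := portmanteau cf f01. Qed.

Lemma limit_moment L : 0 <= L -> \int[mu]_x Num.min (r x) L <= A0.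
Proof.
rewrite le_eqVlt => /predU1P[<-|L0].
  rewrite (_ : \int[mu]_x _ = \int[mu]_x (0 : R)); first by rewrite mean_cst.
  by apply: eq_Rintegral => x _; rewrite (min_idPr (r0 x)).
pose f (x : V) := L^-1 * Num.min (r x) L.
have cf : continuous f.
  move=> x; apply: (@continuous_comp _ _ _ r (fun y : R => L^-1 * Num.min y L)); first exact: cr.
  apply: cvgM; first exact: cvg_cst.
  by apply: (@continuous_min _ _ id (fun=> L)); [exact: cvg_id|exact: cvg_cst].
have f01 x : 0 <= f x <= 1.
  rewrite /f mulr_ge0 ?invr_ge0 ?(ltW L0) ?le_min ?r0 ?(ltW L0)//=.
  by rewrite mulrC ler_pdivrMr// mul1r ge_min lexx orbT.
have bL := bm_min (ltW L0).
have E (m : probability T R) : \int[m]_x f x = L^-1 * \int[m]_x Num.min (r x) L by rewrite meanZ.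
apply/ler_addgt0Pr => e e0.
have e2 : 0 < L^-1 * (e / 2) by rewrite mulr_gt0 ?invr_gt0// divr_gt0.
have [J HJ] := inv_small (mulr_ge0 (ltW L0) A10) (divr_gt0 e0 (ltr0n R 2)).
have HU : U [set j | (J <= j)%N] by apply: oU; exists J.
have [j [Hj /= /HJ Aj]] := filter_ex (filterI (near_close cf f01 e2) HU).
move: Hj; rewrite /= !E -mulrBr normrM ger0_norm ?invr_ge0 ?(ltW L0)// ler_pM2l ?invr_gt0//.
have := occ_bound j (ltW L0); rewrite mulrA; move: Aj.
move: (\int[occ j]_x _) (\int[mu]_x _) (L * A1 / _) => a c z; rewrite ler_norml => + + /andP[].
lra.
Qed.

Local Notation S t := (semigroup W b q G0 t).

Lemma semigroup01 t (f : V -> R) x : 0 <= t -> continuous f -> (forall x, 0 <= f x <= 1) -> 0 <= S t f x <= 1.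
Proof.
move=> t0 cf f01.
have [mfl _] := bm_section1 (bm_flow q lb eb mG0 G0P h_0 h_cvg M_cvg t0 (cont_bm cf f01)) x.
by apply: mean01 => // w; exact: f01.
Qed.

Let lim_at := semigroup_lim q lb eb mG0 PG0 G0P h_0 h_cvg M_cvg.

(** Feller property: for large j, one and the same chain started at y approximates the semigroup at
    x, because y is close to x, and at y itself. *)
Lemma semigroup_cont t (f : V -> R) : 0 <= t -> continuous f -> (forall x, 0 <= f x <= 1) -> continuous (S t f).
Proof.
move=> t0 cf f01 x; apply: eps_cont => e e0.
have [dl dl0 [J HJ]] := lim_at x t0 cf f01 e0.
exists dl => // y; rewrite distrC => yx; apply/ler_addgt0Pr => e' e'0.
have [dl' dl'0 [J' HJ']] := lim_at y t0 cf f01 e'0.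
have := HJ (maxn J J') y (leq_maxl _ _) yx.
have := HJ' (maxn J J') y (leq_maxr _ _); rewrite subrr normr0 dl'0 => /(_ isT).
set g := \int[P]_w _ => H1 H2; rewrite -(subrKA g) (le_trans (ler_normD _ _))// lerD//.
by rewrite distrC.
Qed.

Lemma semigroup_unif t (f : V -> R) (M e : R) : 0 <= t -> continuous f -> (forall x, 0 <= f x <= 1) -> 0 < e ->
  exists J, forall j (y : V), (J <= j)%N -> `|y| <= M ->
   `|\int[P]_w f (chain W (h_ j) (st j) y (nsteps h_ t j) w) - S t f y| <= e.
Proof.
move=> t0 cf f01 e0; have e2 : 0 < e / 2 by rewrite divr_gt0.
have cK : compact [set y : V | `|y| <= M].
  apply: (@closed_bounded_compact _ _ _ M) => //.
  apply: (@closed_comp _ _ (fun y : V => `|y|) [set s : R | s <= M]); last exact: closed_le.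
  by move=> y _; exact: norm_continuous.
move: cK => /compact_near_coveringP /(_ nat \oo) H.
have [] // := H (fun j y => `|\int[P]_w f (chain W (h_ j) (st j) y (nsteps h_ t j) w) - S t f y| <= e) _ _.
  move=> x _; have [dl dl0 [J HJ]] := lim_at x t0 cf f01 e2.
  have [dl' dl'0 Hd] := cont_eps (semigroup_cont t0 cf f01 (x:=x)) e2.
  exists (ball x (Num.min dl dl'), [set j | (J <= j)%N]) => /=.
    split; last by exists J.
    by apply: nbhsx_ballx; rewrite lt_min dl0.
  move=> [y j] [/= + jJ]; rewrite -ball_normE /ball_ /= lt_min => /andP[y1 y2].
  rewrite -(subrKA (S t f x)) (splitr e) (le_trans (ler_normD _ _))// lerD//; last exact: Hd.
  by apply: HJ => //; rewrite distrC.
move=> J _ HJ; exists J => j y jJ yM; exact: HJ.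
Qed.

(** By the Markov property the left integral averages over times shifted by k <= t / h steps, which
    changes an average of N + 1 terms by at most k / (N + 1). *)
Lemma occ_almost_invariant t (f : V -> R) j : 0 <= t -> continuous f -> (forall x, 0 <= f x <= 1) ->
  `|\int[occ j]_y (\int[P]_w f (chain W (h_ j) (st j) y (nsteps h_ t j) w)) - \int[occ j]_x f x| <= t / j.+1%:R.
Proof.
move=> t0 cf f01; have bf := cont_bm cf f01; set k := nsteps h_ t j.
have E : (fun y : T => \int[P]_w f (chain W (h_ j) (st j) y k w)) = iter k (step_op W (h_ j) (st j)) f.
  by apply/funext => y; rewrite (chain_iter hW (h_0 j) (mst j)).
have bE : bounded_meas (fun y : T => \int[P]_w f (chain W (h_ j) (st j) y k w)).
  by rewrite E; exact: (bm_iter W (h_ j) (mst j)).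
rewrite /occ !avg_law_integral//; last 2 first.
- by move=> x; have /andP[] := f01 x.
- by move=> x; apply: Rintegral_ge0 => w _; have /andP[] := f01 (chain W (h_ j) (st j) x k w).
pose a i := \int[P]_w f (state j i w).
rewrite (eq_bigr (fun i : 'I_(N_ j).+1 => a (i + k)%N)); last first.
  by move=> i _; rewrite /a /state (chain_add hW (h_0 j) (mst j)).
rewrite -mulrBr normrM ger0_norm ?invr_ge0//.
have N0 : (0 : R) < (N_ j).+1%:R by rewrite ltr0n.
have a01 i : 0 <= a i <= 1.
  have [ma _] := bm_comp bf (measurable_state j i).
  by apply: mean01 => // w; exact: f01.
rewrite mulrC ler_pdivrMr//; apply: le_trans (shift_sum _ _ a01) _.
have [k1 _] := nsteps_bounds h_0 j t0.
rewrite mulrAC ler_pdivlMr ?ltr0n//; apply: (@le_trans _ _ (k%:R * ((N_ j).+1%:R * h_ j))).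
  by rewrite ler_wpM2l.
by rewrite mulrCA mulrC ler_wpM2r.
Qed.

(** Five errors of size e / 5: weak convergence for f and for its image under the semigroup, which
    is continuous; the distance of chain and semigroup on a ball; the mass outside the ball; the
    almost invariance of the occupation measure. *)
Lemma limit_invariant_cont t (f : V -> R) : 0 <= t -> continuous f -> (forall x, 0 <= f x <= 1) ->
  \int[mu]_x S t f x = \int[mu]_x f x.
Proof.
move=> t0 cf f01; have cS := semigroup_cont t0 cf f01; have S01 x := semigroup01 x t0 cf f01.
apply/eqP; rewrite -subr_eq0 -normr_le0; apply/ler_addgt0Pr => e e0; rewrite add0r.
have e5 : 0 < e / 5 by rewrite divr_gt0.
have [M [J1 HJ1]] := occ_tail e5.
have [J2 HJ2] := semigroup_unif M t0 cf f01 e5.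
have [J3 HJ3] := inv_small t0 e5.
have HU : U [set j | (maxn (maxn J1 J2) J3 <= j)%N] by apply: oU; exists (maxn (maxn J1 J2) J3).
have [j [[H1 H2] /=]] := filter_ex (filterI (filterI (near_close cS S01 e5) (near_close cf f01 e5)) HU).
rewrite !geq_max => /andP[/andP[j1 j2] j3]; rewrite /= in H1 H2.
have H3 := le_trans (occ_almost_invariant j t0 cf f01) (HJ3 j j3).
set G := fun y : T => \int[P]_w f (chain W (h_ j) (st j) y (nsteps h_ t j) w) in H3.
have bf := cont_bm cf f01; have bS := cont_bm cS S01.
have bG : bounded_meas G.
  rewrite (_ : G = iter (nsteps h_ t j) (step_op W (h_ j) (st j)) f); first exact: (bm_iter W (h_ j) (mst j)).
  by apply/funext => y; rewrite /G (chain_iter hW (h_0 j) (mst j)).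
have G01 y : 0 <= G y <= 1.
  have [mw _] := bm_comp bf (measurable_chain W (h_ j) (mst j) y (nsteps h_ t j)).
  by apply: mean01 => // w; exact: f01.
pose o (x : T) : R := if `|x : V| <= M then 0 else 1.
have bo : bounded_meas o by exact: bm_if_norm.
have H4 : `|\int[occ j]_x S t f x - \int[occ j]_x G x| <= e / 5 + e / 5.
  have H6 := HJ1 j j1; rewrite -/(\int[occ j]_x o x) in H6.
  have K (u v : T -> R) : bounded_meas u -> bounded_meas v -> (forall x, u x <= v x + (e / 5 + o x)) ->
      \int[occ j]_x u x <= \int[occ j]_x v x + (e / 5 + e / 5).
    move=> bu bv uv; have beo : bounded_meas (fun x => e / 5 + o x) by apply: bmD => //; exact: bm_cst.
    apply: (@le_trans _ _ (\int[occ j]_x (v x + (e / 5 + o x)))).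
      by apply: mean_le => //; exact: bmD.
    by rewrite meanD// lerD2l meanD ?mean_cst//; [rewrite lerD2l|exact: bm_cst].
  have D x : `|G x - S t f x| <= e / 5 + o x.
    rewrite /o; case: ifPn => xM; first by rewrite addr0; exact: HJ2.
    by apply: le_trans (unit_dist (G01 x) (S01 x)) _; rewrite lerDr ltW.
  have K1 : \int[occ j]_x G x <= \int[occ j]_x S t f x + (e / 5 + e / 5).
    by apply: K => // x; have := D x; rewrite ler_norml => /andP[_]; rewrite lerBlDr addrC.
  have K2 : \int[occ j]_x S t f x <= \int[occ j]_x G x + (e / 5 + e / 5).
    by apply: K => // x; have := D x; rewrite distrC ler_norml => /andP[_]; rewrite lerBlDr addrC.
  move: K1 K2; move: (\int[occ j]_x G x) (\int[occ j]_x S t f x) (e / 5 + e / 5) => g s e' K1 K2.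
  by rewrite ler_norml lerBlDr [e' + _]addrC K2 andbT lerBrDr addrC lerBlDr.
exact: dist_chain H1 H2 H3 H4.
Qed.

(** The law of the flow started from mu is a measure that agrees with mu on continuous functions,
    hence everywhere. Adding a constant reduces bounded functions to nonnegative ones. *)
Lemma limit_invariant t (f : T -> R) : 0 <= t -> bounded_meas f -> \int[mu]_x S t f x = \int[mu]_x f x.
Proof.
move=> t0 bf; have mfl := measurable_flow q lb eb mG0 G0P h_0 h_cvg M_cvg t0.
pose Q : probability (T * Omega)%type R := (mu \x P)%E.
pose Y : {RV Q >-> T} := HB.pack (flow W b q G0 t) (isMeasurableFun.Build _ _ _ _ _ mfl).
have bfl (g : T -> R) : bounded_meas g -> bounded_meas (fun z : T * Omega => g (flow W b q G0 t z)).
  by move=> bg; exact: (bm_flow q lb eb mG0 G0P h_0 h_cvg M_cvg t0 bg).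
have key (g : T -> R) : bounded_meas g -> (forall x, 0 <= g x) -> \int[distribution Q Y]_x g x = \int[mu]_x S t g x.
  move=> bg g0; have [mg _] := bg; have bgf := bfl g bg.
  rewrite /Rintegral ge0_integral_distribution; last 2 first.
  - exact/measurable_EFinP.
  - by move=> x; rewrite lee_fin.
  rewrite /Q fubini_tonelli1; last 2 first.
  - by apply/measurable_EFinP; have [] := bgf.
  - by move=> z; rewrite lee_fin.
  congr fine; apply: eq_integral => x _; rewrite /fubini_F /semigroup EFin_mean//.
  exact: bm_section1 bgf x.
have E B : measurable B -> distribution Q Y B = mu B.
  apply: (eq_measure_cont (m1 := distribution Q Y)) => g cg g01.
  rewrite key; [exact: limit_invariant_cont|exact: cont_bm|].
  by move=> x; have /andP[] := g01 x.
have inv (g : T -> R) : bounded_meas g -> (forall x, 0 <= g x) -> \int[mu]_x S t g x = \int[mu]_x g x.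
  move=> bg g0; rewrite -key//; rewrite /Rintegral; congr fine.
  by apply: eq_measure_integral => B mB _; exact: E.
have [mf [M HM]] := bf; have M0 x : 0 <= f x + M.
  by have := HM x; rewrite ler_norml => /andP[]; lra.
have bM d1 (T1 : measurableType d1) : bounded_meas (fun _ : T1 => M) by exact: bm_cst.
have := inv (fun x => f x + M) (bmD bf (bM _ _)) M0.
have -> : S t (fun x => f x + M) = (fun x => S t f x + M).
  apply/funext => x; rewrite /semigroup meanD ?mean_cst//; exact: (bm_section1 (bfl f bf) x).
rewrite !meanD ?mean_cst// ?bM//; first exact: addIr.
exact: (bm_param P (bfl f bf)).
Qed.

Lemma limit_stationary : stationary_measure b q W mu.
Proof.
exists (semigroup W b q G0).
  exact: (semigroupP q lb eb mG0 PG0 G0P h_0 h_cvg M_cvg).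
move=> t f t0 mf /bounded_funE bf'; have bf : bounded_meas f by [].
rewrite -!EFin_mean//; first by rewrite limit_invariant.
exact: (bm_param P (bm_flow q lb eb mG0 G0P h_0 h_cvg M_cvg t0 bf)).
Qed.

(** The bound A0 for the truncated functions does not depend on the level, so monotone convergence
    removes the truncation. *)
Lemma limit_integrable : mu.-integrable setT (fun x => (r x)%:E).
Proof.
have mr : measurable_fun setT (fun x : T => (r x)%:E).
  by apply/measurable_EFinP; exact: continuous_Rn_measurable.
apply/integrableP; split => //.
rewrite (eq_integral (fun x : T => (r x)%:E)); last by move=> x _ /=; rewrite ger0_norm.
apply: (@le_lt_trans _ _ A0%:E); last by rewrite ltry.
pose g k (x : T) := (Num.min (r x) k%:R)%:E.
have bk k := bm_min (ler0n R k).
have mg k : measurable_fun setT (g k) by apply/measurable_EFinP; have [] := bk k.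
have -> : (\int[mu]_x (r x)%:E = limn (fun k => \int[mu]_x g k x))%E.
  rewrite -monotone_convergence//.
  - apply: eq_integral => x _; apply/esym/cvg_lim => //.
    apply: cvg_near_cst; exists (Num.truncn (r x)).+1 => // k /= xk; congr EFin.
    by apply/min_idPl/ltW; rewrite (lt_le_trans (truncnS_gt _))// ler_nat.
  - by move=> k x _; rewrite lee_fin le_min r0 ler0n.
  - move=> x _ k l kl; rewrite lee_fin le_min ge_min lexx/= ge_min.
    by rewrite ler_nat kl orbT.
apply: lime_le.
  apply: ereal_nondecreasing_is_cvgn => k l kl; apply: ge0_le_integral => //.
  - by move=> x _; rewrite lee_fin le_min r0 ler0n.
  - by move=> x _; rewrite lee_fin le_min ge_min lexx/= ge_min ler_nat kl orbT.
by apply: nearW => k; rewrite /g -EFin_mean// lee_fin limit_moment.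
Qed.

End limit.
End invariant_measure.

(** * The cube root of the bracket *)

Section cbracket_facts.
Context (R : realType) (n : nat).
Local Notation V := 'cV[R]_n.
Local Notation r := (@cbracket R n).

Lemma cbracket_cont : continuous r.
Proof.
have -> : r = fv (rp_fn R n 1) by apply/funext => x; rewrite (rp_val (r := r)).
exact/C2_cont/C2_rp.
Qed.

Lemma cbracket_ge0 x : 0 <= r x.
Proof. exact: le_trans ler01 (r_ge1 x). Qed.

Lemma cbracket_large (L : R) (x : V) : 0 <= L -> L ^+ 3 < `|x| -> L <= r x.
Proof.
move=> L0 Lx; rewrite -(ler_pXn2r (n := 6)) ?nnegrE ?cbracket_ge0// r_6.
apply: (@le_trans _ _ (`|x| ^+ 2)).
  by rewrite -[6%N]/(3 * 2)%N exprM lerXn2r ?nnegrE ?exprn_ge0// ltW.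
apply: (@le_trans _ _ (nrm2 x)); last by rewrite lerDr.
exact: sqr_norm_nrm2.
Qed.

Lemma bracket_rad (x : V) : japanese_bracket x = r x ^+ 3.
Proof.
rewrite /japanese_bracket -[1 + _]/(1 + nrm2 x) -r_6 -[6%N]/(3 * 2)%N exprM sqrtr_sqr.
by rewrite ger0_norm// exprn_ge0// cbracket_ge0.
Qed.

Lemma bracket_powR_le (x : V) (p : R) : p < 1 / 3 -> japanese_bracket x `^ p <= r x.
Proof.
move=> p3; rewrite bracket_rad; have r1 := r_ge1 x; have r0 := cbracket_ge0 x.
apply: (@le_trans _ _ ((r x ^+ 3) `^ 3^-1)).
  by rewrite ler_powR ?exprn_ege1// -div1r ltW.
by rewrite -powR_mulrn// -powRrM mulfV// powRr1.
Qed.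

End cbracket_facts.

Lemma loc_lip_bounded (R : realType) (n : nat) (b : 'cV[R]_n -> 'cV[R]_n) (M : R) : loc_lip b -> 0 < M ->
  exists2 B : R, 0 < B & forall x : 'cV[R]_n, `|x| <= M -> `|b x| <= B.
Proof.
move=> lb M0; have [L L0 HL] := lb M M0.
exists (`|b 0| + L * M + 1); first by rewrite ltr_wpDl// addr_ge0// mulr_ge0// ltW.
move=> x xM; rewrite -[b x](subrK (b 0)) (le_trans (ler_normD _ _))// addrC -addrA lerD2l.
have := HL x 0 xM; rewrite normr0 subr0 => /(_ (ltW M0)) H.
by rewrite (le_trans H)// -[leLHS]addr0 lerD// ler_wpM2l.
Qed.

Theorem theorem1p5 (R : realType) (n : nat) (hn : (6 <= n)%N)
  (q : 'I_n -> R)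
  (hq1 : forall i : 'I_n, i.+2 = n -> q i != 0)
  (hq : forall i : 'I_n, i.+1 = n -> q i != 0)
  (A : 'M[R]_n) (hA : psd A)
  (hker : forall u : 'cV[R]_n,
     A *m u = 0 <-> (forall i : 'I_n, (2 <= i)%N -> u i 0 = 0))
  (d : measure_display) (Omega : measurableType d) (P : probability Omega R)
  (W : 'I_n -> R -> {RV P >-> R}) (hW : indep_brownian_motions W) :
  exists mu : probability (Rn R n) R,
    stationary_measure (lorenz96_drift A) q W mu /\
    forall p : R, p < 1 / 3 ->
      mu.-integrable setT (fun u => (japanese_bracket u `^ p)%:E).
Proof.
set b := lorenz96_drift A.
have lb : loc_lip b by exact: lorenz96_loc_lip.
have eb : energy_bound b := lorenz96_energy_bound hA hker.
have cb : continuous b := loc_lip_cont lb.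
(* Clipped increments of the chain have variance about h [gauss2], so the Lyapunov function is built
   for these noise coefficients. The factor comes from the unnormalized Gaussian moment and leaves
   the equation itself unchanged. *)
pose w (i : 'I_n) := Num.sqrt (gauss2 R) * q i.
have s0 : Num.sqrt (gauss2 R) != 0 by rewrite gt_eqF// sqrtr_gt0 gauss2_gt0.
have w1 (i : 'I_n) : i.+2 = n -> w i != 0 by move=> /hq1 qi; rewrite mulf_neq0.
have w2 (i : 'I_n) : i.+1 = n -> w i != 0 by move=> /hq qi; rewrite mulf_neq0.
have [F [c [C [c0 cF HF HC]]]] := lyapunov hn hA hker w1 w2.
have Hj (j : nat) : exists z : R * R, [/\ 0 < z.1, forall x : 'cV[R]_n, `|x| <= j.+1%:R -> `|b x| <= z.2 &
    forall h (x : 'cV[R]_n), 0 < h -> h < z.1 -> `|x| <= j.+1%:R ->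
    \int[P]_w fv F (stp b q h j.+1%:R (x : Rn R n, dW W h 0 w)) <= fv F x + h * (gen b w F x + 1)].
  have j0 : (0 : R) < j.+1%:R by rewrite ltr0n.
  have [B B0 HB] := loc_lip_bounded lb j0.
  by have [h1 h10 H] := step_lyapunov hW q cb cF j0 B0 HB; exists (h1, B).
have [z Hz] := choice Hj.
(* Small enough for the one-step estimate on the ball of radius j + 1, with strict inequality thanks
   to the division by 2, and at most 1 / (j + 1) so as to tend to 0. *)
pose h_ j := Num.min (z j).1 j.+1%:R^-1 / 2; pose M_ (j : nat) : R := j.+1%:R.
(* The horizon is between j + 1 and j + 2 and the radius is j + 1, so the probability of being
   frozen, at most of order horizon / radius^2, tends to 0. *)
pose N_ j := Num.truncn (j.+1%:R / h_ j).
have m0 j : 0 < Num.min (z j).1 j.+1%:R^-1 by rewrite lt_min invr_gt0 ltr0n andbT; have [] := Hz j.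
have h_0 j : 0 < h_ j by rewrite divr_gt0.
have h_lt j : h_ j < Num.min (z j).1 j.+1%:R^-1 by rewrite ltr_pdivrMr// mulrDr mulr1 ltrDl.
have h_z j : h_ j < (z j).1 by apply: lt_le_trans (h_lt j) _; rewrite ge_min lexx.
have h_inv j : h_ j <= j.+1%:R^-1.
  by apply: le_trans (ltW (h_lt j)) _; rewrite ge_min lexx orbT.
have h_1 j : h_ j <= 1 by rewrite (le_trans (h_inv j))// invf_le1 ?ltr0n// ler1n.
have h_cvg : h_ @ \oo --> (0 : R).
  apply/cvgrPdist_le => e e0; have [J HJ] := inv_small (ler01 : 0 <= (1 : R)) e0.
  exists J => // j /= /HJ; rewrite div1r sub0r normrN (gtr0_norm (h_0 j)).
  exact: le_trans (h_inv j).
have M_cvg : M_ @ \oo --> +oo.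
  apply/cvgryPge => a; exists (Num.truncn a).+1 => // j /= ja.
  by rewrite /M_ ltW// (lt_le_trans (truncnS_gt _))// ler_nat ltnW.
have N_h j : j.+1%:R <= (N_ j).+1%:R * h_ j.
  by rewrite -ler_pdivrMr// ltW// truncnS_gt.
have N_h' j : (N_ j).+1%:R * h_ j <= j.+1%:R + 1.
  rewrite -natr1 mulrDl mul1r lerD//.
  by rewrite -ler_pdivlMr// truncn_le// divr_ge0// ltW.
(* The 1 is the slack of [step_lyapunov]. In A1 the factor 2 bounds the horizon, at most j + 2 <= 2
   (j + 1), relative to j + 1. *)
pose Cp := `|C| + 1; pose K0 := fv F 0 + `|C|; pose A1 := K0 + 2 * Cp.
have Cp0 : 0 <= Cp by rewrite addr_ge0.
have coer (x : 'cV[R]_n) : nrm2 x <= fv F x + `|C| by rewrite (le_trans (HC x))// lerD2l ler_norm.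
have K00 : 0 <= K0 by exact: le_trans (nrm2_ge0 _) (coer 0).
have A10 : 0 <= A1 by rewrite addr_ge0// mulr_ge0.
have A00 : 0 <= A1 / c by rewrite divr_ge0// ltW.
pose r := @cbracket R n.
have occ_bound j L : 0 <= L -> \int[occ W q lb h_ M_ N_ j]_x Num.min (r x) L <= A1 / c + L * (A1 / j.+1%:R).
  move=> L0; rewrite /occ avg_law_integral; last 2 first.
  - exact: (bm_min (@cbracket_cont R n) (@cbracket_ge0 R n) L0).
  - by move=> x; rewrite le_min cbracket_ge0.
  have [z0 zB zS] := Hz j; have j0 : (0 : R) < j.+1%:R by rewrite ltr0n.
  have drift (x : 'cV[R]_n) : `|x| <= M_ j ->
      \int[P]_w fv F (stp b q (h_ j) (M_ j) (x : Rn R n, dW W (h_ j) 0 w)) <= fv F x + h_ j * (Cp - c * r x).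
    move=> xM; apply: le_trans (zS _ x (h_0 j) (h_z j) xM) _.
    rewrite lerD2l ler_pM2l// /Cp; have := HF x; have := ler_norm C; rewrite -/(r x).
    move: (gen _ _ _ _) (`|C|) (c * r x) => g a e; lra.
  pose D := fv F 0 + `|C| + (N_ j).+1%:R * h_ j * Cp.
  have := @occupation R n d Omega P W hW b q (h_ j) (M_ j) cb (h_0 j) (h_1 j) j0 (z j).2 F r c Cp `|C| L
    zB cF (@cbracket_cont R n) (@cbracket_ge0 R n) c0 Cp0 L0 drift coer (N_ j).+1 D isT erefl.
  move=> /le_trans; apply.
  have H1 := N_h j; have H2 := N_h' j.
  have j1 : (1 : R) <= j.+1%:R by rewrite ler1n.
  have n1 : 0 < (N_ j).+1%:R * h_ j by rewrite mulr_gt0// ltr0n.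
  have D1 : D <= A1 * ((N_ j).+1%:R * h_ j).
    have := ler_wpM2l K00 (le_trans j1 H1); have := mulr_ge0 (ltW n1) Cp0.
    by rewrite /D -/K0 /A1; move: (_ * h_ j) => y; lra.
  have D2 : D <= A1 * j.+1%:R.
    have := ler_wpM2l K00 j1; have := ler_wpM2r Cp0 H2; have := ler_wpM2l Cp0 j1.
    by rewrite /D -/K0 /A1; move: (_ * h_ j) (j.+1%:R : R) => y y'; lra.
  apply: lerD.
    rewrite ler_pdivrMr ?mulr_gt0//; apply: le_trans D1 _.
    by rewrite (mulrC _ c) [leRHS]mulrA mulfVK ?gt_eqF.
  rewrite ler_wpM2l// ler_pdivrMr ?exprn_gt0//; apply: le_trans D2 _.
  by rewrite /M_ expr2 [leRHS]mulrA mulfVK ?gt_eqF.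
have [N [mN PN goodN]] := good_path_ae hW.
have G0P w' : (~` N) w' -> good_path W w' by move=> Nw; apply: contrapT => H; apply: Nw; exact: goodN.
have mG0 : measurable (~` N) by exact: measurableC.
have PG0 : P (~` ~` N) = 0 by rewrite setCK.
(* A free ultrafilter replaces the extraction of a convergent subsequence; containing all final
   segments, it sees every estimate valid for large j. *)
have [U [UU oU]] := ultraFilterLemma (eventually_filter : ProperFilter \oo).
have [mu Hmu] := weak_limit UU (occ_tight (@cbracket_cont R n) (@cbracket_ge0 R n) A00 A10 (@cbracket_large R n) occ_bound UU oU).
exists mu; split.
  exact: (limit_stationary hW eb h_0 h_cvg M_cvg N_h (@cbracket_cont R n) (@cbracket_ge0 R n) A00 A10 (@cbracket_large R n) occ_bound mG0 PG0 G0P UU oU Hmu).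
have ir := limit_integrable (@cbracket_cont R n) (@cbracket_ge0 R n) A00 A10 occ_bound UU oU Hmu.
move=> p p3; apply: le_integrable ir => //.
  apply/measurable_EFinP; apply: (measurableT_comp (f := fun y : R => y `^ p)); first exact: measurable_powR.
  apply: continuous_Rn_measurable => x.
  have -> : @japanese_bracket R n = (fun u => cbracket u ^+ 3) by apply/funext => u; exact: bracket_rad.
  apply: (@continuous_comp _ _ _ (@cbracket R n) (fun y : R => y ^+ 3)); first exact: cbracket_cont.
  exact: exprn_continuous.
move=> x _ /=; rewrite lee_fin !ger0_norm ?cbracket_ge0 ?powR_ge0//.
exact: bracket_powR_le.
Qed.
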